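(* There exist smooth coordinates $(\tau,I)$ on $R$ (considered for large values of $v$) such that the first return map $F$ of $f$ to $R$ is given by $$F(\tau,I)=\hat F(\tau,I)+F_1(\tau,I)+r(\tau,I),$$ where: (1) $\hat F(\tau,I)=(\bar\tau,\bar I)$ with $\bar\tau=\tau-I \bmod 1$ and $\bar I=I+\Delta(\bar\tau-\tfrac12)$; (2) $F_1$ is a correction of order $O(I^{-1})$ of the form $F_1(\tau,I)=I^{-1}\bigl(0,\ \Delta_1\bigl((\bar\tau-\tfrac12)^2-\tfrac1{12}\bigr)\bigr)$; (3) $r=O_5(I^{-2})$. Finally, $\boldsymbol\omega=d\tau\wedge dI$.
   Context: Setting (piecewise smooth Fermi-Ulam model). Let $\ell:\mathbb R\to(0,\infty)$ be strictly positive, Lipschitz continuous and $1$-periodic, with $\dot\ell$ piecewise smooth having a jump discontinuity only at $t=0$ (mod $1$). A unit point mass moves freely on a line between a fixed (right) wall and an infinitely heavy moving (left) wall, at distance $\ell(t)$ from each other at time $t$; all collisions are elastic. Let $\mathbb T=\mathbb R/\mathbb Z$. The collision space is $\{(t,v)\in\mathbb T\times\mathbb R: v>-\dot\ell(t)\}$, where $t$ is a time (mod 1) of collision with the moving wall and $v$ is the velocity immediately after it. The collision map $f$ sends $(t,v)$ to the data of the next collision with the moving wall; for large $v$, $f(t,v)=(t+\delta t,\ v-2\dot\ell(t+\delta t))$, where $\delta t=\delta t(t,v)$ solves $\delta t=\frac{\ell(t)+\ell(t+\delta t)}{v}$. The map $f$ preserves the volume form $\boldsymbol\omega=(v+\dot\ell(t))\,dt\wedge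 dv$. Let $S=\{t=0\}$ in the collision space and let $R$ be the infinite strip of width $O(v^{-1})$ bounded by $S$ and $f(S)$. Constants: $\ell_0=\ell(0)$, $\dot\ell^\pm=\dot\ell(0^\pm)$, $\ddot\ell^\pm=\ddot\ell(0^\pm)$, $\alpha=\int_0^1\ell(s)^{-2}\,ds$, $\Delta=\alpha\,\ell_0(\dot\ell^+-\dot\ell^-)$, $\Delta_1=\frac12\alpha^2\ell_0^3(\ddot\ell^+-\ddot\ell^-)$. Notation: $\psi=O_s(I^{-k})$ means that $I^k\psi$ is bounded for sufficiently large $I$, and the same is true for all derivatives of $\psi$ up to order $s$ included (large $I$ corresponds to large $v$).
   Formalization: The last clause is stated as dτ∧dI = (α/4)ω, since ω = dτ∧dI fails unless α = 4 (ω scales with length², τ and I do not); and τ−I mod 1 means the representative close to the actual image, which near the discontinuity need not lie in [0,1). *)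

(* Defs.v *)
From Stdlib Require Import Reals ZArith.
From Coquelicot Require Import Coquelicot.
Open Scope R_scope.

(* The distance [l] between the walls.  "Smooth on the closed interval [0,1]"
   means: restriction of a C^infinity function on R. *)
Definition fermi_ulam_wall (l : R -> R) : Prop :=
  (forall t, 0 < l t) /\
  (exists L, forall s t, Rabs (l s - l t) <= L * Rabs (s - t)) /\
  (forall t, l (t + 1) = l t) /\
  (exists g : R -> R,
      (forall n t, ex_derive_n g n t) /\
      (forall t, 0 <= t <= 1 -> l t = g t)).

(* Points of the phase space are pairs (t,v); a time modulo 1 is represented by
   its representative in [0,1).  The wall velocity is undefined at integer
   times; there the right limit [lp] is used (the choice that makes the map
   right-continuous in t, consistently with the half-open strip below). *)
Definition ldot (l : R -> R) (lp t : R) : R :=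
  if Req_EM_T (frac_part t) 0 then lp else Derive l t.

Definition collision_space (l : R -> R) (lp : R) (p : R * R) : Prop :=
  0 <= fst p < 1 /\ - ldot l lp (fst p) < snd p.

(* After a collision at (t,v) the signed distance to the fixed wall, unfolded
   across that wall, is l t - v s at time t + s; the next collision with the
   moving wall is the first s > 0 at which its absolute value reaches l (t + s). *)
Definition flight_time (l : R -> R) (p : R * R) : R :=
  real (Glb_Rbar (fun s =>
    0 < s /\ l (fst p + s) <= Rabs (l (fst p) - snd p * s))).

(* A particle arriving with velocity [u] towards the moving wall leaves with
   velocity u - 2 ldot away from it.  Here u = v when it has bounced off the fixed
   wall in between (always the case for large v) and u = -v otherwise. *)
Definition collision_map (l : R -> R) (lp : R) (p : R * R) : R * R :=
  let s := flight_time l p in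
  let u := if Rlt_dec (l (fst p) - snd p * s) 0 then snd p else - snd p in
  (frac_part (fst p + s), u - 2 * ldot l lp (fst p + s)).

Definition singular_line (l : R -> R) (lp : R) (q : R * R) : Prop :=
  collision_space l lp q /\ fst q = 0.

(* The part v > V of the strip between S = {t = 0} (included) and f(S)
   (excluded): (t,v) lies on the horizontal segment from S to a point f(q), q in S. *)
Definition strip (l : R -> R) (lp V : R) (p : R * R) : Prop :=
  collision_space l lp p /\ V < snd p /\
  exists q, singular_line l lp q /\
    snd (collision_map l lp q) = snd p /\
    fst p < fst (collision_map l lp q).

Definition first_return_time
  (f : R * R -> R * R) (A : R * R -> Prop) (p : R * R) (n : nat) : Prop :=
  (0 < n)%nat /\ A (Nat.iter n f p) /\
  forall k, (0 < k < n)%nat -> ~ A (Nat.iter k f p).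

Definition smooth_on (U : R * R -> Prop) (h : R -> R -> R) : Prop :=
  forall n x y, U (x, y) -> ex_diff_n h n x y.

(* da /\ db = jacobian a b x y (dx /\ dy). *)
Definition jacobian (a b : R -> R -> R) (x y : R) : R :=
  Derive (fun z => a z y) x * Derive (fun z => b x z) y -
  Derive (fun z => a x z) y * Derive (fun z => b z y) x.

(* Smooth (up to S) coordinates on A with values in [0,1) x R, such that every
   pair with large second coordinate is attained, and in which a large second
   coordinate is the same thing as a large velocity. *)
Definition strip_coordinates (A : R * R -> Prop) (tau I : R -> R -> R) : Prop :=
  (exists U : R * R -> Prop,
      open U /\ (forall p, A p -> U p) /\ smooth_on U tau /\ smooth_on U I) /\
  (forall t v, A (t, v) -> jacobian tau I t v <> 0) /\
  (forall t v t' v', A (t, v) -> A (t', v') ->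
      tau t v = tau t' v' -> I t v = I t' v' -> t = t' /\ v = v') /\
  (forall t v, A (t, v) -> 0 <= tau t v < 1) /\
  (exists I0, forall x y, 0 <= x < 1 -> I0 < y ->
      exists t v, A (t, v) /\ tau t v = x /\ I t v = y) /\
  (forall M, exists V, forall t v, A (t, v) -> V < v -> M < I t v) /\
  (forall V, exists M, forall t v, A (t, v) -> M < I t v -> V < v).

(* psi = O_s(I^{-k}), the second variable being I.  [D] is the domain of psi and
   [W] the part of D, interior to its domains of continuity, on which
   derivatives are taken. *)
Definition O_s (s k : nat) (D W : R -> R -> Prop) (psi : R -> R -> R) : Prop :=
  exists M C,
    (forall x y, D x y -> M < y -> Rabs (y ^ k * psi x y) <= C) /\
    (forall x y, W x y -> M < y ->
       ex_diff_n psi s x y /\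
       forall i j, (i + j <= s)%nat ->
         Rabs (y ^ k * partial_derive i j psi x y) <= C).

(* tau - I mod 1, the representative being selected by the integer m.  Near the
   discontinuity of the return map the representative of tau - I has to be the
   one close to the actual image, which need not be the one in [0,1). *)
Definition tau_bar (m : Z) (x y : R) : R := x - y + IZR m.

Definition Fhat (Delta : R) (m : Z) (x y : R) : R * R :=
  (tau_bar m x y, y + Delta * (tau_bar m x y - / 2)).

Definition Fcorr (Delta1 : R) (m : Z) (x y : R) : R * R :=
  (0, / y * (Delta1 * ((tau_bar m x y - / 2) ^ 2 - / 12))).

(* Main.v *)
(* Let g be the smooth extension of l from [0,1]. With w = g (v + g'), the
   quantity J = sqrt (w^2 + 2/3 g^3 g'') is an adiabatic invariant: along a flight
   that does not cross the jump of l' it changes by O(J^-3), while S = int g^-2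
   grows by 2/J + O(J^-4). In the variables X = S J / 2 and J such a flight is
   therefore (X, J) -> (X + 1, J) up to O(J^-3), together with derivatives, and
   the O(J) flights of one period add up to an error O(J^-2). The single flight
   across the jump is expanded explicitly: with z = 1 + X - alpha J / 2 before it,
   X becomes z + O(J^-2), and alpha J / 2 increases by
   Delta (z - 1/2) + 2 / (alpha J) Delta1 ((z - 1/2)^2 - 1/12) + O(J^-2).
   The boundary f(S) of the strip is the curve S = sigma (1/J) with
   sigma (e) = 2 e + O(e^4), so tau = S / sigma (1/J) takes values in [0,1), and
   I = alpha J / 2 + H (1/J) with H (e) = O(e^2) chosen so that dtau /\ dI is a
   constant multiple of omega. Composing the three expansions gives the return
   map, and the number of regular flights, being determined by the minimality of
   the return time, is locally constant where the image is off the line tau = 0. *)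

Require Import Defs.
From Stdlib Require Import Reals ZArith Lra Lia ClassicalEpsilon.
From Coquelicot Require Import Coquelicot.
Open Scope R_scope.

(** * Uniform bounds on derivatives *)

(** As v tends to infinity, a flight is better described by its departure time t and its duration d
    than by (t, v): J d is smooth in (t, d) through d = 0, and each estimate on a single flight
    becomes the vanishing of some Taylor coefficients in d. Solving for d as a function of t and 1/J
    then carries the estimates over to the small variable 1/J. The obstacle is that the remainder
    must be small together with five derivatives after a number of flights of order I. The deviation
    from the linear orbit is supposed to be at most 1 in C^s on boxes of fixed size; this bounds the
    next increment by C I^-3 with C independent of the number of flights made so far, and the sum of
    the increments confirms the supposition. For this reason constants are chosen before the
    functions and domains to which they apply. The jump is never differentiated across: g and its
    translate by one period are both smooth beyond it, and the flight over the jump is computed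
    between these two walls for z in (-1, 2), a range larger than the one that occurs. *)

Definition open2 (U : R -> R -> Prop) : Prop :=
  forall x y, U x y -> locally_2d U x y.

(** The first partials are existential witnesses, so closure properties are proved by exhibiting
    formulas. Continuity is demanded at every order: it makes the partials yield a total
    differential, which the chain rule needs. *)
Fixpoint Cb (n : nat) (U : R -> R -> Prop) (K : R) (f : R -> R -> R) : Prop :=
  (forall x y, U x y -> continuity_2d_pt f x y /\ Rabs (f x y) <= K) /\
  match n with
  | O => True
  | S m => exists fx fy,
      (forall x y, U x y -> is_derive (fun z => f z y) x (fx x y) /\
                            is_derive (fun z => f x z) y (fy x y)) /\
      Cb m U K fx /\ Cb m U K fy
  end.

Lemma Cb_value n U K f x y : Cb n U K f -> U x y -> Rabs (f x y) <= K.
Proof. destruct n; intros [H _] Hu; apply H; auto. Qed.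

Lemma Cb_cont n U K f x y : Cb n U K f -> U x y -> continuity_2d_pt f x y.
Proof. destruct n; intros [H _] Hu; apply H; auto. Qed.

Lemma Cb_le n U K K' f : K <= K' -> Cb n U K f -> Cb n U K' f.
Proof.
  revert f; induction n as [|n IH]; intros f HK [H1 H2]; split.
  - intros x y Hu; destruct (H1 x y Hu); split; auto; lra.
  - auto.
  - intros x y Hu; destruct (H1 x y Hu); split; auto; lra.
  - destruct H2 as (fx & fy & Hd & Hx & Hy); exists fx, fy; auto.
Qed.

Lemma Cb_sub n (U V : R -> R -> Prop) K f :
  (forall x y, V x y -> U x y) -> Cb n U K f -> Cb n V K f.
Proof.
  intros HV; revert f; induction n as [|n IH]; intros f [H1 H2]; split; auto.
  destruct H2 as (fx & fy & Hd & Hx & Hy); exists fx, fy; auto.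
Qed.

Lemma Cb_pred n U K f : Cb (S n) U K f -> Cb n U K f.
Proof.
  revert f; induction n as [|n IH]; intros f [H1 H2]; split; auto.
  destruct H2 as (fx & fy & Hd & Hx & Hy); exists fx, fy; auto.
Qed.

Lemma locally_2d_slice (U : R -> R -> Prop) x y :
  locally_2d U x y -> locally x (fun z => U z y) /\ locally y (fun z => U x z).
Proof.
  intros [d Hd]; split; exists d; intros z Hz; apply Hd; try exact Hz;
    rewrite Rminus_diag, Rabs_R0; apply cond_pos.
Qed.

Lemma Cb_ext n U K f g :
  open2 U -> (forall x y, U x y -> f x y = g x y) -> Cb n U K f -> Cb n U K g.
Proof.
  intros HU He Hf.
  assert (Hloc : forall x y, U x y -> locally_2d (fun u v => f u v = g u v) x y).
  { intros x y Hu; destruct (HU x y Hu) as [d Hd]; exists d; intros; apply He, Hd; auto. }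
  assert (H1' : forall x y, U x y -> continuity_2d_pt g x y /\ Rabs (g x y) <= K).
  { intros x y Hu; split.
    - exact (continuity_2d_pt_ext_loc _ _ _ _ (Hloc x y Hu) (Cb_cont _ _ _ _ _ _ Hf Hu)).
    - rewrite <- He; eauto using Cb_value. }
  destruct n; split; auto.
  destruct Hf as (_ & Hf); destruct Hf as (fx & fy & Hd & Hx & Hy); exists fx, fy; split; auto.
  intros x y Hu; destruct (Hd x y Hu) as [D1 D2].
  destruct (locally_2d_slice _ _ _ (Hloc x y Hu)) as [L1 L2].
  split.
  - eapply is_derive_ext_loc; [exact L1 | exact D1].
  - eapply is_derive_ext_loc; [exact L2 | exact D2].
Qed.

Lemma Cb_const n U K c : Rabs c <= K -> Cb n U K (fun _ _ => c).
Proof.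
  revert c; induction n as [|n IH]; intros c Hc; split; auto.
  - intros; split; auto; apply continuity_2d_pt_const.
  - intros; split; auto; apply continuity_2d_pt_const.
  - exists (fun _ _ => 0), (fun _ _ => 0).
    assert (H0 : Rabs 0 <= K) by (rewrite Rabs_R0; generalize (Rabs_pos c); lra).
    split; [|split; apply IH; auto].
    intros; split; apply is_derive_Reals, derivable_pt_lim_const.
Qed.

Lemma Cb_fst n (U : R -> R -> Prop) K :
  1 <= K -> (forall x y, U x y -> Rabs x <= K) -> Cb n U K (fun x _ => x).
Proof.
  intros HK HU; destruct n; split; auto.
  - intros; split; [apply continuity_2d_pt_id1 | eapply HU; eauto].
  - intros; split; [apply continuity_2d_pt_id1 | eapply HU; eauto].
  - exists (fun _ _ => 1), (fun _ _ => 0); split; [|split; apply Cb_const].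
    + intros; split; apply is_derive_Reals;
        [apply derivable_pt_lim_id | apply derivable_pt_lim_const].
    + rewrite Rabs_R1; auto.
    + rewrite Rabs_R0; lra.
Qed.

Lemma Cb_snd n (U : R -> R -> Prop) K :
  1 <= K -> (forall x y, U x y -> Rabs y <= K) -> Cb n U K (fun _ y => y).
Proof.
  intros HK HU; destruct n; split; auto.
  - intros; split; [apply continuity_2d_pt_id2 | eapply HU; eauto].
  - intros; split; [apply continuity_2d_pt_id2 | eapply HU; eauto].
  - exists (fun _ _ => 0), (fun _ _ => 1); split; [|split; apply Cb_const].
    + intros; split; apply is_derive_Reals;
        [apply derivable_pt_lim_const | apply derivable_pt_lim_id].
    + rewrite Rabs_R0; lra.
    + rewrite Rabs_R1; auto.
Qed.

Lemma Cb_plus n U K1 K2 f g :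
  Cb n U K1 f -> Cb n U K2 g -> Cb n U (K1 + K2) (fun x y => f x y + g x y).
Proof.
  assert (H0 : forall f g K1 K2,
    (forall x y, U x y -> continuity_2d_pt f x y /\ Rabs (f x y) <= K1) ->
    (forall x y, U x y -> continuity_2d_pt g x y /\ Rabs (g x y) <= K2) ->
    forall x y, U x y -> continuity_2d_pt (fun x y => f x y + g x y) x y /\
       Rabs (f x y + g x y) <= K1 + K2).
  { intros f0 g0 k1 k2 Hf Hg x y Hu.
    destruct (Hf x y Hu) as [Cf Bf], (Hg x y Hu) as [Cg Bg]; split.
    - apply continuity_2d_pt_plus; auto.
    - eapply Rle_trans; [apply Rabs_triang | lra]. }
  revert f g; induction n as [|n IH]; intros f g [Hf1 Hf2] [Hg1 Hg2]; split; eauto.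
  destruct Hf2 as (fx & fy & Hd & Hx & Hy), Hg2 as (gx & gy & Gd & Gx & Gy).
  exists (fun x y => fx x y + gx x y), (fun x y => fy x y + gy x y).
  split; [|split; apply IH; auto].
  intros x y Hu; destruct (Hd x y Hu), (Gd x y Hu); split;
    apply (is_derive_plus (V := R_NormedModule)); auto.
Qed.

(** Each differentiation turns a product into a sum of two products, whence the factor 2 ^ n. *)
Lemma Cb_mult n U K1 K2 f g :
  Cb n U K1 f -> Cb n U K2 g -> Cb n U (2 ^ n * (K1 * K2)) (fun x y => f x y * g x y).
Proof.
  assert (H0 : forall n f g K1 K2,
    (forall x y, U x y -> continuity_2d_pt f x y /\ Rabs (f x y) <= K1) ->
    (forall x y, U x y -> continuity_2d_pt g x y /\ Rabs (g x y) <= K2) ->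
    forall x y, U x y -> continuity_2d_pt (fun x y => f x y * g x y) x y /\
       Rabs (f x y * g x y) <= 2 ^ n * (K1 * K2)).
  { intros m f0 g0 k1 k2 Hf Hg x y Hu.
    destruct (Hf x y Hu) as [Cf Bf], (Hg x y Hu) as [Cg Bg]; split.
    - apply continuity_2d_pt_mult; auto.
    - rewrite Rabs_mult.
      assert (0 <= k1) by (generalize (Rabs_pos (f0 x y)); lra).
      assert (0 <= k2) by (generalize (Rabs_pos (g0 x y)); lra).
      assert (1 <= 2 ^ m) by (apply pow_R1_Rle; lra).
      assert (Rabs (f0 x y) * Rabs (g0 x y) <= k1 * k2)
        by (apply Rmult_le_compat; auto using Rabs_pos).
      assert (0 <= k1 * k2) by (apply Rmult_le_pos; auto).
      nra. }
  revert f g; induction n as [|n IH]; intros f g [Hf1 Hf2] [Hg1 Hg2]; split; eauto.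
  pose proof (conj Hf1 Hf2 : Cb (S n) U K1 f) as Cf; apply Cb_pred in Cf.
  pose proof (conj Hg1 Hg2 : Cb (S n) U K2 g) as Cg; apply Cb_pred in Cg.
  destruct Hf2 as (fx & fy & Hd & Hx & Hy), Hg2 as (gx & gy & Gd & Gx & Gy).
  exists (fun x y => fx x y * g x y + f x y * gx x y),
         (fun x y => fy x y * g x y + f x y * gy x y).
  replace (2 ^ S n * (K1 * K2)) with (2 ^ n * (K1 * K2) + 2 ^ n * (K1 * K2))
    by (simpl; ring).
  split; [|split; apply Cb_plus; apply IH; auto].
  intros x y Hu; destruct (Hd x y Hu), (Gd x y Hu).
  split; apply is_derive_Reals; apply (derivable_pt_lim_mult (fun z => f _ z) (fun z => g _ z))
   || apply (derivable_pt_lim_mult (fun z => f z _) (fun z => g z _)); apply is_derive_Reals; auto.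
Qed.

Lemma Cb_scal n U K c f : Cb n U K f -> Cb n U (Rabs c * K) (fun x y => c * f x y).
Proof.
  revert f; induction n as [|n IH]; intros f [H1 H2].
  - split; auto; intros x y Hu; destruct (H1 x y Hu); split.
    + apply (continuity_2d_pt_mult (fun _ _ => c)); auto using continuity_2d_pt_const.
    + rewrite Rabs_mult; apply Rmult_le_compat_l; auto using Rabs_pos.
  - split.
    + intros x y Hu; destruct (H1 x y Hu); split.
      * apply (continuity_2d_pt_mult (fun _ _ => c)); auto using continuity_2d_pt_const.
      * rewrite Rabs_mult; apply Rmult_le_compat_l; auto using Rabs_pos.
    + destruct H2 as (fx & fy & Hd & Hx & Hy).
      exists (fun x y => c * fx x y), (fun x y => c * fy x y); split; auto.
      intros x y Hu; destruct (Hd x y Hu); split;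
        apply is_derive_Reals; apply derivable_pt_lim_scal; apply is_derive_Reals; auto.
Qed.

Lemma Cb_opp n U K f : Cb n U K f -> Cb n U K (fun x y => - f x y).
Proof.
  revert f; induction n as [|n IH]; intros f [H1 H2].
  - split; auto; intros x y Hu; destruct (H1 x y Hu); split.
    + apply continuity_2d_pt_opp; auto.
    + rewrite Rabs_Ropp; auto.
  - split.
    + intros x y Hu; destruct (H1 x y Hu); split.
      * apply continuity_2d_pt_opp; auto.
      * rewrite Rabs_Ropp; auto.
    + destruct H2 as (fx & fy & Hd & Hx & Hy).
      exists (fun x y => - fx x y), (fun x y => - fy x y); split; auto.
      intros x y Hu; destruct (Hd x y Hu); split; apply (is_derive_opp (V := R_NormedModule)); auto.
Qed.

(** The constant depends on n, K and c alone, so that it serves a whole family of functions on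
    different domains. The induction uses (1/f)' = - f' / f^2, a product of functions already
    bounded to order n. *)
Lemma Cb_inv n K c : 0 < c -> exists C, 0 <= C /\ forall U f, Cb n U K f ->
  (forall x y, U x y -> c <= Rabs (f x y)) -> Cb n U C (fun x y => / f x y).
Proof.
  intros Hc.
  assert (H0 : forall U f, (forall x y, U x y -> continuity_2d_pt f x y /\ Rabs (f x y) <= K) ->
    (forall x y, U x y -> c <= Rabs (f x y)) -> forall x y, U x y ->
     f x y <> 0 /\ continuity_2d_pt (fun x y => / f x y) x y /\ Rabs (/ f x y) <= / c).
  { intros U f H Hl x y Hu; specialize (Hl x y Hu); destruct (H x y Hu) as [C B].
    assert (f x y <> 0) by (intros E; rewrite E, Rabs_R0 in Hl; lra).
    split; [auto|split].
    - apply continuity_2d_pt_inv; auto.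
    - rewrite Rabs_inv; apply Rinv_le_contravar; lra. }
  assert (Hic : 0 < / c) by (apply Rinv_0_lt_compat; auto).
  induction n as [|n [C [HC IH]]].
  - exists (/ c); split; [lra|]; intros U f [H1 _] Hl; split; auto.
    intros x y Hu; apply (H0 U f H1 Hl x y Hu).
  - set (C' := 2 ^ n * (K * (2 ^ n * (C * C)))).
    exists (/ c + Rabs C'); split; [generalize (Rabs_pos C'); lra|].
    intros U f [H1 H2] Hl.
    pose proof (conj H1 H2 : Cb (S n) U K f) as Cf; apply Cb_pred in Cf.
    split.
    + intros x y Hu; destruct (H0 U f H1 Hl x y Hu) as (_ & A & B); split; auto.
      generalize (Rabs_pos C'); lra.
    + destruct H2 as (fx & fy & Hd & Hx & Hy).
      exists (fun x y => - (fx x y * (/ f x y * / f x y))),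
             (fun x y => - (fy x y * (/ f x y * / f x y))).
      specialize (IH U f Cf Hl).
      split; [|split; apply Cb_opp; (apply Cb_le with C'; [generalize (Rle_abs C'); lra|]);
        (apply Cb_mult; [auto | apply Cb_mult; auto])].
      intros x y Hu; destruct (Hd x y Hu) as [D1 D2], (H0 U f H1 Hl x y Hu) as (N & _ & _).
      split.
      * replace (- (fx x y * (/ f x y * / f x y))) with (- fx x y / f x y ^ 2) by (field; auto).
        apply (is_derive_inv (fun z => f z y)); auto.
      * replace (- (fy x y * (/ f x y * / f x y))) with (- fy x y / f x y ^ 2) by (field; auto).
        apply (is_derive_inv (fun z => f x z)); auto.
Qed.

Lemma continuity_2d_pt_comp f a b x y :
  continuity_2d_pt f (a x y) (b x y) -> continuity_2d_pt a x y -> continuity_2d_pt b x y ->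
  continuity_2d_pt (fun u v => f (a u v) (b u v)) x y.
Proof.
  intros Hf Ha Hb eps.
  destruct (Hf eps) as [d Hd].
  destruct (Ha d) as [d1 H1], (Hb d) as [d2 H2].
  exists (mkposreal (Rmin d1 d2) (Rmin_pos _ _ (cond_pos d1) (cond_pos d2))).
  simpl; intros u v Hu Hv; apply Hd.
  - apply H1; eapply Rlt_le_trans; eauto using Rmin_l.
  - apply H2; eapply Rlt_le_trans; eauto using Rmin_r.
Qed.

(** The mean value theorem is applied on the two legs from (x, y) to (x, v) and from there to (u,
    v); the intermediate points stay where the partials are close to their values at (x, y). *)
Lemma differentiable_of_partials (V : R -> R -> Prop) f fx fy x y :
  open2 V -> V x y ->
  (forall u v, V u v -> is_derive (fun z => f z v) u (fx u v) /\
                        is_derive (fun z => f u z) v (fy u v)) ->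
  continuity_2d_pt fx x y -> continuity_2d_pt fy x y ->
  differentiable_pt_lim f x y (fx x y) (fy x y).
Proof.
  intros HV Hxy Hd Cx Cy.
  destruct (HV x y Hxy) as [d0 H0].
  intros eps.
  set (e2 := pos_div_2 eps).
  destruct (Cx e2) as [d1 H1], (Cy e2) as [d2 H2].
  assert (Hp : 0 < Rmin d0 (Rmin d1 d2))
    by (apply Rmin_pos; [apply cond_pos | apply Rmin_pos; apply cond_pos]).
  exists (mkposreal _ Hp); simpl; intros u v Hu Hv.
  assert (L0 := Rmin_l d0 (Rmin d1 d2)); assert (L1 := Rmin_r d0 (Rmin d1 d2)).
  assert (L2 := Rmin_l d1 d2); assert (L3 := Rmin_r d1 d2).
  assert (Hb : forall s t r, Rmin s t <= r <= Rmax s t -> Rabs (r - s) <= Rabs (t - s)).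
  { intros s t r; unfold Rmin, Rmax; destruct (Rle_dec s t); intros;
      [rewrite !Rabs_right by lra | rewrite !Rabs_left1 by lra]; lra. }
  destruct (MVT_gen (fun z => f z v) x u (fun z => fx z v)) as (c1 & Hc1 & E1).
  { intros z Hz; apply Hd, H0; [|lra].
    eapply Rle_lt_trans; [apply (Hb x u); lra | lra]. }
  { intros z Hz; apply derivable_continuous_pt; exists (fx z v).
    apply is_derive_Reals; apply Hd, H0; [|lra].
    eapply Rle_lt_trans; [apply (Hb x u); lra | lra]. }
  destruct (MVT_gen (fun z => f x z) y v (fun z => fy x z)) as (c2 & Hc2 & E2).
  { intros z Hz; apply Hd, H0; [rewrite Rminus_diag, Rabs_R0; apply cond_pos|].
    eapply Rle_lt_trans; [apply (Hb y v); lra | lra]. }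
  { intros z Hz; apply derivable_continuous_pt; exists (fy x z).
    apply is_derive_Reals; apply Hd, H0; [rewrite Rminus_diag, Rabs_R0; apply cond_pos|].
    eapply Rle_lt_trans; [apply (Hb y v); lra | lra]. }
  apply Hb in Hc1; apply Hb in Hc2; cbv beta in E1, E2.
  replace (f u v - f x y - (fx x y * (u - x) + fy x y * (v - y)))
    with ((fx c1 v - fx x y) * (u - x) + (fy x c2 - fy x y) * (v - y)) by lra.
  assert (A1 : Rabs (fx c1 v - fx x y) < eps / 2) by (apply H1; lra).
  assert (A2 : Rabs (fy x c2 - fy x y) < eps / 2).
  { apply H2; [rewrite Rminus_diag, Rabs_R0; apply cond_pos | lra]. }
  eapply Rle_trans; [apply Rabs_triang|]; rewrite !Rabs_mult.
  assert (M1 := Rmax_l (Rabs (u - x)) (Rabs (v - y))).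
  assert (M2 := Rmax_r (Rabs (u - x)) (Rabs (v - y))).
  generalize (Rabs_pos (u - x)) (Rabs_pos (v - y)) (Rabs_pos (fx c1 v - fx x y))
     (Rabs_pos (fy x c2 - fy x y)); intros.
  set (m := Rmax _ _) in *.
  assert (Rabs (fx c1 v - fx x y) * Rabs (u - x) <= eps / 2 * m)
    by (apply Rmult_le_compat; lra).
  assert (Rabs (fy x c2 - fy x y) * Rabs (v - y) <= eps / 2 * m)
    by (apply Rmult_le_compat; lra).
  lra.
Qed.

(** As for the inverse, the constant precedes the domains and the functions. The partials of the
    composition are sums of products of compositions to which the induction hypothesis applies, with
    [a] and [b] taken at one order less. *)
Lemma Cb_comp n K Ka : exists C, 0 <= C /\ forall U V f a b, open2 V ->
  Cb n V K f -> Cb n U Ka a -> Cb n U Ka b ->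
  (forall x y, U x y -> V (a x y) (b x y)) ->
  Cb n U C (fun x y => f (a x y) (b x y)).
Proof.
  assert (H0 : forall n U V f a b, Cb n V K f -> Cb n U Ka a -> Cb n U Ka b ->
    (forall x y, U x y -> V (a x y) (b x y)) ->
    forall x y, U x y -> continuity_2d_pt (fun x y => f (a x y) (b x y)) x y /\
      Rabs (f (a x y) (b x y)) <= Rabs K).
  { intros m U V f a b Hf Ha Hb HUV x y Hu; split.
    - apply continuity_2d_pt_comp; eauto using Cb_cont.
    - eapply Rle_trans; [|apply Rle_abs]; eauto using Cb_value. }
  induction n as [|n [C [HC IH]]].
  - exists (Rabs K); split; [apply Rabs_pos|].
    intros U V f a b HV Hf Ha Hb HUV; split; auto.
    eapply (H0 0%nat); eauto.
  - set (C' := 2 ^ n * (C * Ka) + 2 ^ n * (C * Ka)).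
    exists (Rabs K + Rabs C'); split; [generalize (Rabs_pos K) (Rabs_pos C'); lra|].
    intros U V f a b HV Hf Ha Hb HUV; split.
    + intros x y Hu; destruct (H0 _ U V f a b Hf Ha Hb HUV x y Hu); split; auto.
      generalize (Rabs_pos C'); lra.
    + pose proof (Cb_pred _ _ _ _ Ha) as Ha'; pose proof (Cb_pred _ _ _ _ Hb) as Hb'.
      destruct Hf as (_ & fx & fy & Hd & Hx & Hy).
      destruct Ha as (_ & ax & ay & Ad & Ax & Ay).
      destruct Hb as (_ & bx & b_y & Bd & Bx & By).
      exists (fun x y => fx (a x y) (b x y) * ax x y + fy (a x y) (b x y) * bx x y),
             (fun x y => fx (a x y) (b x y) * ay x y + fy (a x y) (b x y) * b_y x y).
      split.
      * intros x y Hu.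
        destruct (Ad x y Hu) as [A1 A2], (Bd x y Hu) as [B1 B2].
        pose proof (differentiable_of_partials V f fx fy _ _ HV (HUV x y Hu) Hd
          (Cb_cont _ _ _ _ _ _ Hx (HUV x y Hu)) (Cb_cont _ _ _ _ _ _ Hy (HUV x y Hu))) as DF.
        split; apply is_derive_Reals.
        -- apply (derivable_pt_lim_comp_2d f (fun z => a z y) (fun z => b z y)); auto;
             apply is_derive_Reals; auto.
        -- apply (derivable_pt_lim_comp_2d f (fun z => a x z) (fun z => b x z)); auto;
             apply is_derive_Reals; auto.
      * assert (HC' : C' <= Rabs K + Rabs C') by (generalize (Rabs_pos K) (Rle_abs C'); lra).
        split; (apply Cb_le with C'; [auto|]); apply Cb_plus; apply Cb_mult; eauto.
Qed.

Lemma Cb_ex_diff_n n U K f x y : open2 U -> Cb n U K f -> U x y -> ex_diff_n f n x y.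
Proof.
  intros HU; revert f x y; induction n as [|n IH]; intros f x y [H1 H2] Hu; split;
    try apply H1; auto.
  destruct H2 as (fx & fy & Hd & Hx & Hy).
  destruct (HU x y Hu) as [d HD].
  split; [exists (fx x y); apply Hd; auto|].
  split; [exists (fy x y); apply Hd; auto|].
  split.
  - apply ex_diff_n_ext_loc with fx; auto.
    exists d; intros u v A B; symmetry; apply is_derive_unique, Hd; auto.
  - apply ex_diff_n_ext_loc with fy; auto.
    exists d; intros u v A B; symmetry; apply is_derive_unique, Hd; auto.
Qed.

(** [partial_derive i j] differentiates j times in the second variable and then i times in the
    first, so the witnesses of [Cb] are followed in that order; on the open set U they agree with
    the iterated [Derive]. *)
Lemma Cb_partial_derive n U K f i j x y : open2 U -> Cb n U K f -> (i + j <= n)%nat ->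
  U x y -> Rabs (partial_derive i j f x y) <= K.
Proof.
  intros HU Hf Hij.
  assert (Hy : exists h, Cb (n - j) U K h /\
            forall x y, U x y -> Derive_n (fun z => f x z) j y = h x y).
  { assert (Hj : (j <= n)%nat) by lia; clear Hij i.
    induction j as [|j IH].
    - exists f; rewrite Nat.sub_0_r; auto.
    - destruct IH as (h & Hh & E); [lia|].
      replace (n - j)%nat with (S (n - S j)) in Hh by lia.
      destruct Hh as (_ & hx & hy & Hd & _ & Hy).
      exists hy; split; auto; intros u v Hu; simpl.
      rewrite (Derive_ext_loc _ (fun z => h u z)).
      + apply is_derive_unique, Hd; auto.
      + destruct (locally_2d_slice _ _ _ (HU u v Hu)) as [_ L].
        revert L; apply filter_imp; auto. }
  destruct Hy as (h & Hh & E).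
  assert (Hx : exists k, Cb (n - j - i) U K k /\
            forall x y, U x y -> Derive_n (fun t => Derive_n (fun z => f t z) j y) i x = k x y).
  { assert (Hi : (i <= n - j)%nat) by lia; clear Hij.
    induction i as [|i IH].
    - exists h; rewrite Nat.sub_0_r; auto.
    - destruct IH as (k & Hk & Ek); [lia|].
      replace (n - j - i)%nat with (S (n - j - S i)) in Hk by lia.
      destruct Hk as (_ & kx & ky & Hd & Hkx & _).
      exists kx; split; auto; intros u v Hu; simpl.
      rewrite (Derive_ext_loc _ (fun z => k z v)).
      + apply is_derive_unique, Hd; auto.
      + destruct (locally_2d_slice _ _ _ (HU u v Hu)) as [L _].
        revert L; apply filter_imp; auto. }
  destruct Hx as (k & Hk & Ek).
  intros Hu; unfold partial_derive; rewrite Ek by auto; eauto using Cb_value.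
Qed.

(** * Smooth functions with bounded derivatives *)

(** The bound may depend on the order. This notion serves for the finitely many fixed functions of
    the construction, where constants need not be followed; [Cb] is kept for families. *)
Definition Sm (U : R -> R -> Prop) (f : R -> R -> R) : Prop :=
  forall n, exists K, 0 <= K /\ Cb n U K f.

Lemma Sm_intro U f : (forall n, exists K, Cb n U K f) -> Sm U f.
Proof.
  intros H n; destruct (H n) as [K HK]; exists (Rabs K); split; [apply Rabs_pos|].
  eapply Cb_le; [apply Rle_abs | exact HK].
Qed.

Lemma Sm_bound U f : Sm U f -> exists K, 0 <= K /\ forall x y, U x y -> Rabs (f x y) <= K.
Proof.
  intros H; destruct (H 0%nat) as (K & HK & HC); exists K; split; auto.
  intros; eauto using Cb_value.
Qed.

Lemma Sm_cont U f x y : Sm U f -> U x y -> continuity_2d_pt f x y.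
Proof. intros H Hu; destruct (H 0%nat) as (K & _ & HC); eauto using Cb_cont. Qed.

Lemma Sm_sub (U V : R -> R -> Prop) f : (forall x y, V x y -> U x y) -> Sm U f -> Sm V f.
Proof. intros HV H n; destruct (H n) as (K & HK & HC); exists K; eauto using Cb_sub. Qed.

Lemma Sm_ext U f g : open2 U -> (forall x y, U x y -> f x y = g x y) -> Sm U f -> Sm U g.
Proof. intros HU He H n; destruct (H n) as (K & HK & HC); exists K; eauto using Cb_ext. Qed.

Lemma Sm_const U c : Sm U (fun _ _ => c).
Proof. apply Sm_intro; intros n; exists (Rabs c); apply Cb_const, Rle_refl. Qed.

Lemma Sm_fst U K : (forall x y, U x y -> Rabs x <= K) -> Sm U (fun x _ => x).
Proof.
  intros H; apply Sm_intro; intros n; exists (1 + Rabs K).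
  apply Cb_fst; [generalize (Rabs_pos K); lra|].
  intros x y Hu; specialize (H x y Hu); generalize (Rle_abs K); lra.
Qed.

Lemma Sm_snd U K : (forall x y, U x y -> Rabs y <= K) -> Sm U (fun _ y => y).
Proof.
  intros H; apply Sm_intro; intros n; exists (1 + Rabs K).
  apply Cb_snd; [generalize (Rabs_pos K); lra|].
  intros x y Hu; specialize (H x y Hu); generalize (Rle_abs K); lra.
Qed.

Lemma Sm_plus U f g : Sm U f -> Sm U g -> Sm U (fun x y => f x y + g x y).
Proof.
  intros Hf Hg; apply Sm_intro; intros n.
  destruct (Hf n) as (K & _ & HK), (Hg n) as (L & _ & HL); eauto using Cb_plus.
Qed.

Lemma Sm_opp U f : Sm U f -> Sm U (fun x y => - f x y).
Proof.
  intros Hf; apply Sm_intro; intros n; destruct (Hf n) as (K & _ & HK); eauto using Cb_opp.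
Qed.

Lemma Sm_minus U f g : Sm U f -> Sm U g -> Sm U (fun x y => f x y - g x y).
Proof. intros; unfold Rminus; apply Sm_plus; auto using Sm_opp. Qed.

Lemma Sm_mult U f g : Sm U f -> Sm U g -> Sm U (fun x y => f x y * g x y).
Proof.
  intros Hf Hg; apply Sm_intro; intros n.
  destruct (Hf n) as (K & _ & HK), (Hg n) as (L & _ & HL); eauto using Cb_mult.
Qed.

Lemma Sm_pow U f k : Sm U f -> Sm U (fun x y => f x y ^ k).
Proof.
  intros Hf; induction k as [|k IH]; [exact (Sm_const U 1)|].
  apply (Sm_mult U f (fun x y => f x y ^ k)); auto.
Qed.

Lemma Sm_inv U f c : 0 < c -> (forall x y, U x y -> c <= Rabs (f x y)) -> Sm U f ->
  Sm U (fun x y => / f x y).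
Proof.
  intros Hc Hl Hf; apply Sm_intro; intros n; destruct (Hf n) as (K & _ & HK).
  destruct (Cb_inv n K c Hc) as (C & _ & HC); eauto.
Qed.

Lemma Sm_div U f g c : 0 < c -> (forall x y, U x y -> c <= Rabs (g x y)) -> Sm U f -> Sm U g ->
  Sm U (fun x y => f x y / g x y).
Proof. intros; unfold Rdiv; apply Sm_mult; eauto using Sm_inv. Qed.

Lemma Sm_comp U V f a b : open2 V -> Sm V f -> Sm U a -> Sm U b ->
  (forall x y, U x y -> V (a x y) (b x y)) -> Sm U (fun x y => f (a x y) (b x y)).
Proof.
  intros HV Hf Ha Hb HUV; apply Sm_intro; intros n.
  destruct (Hf n) as (K & _ & HK), (Ha n) as (L & HL0 & HL), (Hb n) as (M & HM0 & HM).
  destruct (Cb_comp n K (L + M)) as (C & _ & HC); exists C.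
  apply HC with V; auto; (eapply Cb_le; [|eassumption]); lra.
Qed.

Lemma Sm_deriv U f : open2 U -> Sm U f -> exists fx fy,
  (forall x y, U x y -> is_derive (fun z => f z y) x (fx x y) /\
                        is_derive (fun z => f x z) y (fy x y)) /\ Sm U fx /\ Sm U fy.
Proof.
  intros HU H.
  exists (fun x y => Derive (fun z => f z y) x), (fun x y => Derive (fun z => f x z) y).
  split; [|split].
  - intros x y Hu; destruct (H 1%nat) as (K & _ & _ & fx & fy & Hd & _).
    destruct (Hd x y Hu) as [D1 D2].
    split; apply Derive_correct; eexists; eassumption.
  - intros n; destruct (H (S n)) as (K & HK & _ & fx & fy & Hd & Hx & Hy); exists K; split; auto.
    apply Cb_ext with fx; auto; intros; symmetry; apply is_derive_unique, Hd; auto.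
  - intros n; destruct (H (S n)) as (K & HK & _ & fx & fy & Hd & Hx & Hy); exists K; split; auto.
    apply Cb_ext with fy; auto; intros; symmetry; apply is_derive_unique, Hd; auto.
Qed.

(** The partials of sqrt f are f' / (2 sqrt f), so a bound of order n for sqrt f yields one of order
    n + 1 through [Cb_inv]; the lower bound on f keeps the root away from 0. *)
Lemma Sm_sqrt U f c : open2 U -> 0 < c -> (forall x y, U x y -> c <= f x y) -> Sm U f ->
  Sm U (fun x y => sqrt (f x y)).
Proof.
  intros HU Hc Hl Hf.
  destruct (Sm_deriv U f HU Hf) as (fx & fy & Hd & Hx & Hy).
  destruct (Sm_bound U f Hf) as (K & HK & HB).
  assert (H0 : forall x y, U x y -> continuity_2d_pt (fun x y => sqrt (f x y)) x y /\
     Rabs (sqrt (f x y)) <= sqrt K).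
  { intros x y Hu; split.
    - apply (continuity_1d_2d_pt_comp sqrt); [|eapply Sm_cont; eauto].
      apply continuity_pt_sqrt; specialize (Hl x y Hu); lra.
    - rewrite Rabs_right by (apply Rle_ge, sqrt_pos); apply sqrt_le_1_alt.
      eapply Rle_trans; [apply Rle_abs | auto]. }
  apply Sm_intro; induction n as [|n [L HL]].
  - exists (sqrt K); split; auto.
  - assert (Hs : 0 < sqrt c) by (apply sqrt_lt_R0; auto).
    destruct (Cb_inv n L (sqrt c) Hs) as (C & _ & HC).
    assert (HI : Cb n U C (fun x y => / sqrt (f x y))).
    { apply HC; auto; intros x y Hu.
      rewrite Rabs_right by (apply Rle_ge, sqrt_pos); apply sqrt_le_1_alt; auto. }
    clear HC.
    destruct (Hx n) as (Kx & _ & HKx), (Hy n) as (Ky & _ & HKy).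
    pose proof (Cb_scal _ _ _ (/2) _ (Cb_mult _ _ _ _ _ _ HKx HI)) as Bx.
    pose proof (Cb_scal _ _ _ (/2) _ (Cb_mult _ _ _ _ _ _ HKy HI)) as By.
    match type of Bx with Cb _ _ ?A _ => set (k1 := A) in * end.
    match type of By with Cb _ _ ?A _ => set (k2 := A) in * end.
    exists (sqrt K + Rabs k1 + Rabs k2).
    generalize (Rabs_pos k1) (Rabs_pos k2) (Rle_abs k1) (Rle_abs k2) (sqrt_pos K); intros.
    split.
    + intros x y Hu; destruct (H0 x y Hu); split; auto; lra.
    + eexists; eexists; split;
        [|split; [eapply Cb_le; [|exact Bx] | eapply Cb_le; [|exact By]]; lra].
      intros x y Hu; destruct (Hd x y Hu) as [D1 D2]; specialize (Hl x y Hu).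
      assert (sqrt (f x y) <> 0) by (apply Rgt_not_eq, sqrt_lt_R0; lra).
      split.
      * replace (/ 2 * (fx x y * / sqrt (f x y))) with (fx x y / (2 * sqrt (f x y)))
          by (field; auto).
        apply (is_derive_sqrt (fun z => f z y)); auto; lra.
      * replace (/ 2 * (fy x y * / sqrt (f x y))) with (fy x y / (2 * sqrt (f x y)))
          by (field; auto).
        apply (is_derive_sqrt (fun z => f x z)); auto; lra.
Qed.

(** Functions of one variable are treated as functions of two that ignore the second, so that the
    calculus above applies to them. *)
Definition itv (a b : R) : R -> R -> Prop := fun x _ => a < x < b.
Definition smI (a b : R) (h : R -> R) : Prop := Sm (itv a b) (fun x _ => h x).

Lemma open2_lt_cont (P : R -> R -> Prop) (f : R -> R -> R) : 
  (forall x y, continuity_2d_pt f x y) -> (forall x y, P x y <-> 0 < f x y) -> open2 P.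
Proof.
  intros Hf HP x y H; apply HP in H.
  destruct (Hf x y (mkposreal _ H)) as [d Hd]; exists d; simpl in *.
  intros u v Hu Hv; apply HP; specialize (Hd u v Hu Hv).
  apply Rabs_lt_between in Hd; lra.
Qed.

Lemma open2_and (P Q : R -> R -> Prop) : open2 P -> open2 Q -> open2 (fun x y => P x y /\ Q x y).
Proof.
  intros HP HQ x y [H1 H2].
  destruct (HP x y H1) as [d1 D1], (HQ x y H2) as [d2 D2].
  exists (mkposreal (Rmin d1 d2) (Rmin_pos _ _ (cond_pos d1) (cond_pos d2))).
  simpl; intros u v Hu Hv; split; [apply D1 | apply D2];
    eapply Rlt_le_trans; eauto using Rmin_l, Rmin_r.
Qed.

Lemma open2_itv a b : open2 (itv a b).
Proof.
  apply (open2_and (fun x _ => a < x) (fun x _ => x < b)).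
  - apply open2_lt_cont with (fun x _ => x - a); [|intros; lra].
    intros; apply continuity_2d_pt_minus;
      [apply continuity_2d_pt_id1 | apply continuity_2d_pt_const].
  - apply open2_lt_cont with (fun x _ => b - x); [|intros; lra].
    intros; apply continuity_2d_pt_minus;
      [apply continuity_2d_pt_const | apply continuity_2d_pt_id1].
Qed.

Lemma Sm_comp1 U a b h f : smI a b h -> Sm U f -> (forall x y, U x y -> a < f x y < b) ->
  Sm U (fun x y => h (f x y)).
Proof.
  intros Hh Hf HU.
  apply (Sm_comp U (itv a b) (fun x _ => h x) f f); auto using open2_itv.
Qed.

Lemma smI_deriv a b h : smI a b h ->
  (forall t, a < t < b -> is_derive h t (Derive h t)) /\ smI a b (Derive h).
Proof.
  intros H; destruct (Sm_deriv _ _ (open2_itv a b) H) as (fx & fy & Hd & Hx & _).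
  split.
  - intros t Ht; destruct (Hd t 0 Ht) as [D _]; apply Derive_correct; eexists; exact D.
  - apply Sm_ext with fx; auto using open2_itv.
    intros x y Hu; symmetry; apply is_derive_unique, Hd; auto.
Qed.

Lemma smI_intro a b h r : (forall t, a < t < b -> is_derive h t (r t)) -> smI a b r ->
  (exists K, forall t, a < t < b -> Rabs (h t) <= K) -> smI a b h.
Proof.
  intros Hd Hr [K HK]; apply Sm_intro; intros n.
  assert (H0 : forall x y, itv a b x y -> continuity_2d_pt (fun x _ => h x) x y /\ Rabs (h x) <= K).
  { intros x y Hu; split; [|apply HK; auto].
    apply (continuity_1d_2d_pt_comp h (fun x _ => x)); [|apply continuity_2d_pt_id1].
    apply derivable_continuous_pt; exists (r x); apply is_derive_Reals; auto. }
  destruct n as [|n]; [exists K; split; auto|].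
  destruct (Hr n) as (L & HL & HC).
  exists (Rabs K + L); generalize (Rle_abs K) (Rabs_pos K); intros; split.
  - intros x y Hu; destruct (H0 x y Hu); split; auto; lra.
  - exists (fun x _ => r x), (fun _ _ => 0); split; [|split].
    + intros x y Hu; split; [apply Hd; auto|].
      apply is_derive_Reals, derivable_pt_lim_const.
    + eapply Cb_le; [|exact HC]; lra.
    + apply Cb_const; rewrite Rabs_R0; lra.
Qed.

Lemma bounded_on_segment (f : R -> R) a b :
  (forall c, a <= c <= b -> continuity_pt f c) ->
  exists K, forall c, a <= c <= b -> Rabs (f c) <= K.
Proof.
  intros H; destruct (Rle_lt_dec a b) as [Hab|Hab]; [|exists 0; intros; lra].
  destruct (continuity_ab_maj (fun x => Rabs (f x)) a b Hab) as (M & HM & _).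
  - intros c Hc; apply (continuity_pt_comp f Rabs); auto; apply Rcontinuity_abs.
  - exists (Rabs (f M)); auto.
Qed.

Lemma smI_of_ex_derive_n g : (forall n t, ex_derive_n g n t) -> forall a b, smI a b g.
Proof.
  intros Hg a b.
  enough (H : forall n k, exists K, 0 <= K /\ Cb n (itv a b) K (fun x _ => Derive_n g k x))
    by (intros n; exact (H n 0%nat)).
  assert (Hd : forall k t, is_derive (Derive_n g k) t (Derive_n g (S k) t))
    by (intros k t; apply Derive_correct; exact (Hg (S k) t)).
  assert (Hb : forall k, exists K, 0 <= K /\ forall x y, itv a b x y ->
     continuity_2d_pt (fun x _ => Derive_n g k x) x y /\ Rabs (Derive_n g k x) <= K).
  { intros k.
    assert (Hc : forall x, continuity_pt (Derive_n g k) x)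
      by (intros x; apply derivable_continuous_pt; eexists; apply is_derive_Reals, Hd).
    destruct (bounded_on_segment (Derive_n g k) a b) as [K HK]; [auto|].
    exists (Rabs K); split; [apply Rabs_pos|]; intros x y [H1 H2]; split.
    - apply (continuity_1d_2d_pt_comp (Derive_n g k) (fun x _ => x)); auto.
      apply continuity_2d_pt_id1.
    - eapply Rle_trans; [apply HK; lra | apply Rle_abs]. }
  induction n as [|n IH]; intros k.
  - destruct (Hb k) as (K & HK & HB); exists K; split; auto; split; auto.
  - destruct (Hb k) as (K & HK & HB), (IH (S k)) as (L & HL & HC).
    exists (K + L); split; [lra|]; split.
    + intros x y Hu; destruct (HB x y Hu); split; auto; lra.
    + exists (fun x _ => Derive_n g (S k) x), (fun _ _ => 0); split; [|split].
      * intros x y Hu; split; [apply Hd|]; apply is_derive_Reals, derivable_pt_lim_const.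
      * eapply Cb_le; [|exact HC]; lra.
      * apply Cb_const; rewrite Rabs_R0; lra.
Qed.

Lemma smI_Derive_n a b h k : smI a b h -> smI a b (Derive_n h k).
Proof. intros H; induction k as [|k IH]; auto; simpl; apply smI_deriv in IH; apply IH. Qed.

(** A quadratic increment estimate can be integrated over a parameter, so this criterion allows
    differentiation under the integral sign. *)
Lemma is_derive_quadratic (F : R -> R) x l C (d : posreal) :
  (forall k, Rabs k < d -> Rabs (F (x + k) - F x - k * l) <= C * k ^ 2) -> is_derive F x l.
Proof.
  intros H; apply is_derive_Reals; intros eps He.
  set (C' := Rabs C + 1).
  assert (HC : 0 < C') by (unfold C'; generalize (Rabs_pos C); lra).
  assert (Hp : 0 < Rmin d (eps / C'))
    by (apply Rmin_pos; [apply cond_pos | apply Rdiv_lt_0_compat; auto]).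
  exists (mkposreal _ Hp); simpl; intros k Hk Hlt.
  assert (L1 := Rmin_l d (eps / C')); assert (L2 := Rmin_r d (eps / C')).
  replace ((F (x + k) - F x) / k - l) with ((F (x + k) - F x - k * l) / k) by (field; auto).
  unfold Rdiv; rewrite Rabs_mult, Rabs_inv.
  assert (Hkp : 0 < Rabs k) by (apply Rabs_pos_lt; auto).
  apply Rmult_lt_reg_r with (Rabs k); auto.
  rewrite Rmult_assoc, Rinv_l, Rmult_1_r by lra.
  eapply Rle_lt_trans; [apply H; lra|].
  rewrite <- (pow2_abs k).
  assert (C * Rabs k < eps).
  { apply Rle_lt_trans with (C' * Rabs k).
    - apply Rmult_le_compat_r; [lra|]; unfold C'; generalize (Rle_abs C); lra.
    - apply Rlt_le_trans with (C' * (eps / C')); [apply Rmult_lt_compat_l; lra|].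
      right; field; lra. }
  simpl; nra.
Qed.

Lemma Rabs_between s t r : Rmin s t <= r <= Rmax s t -> Rabs (r - s) <= Rabs (t - s).
Proof.
  unfold Rmin, Rmax; destruct (Rle_dec s t); intros;
    [rewrite !Rabs_right by lra | rewrite !Rabs_left1 by lra]; lra.
Qed.

Lemma lipschitz_of_derive (f df : R -> R) a b K :
  (forall t, a < t < b -> is_derive f t (df t)) -> (forall t, a < t < b -> Rabs (df t) <= K) ->
  forall u v, a < u < b -> a < v < b -> Rabs (f v - f u) <= K * Rabs (v - u).
Proof.
  intros Hd HK u v Hu Hv.
  assert (Hin : forall t, Rmin u v <= t <= Rmax u v -> a < t < b).
  { intros t; unfold Rmin, Rmax; destruct (Rle_dec u v); lra. }
  destruct (MVT_gen f u v df) as (c & Hc & E).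
  - intros t Ht; apply Hd, Hin; lra.
  - intros t Ht; apply derivable_continuous_pt; exists (df t); apply is_derive_Reals; auto.
  - rewrite E, Rabs_mult; apply Rmult_le_compat_r; auto using Rabs_pos.
Qed.

Lemma quadratic_of_derive (f df ddf : R -> R) a b K :
  (forall t, a < t < b -> is_derive f t (df t)) -> (forall t, a < t < b -> is_derive df t (ddf t)) ->
  (forall t, a < t < b -> Rabs (ddf t) <= K) ->
  forall u v, a < u < b -> a < v < b ->
    Rabs (f v - f u - (v - u) * df u) <= K * (v - u) ^ 2.
Proof.
  intros Hd Hdd HK u v Hu Hv.
  assert (Hin : forall t, Rmin u v <= t <= Rmax u v -> a < t < b).
  { intros t; unfold Rmin, Rmax; destruct (Rle_dec u v); lra. }
  destruct (MVT_gen f u v df) as (c & Hc & E).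
  - intros t Ht; apply Hd, Hin; lra.
  - intros t Ht; apply derivable_continuous_pt; exists (df t); apply is_derive_Reals; auto.
  - rewrite E; replace (df c * (v - u) - (v - u) * df u) with ((df c - df u) * (v - u)) by ring.
    rewrite Rabs_mult, <- (pow2_abs (v - u)).
    assert (L := lipschitz_of_derive df ddf a b K Hdd HK u c Hu (Hin c Hc)).
    assert (B := Rabs_between u v c Hc).
    assert (0 <= K) by (eapply Rle_trans; [apply Rabs_pos | apply (HK u Hu)]).
    generalize (Rabs_pos (v - u)) (Rabs_pos (c - u)); intros.
    assert (Rabs (df c - df u) <= K * Rabs (v - u)) by nra.
    simpl; nra.
Qed.

(** * Taylor's formula with a remainder smooth in the base point and the increment *)

Definition seg (a b : R) : R -> R -> Prop := fun t d => a < t < b /\ a < t + d < b.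

Lemma open2_seg a b : open2 (seg a b).
Proof.
  apply (open2_and (fun t _ => a < t < b) (fun t d => a < t + d < b)); [apply open2_itv|].
  apply (open2_and (fun t d => a < t + d) (fun t d => t + d < b)).
  - apply open2_lt_cont with (fun x y => x + y - a); [|intros; lra].
    intros; apply continuity_2d_pt_minus; [|apply continuity_2d_pt_const].
    apply continuity_2d_pt_plus; [apply continuity_2d_pt_id1 | apply continuity_2d_pt_id2].
  - apply open2_lt_cont with (fun x y => b - (x + y)); [|intros; lra].
    intros; apply continuity_2d_pt_minus; [apply continuity_2d_pt_const|].
    apply continuity_2d_pt_plus; [apply continuity_2d_pt_id1 | apply continuity_2d_pt_id2].
Qed.

Lemma seg_in a b t d x : seg a b t d -> 0 <= x <= 1 -> a < t + x * d < b.
Proof.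
  intros [H1 H2] Hx; destruct (Rle_lt_dec 0 d).
  - assert (0 <= x * d <= d) by nra; lra.
  - assert (d <= x * d <= 0) by nra; lra.
Qed.

(** With p x = (1 - x)^k / k! and the derivative of order k + 1 in the place of h, this is the
    integral remainder of Taylor's formula divided by d^(k+1); in this form it is smooth through d =
    0. *)
Definition taylor_mean (p h : R -> R) (t d : R) : R := RInt (fun x => p x * h (t + x * d)) 0 1.

Section TaylorRemainder.
Variables a b : R.

Lemma ex_RInt_taylor_mean (p h : R -> R) t d :
  (forall x, continuous p x) -> (forall u, a < u < b -> continuous h u) -> seg a b t d ->
  ex_RInt (fun x => p x * h (t + x * d)) 0 1.
Proof.
  intros Hp Hh Hs; apply (ex_RInt_continuous (V := R_CompleteNormedModule)).
  rewrite Rmin_left, Rmax_right by lra; intros x Hx.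
  apply (continuous_mult p (fun x => h (t + x * d))); auto.
  apply (continuous_comp (fun x => t + x * d) h); [|apply Hh, seg_in; auto].
  apply (continuous_plus (V := R_NormedModule)); [apply continuous_const|].
  apply (continuous_mult (fun x => x) (fun _ => d)); [apply continuous_id | apply continuous_const].
Qed.

Lemma abs_RInt_01_le (f : R -> R) K : ex_RInt f 0 1 ->
  (forall x, 0 <= x <= 1 -> Rabs (f x) <= K) -> Rabs (RInt f 0 1) <= K.
Proof.
  intros Hf HK; replace K with ((1 - 0) * K) by ring.
  apply (abs_RInt_le_const f 0 1 K); auto; lra.
Qed.

(** Differentiation in t replaces h by h'; differentiation in d also replaces p x by x p x, which is
    again bounded by 1 on [0, 1]. Hence the induction runs over all weights p with the same K. One
    order of h is spent on the continuity of the top derivatives. *)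
Lemma Cb_taylor_mean n p h K :
  (forall x, continuous p x) -> (forall x, 0 <= x <= 1 -> Rabs (p x) <= 1) ->
  Cb (S n) (itv a b) K (fun x _ => h x) -> Cb n (seg a b) K (taylor_mean p h).
Proof.
  revert p h; induction n as [|n IH]; intros p h Hpc Hp1 Hh.
  - destruct Hh as (H0 & hx & hy & Hd & Hx & _).
    assert (Hd' : forall t, a < t < b -> is_derive h t (hx t 0)) by (intros t Ht; apply (Hd t 0 Ht)).
    assert (Hc : forall u, a < u < b -> continuous h u)
      by (intros u Hu; apply (ex_derive_continuous h); eexists; apply Hd'; auto).
    assert (HL := lipschitz_of_derive h (fun t => hx t 0) a b K Hd'
                   (fun t Ht => Cb_value _ _ _ _ t 0 Hx Ht)).
    split; [|exact I]; intros t d Hs; split.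
    + intros eps.
      set (L := Rabs K + 1); assert (HLp : 0 < L) by (unfold L; generalize (Rabs_pos K); lra).
      destruct (open2_seg a b t d Hs) as [d1 H1].
      assert (Hq : 0 < eps / (4 * L)) by (apply Rdiv_lt_0_compat; [apply cond_pos | lra]).
      assert (Hp : 0 < Rmin d1 (eps / (4 * L))) by (apply Rmin_pos; auto; apply cond_pos).
      exists (mkposreal _ Hp); simpl; intros u v Hu Hv.
      assert (M1 := Rmin_l d1 (eps / (4 * L))); assert (M2 := Rmin_r d1 (eps / (4 * L))).
      assert (Hs' : seg a b u v) by (apply H1; lra).
      unfold taylor_mean; rewrite <- (RInt_minus (V := R_CompleteNormedModule)) by (apply ex_RInt_taylor_mean; auto).
      apply Rle_lt_trans with (eps / 2); [|generalize (cond_pos eps); lra].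
      apply abs_RInt_01_le;
        [apply (ex_RInt_minus (V := R_CompleteNormedModule)); apply ex_RInt_taylor_mean; auto|].
      intros x Hx2; unfold minus, plus, opp; simpl.
      replace (p x * h (u + x * v) + - (p x * h (t + x * d)))
        with (p x * (h (u + x * v) - h (t + x * d))) by ring.
      rewrite Rabs_mult.
      assert (B := HL (t + x * d) (u + x * v) (seg_in _ _ _ _ _ Hs Hx2) (seg_in _ _ _ _ _ Hs' Hx2)).
      assert (E : Rabs (u + x * v - (t + x * d)) <= eps / (2 * L)).
      { replace (u + x * v - (t + x * d)) with ((u - t) + x * (v - d)) by ring.
        eapply Rle_trans; [apply Rabs_triang|]; rewrite Rabs_mult, (Rabs_right x) by lra.
        replace (eps / (2 * L)) with (eps / (4 * L) + eps / (4 * L)) by (field; lra).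
        generalize (Rabs_pos (v - d)); intros; nra. }
      assert (F : K * Rabs (u + x * v - (t + x * d)) <= L * (eps / (2 * L))).
      { apply Rle_trans with (L * Rabs (u + x * v - (t + x * d))).
        - apply Rmult_le_compat_r; [apply Rabs_pos|]; unfold L; generalize (Rle_abs K); lra.
        - apply Rmult_le_compat_l; lra. }
      replace (L * (eps / (2 * L))) with (eps / 2) in F by (field; lra).
      specialize (Hp1 x Hx2); generalize (Rabs_pos (p x)) (Rabs_pos (h (u + x * v) - h (t + x * d))).
      intros; nra.
    + apply abs_RInt_01_le; [apply ex_RInt_taylor_mean; auto|].
      intros x Hx2; rewrite Rabs_mult.
      destruct (H0 (t + x * d) 0 (seg_in _ _ _ _ _ Hs Hx2)) as [_ B].
      specialize (Hp1 x Hx2); generalize (Rabs_pos (p x)) (Rabs_pos (h (t + x * d))); nra.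
  - pose proof (Cb_pred _ _ _ _ Hh) as Hh'; apply IH with (p := p) in Hh'; auto.
    split; [intros t d Hs; split; eauto using Cb_cont, Cb_value|].
    destruct Hh as (H0 & hx & hy & Hd & Hx & _).
    assert (Hd' : forall t, a < t < b -> is_derive h t (hx t 0)) by (intros t Ht; apply (Hd t 0 Ht)).
    assert (Hx0 : Cb (S n) (itv a b) K (fun x _ => hx x 0)).
    { apply Cb_ext with hx; auto using open2_itv; intros x y Hxy.
      destruct (Hd x y Hxy) as [D1 _], (Hd x 0 Hxy) as [D2 _].
      rewrite <- (is_derive_unique _ _ _ D1), <- (is_derive_unique _ _ _ D2); auto. }
    assert (Hx0' := Hx0).
    destruct Hx0' as (Hx1 & hxx & hxy & Hdd & Hxx & _).
    assert (Hdd' : forall t, a < t < b -> is_derive (fun t => hx t 0) t (hxx t 0))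
      by (intros t Ht; apply (Hdd t 0 Ht)).
    assert (Hc : forall u, a < u < b -> continuous h u)
      by (intros u Hu; apply (ex_derive_continuous h); eexists; apply Hd'; auto).
    assert (Hcx : forall u, a < u < b -> continuous (fun t => hx t 0) u)
      by (intros u Hu; apply (ex_derive_continuous (fun t => hx t 0)); eexists; apply Hdd'; auto).
    assert (HQ := quadratic_of_derive h (fun t => hx t 0) (fun t => hxx t 0) a b K Hd' Hdd'
                   (fun t Ht => Cb_value _ _ _ _ t 0 Hxx Ht)).
    assert (Hxp : forall x, continuous (fun x => x * p x) x)
      by (intros x; apply (continuous_mult (fun x => x) p); auto using continuous_id).
    assert (Hxp1 : forall x, 0 <= x <= 1 -> Rabs (x * p x) <= 1).
    { intros x Hx2; rewrite Rabs_mult, (Rabs_right x) by lra.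
      specialize (Hp1 x Hx2); generalize (Rabs_pos (p x)); nra. }
    (* Increment estimates that are uniform in x integrate to increment estimates for the means. *)
    assert (Key : forall (w : R -> R) (F G : R -> R) k,
      ex_RInt F 0 1 -> ex_RInt G 0 1 -> ex_RInt w 0 1 ->
      (forall x, 0 <= x <= 1 -> Rabs (F x - G x - k * w x) <= K * k ^ 2) ->
      Rabs (RInt F 0 1 - RInt G 0 1 - k * RInt w 0 1) <= K * k ^ 2).
    { intros w F G k HF HG Hw HB.
      assert (E1 : ex_RInt (fun x => F x - G x) 0 1) by (apply (ex_RInt_minus (V := R_NormedModule)); auto).
      assert (E2 : ex_RInt (fun x => k * w x) 0 1) by (apply (ex_RInt_scal (V := R_NormedModule)); auto).
      replace (RInt F 0 1 - RInt G 0 1 - k * RInt w 0 1)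
        with (RInt (fun x => F x - G x - k * w x) 0 1).
      - apply abs_RInt_01_le; auto; apply (ex_RInt_minus (V := R_NormedModule)); auto.
      - rewrite (RInt_minus (V := R_CompleteNormedModule) (fun x => F x - G x) (fun x => k * w x)) by auto.
        rewrite (RInt_minus (V := R_CompleteNormedModule) F G) by auto.
        pose proof (RInt_scal (V := R_CompleteNormedModule) w 0 1 k Hw) as Es.
        unfold scal in Es; simpl in Es; unfold mult in Es; simpl in Es; rewrite Es.
        reflexivity. }
    exists (taylor_mean p (fun t => hx t 0)), (taylor_mean (fun x => x * p x) (fun t => hx t 0)).
    split; [|split; apply IH; auto].
    intros t d Hs; destruct (open2_seg a b t d Hs) as [d1 H1].
    split; apply is_derive_quadratic with K d1; intros k Hk.
    + assert (Hs' : seg a b (t + k) d).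
      { apply H1; [replace (t + k - t) with k by ring; auto|].
        rewrite Rminus_diag, Rabs_R0; apply cond_pos. }
      apply (Key (fun x => p x * hx (t + x * d) 0) (fun x => p x * h (t + k + x * d))
        (fun x => p x * h (t + x * d)));
        [apply (ex_RInt_taylor_mean p h (t + k) d) | apply (ex_RInt_taylor_mean p h t d)
        | apply (ex_RInt_taylor_mean p (fun t => hx t 0) t d) |]; auto.
      intros x Hx2.
      replace (p x * h (t + k + x * d) - p x * h (t + x * d) - k * (p x * hx (t + x * d) 0))
       with (p x * (h (t + k + x * d) - h (t + x * d) - (t + k + x * d - (t + x * d)) * hx (t + x * d) 0))
       by ring.
      rewrite Rabs_mult.
      assert (B := HQ _ _ (seg_in _ _ _ _ _ Hs Hx2) (seg_in _ _ _ _ _ Hs' Hx2)); cbv beta in B.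
      replace (t + k + x * d - (t + x * d)) with k in * by ring.
      specialize (Hp1 x Hx2); generalize (Rabs_pos (p x)).
      match goal with |- context [Rabs (h ?A - ?B - ?C)] => generalize (Rabs_pos (h A - B - C)) end.
      intros; nra.
    + assert (Hs' : seg a b t (d + k)).
      { apply H1; [rewrite Rminus_diag, Rabs_R0; apply cond_pos|].
        replace (d + k - d) with k by ring; auto. }
      apply (Key (fun x => x * p x * hx (t + x * d) 0) (fun x => p x * h (t + x * (d + k)))
        (fun x => p x * h (t + x * d)));
        [apply (ex_RInt_taylor_mean p h t (d + k)) | apply (ex_RInt_taylor_mean p h t d)
        | apply (ex_RInt_taylor_mean (fun x => x * p x) (fun t => hx t 0) t d) |]; auto.
      intros x Hx2.
      replace (p x * h (t + x * (d + k)) - p x * h (t + x * d) - k * (x * p x * hx (t + x * d) 0))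
       with (p x * (h (t + x * (d + k)) - h (t + x * d) -
             (t + x * (d + k) - (t + x * d)) * hx (t + x * d) 0))
       by ring.
      rewrite Rabs_mult.
      assert (B := HQ _ _ (seg_in _ _ _ _ _ Hs Hx2) (seg_in _ _ _ _ _ Hs' Hx2)); cbv beta in B.
      replace (t + x * (d + k) - (t + x * d)) with (x * k) in * by ring.
      assert (B0 : K * (x * k) ^ 2 <= K * k ^ 2).
      { assert (0 <= K) by (eapply Rle_trans; [apply Rabs_pos |
          apply (Cb_value _ _ _ _ t 0 Hxx); apply Hs]).
        apply Rmult_le_compat_l; auto; rewrite Rpow_mult_distr.
        assert (0 <= k ^ 2) by apply pow2_ge_0; assert (x ^ 2 <= 1) by nra; nra. }
      specialize (Hp1 x Hx2); generalize (Rabs_pos (p x)).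
      match goal with |- context [Rabs (h ?A - ?B - ?C)] => generalize (Rabs_pos (h A - B - C)) end.
      intros; nra.
Qed.

Lemma Sm_taylor_mean p h : (forall x, continuous p x) -> (forall x, 0 <= x <= 1 -> Rabs (p x) <= 1) ->
  smI a b h -> Sm (seg a b) (taylor_mean p h).
Proof.
  intros Hp Hp1 Hh; apply Sm_intro; intros n; destruct (Hh (S n)) as (K & _ & HK).
  exists K; apply Cb_taylor_mean; auto.
Qed.

Definition weight (k : nat) (x : R) : R := (1 - x) ^ k / INR (fact k).

Lemma is_derive_weight k x : is_derive (weight (S k)) x (- weight k x).
Proof.
  unfold weight; rewrite fact_simpl, mult_INR.
  assert (INR (S k) <> 0) by (apply not_0_INR; discriminate).
  auto_derive; auto; fold (INR (S k)); fold (1 - x).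
  change (match k with 0%nat => 1 | S _ => INR k + 1 end) with (INR (S k)).
  assert (INR (fact k) <> 0) by apply INR_fact_neq_0.
  field; auto.
Qed.

Lemma continuous_weight k x : continuous (weight k) x.
Proof. apply (ex_derive_continuous (weight k)); unfold weight; auto_derive; auto. Qed.

Lemma weight_le k x : 0 <= x <= 1 -> Rabs (weight k x) <= 1.
Proof.
  intros Hx; unfold weight, Rdiv.
  assert (1 <= INR (fact k)).
  { replace 1 with (INR 1) by reflexivity; apply le_INR, lt_O_fact. }
  assert (0 <= (1 - x) ^ k) by (apply pow_le; lra).
  assert ((1 - x) ^ k <= 1 ^ k) by (apply pow_incr; lra); rewrite pow1 in *.
  assert (/ INR (fact k) <= 1) by (rewrite <- Rinv_1; apply Rinv_le_contravar; lra).
  assert (0 < / INR (fact k)) by (apply Rinv_0_lt_compat; lra).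
  rewrite Rabs_right; nra.
Qed.

(** Integration by parts: F is minus the next weight times the derivative of order k + 1, and its
    boundary value at x = 0 gives the next Taylor coefficient. *)
Lemma taylor_step h k t d : smI a b h -> seg a b t d ->
  taylor_mean (weight k) (Derive_n h (S k)) t d =
  Derive_n h (S k) t / INR (fact (S k)) + d * taylor_mean (weight (S k)) (Derive_n h (S (S k))) t d.
Proof.
  intros Hh Hs.
  set (F := fun x => - (weight (S k) x * Derive_n h (S k) (t + x * d))).
  assert (Hk : forall j u, a < u < b -> is_derive (Derive_n h j) u (Derive_n h (S j) u)).
  { intros j u Hu; apply (smI_deriv a b (Derive_n h j)); auto using smI_Derive_n. }
  assert (Hkc : forall j u, a < u < b -> continuous (Derive_n h j) u).
  { intros j u Hu; apply (ex_derive_continuous (Derive_n h j)); eexists; eauto. }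
  assert (HF : forall x, 0 <= x <= 1 -> is_derive F x
     (weight k x * Derive_n h (S k) (t + x * d) -
      d * (weight (S k) x * Derive_n h (S (S k)) (t + x * d)))).
  { intros x Hx; unfold F.
    pose proof (Hk (S k) (t + x * d) (seg_in _ _ _ _ _ Hs Hx)) as D1.
    assert (D2 : is_derive (fun x => t + x * d) x d) by (auto_derive; auto; ring).
    pose proof (is_derive_comp (Derive_n h (S k)) (fun x => t + x * d) x _ _ D1 D2) as D3.
    pose proof (is_derive_weight k x) as D4.
    apply is_derive_Reals in D3; apply is_derive_Reals in D4.
    pose proof (derivable_pt_lim_opp _ _ _ (derivable_pt_lim_mult _ _ _ _ _ D4 D3)) as D5.
    apply is_derive_Reals in D5.
    eapply is_derive_ext; [|evar_last; [exact D5|]].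
    - intros y; reflexivity.
    - cbv beta; unfold scal; simpl; unfold mult; simpl; ring. }
  assert (E1 : ex_RInt (fun x => weight k x * Derive_n h (S k) (t + x * d)) 0 1)
    by (apply ex_RInt_taylor_mean; auto using continuous_weight).
  assert (E2 : ex_RInt (fun x => weight (S k) x * Derive_n h (S (S k)) (t + x * d)) 0 1)
    by (apply ex_RInt_taylor_mean; auto using continuous_weight).
  assert (E3 : ex_RInt (fun x => d * (weight (S k) x * Derive_n h (S (S k)) (t + x * d))) 0 1)
    by (apply (ex_RInt_scal (V := R_NormedModule)); auto).
  assert (Hint : is_RInt (fun x => weight k x * Derive_n h (S k) (t + x * d) -
      d * (weight (S k) x * Derive_n h (S (S k)) (t + x * d))) 0 1 (F 1 - F 0)).
  { apply (is_RInt_derive (V := R_CompleteNormedModule) F).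
    - rewrite Rmin_left, Rmax_right by lra; auto.
    - rewrite Rmin_left, Rmax_right by lra; intros x Hx.
      assert (Hin := seg_in _ _ _ _ _ Hs Hx).
      assert (Hl : continuous (fun x => t + x * d) x)
        by (apply (ex_derive_continuous (fun x => t + x * d)); auto_derive; auto).
      apply (continuous_minus (V := R_NormedModule)).
      + apply (continuous_mult (weight k)); [apply continuous_weight|].
        apply (continuous_comp (fun x => t + x * d)); auto.
      + apply (continuous_scal_r (V := R_NormedModule) d).
        apply (continuous_mult (weight (S k))); [apply continuous_weight|].
        apply (continuous_comp (fun x => t + x * d)); auto. }
  apply (is_RInt_unique (V := R_CompleteNormedModule)) in Hint.
  assert (Es : d * taylor_mean (weight (S k)) (Derive_n h (S (S k))) t d =
     RInt (fun x => d * (weight (S k) x * Derive_n h (S (S k)) (t + x * d))) 0 1)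
    by (symmetry; exact (RInt_scal (V := R_CompleteNormedModule) _ 0 1 d E2)).
  assert (Em : taylor_mean (weight k) (Derive_n h (S k)) t d -
     RInt (fun x => d * (weight (S k) x * Derive_n h (S (S k)) (t + x * d))) 0 1 = F 1 - F 0)
    by (rewrite <- Hint; symmetry; exact (RInt_minus (V := R_CompleteNormedModule) _ _ 0 1 E1 E3)).
  assert (EF : F 1 - F 0 = Derive_n h (S k) t / INR (fact (S k))).
  { unfold F, weight; rewrite Rminus_diag, pow_i by lia.
    rewrite Rminus_0_r, pow1; replace (t + 0 * d) with t by ring.
    assert (INR (fact (S k)) <> 0) by apply INR_fact_neq_0.
    field; auto. }
  rewrite <- EF; lra.
Qed.

Lemma taylor_first h t d : smI a b h -> seg a b t d ->
  h (t + d) = h t + d * taylor_mean (weight 0) (Derive_n h 1) t d.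
Proof.
  intros Hh Hs.
  destruct (smI_deriv a b h Hh) as [Hd Hd1].
  destruct (smI_deriv a b _ Hd1) as [Hdd _].
  assert (Hc : forall u, a < u < b -> continuous (Derive h) u)
    by (intros u Hu; apply (ex_derive_continuous (Derive h)); eexists; eauto).
  assert (Hint : is_RInt (fun x => d * (weight 0 x * Derive h (t + x * d))) 0 1
     (h (t + 1 * d) - h (t + 0 * d))).
  { apply (is_RInt_derive (V := R_CompleteNormedModule) (fun x => h (t + x * d))).
    - rewrite Rmin_left, Rmax_right by lra; intros x Hx.
      assert (D2 : is_derive (fun x => t + x * d) x d) by (auto_derive; auto; ring).
      pose proof (is_derive_comp h (fun x => t + x * d) x _ _
        (Hd _ (seg_in _ _ _ _ _ Hs Hx)) D2) as D3.
      evar_last; [exact D3|]; unfold scal, weight; simpl; unfold mult; simpl; field.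
    - rewrite Rmin_left, Rmax_right by lra; intros x Hx.
      apply (continuous_scal_r (V := R_NormedModule) d).
      apply (continuous_mult (weight 0)); [apply continuous_weight|].
      apply (continuous_comp (fun x => t + x * d));
       [apply (ex_derive_continuous (fun x => t + x * d)); auto_derive; auto
       | apply Hc, seg_in; auto]. }
  apply (is_RInt_unique (V := R_CompleteNormedModule)) in Hint.
  assert (E0 : ex_RInt (fun x => weight 0 x * Derive h (t + x * d)) 0 1)
    by (apply ex_RInt_taylor_mean; auto using continuous_weight).
  assert (Es : d * taylor_mean (weight 0) (Derive_n h 1) t d =
     RInt (fun x => d * (weight 0 x * Derive h (t + x * d))) 0 1)
    by (symmetry; exact (RInt_scal (V := R_CompleteNormedModule) _ 0 1 d E0)).
  rewrite Es, Hint, Rmult_1_l, Rmult_0_l, Rplus_0_r; ring.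
Qed.

(** The remainder will be composed and differentiated as a function of (t, d), hence the integral
    form instead of a derivative at an unspecified intermediate point. *)
Lemma taylor h k : smI a b h -> exists r, Sm (seg a b) r /\ forall t d, seg a b t d ->
  h (t + d) = sum_f_R0 (fun i => d ^ i / INR (fact i) * Derive_n h i t) k + d ^ S k * r t d.
Proof.
  intros Hh; exists (taylor_mean (weight k) (Derive_n h (S k))); split.
  - apply Sm_taylor_mean; auto using continuous_weight, weight_le, smI_Derive_n.
  - intros t d Hs; induction k as [|k IH].
    + rewrite (taylor_first h t d Hh Hs); simpl; field.
    + rewrite IH, (taylor_step h k t d Hh Hs); rewrite tech5.
      assert (INR (fact (S k)) <> 0) by apply INR_fact_neq_0.
      change (d ^ S (S k)) with (d * d ^ S k); field; auto.
Qed.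
End TaylorRemainder.

Ltac sm := repeat match goal with
  | |- Sm _ _ => assumption
  | |- Sm ?U (fun _ _ => ?c) => apply (Sm_const U c)
  | |- Sm ?U (fun x y => @?f x y + @?g x y) => apply (Sm_plus U f g)
  | |- Sm ?U (fun x y => @?f x y - @?g x y) => apply (Sm_minus U f g)
  | |- Sm ?U (fun x y => - @?f x y) => apply (Sm_opp U f)
  | |- Sm ?U (fun x y => @?f x y * @?g x y) => apply (Sm_mult U f g)
  | |- Sm ?U (fun x y => @?f x y / @?g x y) => apply (Sm_mult U f (fun x y => / g x y))
  | |- Sm ?U (fun x y => @?f x y ^ ?k) => apply (Sm_pow U f k)
  end.

(** * Implicit functions and jets *)

Section Implicit.
Variables (U V : R -> R -> Prop) (e ex ey d : R -> R -> R) (c : R).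
Hypothesis HU : open2 U.
Hypothesis HV : open2 V.
Hypothesis Hconv : forall x y1 y2 y, V x y1 -> V x y2 -> Rmin y1 y2 <= y <= Rmax y1 y2 -> V x y.
Hypothesis Hde : forall x y, V x y ->
  is_derive (fun z => e z y) x (ex x y) /\ is_derive (fun z => e x z) y (ey x y).
Hypothesis Hex : Sm V ex.
Hypothesis Hey : Sm V ey.
Hypothesis Hc : 0 < c.
Hypothesis Hcey : forall x y, V x y -> c <= ey x y.
Hypothesis Hd : forall x y, U x y -> V x (d x y) /\ e x (d x y) = y.

(** The mean value theorem with [ey] at least c on the segment, which lies in V by [Hconv]. The
    expansion yields the Lipschitz bound for the inverse d below. *)
Lemma implicit_expand x y1 y2 : V x y1 -> V x y2 -> c * Rabs (y1 - y2) <= Rabs (e x y1 - e x y2).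
Proof.
  intros H1 H2.
  destruct (MVT_gen (fun z => e x z) y2 y1 (fun z => ey x z)) as (z & Hz & E).
  - intros z Hz; apply Hde; apply (Hconv x y2 y1); auto; lra.
  - intros z Hz; apply derivable_continuous_pt; exists (ey x z); apply is_derive_Reals.
    apply Hde; apply (Hconv x y2 y1); auto.
  - cbv beta in E; rewrite E, Rabs_mult; apply Rmult_le_compat_r; [apply Rabs_pos|].
    eapply Rle_trans; [|apply Rle_abs]; apply Hcey; apply (Hconv x y2 y1); auto.
Qed.

Lemma implicit_near x0 y0 : U x0 y0 -> locally_2d (fun x y =>
  c * Rabs (d x y - d x0 y0) <= Rabs (y - y0) + Rabs (e x (d x0 y0) - e x0 (d x0 y0))) x0 y0.
Proof.
  intros H0; destruct (HU _ _ H0) as [d1 D1]; destruct (Hd _ _ H0) as [V0 E0].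
  destruct (HV _ _ V0) as [d2 D2].
  exists (mkposreal (Rmin d1 d2) (Rmin_pos _ _ (cond_pos d1) (cond_pos d2))).
  simpl; intros x y Hx Hy.
  assert (M1 := Rmin_l d1 d2); assert (M2 := Rmin_r d1 d2).
  destruct (Hd x y) as [V1 E1]; [apply D1; lra|].
  assert (V2 : V x (d x0 y0)) by (apply D2; [lra | rewrite Rminus_diag, Rabs_R0; apply cond_pos]).
  eapply Rle_trans; [apply (implicit_expand x); auto|].
  rewrite E1, E0.
  replace (y - e x (d x0 y0)) with ((y - y0) + - (e x (d x0 y0) - y0)) by ring.
  eapply Rle_trans; [apply Rabs_triang|]; rewrite Rabs_Ropp; lra.
Qed.

(** Expansion makes d Lipschitz at (x0, y0); the differential of e then becomes a linear equation
    for the increment of d, with an error that is still of smaller order. *)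
Lemma implicit_differentiable x0 y0 : U x0 y0 ->
  differentiable_pt_lim d x0 y0 (- ex x0 (d x0 y0) / ey x0 (d x0 y0)) (/ ey x0 (d x0 y0)).
Proof.
  intros H0; destruct (Hd _ _ H0) as [V0 E0].
  set (d0 := d x0 y0) in *.
  assert (De := differentiable_of_partials V e ex ey x0 d0 HV V0 Hde
    (Sm_cont _ _ _ _ Hex V0) (Sm_cont _ _ _ _ Hey V0)).
  set (lx := ex x0 d0) in *; set (ly := ey x0 d0) in *.
  assert (Hly : c <= ly) by (apply Hcey; auto).
  set (L := (2 + Rabs lx) / c).
  assert (HL : 0 < L) by (apply Rdiv_lt_0_compat; auto; generalize (Rabs_pos lx); lra).
  destruct (De (mkposreal 1 Rlt_0_1)) as [r1 R1]; simpl in R1.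
  destruct (implicit_near x0 y0 H0) as [r2 R2]; fold d0 in R2.
  assert (Lip : forall x y, Rabs (x - x0) < Rmin r1 r2 -> Rabs (y - y0) < Rmin r1 r2 ->
     Rabs (d x y - d0) <= L * Rmax (Rabs (x - x0)) (Rabs (y - y0))).
  { intros x y Hx Hy.
    assert (M1 := Rmin_l r1 r2); assert (M2 := Rmin_r r1 r2).
    specialize (R2 x y ltac:(lra) ltac:(lra)).
    specialize (R1 x d0 ltac:(lra)).
    rewrite (Rminus_diag d0), Rabs_R0, Rmult_0_r, Rplus_0_r in R1.
    specialize (R1 ltac:(apply cond_pos)).
    rewrite (Rmax_left (Rabs (x - x0)) 0) in R1 by apply Rabs_pos.
    assert (A : Rabs (e x d0 - e x0 d0) <= (1 + Rabs lx) * Rabs (x - x0)).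
    { replace (e x d0 - e x0 d0) with ((e x d0 - e x0 d0 - lx * (x - x0)) + lx * (x - x0)) by ring.
      eapply Rle_trans; [apply Rabs_triang|]; rewrite Rabs_mult; lra. }
    assert (N1 := Rmax_l (Rabs (x - x0)) (Rabs (y - y0))).
    assert (N2 := Rmax_r (Rabs (x - x0)) (Rabs (y - y0))).
    set (m := Rmax _ _) in *.
    apply Rmult_le_reg_l with c; auto.
    replace (c * (L * m)) with ((2 + Rabs lx) * m) by (unfold L; field; lra).
    assert ((1 + Rabs lx) * Rabs (x - x0) <= (1 + Rabs lx) * m)
      by (apply Rmult_le_compat_l; generalize (Rabs_pos lx); lra).
    lra. }
  intros eps.
  (* Chosen so that e2 (1 + L) = c eps: L converts increments of (x, y) into increments of d, and c
     comes from the division by [ey]. *)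
  set (e2 := eps * c / (1 + L)).
  assert (He2 : 0 < e2).
  { apply Rdiv_lt_0_compat; [apply Rmult_lt_0_compat; auto; apply cond_pos | lra]. }
  destruct (De (mkposreal e2 He2)) as [r3 R3]; simpl in R3.
  destruct (HU _ _ H0) as [r4 R4].
  set (r := Rmin (Rmin r1 r2) (Rmin r4 (Rmin r3 (r3 / L)))).
  assert (Hr : 0 < r).
  { unfold r; repeat apply Rmin_pos; try apply cond_pos; apply Rdiv_lt_0_compat; auto; apply cond_pos. }
  exists (mkposreal r Hr); simpl; intros x y Hx Hy; fold d0.
  assert (Q1 := Rmin_l (Rmin r1 r2) (Rmin r4 (Rmin r3 (r3 / L)))).
  assert (Q2 := Rmin_r (Rmin r1 r2) (Rmin r4 (Rmin r3 (r3 / L)))).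
  assert (Q3 := Rmin_l r4 (Rmin r3 (r3 / L))); assert (Q4 := Rmin_r r4 (Rmin r3 (r3 / L))).
  assert (Q5 := Rmin_l r3 (r3 / L)); assert (Q6 := Rmin_r r3 (r3 / L)).
  fold r in Q1, Q2.
  specialize (Lip x y ltac:(lra) ltac:(lra)).
  destruct (Hd x y) as [_ E1]; [apply R4; lra|].
  set (m := Rmax (Rabs (x - x0)) (Rabs (y - y0))) in *.
  assert (Hm : m < r3 / L) by (apply Rmax_lub_lt; lra).
  assert (Hm0 : 0 <= m) by (eapply Rle_trans; [apply (Rabs_pos (x - x0)) | apply Rmax_l]).
  assert (HLm : L * m < r3).
  { apply Rlt_le_trans with (L * (r3 / L)); [apply Rmult_lt_compat_l; auto|].
    right; field; lra. }
  specialize (R3 x (d x y) ltac:(lra) ltac:(lra)).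
  rewrite E1, E0 in R3.
  assert (B : Rmax (Rabs (x - x0)) (Rabs (d x y - d0)) <= (1 + L) * m).
  { apply Rmax_lub; [|nra]. assert (Rabs (x - x0) <= m) by apply Rmax_l; nra. }
  replace (d x y - d0 - (- lx / ly * (x - x0) + / ly * (y - y0)))
    with (- / ly * (y - y0 - (lx * (x - x0) + ly * (d x y - d0)))) by (field; lra).
  rewrite Rabs_mult, Rabs_Ropp, Rabs_inv, (Rabs_right ly) by lra.
  apply Rmult_le_reg_l with ly; [lra|].
  rewrite <- Rmult_assoc, Rinv_r, Rmult_1_l by lra.
  eapply Rle_trans; [exact R3|].
  apply Rle_trans with (e2 * ((1 + L) * m)); [apply Rmult_le_compat_l; lra|].
  replace (e2 * ((1 + L) * m)) with (c * (eps * m)) by (unfold e2; field; lra).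
  apply Rmult_le_compat_r; auto; apply Rmult_le_pos; auto; apply Rlt_le, cond_pos.
Qed.

Lemma implicit_is_derive x y : U x y ->
  is_derive (fun z => d z y) x (- ex x (d x y) / ey x (d x y)) /\
  is_derive (fun z => d x z) y (/ ey x (d x y)).
Proof.
  intros Hu; assert (D := implicit_differentiable x y Hu); split; apply is_derive_Reals.
  - replace (- ex x (d x y) / ey x (d x y))
      with (- ex x (d x y) / ey x (d x y) * 1 + / ey x (d x y) * 0) by ring.
    apply (derivable_pt_lim_comp_2d d (fun z => z) (fun _ => y)); auto;
      [apply derivable_pt_lim_id | apply derivable_pt_lim_const].
  - replace (/ ey x (d x y))
      with (- ex x (d x y) / ey x (d x y) * 0 + / ey x (d x y) * 1) by ring.
    apply (derivable_pt_lim_comp_2d d (fun _ => x) (fun z => z)); auto;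
      [apply derivable_pt_lim_const | apply derivable_pt_lim_id].
Qed.

(** Bootstrap: the partials of d are smooth functions of (x, d x y), so a bound of order n on d
    gives one of order n + 1. *)
Lemma Sm_implicit K : (forall x y, U x y -> Rabs x <= K /\ Rabs (d x y) <= K) -> Sm U d.
Proof.
  intros HK.
  assert (H0 : forall x y, U x y -> continuity_2d_pt d x y /\ Rabs (d x y) <= K).
  { intros x y Hu; split; [|apply HK; auto].
    apply differentiable_continuity_pt; eexists; eexists; apply implicit_differentiable; auto. }
  assert (HF := Sm_fst U K (fun x y Hu => proj1 (HK x y Hu))).
  apply Sm_intro; induction n as [|n [L IH]].
  - exists K; split; auto.
  - assert (Hinv : Sm V (fun x y => / ey x y)).
    { apply Sm_inv with c; auto; intros x y Hu; specialize (Hcey x y Hu).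
      eapply Rle_trans; [exact Hcey | apply Rle_abs]. }
    assert (Hmul : Sm V (fun x y => - ex x y * / ey x y)) by (apply Sm_mult; auto using Sm_opp).
    destruct (HF n) as (F & HF0 & HFn).
    destruct (Hinv n) as (A & HA0 & HAn), (Hmul n) as (B & HB0 & HBn).
    assert (IH' : Cb n U (F + Rabs L) d) by (eapply Cb_le; [|exact IH]; generalize (Rle_abs L); lra).
    assert (HFn' : Cb n U (F + Rabs L) (fun x _ => x))
      by (eapply Cb_le; [|exact HFn]; generalize (Rabs_pos L); lra).
    destruct (Cb_comp n A (F + Rabs L)) as (C1 & HC1 & P1).
    destruct (Cb_comp n B (F + Rabs L)) as (C2 & HC2 & P2).
    specialize (P1 U V _ _ _ HV HAn HFn' IH' (fun x y Hu => proj1 (Hd x y Hu))).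
    specialize (P2 U V _ _ _ HV HBn HFn' IH' (fun x y Hu => proj1 (Hd x y Hu))).
    exists (Rabs K + C1 + C2); generalize (Rle_abs K) (Rabs_pos K); intros.
    split; [intros x y Hu; destruct (H0 x y Hu); split; auto; lra|].
    eexists; eexists; split;
      [|split; [eapply Cb_le; [|exact P2] | eapply Cb_le; [|exact P1]]; lra].
    intros x y Hu; exact (implicit_is_derive x y Hu).
Qed.
End Implicit.

Definition box (a b r : R) : R -> R -> Prop := fun x y => a < x < b /\ - r < y < r.

Lemma open2_box a b r : open2 (box a b r).
Proof.
  apply (open2_and (fun x _ => a < x < b) (fun _ y => - r < y < r)); [apply open2_itv|].
  apply (open2_and (fun _ y => - r < y) (fun _ y => y < r)).
  - apply open2_lt_cont with (fun _ y => y - - r); [|intros; lra].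
    intros; apply continuity_2d_pt_minus;
      [apply continuity_2d_pt_id2 | apply continuity_2d_pt_const].
  - apply open2_lt_cont with (fun _ y => r - y); [|intros; lra].
    intros; apply continuity_2d_pt_minus;
      [apply continuity_2d_pt_const | apply continuity_2d_pt_id2].
Qed.

Lemma Sm_box_fst a b r : Sm (box a b r) (fun x _ => x).
Proof.
  apply Sm_fst with (Rabs a + Rabs b); intros x y [H _].
  apply Rabs_le; generalize (Rle_abs a) (Rle_abs b) (Rabs_maj2 a) (Rabs_maj2 b)
    (Rabs_pos a) (Rabs_pos b); lra.
Qed.

Lemma Sm_box_snd a b r : Sm (box a b r) (fun _ y => y).
Proof. apply Sm_snd with r; intros x y [_ H]; apply Rabs_le; lra. Qed.

(* y |-> y * u x y has derivative u x 0 > 0 at y = 0, hence is invertible in y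
   near y = 0, uniformly in x. *)
Lemma partial_inverse a b r u c : 0 < r -> 0 < c -> Sm (box a b r) u ->
  (forall x y, box a b r x y -> c <= u x y) ->
  exists r1 r2 d, 0 < r1 <= r /\ 0 < r2 /\ Sm (box a b r2) d /\
    (forall x y, box a b r2 x y -> - r1 < d x y < r1 /\ d x y * u x (d x y) = y) /\
    (forall x y1 y2, box a b r1 x y1 -> box a b r1 x y2 -> y1 < y2 -> y1 * u x y1 < y2 * u x y2).
Proof.
  intros Hr Hc Hu Hcu.
  destruct (Sm_deriv _ _ (open2_box a b r) Hu) as (ux & uy & Hdu & Hux & Huy).
  destruct (Sm_bound _ _ Huy) as (K & HK & HKb).
  (* For |y| < r1 the term y uy is at most c / 2 in absolute value, so the y-derivative u + y uy
     stays above c / 2. *)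
  set (r1 := Rmin r (c / (2 * (K + 1)))).
  assert (Hr1 : 0 < r1) by (apply Rmin_pos; auto; apply Rdiv_lt_0_compat; lra).
  assert (Hr1r : r1 <= r) by apply Rmin_l.
  assert (HrK : r1 * K <= c / 2).
  { apply Rle_trans with (c / (2 * (K + 1)) * K).
    - apply Rmult_le_compat_r; auto; apply Rmin_r.
    - apply Rmult_le_reg_r with (2 * (K + 1)); [lra|].
      replace (c / (2 * (K + 1)) * K * (2 * (K + 1))) with (c * K) by (field; lra).
      nra. }
  set (V := box a b r1).
  assert (HVs : forall x y, V x y -> box a b r x y) by (unfold V, box; intros; lra).
  set (e := fun x y => y * u x y).
  set (ey := fun x y => u x y + y * uy x y).
  assert (Hde : forall x y, V x y -> is_derive (fun z => e z y) x (y * ux x y) /\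
             is_derive (fun z => e x z) y (ey x y)).
  { intros x y Hxy; destruct (Hdu x y (HVs x y Hxy)) as [D1 D2]; split.
    - apply is_derive_Reals; apply derivable_pt_lim_scal; apply is_derive_Reals; auto.
    - unfold e, ey; replace (u x y + y * uy x y) with (1 * u x y + y * uy x y) by ring.
      apply is_derive_Reals, (derivable_pt_lim_mult (fun z => z) (fun z => u x z));
       [apply derivable_pt_lim_id | apply is_derive_Reals; auto]. }
  assert (Hcey : forall x y, V x y -> c / 2 <= ey x y).
  { intros x y Hxy; unfold ey.
    assert (c <= u x y) by auto.
    assert (Rabs (y * uy x y) <= r1 * K).
    { rewrite Rabs_mult; apply Rmult_le_compat; auto using Rabs_pos.
      apply Rabs_le; destruct Hxy; lra. }
    assert (- (y * uy x y) <= Rabs (y * uy x y)) by (rewrite <- Rabs_Ropp; apply Rle_abs).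
    lra. }
  assert (Hconv : forall x y1 y2 y, V x y1 -> V x y2 -> Rmin y1 y2 <= y <= Rmax y1 y2 -> V x y).
  { intros x y1 y2 y [A1 B1] [A2 B2]; unfold Rmin, Rmax; destruct (Rle_dec y1 y2);
      intros; split; lra. }
  (* At the points r1 / 2 and - r1 / 2 the function y u has passed r2 and - r2, so the intermediate
     value theorem reaches every value in between. *)
  set (r2 := c * (r1 / 2)).
  assert (Hr2 : 0 < r2) by (unfold r2; apply Rmult_lt_0_compat; lra).
  set (P := fun x y z => - r1 < z < r1 /\ z * u x z = y).
  set (d := fun x y => epsilon (inhabits 0) (P x y)).
  assert (Hd : forall x y, box a b r2 x y -> P x y (d x y)).
  { intros x y Hxy; apply epsilon_spec.
    assert (Hin : forall z, - (r1 / 2) <= z <= r1 / 2 -> V x z)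
      by (intros z Hz; destruct Hxy; split; lra).
    destruct (Ranalysis5.IVT_interv (fun z => e x z - y) (- (r1 / 2)) (r1 / 2)) as (z & Hz & E).
    - intros z Hz1 Hz2; apply continuity_pt_minus; [|apply continuity_const; intros p q; reflexivity].
      apply derivable_continuous_pt; exists (ey x z); apply is_derive_Reals, Hde, Hin; lra.
    - lra.
    - unfold e; assert (c <= u x (- (r1 / 2))) by (apply Hcu, HVs, Hin; lra).
      destruct Hxy; unfold r2 in *; nra.
    - unfold e; assert (c <= u x (r1 / 2)) by (apply Hcu, HVs, Hin; lra).
      destruct Hxy; unfold r2 in *; nra.
    - exists z; split; [lra|]; unfold e in E; lra. }
  exists r1, r2, d; repeat split; auto; try (apply Hd; auto).
  - assert (Hsx : Sm V (fun x y => y * ux x y)).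
    { apply Sm_mult; [apply Sm_box_snd|]; apply Sm_sub with (box a b r); auto. }
    assert (Hsy : Sm V ey).
    { apply Sm_plus; [apply Sm_sub with (box a b r); auto|].
      apply Sm_mult; [apply Sm_box_snd|]; apply Sm_sub with (box a b r); auto. }
    apply (Sm_implicit (box a b r2) V e (fun x y => y * ux x y) ey d (c / 2)) with
      (K := Rabs a + Rabs b + r1); auto using open2_box; try (apply open2_box); try lra.
    + intros x y Hxy; destruct (Hd x y Hxy) as [H1 H2]; split; auto.
      destruct Hxy; split; auto.
    + intros x y Hxy; destruct (Hd x y Hxy) as [H1 H2], Hxy as [H3 H4].
      generalize (Rle_abs a) (Rle_abs b) (Rabs_maj2 a) (Rabs_maj2 b)
         (Rabs_pos a) (Rabs_pos b); intros; split; apply Rabs_le; lra.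
  - intros x y1 y2 H1 H2 Hlt.
    destruct (MVT_gen (fun z => e x z) y1 y2 (fun z => ey x z)) as (z & Hz & E).
    + intros z Hz; apply Hde, (Hconv x y1 y2); auto; lra.
    + intros z Hz; apply derivable_continuous_pt; exists (ey x z).
      apply is_derive_Reals, Hde, (Hconv x y1 y2); auto.
    + assert (c / 2 <= ey x z) by (apply Hcey, (Hconv x y1 y2); auto).
      unfold e in E; nra.
Qed.

(** An expansion in y to third order with coefficients depending on x. The order is dictated by the
    conservation of J over a flight: d^2 J^2 has to agree at both ends up to O(d^4). *)
Definition jet (U : R -> R -> Prop) (f : R -> R -> R) (c0 c1 c2 c3 : R -> R) : Prop :=
  Sm U (fun x _ => c0 x) /\ Sm U (fun x _ => c1 x) /\ Sm U (fun x _ => c2 x) /\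
  Sm U (fun x _ => c3 x) /\ exists h, Sm U h /\ forall x y, U x y ->
    f x y = c0 x + c1 x * y + c2 x * y ^ 2 + c3 x * y ^ 3 + y ^ 4 * h x y.

Section Jets.
Variables (U : R -> R -> Prop).
Hypothesis HU : open2 U.
Hypothesis Hsnd : Sm U (fun _ y => y).

Lemma jet_ext f g c0 c1 c2 c3 d0 d1 d2 d3 : jet U f c0 c1 c2 c3 ->
  (forall x y, U x y -> f x y = g x y /\ c0 x = d0 x /\ c1 x = d1 x /\ c2 x = d2 x /\ c3 x = d3 x) ->
  jet U g d0 d1 d2 d3.
Proof.
  intros (H0 & H1 & H2 & H3 & h & Hh & E) He.
  split; [|split; [|split; [|split]]].
  - apply Sm_ext with (fun x _ => c0 x); auto; intros x y Hu; apply (He x y Hu).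
  - apply Sm_ext with (fun x _ => c1 x); auto; intros x y Hu; apply (He x y Hu).
  - apply Sm_ext with (fun x _ => c2 x); auto; intros x y Hu; apply (He x y Hu).
  - apply Sm_ext with (fun x _ => c3 x); auto; intros x y Hu; apply (He x y Hu).
  - exists h; split; auto; intros x y Hu; destruct (He x y Hu) as (<- & <- & <- & <- & <-); auto.
Qed.

Lemma jet_const c : Sm U (fun x _ => c x) ->
  jet U (fun x _ => c x) c (fun _ => 0) (fun _ => 0) (fun _ => 0).
Proof.
  intros; split; [|split; [|split; [|split]]]; auto using Sm_const.
  exists (fun _ _ => 0); split; [apply Sm_const | intros; ring].
Qed.

Lemma jet_var : jet U (fun _ y => y) (fun _ => 0) (fun _ => 1) (fun _ => 0) (fun _ => 0).
Proof.
  split; [|split; [|split; [|split]]]; auto using Sm_const.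
  exists (fun _ _ => 0); split; [apply Sm_const | intros; ring].
Qed.

Lemma jet_plus f g c0 c1 c2 c3 d0 d1 d2 d3 :
  jet U f c0 c1 c2 c3 -> jet U g d0 d1 d2 d3 ->
  jet U (fun x y => f x y + g x y) (fun x => c0 x + d0 x) (fun x => c1 x + d1 x)
    (fun x => c2 x + d2 x) (fun x => c3 x + d3 x).
Proof.
  intros (H0 & H1 & H2 & H3 & h & Hh & E) (G0 & G1 & G2 & G3 & k & Hk & F).
  split; [|split; [|split; [|split]]]; try (sm; fail).
  exists (fun x y => h x y + k x y); split; [apply Sm_plus; auto|].
  intros x y Hu; rewrite E, F by auto; ring.
Qed.

Lemma jet_mult f g c0 c1 c2 c3 d0 d1 d2 d3 :
  jet U f c0 c1 c2 c3 -> jet U g d0 d1 d2 d3 ->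
  jet U (fun x y => f x y * g x y) (fun x => c0 x * d0 x) (fun x => c0 x * d1 x + c1 x * d0 x)
    (fun x => c0 x * d2 x + c1 x * d1 x + c2 x * d0 x)
    (fun x => c0 x * d3 x + c1 x * d2 x + c2 x * d1 x + c3 x * d0 x).
Proof.
  intros (H0 & H1 & H2 & H3 & h & Hh & E) (G0 & G1 & G2 & G3 & k & Hk & F).
  split; [|split; [|split; [|split]]];
    try (sm; fail).
  exists (fun x y => c1 x * d3 x + c2 x * d2 x + c3 x * d1 x + y * (c2 x * d3 x + c3 x * d2 x)
     + y ^ 2 * (c3 x * d3 x) + (c0 x + c1 x * y + c2 x * y ^ 2 + c3 x * y ^ 3) * k x y
     + (d0 x + d1 x * y + d2 x * y ^ 2 + d3 x * y ^ 3 + y ^ 4 * k x y) * h x y).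
  split.
  - sm.
  - intros x y Hu; rewrite E, F by auto; ring.
Qed.

Lemma jet_scal f c c0 c1 c2 c3 : jet U f c0 c1 c2 c3 ->
  jet U (fun x y => c * f x y) (fun x => c * c0 x) (fun x => c * c1 x)
    (fun x => c * c2 x) (fun x => c * c3 x).
Proof.
  intros Hf; eapply jet_ext; [apply (jet_mult (fun _ _ => c)); [|exact Hf]|].
  - apply (jet_const (fun _ => c)), Sm_const.
  - intros; cbv beta; repeat split; ring.
Qed.

(** With p the candidate cubic, (sqrt f - p) (sqrt f + p) = f - p^2 is divisible by y^4 once the
    coefficients satisfy the listed equations, and the second factor is bounded below by r. *)
Lemma jet_sqrt f c c0 c1 c2 c3 s0 s1 s2 s3 : 0 < c -> (forall x y, U x y -> c <= f x y) ->
  Sm U f -> jet U f c0 c1 c2 c3 ->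
  Sm U (fun x _ => s0 x) -> Sm U (fun x _ => s1 x) -> Sm U (fun x _ => s2 x) -> Sm U (fun x _ => s3 x) ->
  (exists r, 0 < r /\ forall x y, U x y -> r <= sqrt (f x y) + (s0 x + s1 x * y + s2 x * y ^ 2 + s3 x * y ^ 3)) ->
  (forall x y, U x y -> s0 x ^ 2 = c0 x /\ 2 * s0 x * s1 x = c1 x /\
     2 * s0 x * s2 x + s1 x ^ 2 = c2 x /\ 2 * s0 x * s3 x + 2 * s1 x * s2 x = c3 x) ->
  jet U (fun x y => sqrt (f x y)) s0 s1 s2 s3.
Proof.
  intros Hc Hcf Hf (H0 & H1 & H2 & H3 & h & Hh & E) S0 S1 S2 S3 (r & Hr & Hrs) Hs.
  split; [|split; [|split; [|split]]]; auto.
  set (p := fun x y => s0 x + s1 x * y + s2 x * y ^ 2 + s3 x * y ^ 3).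
  exists (fun x y => (h x y - s2 x ^ 2 - 2 * (s1 x * s3 x) - 2 * (s2 x * s3 x) * y - s3 x ^ 2 * y ^ 2)
     / (sqrt (f x y) + p x y)).
  split.
  - apply Sm_div with r; auto.
    + intros x y Hu; eapply Rle_trans; [exact (Hrs x y Hu) | apply Rle_abs].
    + sm.
    + apply Sm_plus; [apply Sm_sqrt with c; auto|]; unfold p; sm.
  - intros x y Hu.
    specialize (Hrs x y Hu); change (r <= sqrt (f x y) + p x y) in Hrs.
    assert (Hq : sqrt (f x y) * sqrt (f x y) = f x y)
      by (apply sqrt_sqrt; specialize (Hcf x y Hu); lra).
    assert (Hd : f x y - p x y ^ 2 = y ^ 4 *
       (h x y - s2 x ^ 2 - 2 * (s1 x * s3 x) - 2 * (s2 x * s3 x) * y - s3 x ^ 2 * y ^ 2)).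
    { rewrite E by auto; destruct (Hs x y Hu) as (<- & <- & <- & <-); unfold p; ring. }
    apply Rmult_eq_reg_r with (sqrt (f x y) + p x y); [|lra].
    change (sqrt (f x y) * (sqrt (f x y) + p x y) = (p x y + y ^ 4 *
      ((h x y - s2 x ^ 2 - 2 * (s1 x * s3 x) - 2 * (s2 x * s3 x) * y - s3 x ^ 2 * y ^ 2) /
        (sqrt (f x y) + p x y))) * (sqrt (f x y) + p x y)).
    set (q := h x y - s2 x ^ 2 - 2 * (s1 x * s3 x) - 2 * (s2 x * s3 x) * y - s3 x ^ 2 * y ^ 2) in *.
    replace ((p x y + y ^ 4 * (q / (sqrt (f x y) + p x y))) * (sqrt (f x y) + p x y))
      with (p x y * (sqrt (f x y) + p x y) + y ^ 4 * q) by (field; lra).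
    rewrite <- Hd; transitivity (sqrt (f x y) * sqrt (f x y) + sqrt (f x y) * p x y);
      [ring | rewrite Hq; ring].
Qed.
End Jets.

Lemma jet_taylor a b h : smI a b h ->
  jet (seg a b) (fun t d => h (t + d)) h (Derive_n h 1) (fun t => Derive_n h 2 t / 2)
    (fun t => Derive_n h 3 t / 6).
Proof.
  intros Hh.
  assert (Hs : forall k, Sm (seg a b) (fun t _ => Derive_n h k t)).
  { intros k; apply Sm_sub with (itv a b); [intros x y [H _]; exact H|].
    exact (smI_Derive_n a b h k Hh). }
  split; [|split; [|split; [|split]]].
  - exact (Hs 0%nat).
  - exact (Hs 1%nat).
  - apply (Sm_mult _ (fun t _ => Derive_n h 2 t)); [apply Hs | apply Sm_const].
  - apply (Sm_mult _ (fun t _ => Derive_n h 3 t)); [apply Hs | apply Sm_const].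
  - destruct (taylor a b h 3 Hh) as (r & Hr & E); exists r; split; auto.
    intros t d Hu; rewrite E by auto; simpl; field.
Qed.

Lemma jet_sub (U V : R -> R -> Prop) f c0 c1 c2 c3 : (forall x y, V x y -> U x y) ->
  jet U f c0 c1 c2 c3 -> jet V f c0 c1 c2 c3.
Proof.
  intros HV (H0 & H1 & H2 & H3 & h & Hh & E).
  split; [|split; [|split; [|split]]]; try (apply Sm_sub with U; assumption).
  exists h; split; [apply Sm_sub with U|]; auto.
Qed.

Lemma smI_sub a b a' b' h : a <= a' -> b' <= b -> smI a b h -> smI a' b' h.
Proof. intros; apply Sm_sub with (itv a b); auto; unfold itv; intros; lra. Qed.

Lemma Sm_seg_snd a b : Sm (seg a b) (fun _ d => d).
Proof. apply Sm_snd with (b - a); intros t d [H1 H2]; apply Rabs_le; lra. Qed.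

Lemma Sm_seg_left a b h : smI a b h -> Sm (seg a b) (fun t _ => h t).
Proof. intros H; apply Sm_sub with (itv a b); [intros x y [Hx _]; exact Hx | exact H]. Qed.

Lemma Sm_seg_right a b h : smI a b h -> Sm (seg a b) (fun t d => h (t + d)).
Proof.
  intros H; apply (Sm_comp1 _ a b h (fun t d => t + d)); auto.
  - apply (Sm_plus _ (fun t _ => t)); [|apply Sm_seg_snd].
    apply Sm_fst with (Rabs a + Rabs b); intros t d [H1 _].
    apply Rabs_le; generalize (Rle_abs a) (Rle_abs b) (Rabs_maj2 a) (Rabs_maj2 b)
      (Rabs_pos a) (Rabs_pos b); lra.
  - intros t d [_ H2]; exact H2.
Qed.

Lemma smI_bound a b h : smI a b h -> exists K, 0 <= K /\ forall t, a < t < b -> Rabs (h t) <= K.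
Proof.
  intros H; destruct (Sm_bound _ _ H) as (K & HK & HB); exists K; split; auto.
  intros t Ht; exact (HB t 0 Ht).
Qed.

Lemma smI_mult a b h k : smI a b h -> smI a b k -> smI a b (fun t => h t * k t).
Proof. intros; apply (Sm_mult _ (fun t _ => h t) (fun t _ => k t)); auto. Qed.

Lemma smI_pow a b h n : smI a b h -> smI a b (fun t => h t ^ n).
Proof. intros; apply (Sm_pow _ (fun t _ => h t)); auto. Qed.

Lemma smI_inv a b h c : 0 < c -> (forall t, a < t < b -> c <= h t) -> smI a b h ->
  smI a b (fun t => / h t).
Proof.
  intros Hc Hl H; apply (Sm_inv _ (fun t _ => h t) c); auto.
  intros x y Hu; eapply Rle_trans; [apply (Hl x Hu) | apply Rle_abs].
Qed.

Lemma smI_is_derive a b h t : smI a b h -> a < t < b -> is_derive h t (Derive h t).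
Proof. intros H; apply (smI_deriv a b h H). Qed.

Lemma smI_increasing a b h c : smI a b h -> 0 < c -> (forall t, a < t < b -> c <= Derive h t) ->
  forall t u, a < t -> t < u -> u < b -> c * (u - t) <= h u - h t.
Proof.
  intros Hh Hc Hl t u Ht Htu Hu.
  destruct (MVT_gen h t u (Derive h)) as (z & Hz & E); rewrite ?Rmin_left, ?Rmax_right in * by lra.
  - intros z Hz; apply (smI_is_derive a b); auto; lra.
  - intros z Hz; apply derivable_continuous_pt; exists (Derive h z).
    apply is_derive_Reals, (smI_is_derive a b); auto; lra.
  - rewrite E; apply Rmult_le_compat_r; [lra | apply Hl; lra].
Qed.

Lemma smI_inverse a b a' b' h c : smI a b h -> 0 < c -> (forall t, a < t < b -> c <= Derive h t) ->
  a < a' -> a' < b' -> b' < b ->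
  exists psi, smI (h a') (h b') psi /\
    (forall y, h a' < y < h b' -> a' < psi y < b' /\ h (psi y) = y) /\
    (forall t, a' < t < b' -> h a' < h t < h b' /\ psi (h t) = t).
Proof.
  intros Hh Hc Hl Ha Hab Hb.
  assert (Hinc := smI_increasing a b h c Hh Hc Hl).
  assert (Hlt : forall t u, a < t -> t < u -> u < b -> h t < h u)
    by (intros t u H1 H2 H3; specialize (Hinc t u H1 H2 H3); nra).
  set (P := fun y t => a' < t < b' /\ h t = y).
  set (psi := fun y => epsilon (inhabits 0) (P y)).
  assert (Hpsi : forall y, h a' < y < h b' -> P y (psi y)).
  { intros y Hy; apply epsilon_spec.
    destruct (Ranalysis5.IVT_interv (fun t => h t - y) a' b') as (t & Ht & E); try lra.
    - intros t H1 H2; apply continuity_pt_minus; [|apply continuity_const; intros p q; reflexivity].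
      apply derivable_continuous_pt; exists (Derive h t); apply is_derive_Reals.
      apply (smI_is_derive a b); auto; lra.
    - exists t; split; [|lra].
      assert (t <> a') by (intros ->; lra); assert (t <> b') by (intros ->; lra); lra. }
  exists psi; split; [|split].
  - set (U := fun x y => 0 < x < 1 /\ h a' < y < h b').
    set (V := fun (x y : R) => a' < y < b').
    assert (HU : open2 U).
    { apply (open2_and (fun x _ => 0 < x < 1) (fun _ y => h a' < y < h b')); [apply open2_itv|].
      intros x y H; destruct (open2_itv (h a') (h b') y x H) as [d D]; exists d; intros u v A B.
      apply (D v u); auto. }
    assert (HV : open2 V).
    { intros x y H; destruct (open2_itv a' b' y x H) as [d D]; exists d; intros u v A B.
      apply (D v u); auto. }
    assert (Hd1 : Sm V (fun x y => Derive h y)).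
    { apply (Sm_comp V (itv a b) (fun t _ => Derive h t) (fun _ y => y) (fun _ y => y));
       auto using open2_itv.
      - apply (smI_deriv a b h Hh).
      - apply Sm_snd with (Rabs a' + Rabs b'); intros x y H; unfold V in H.
        apply Rabs_le; generalize (Rle_abs a') (Rle_abs b') (Rabs_maj2 a') (Rabs_maj2 b')
          (Rabs_pos a') (Rabs_pos b'); lra.
      - apply Sm_snd with (Rabs a' + Rabs b'); intros x y H; unfold V in H.
        apply Rabs_le; generalize (Rle_abs a') (Rle_abs b') (Rabs_maj2 a') (Rabs_maj2 b')
          (Rabs_pos a') (Rabs_pos b'); lra.
      - unfold V, itv; intros; lra. }
    assert (HS : Sm U (fun _ y => psi y)).
    { apply (Sm_implicit U V (fun _ y => h y) (fun _ _ => 0) (fun _ y => Derive h y)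
        (fun _ y => psi y) c) with (K := 1 + Rabs a' + Rabs b'); auto.
      - intros x y1 y2 y; unfold V, Rmin, Rmax; destruct (Rle_dec y1 y2); lra.
      - intros x y Hy; split; [apply is_derive_Reals, derivable_pt_lim_const|].
        apply (smI_is_derive a b); auto; unfold V in Hy; lra.
      - apply Sm_const.
      - unfold V; intros; apply Hl; lra.
      - intros x y [_ Hy]; exact (Hpsi y Hy).
      - intros x y [Hx Hy]; destruct (Hpsi y Hy) as [H1 _].
        generalize (Rle_abs a') (Rle_abs b') (Rabs_maj2 a') (Rabs_maj2 b')
          (Rabs_pos a') (Rabs_pos b'); intros; split; apply Rabs_le; lra. }
    apply (Sm_comp (itv (h a') (h b')) U (fun _ y => psi y) (fun _ _ => / 2) (fun x _ => x));
      auto using Sm_const.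
    + apply Sm_fst with (Rabs (h a') + Rabs (h b')); intros x y H; unfold itv in H.
      apply Rabs_le; generalize (Rle_abs (h a')) (Rle_abs (h b')) (Rabs_maj2 (h a'))
         (Rabs_maj2 (h b')) (Rabs_pos (h a')) (Rabs_pos (h b')); lra.
    + unfold U, itv; intros; lra.
  - intros y Hy; exact (Hpsi y Hy).
  - intros t Ht.
    assert (Hr : h a' < h t < h b') by (split; apply Hlt; lra).
    split; auto; destruct (Hpsi (h t) Hr) as [H1 H2].
    destruct (Rtotal_order (psi (h t)) t) as [L|[E|L]]; auto.
    + assert (h (psi (h t)) < h t) by (apply Hlt; lra); lra.
    + assert (h t < h (psi (h t))) by (apply Hlt; lra); lra.
Qed.

(** * The adiabatic invariant *)

(* NN comes from the adiabatic invariant J = sqrt (w^2 + 2/3 g^3 g''), w = g (v + g').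
   With t' = t + d, gl the wall before and gr the wall after the collision:
   if v = (gl t + gr t') / d then J = sqrt (NN gl gr t d) / d at time t and
   J' = sqrt (NN gr gl t' (-d)) / d at time t'. *)
Definition WW (gl gr : R -> R) (t d : R) : R := gl t * (gl t + gr (t + d) + d * Derive gl t).
Definition q (gl : R -> R) (t : R) : R := gl t ^ 3 * Derive_n gl 2 t.
Definition NN (gl gr : R -> R) (t d : R) : R := WW gl gr t d ^ 2 + 2 / 3 * q gl t * d ^ 2.

Lemma smI_q a b gl : smI a b gl -> smI a b (q gl).
Proof.
  intros H; unfold q; apply smI_mult; [apply smI_pow; auto | apply smI_Derive_n; auto].
Qed.

Lemma Sm_N a b gl gr : smI a b gl -> smI a b gr -> Sm (seg a b) (NN gl gr).
Proof.
  intros Hl Hr.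
  assert (H1 := Sm_seg_left a b gl Hl).
  assert (H2 := Sm_seg_left a b _ (smI_Derive_n a b gl 1 Hl)).
  assert (H3 := Sm_seg_right a b gr Hr).
  assert (H4 := Sm_seg_left a b _ (smI_q a b gl Hl)).
  assert (H5 := Sm_seg_snd a b).
  unfold NN, WW; sm.
Qed.

(** At d = 0 the bracket in [WW] is at least 2 g0. The radius lets d gl' take away at most g0 from
    it, leaving W at least g0^2, and lets the q-term take away at most half of g0^4 from W^2. *)
Lemma N_lower a b gl gr g0 : smI a b gl -> 0 < g0 ->
  (forall t, a < t < b -> g0 <= gl t /\ g0 <= gr t) ->
  exists r c, 0 < r /\ 0 < c /\ forall t d, seg a b t d -> - r < d < r ->
    c <= NN gl gr t d /\ c <= WW gl gr t d.
Proof.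
  intros Hl Hg0 Hg.
  destruct (smI_bound a b _ (smI_Derive_n a b gl 1 Hl)) as (K1 & HK1 & B1).
  destruct (smI_bound a b _ (smI_q a b gl Hl)) as (Kq & HKq & Bq).
  set (r := Rmin 1 (Rmin (g0 / (K1 + 1)) (g0 ^ 4 / (2 * (Kq + 1))))).
  assert (Hg4 : 0 < g0 ^ 4) by (apply pow_lt; auto).
  assert (Hg2 : 0 < g0 ^ 2) by (apply pow_lt; auto).
  assert (Hr : 0 < r).
  { unfold r; repeat apply Rmin_pos; try lra; apply Rdiv_lt_0_compat; lra. }
  assert (M1 := Rmin_l 1 (Rmin (g0 / (K1 + 1)) (g0 ^ 4 / (2 * (Kq + 1))))).
  assert (M2 := Rmin_r 1 (Rmin (g0 / (K1 + 1)) (g0 ^ 4 / (2 * (Kq + 1))))).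
  assert (M3 := Rmin_l (g0 / (K1 + 1)) (g0 ^ 4 / (2 * (Kq + 1)))).
  assert (M4 := Rmin_r (g0 / (K1 + 1)) (g0 ^ 4 / (2 * (Kq + 1)))).
  fold r in M1, M2.
  assert (R1 : r * (K1 + 1) <= g0).
  { apply Rle_trans with (g0 / (K1 + 1) * (K1 + 1)); [apply Rmult_le_compat_r; lra|].
    right; field; lra. }
  assert (R2 : r * (Kq + 1) <= g0 ^ 4 / 2).
  { apply Rle_trans with (g0 ^ 4 / (2 * (Kq + 1)) * (Kq + 1)); [apply Rmult_le_compat_r; lra|].
    right; field; lra. }
  exists r, (Rmin (g0 ^ 2) (g0 ^ 4 / 2)).
  split; [auto|split; [apply Rmin_pos; lra|]].
  intros t d [Ht Htd] Hd.
  destruct (Hg t Ht) as [L1 _], (Hg (t + d) Htd) as [_ L2].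
  specialize (B1 t Ht); specialize (Bq t Ht); change (Derive_n gl 1 t) with (Derive gl t) in B1.
  assert (Hda : Rabs d <= r) by (apply Rabs_le; lra).
  assert (A1 : - g0 <= d * Derive gl t).
  { assert (A : Rabs (d * Derive gl t) <= r * K1)
      by (rewrite Rabs_mult; apply Rmult_le_compat; auto using Rabs_pos).
    apply Rabs_le_between in A; lra. }
  assert (HW : g0 ^ 2 <= WW gl gr t d) by (unfold WW; simpl; nra).
  assert (HW2 : g0 ^ 4 <= WW gl gr t d ^ 2).
  { replace (g0 ^ 4) with ((g0 ^ 2) ^ 2) by ring; apply pow_incr; lra. }
  assert (A2 : - (r * Kq) <= q gl t * d ^ 2).
  { assert (A : Rabs (q gl t * d ^ 2) <= Kq * r).
    { rewrite Rabs_mult; apply Rmult_le_compat; auto using Rabs_pos.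
      rewrite <- RPow_abs; generalize (Rabs_pos d); simpl; nra. }
    apply Rabs_le_between in A; lra. }
  split.
  - eapply Rle_trans; [apply Rmin_r|]; unfold NN; nra.
  - eapply Rle_trans; [apply Rmin_l | auto].
Qed.

Section Regular.
Variables (a b : R) (g : R -> R) (g0 : R).
Hypothesis Hg : smI a b g.
Hypothesis Hg0 : 0 < g0.
Hypothesis Hgpos : forall t, a < t < b -> g0 <= g t.
Hypothesis Ha : a < 0.
Hypothesis Hb : 1 < b.

Definition S_ (t : R) : R := RInt (fun s => / g s ^ 2) 0 t.

Lemma smI_invsq : smI a b (fun t => / g t ^ 2).
Proof.
  apply smI_inv with (g0 ^ 2); [apply pow_lt; auto| |apply smI_pow; auto].
  intros t Ht; apply pow_incr; specialize (Hgpos t Ht); lra.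
Qed.

Lemma S_is_derive t : a < t < b -> is_derive S_ t (/ g t ^ 2).
Proof.
  intros Ht.
  assert (Hc : forall u, a < u < b -> continuous (fun s => / g s ^ 2) u).
  { intros u Hu; apply (ex_derive_continuous (fun s => / g s ^ 2)); eexists.
    apply (smI_is_derive a b); auto using smI_invsq. }
  apply (is_derive_RInt (V := R_CompleteNormedModule) (fun s => / g s ^ 2) S_ 0 t).
  - assert (Hopen : locally t (fun u => a < u < b)).
    { destruct (locally_2d_slice _ _ _ (open2_itv a b t 0 Ht)) as [L _]; exact L. }
    revert Hopen; apply filter_imp; intros u Hu.
    apply RInt_correct, (ex_RInt_continuous (V := R_CompleteNormedModule)).
    intros z; unfold Rmin, Rmax; destruct (Rle_dec 0 u); intros Hz; apply Hc; lra.
  - apply Hc; auto.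
Qed.

Lemma smI_S : smI a b S_.
Proof.
  apply smI_intro with (fun t => / g t ^ 2); [exact S_is_derive | exact smI_invsq|].
  exists (/ g0 ^ 2 * (b - a)); intros t Ht.
  assert (E : S_ 0 = 0) by (unfold S_; apply (RInt_point (V := R_CompleteNormedModule))).
  assert (L := lipschitz_of_derive S_ (fun t => / g t ^ 2) a b (/ g0 ^ 2)).
  replace (S_ t) with (S_ t - S_ 0) by lra.
  assert (Hp : 0 < g0 ^ 2) by (apply pow_lt; auto).
  assert (0 < / g0 ^ 2) by (apply Rinv_0_lt_compat; auto).
  eapply Rle_trans; [apply L; try lra; [exact S_is_derive|]|].
  - intros u Hu; rewrite Rabs_right.
    + apply Rinv_le_contravar; auto; apply pow_incr; specialize (Hgpos u Hu); lra.
    + apply Rle_ge, Rlt_le, Rinv_0_lt_compat, pow_lt; specialize (Hgpos u Hu); lra.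
  - apply Rmult_le_compat_l; [lra|]; apply Rabs_le; lra.
Qed.

Lemma S_0 : S_ 0 = 0.
Proof. unfold S_; apply (RInt_point (V := R_CompleteNormedModule)). Qed.

Lemma derive_S_lower : exists c, 0 < c /\ forall t, a < t < b -> c <= Derive S_ t.
Proof.
  destruct (smI_bound a b g Hg) as (K & HK & B).
  exists (/ (K + 1) ^ 2).
  assert (0 < (K + 1) ^ 2) by (apply pow_lt; lra).
  split; [apply Rinv_0_lt_compat; auto|].
  intros t Ht; rewrite (is_derive_unique _ _ _ (S_is_derive t Ht)).
  specialize (B t Ht); specialize (Hgpos t Ht); apply Rabs_le_between in B.
  apply Rinv_le_contravar; [apply pow_lt; lra | apply pow_incr; lra].
Qed.

Lemma locally_ab t : a < t < b -> locally t (fun u => a < u < b).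
Proof.
  intros Ht; destruct (locally_2d_slice _ _ _ (open2_itv a b t 0 Ht)) as [L _]; exact L.
Qed.

Lemma g_derivs k t : a < t < b -> is_derive (Derive_n g k) t (Derive_n g (S k) t).
Proof. intros Ht; apply (smI_is_derive a b (Derive_n g k)); auto using smI_Derive_n. Qed.

Lemma S_derivs t : a < t < b ->
  Derive_n S_ 1 t = / g t ^ 2 /\
  Derive_n S_ 2 t = - 2 * Derive_n g 1 t / g t ^ 3 /\
  Derive_n S_ 3 t = 6 * Derive_n g 1 t ^ 2 / g t ^ 4 - 2 * Derive_n g 2 t / g t ^ 3.
Proof.
  assert (H1 : forall t, a < t < b -> Derive_n S_ 1 t = / g t ^ 2)
    by (intros u Hu; exact (is_derive_unique _ _ _ (S_is_derive u Hu))).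
  assert (Hne : forall t, a < t < b -> g t <> 0) by (intros u Hu; specialize (Hgpos u Hu); lra).
  assert (H2 : forall t, a < t < b -> Derive_n S_ 2 t = - 2 * Derive_n g 1 t / g t ^ 3).
  { intros u Hu; change (Derive_n S_ 2 u) with (Derive (Derive_n S_ 1) u).
    rewrite (Derive_ext_loc _ (fun t => / g t ^ 2)).
    - assert (D := g_derivs 0 u Hu); simpl Derive_n in D.
      apply is_derive_unique; auto_derive.
      + split; [eexists; exact D|split; [exact (pow_nonzero (g u) 2 (Hne u Hu)) | auto]].
      + specialize (Hne u Hu); simpl.
        change (Derive (fun x : R => g x) u) with (Derive g u); field; auto.
    - generalize (locally_ab u Hu); apply filter_imp; auto. }
  intros Ht; split; [auto|split; [auto|]].
  change (Derive_n S_ 3 t) with (Derive (Derive_n S_ 2) t).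
  rewrite (Derive_ext_loc _ (fun t => - 2 * Derive g t / g t ^ 3)).
  - assert (D := g_derivs 0 t Ht); simpl Derive_n in D.
    assert (D2 := g_derivs 1 t Ht); simpl Derive_n in D2.
    specialize (Hne t Ht).
    apply is_derive_unique; auto_derive.
    + repeat split; try (eexists; eassumption); exact (pow_nonzero (g t) 3 Hne).
    + simpl; change (Derive (fun x : R => g x) t) with (Derive g t).
      change (Derive (fun x : R => Derive g x) t) with (Derive (Derive g) t).
      change (Derive (fun x : R => Derive (fun x : R => g x) x) t) with (Derive (Derive g) t).
      field; auto.
  - generalize (locally_ab t Ht); apply filter_imp; intros u Hu; rewrite H2; auto.
Qed.
End Regular.

Lemma Derive_n_Derive_n (g : R -> R) k j : Derive_n (Derive_n g k) j = Derive_n g (j + k).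
Proof. induction j as [|j IH]; simpl; [reflexivity | rewrite IH; reflexivity]. Qed.

Definition segr (a b r : R) : R -> R -> Prop := fun t d => seg a b t d /\ - r < d < r.

Lemma open2_segr a b r : open2 (segr a b r).
Proof.
  apply (open2_and (seg a b) (fun _ d => - r < d < r)); [apply open2_seg|].
  intros x y H; destruct (open2_itv (- r) r y x H) as [d D]; exists d; intros u v A B.
  apply (D v u); auto.
Qed.

(** Time reversal of a flight: quantities at arrival are those at departure evaluated at the
    reversed pair. *)
Lemma segr_flip a b r t d : segr a b r t d -> segr a b r (t + d) (- d).
Proof.
  intros [[H1 H2] H3]; split; [split; auto|lra].
  replace (t + d + - d) with t by ring; auto.
Qed.

Lemma Sm_segr a b r f : Sm (seg a b) f -> Sm (segr a b r) f.
Proof. apply Sm_sub; intros t d [H _]; exact H. Qed.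

Lemma Sm_flip a b r f : Sm (segr a b r) f -> Sm (segr a b r) (fun t d => f (t + d) (- d)).
Proof.
  intros H; apply (Sm_comp _ (segr a b r) f (fun t d => t + d) (fun _ d => - d));
    auto using open2_segr, segr_flip.
  - apply (Sm_segr a b r (fun t d => t + d)).
    apply Sm_plus; [|apply Sm_seg_snd].
    apply Sm_fst with (Rabs a + Rabs b); intros t d [H1 _].
    apply Rabs_le; generalize (Rle_abs a) (Rle_abs b) (Rabs_maj2 a) (Rabs_maj2 b)
      (Rabs_pos a) (Rabs_pos b); lra.
  - apply Sm_opp, Sm_segr, Sm_seg_snd.
Qed.

Ltac jet_coeffs := cbn [Nat.add];
  repeat match goal with |- context [Derive ?h ?t] => change (Derive h t) with (Derive_n h 1 t) end;
  repeat match goal with |- context [Derive_n ?h 0] => change (Derive_n h 0) with h end.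

Section Step.
Variables (a b : R) (g : R -> R) (g0 : R).
Hypothesis Hg : smI a b g.
Hypothesis Hg0 : 0 < g0.
Hypothesis Hgpos : forall t, a < t < b -> g0 <= g t.
Hypothesis Ha : a < 0.
Hypothesis Hb : 1 < b.
Let S := S_ g.

Let g1 := Derive_n g 1.
Let g2 := Derive_n g 2.
Let g3 := Derive_n g 3.

Let SL k : Sm (seg a b) (fun t _ => Derive_n g k t) := Sm_seg_left a b _ (smI_Derive_n a b g k Hg).

Lemma jet_g k : jet (seg a b) (fun t d => Derive_n g k (t + d)) (Derive_n g k) (Derive_n g (1 + k))
   (fun t => Derive_n g (2 + k) t / 2) (fun t => Derive_n g (3 + k) t / 6).
Proof.
  rewrite <- !(Derive_n_Derive_n g); apply jet_taylor, smI_Derive_n; auto.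
Qed.

Lemma jet_W : jet (seg a b) (WW g g) (fun t => 2 * g t ^ 2) (fun t => 2 * g t * g1 t)
   (fun t => g t * g2 t / 2) (fun t => g t * g3 t / 6).
Proof.
  assert (H0 := SL 0); assert (H1 := SL 1); assert (Hs := Sm_seg_snd a b).
  eapply jet_ext; [apply open2_seg| |].
  - apply (jet_mult _ Hs (fun t _ => g t)); [apply jet_const, H0|].
    apply (jet_plus _ (fun t d => g t + g (t + d)) (fun t d => d * g1 t)).
    + apply (jet_plus _ (fun t _ => g t) (fun t d => g (t + d))); [apply jet_const, H0 | exact (jet_g 0)].
    + apply (jet_mult _ Hs (fun _ d => d) (fun t _ => g1 t)); [apply jet_var | apply jet_const, H1].
  - intros t d Htd; cbv beta; unfold WW, g1, g2, g3; jet_coeffs.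
    repeat split; field.
Qed.

Lemma jet_W' : jet (seg a b) (fun t d => WW g g (t + d) (- d)) (fun t => 2 * g t ^ 2)
   (fun t => 2 * g t * g1 t) (fun t => g t * g2 t / 2) (fun t => - g1 t * g2 t / 2).
Proof.
  assert (H0 := SL 0); assert (H1 := SL 1); assert (Hs := Sm_seg_snd a b).
  eapply jet_ext; [apply open2_seg| |].
  - apply (jet_mult _ Hs (fun t d => g (t + d))); [exact (jet_g 0)|].
    apply (jet_plus _ (fun t d => g t + g (t + d)) (fun t d => - 1 * (d * g1 (t + d)))).
    + apply (jet_plus _ (fun t _ => g t) (fun t d => g (t + d))); [apply jet_const, H0 | exact (jet_g 0)].
    + apply (jet_scal _ (open2_seg a b) Hs (fun t d => d * g1 (t + d)) (- 1)).
      apply (jet_mult _ Hs (fun _ d => d) (fun t d => g1 (t + d))); [apply jet_var | exact (jet_g 1)].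
  - intros t d Htd; cbv beta; unfold WW, g1, g2, g3; jet_coeffs.
    replace (t + d + - d) with t by ring.
    repeat split; field.
Qed.

Lemma jet_N : jet (seg a b) (NN g g) (fun t => 4 * g t ^ 4) (fun t => 8 * g t ^ 3 * g1 t)
   (fun t => 8 / 3 * g t ^ 3 * g2 t + 4 * g t ^ 2 * g1 t ^ 2)
   (fun t => 2 / 3 * g t ^ 3 * g3 t + 2 * g t ^ 2 * g1 t * g2 t).
Proof.
  assert (Hs := Sm_seg_snd a b).
  assert (Hq := Sm_seg_left a b _ (smI_q a b g Hg)).
  eapply jet_ext; [apply open2_seg| |].
  - apply (jet_plus _ (fun t d => WW g g t d * WW g g t d) (fun t d => 2 / 3 * (q g t * (d * d)))).
    + apply (jet_mult _ Hs); apply jet_W.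
    + apply (jet_scal _ (open2_seg a b) Hs (fun t d => q g t * (d * d)) (2 / 3)).
      apply (jet_mult _ Hs (fun t _ => q g t) (fun _ d => d * d)); [apply jet_const, Hq|].
      apply (jet_mult _ Hs (fun _ d => d) (fun _ d => d)); apply jet_var.
  - intros t d Htd; cbv beta; unfold NN, q, g1, g2, g3; repeat split; field.
Qed.

Lemma jet_N' : jet (seg a b) (fun t d => NN g g (t + d) (- d)) (fun t => 4 * g t ^ 4)
   (fun t => 8 * g t ^ 3 * g1 t)
   (fun t => 8 / 3 * g t ^ 3 * g2 t + 4 * g t ^ 2 * g1 t ^ 2)
   (fun t => 2 / 3 * g t ^ 3 * g3 t + 2 * g t ^ 2 * g1 t * g2 t).
Proof.
  assert (Hs := Sm_seg_snd a b).
  eapply jet_ext; [apply open2_seg| |].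
  - apply (jet_plus _ (fun t d => WW g g (t + d) (- d) * WW g g (t + d) (- d))
       (fun t d => 2 / 3 * (g (t + d) * (g (t + d) * (g (t + d) * g2 (t + d))) * (d * d)))).
    + apply (jet_mult _ Hs); apply jet_W'.
    + apply (jet_scal _ (open2_seg a b) Hs
        (fun t d => (g (t + d) * (g (t + d) * (g (t + d) * g2 (t + d))) * (d * d))) (2 / 3)).
      apply (jet_mult _ Hs (fun t d => (g (t + d) * (g (t + d) * (g (t + d) * g2 (t + d)))))
        (fun _ d => d * d)).
      * apply (jet_mult _ Hs); [exact (jet_g 0)|].
        apply (jet_mult _ Hs); [exact (jet_g 0)|].
        apply (jet_mult _ Hs); [exact (jet_g 0)|exact (jet_g 2)].
      * apply (jet_mult _ Hs (fun _ d => d) (fun _ d => d)); apply jet_var.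
  - intros t d Htd; cbv beta; unfold NN, q, g1, g2, g3; jet_coeffs.
    repeat split; field.
Qed.

(** W and its reversal agree up to d^2; at order d^3 their squares differ by - 2/3 (g^3 g'')', and
    the increment of the term 2/3 q d^2 cancels exactly this. Here lies the origin of the correction
    2/3 g^3 g'' in J. *)
Lemma N_defect : exists h, Sm (seg a b) h /\ forall t d, seg a b t d ->
  NN g g (t + d) (- d) - NN g g t d = d ^ 4 * h t d.
Proof.
  destruct jet_N as (_ & _ & _ & _ & h & Hh & E).
  destruct jet_N' as (_ & _ & _ & _ & k & Hk & F).
  exists (fun t d => k t d - h t d); split; [sm|].
  intros t d Htd; rewrite (F t d Htd), (E t d Htd); ring.
Qed.

Lemma S_jet : exists sg, jet (seg a b) sg (fun t => / g t ^ 2) (fun t => - g1 t / g t ^ 3)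
    (fun t => g1 t ^ 2 / g t ^ 4 - g2 t / (3 * g t ^ 3)) (fun t => Derive_n S 4 t / 24) /\
  forall t d, seg a b t d -> S (t + d) - S t = d * sg t d.
Proof.
  assert (HS : smI a b S) by (apply (smI_S a b g g0); auto).
  assert (SS : forall k, Sm (seg a b) (fun t _ => Derive_n S k t))
    by (intros k; exact (Sm_seg_left a b _ (smI_Derive_n a b S k HS))).
  assert (Hs := Sm_seg_snd a b).
  destruct (taylor a b S 4 HS) as (r & Hr & E).
  exists (fun t d => Derive_n S 1 t + Derive_n S 2 t / 2 * d + Derive_n S 3 t / 6 * d ^ 2
     + Derive_n S 4 t / 24 * d ^ 3 + d ^ 4 * r t d).
  assert (Hd := S_derivs a b g g0 Hg Hg0 Hgpos Ha Hb).
  assert (Hne : forall t, a < t < b -> g t <> 0) by (intros u Hu; specialize (Hgpos u Hu); lra).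
  split.
  - assert (J : jet (seg a b) (fun t d => Derive_n S 1 t + Derive_n S 2 t / 2 * d
       + Derive_n S 3 t / 6 * d ^ 2 + Derive_n S 4 t / 24 * d ^ 3 + d ^ 4 * r t d)
       (fun t => Derive_n S 1 t) (fun t => Derive_n S 2 t / 2) (fun t => Derive_n S 3 t / 6)
       (fun t => Derive_n S 4 t / 24)).
    { assert (S1 := SS 1%nat); assert (S2 := SS 2%nat); assert (S3 := SS 3%nat); assert (S4 := SS 4%nat).
      split; [|split; [|split; [|split]]]; [sm|sm|sm|sm|]; exists r; split; auto. }
    eapply jet_ext; [apply open2_seg|exact J|].
    intros t d [Ht _]; destruct (Hd t Ht) as (D1 & D2 & D3); specialize (Hne t Ht).
    fold S in D1, D2, D3; rewrite D1, D2, D3; unfold g1, g2.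
    repeat split; field; auto.
  - intros t d Htd; rewrite E by auto; simpl; field.
Qed.

(* The two adiabatic estimates: J is conserved up to O(d^3) and J dS = 2 + O(d^3). *)
Lemma adiabatic_step : exists r c hS hN, 0 < r /\ 0 < c /\ Sm (segr a b r) hS /\ Sm (segr a b r) hN /\
  forall t d, segr a b r t d -> c <= NN g g t d /\ c <= WW g g t d /\
    (S (t + d) - S t) * sqrt (NN g g t d) = d * (2 + d ^ 3 * hS t d) /\
    NN g g (t + d) (- d) - NN g g t d = d ^ 4 * hN t d.
Proof.
  destruct (N_lower a b g g g0 Hg Hg0) as (r0 & c & Hr0 & Hc & HNW); [auto|].
  (* The coefficients of sqrt N, found by solving (s0 + s1 d + s2 d^2 + s3 d^3)^2 = N order by
     order. *)
  set (s0 := fun t => 2 * g t ^ 2); set (s1 := fun t => 2 * g t * g1 t).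
  set (s2 := fun t => 2 / 3 * g t * g2 t); set (s3 := fun t => g t * g3 t / 6 - g1 t * g2 t / 6).
  assert (H0 : Sm (seg a b) (fun t _ => g t)) by exact (SL 0).
  assert (H1 : Sm (seg a b) (fun t _ => g1 t)) by exact (SL 1).
  assert (H2 : Sm (seg a b) (fun t _ => g2 t)) by exact (SL 2).
  assert (H3 : Sm (seg a b) (fun t _ => g3 t)) by exact (SL 3).
  assert (Hs := Sm_seg_snd a b).
  assert (Hp : Sm (seg a b) (fun t d => s1 t + s2 t * d + s3 t * d ^ 2)) by (unfold s1, s2, s3; sm).
  destruct (Sm_bound _ _ Hp) as (K & HK & HB).
  set (r := Rmin r0 (g0 ^ 2 / (K + 1))).
  assert (Hg2 : 0 < g0 ^ 2) by (apply pow_lt; auto).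
  assert (Hr : 0 < r) by (apply Rmin_pos; auto; apply Rdiv_lt_0_compat; lra).
  assert (HrK : r * (K + 1) <= g0 ^ 2).
  { apply Rle_trans with (g0 ^ 2 / (K + 1) * (K + 1));
      [apply Rmult_le_compat_r; [lra|apply Rmin_r]|right; field; lra]. }
  assert (Hr0' : r <= r0) by apply Rmin_l.
  assert (HNW' : forall t d, segr a b r t d -> c <= NN g g t d /\ c <= WW g g t d)
    by (intros t d [A B]; apply HNW; auto; lra).
  assert (Hsub : forall t d, segr a b r t d -> seg a b t d) by (intros t d [A _]; exact A).
  assert (Jq : jet (segr a b r) (fun t d => sqrt (NN g g t d)) s0 s1 s2 s3).
  { eapply (jet_sqrt _ (open2_segr a b r)) with (c := c).
    - apply Sm_segr; auto.
    - auto.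
    - intros t d Htd; apply HNW'; auto.
    - apply Sm_segr, Sm_N; auto.
    - apply (jet_sub (seg a b)); [auto|exact jet_N].
    - apply Sm_segr; unfold s0; sm.
    - apply Sm_segr; unfold s1; sm.
    - apply Sm_segr; unfold s2; sm.
    - apply Sm_segr; unfold s3; sm.
    - exists (g0 ^ 2); split; auto; intros t d Htd.
      assert (Hgt := Hgpos t (proj1 (Hsub t d Htd))).
      assert (g0 ^ 2 <= g t ^ 2) by (apply pow_incr; lra).
      assert (A : Rabs (d * (s1 t + s2 t * d + s3 t * d ^ 2)) <= r * K).
      { rewrite Rabs_mult; apply Rmult_le_compat; auto using Rabs_pos.
        apply Rabs_le; destruct Htd; lra. }
      apply Rabs_le_between in A.
      generalize (sqrt_pos (NN g g t d)); unfold s0 at 1; intros.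
      replace (2 * g t ^ 2 + s1 t * d + s2 t * d ^ 2 + s3 t * d ^ 3)
        with (2 * g t ^ 2 + d * (s1 t + s2 t * d + s3 t * d ^ 2)) by ring.
      lra.
    - intros t d Htd; unfold s0, s1, s2, s3, g1, g2, g3; repeat split; field. }
  destruct S_jet as (sg & Jsg & Esg).
  assert (Js : jet (segr a b r) sg (fun t => / g t ^ 2) (fun t => - g1 t / g t ^ 3)
    (fun t => g1 t ^ 2 / g t ^ 4 - g2 t / (3 * g t ^ 3)) (fun t => Derive_n S 4 t / 24))
    by (apply (jet_sub (seg a b)); auto).
  assert (Hs' : Sm (segr a b r) (fun _ d => d)) by (apply Sm_segr; auto).
  (* In the product of sqrt N and (S (t + d) - S t) / d the coefficients of d and d^2 vanish
     identically; the constant 2 and terms of order at least 3 remain. *)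
  destruct (jet_mult _ Hs' _ _ _ _ _ _ _ _ _ _ Jq Js) as (_ & _ & _ & M3 & h & Hh & E).
  destruct N_defect as (hN & HhN & EN).
  match type of M3 with Sm _ ?C => set (c3 := C) in * end.
  exists r, c, (fun t d => c3 t 0 + d * h t d), hN.
  split; [auto|split; [auto|split; [sm|split; [apply Sm_segr; auto|]]]].
  intros t d Htd; split; [apply HNW'; auto|split; [apply HNW'; auto|split]].
  - rewrite Esg by auto; rewrite (Rmult_comm d), Rmult_assoc, (Rmult_comm d), <- Rmult_assoc.
    rewrite (Rmult_comm (sg t d)), E by auto.
    assert (Hne : g t <> 0) by (specialize (Hgpos t (proj1 (Hsub t d Htd))); lra).
    unfold c3; cbv beta; unfold s0, s1, s2, g1, g2.
    field; auto.
  - apply EN; auto.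
Qed.
End Step.

Lemma smI_of_dummy a b f : Sm (box 0 1 b) f -> a = - b -> smI a b (fun y => f (/ 2) y).
Proof.
  intros Hf ->.
  apply (Sm_comp (itv (- b) b) (box 0 1 b) f (fun _ _ => / 2) (fun y _ => y));
    auto using open2_box, Sm_const.
  - apply Sm_fst with b; intros x y H; unfold itv in H; apply Rabs_le; lra.
  - intros x y H; unfold itv in H; split; lra.
Qed.

Lemma Sm_box_snd_fun a b r r' h : r <= r' -> smI (- r') r' h -> Sm (box a b r) (fun _ y => h y).
Proof.
  intros Hr Hh; apply (Sm_comp1 _ (- r') r' h (fun _ y => y)); auto using Sm_box_snd.
  intros x y [_ Hy]; lra.
Qed.

Lemma Sm_box_fst_fun a b r a' b' h : a' <= a -> b <= b' -> smI a' b' h ->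
  Sm (box a b r) (fun x _ => h x).
Proof.
  intros H1 H2 Hh; apply (Sm_comp1 _ a' b' h (fun x _ => x)); auto using Sm_box_fst.
  intros x y [Hx _]; lra.
Qed.

Lemma partial_inverse1 r u c : 0 < r -> 0 < c -> smI (- r) r u ->
  (forall y, - r < y < r -> c <= u y) ->
  exists r1 r2 d, 0 < r1 <= r /\ 0 < r2 /\ smI (- r2) r2 d /\
    (forall y, - r2 < y < r2 -> - r1 < d y < r1 /\ d y * u (d y) = y) /\
    (forall y1 y2, - r1 < y1 -> y1 < y2 -> y2 < r1 -> y1 * u y1 < y2 * u y2).
Proof.
  intros Hr Hc Hu Hcu.
  destruct (partial_inverse 0 1 r (fun _ y => u y) c Hr Hc) as (r1 & r2 & d & H1 & H2 & H3 & H4 & H5).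
  - apply Sm_box_snd_fun with r; auto; lra.
  - intros x y [_ Hy]; auto.
  - exists r1, r2, (fun y => d (/ 2) y); split; [auto|split; [auto|split]].
    + apply smI_of_dummy; auto.
    + split.
      * intros y Hy; apply H4; split; lra.
      * intros y1 y2 A B C; apply (H5 (/ 2)); auto; split; lra.
Qed.

Lemma sqrt_N_bounds (U : R -> R -> Prop) f c : open2 U -> Sm U f -> 0 < c ->
  (forall x y, U x y -> c <= f x y) ->
  exists c', 0 < c' /\ forall x y, U x y -> c' <= / sqrt (f x y).
Proof.
  intros HU Hf Hc Hcf; destruct (Sm_bound _ _ Hf) as (K & HK & HB).
  assert (0 < sqrt (K + 1)) by (apply sqrt_lt_R0; lra).
  exists (/ sqrt (K + 1)); split; [apply Rinv_0_lt_compat; auto|].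
  intros x y Hu; specialize (HB x y Hu); specialize (Hcf x y Hu).
  apply Rabs_le_between in HB.
  apply Rinv_le_contravar; [apply sqrt_lt_R0; lra | apply sqrt_le_1_alt; lra].
Qed.

(** * Regular flights and the boundary of the strip in terms of 1/J *)

Section Step2.
Variables (a b a' b' : R) (g : R -> R) (g0 : R).
Hypothesis Hg : smI a b g.
Hypothesis Hg0 : 0 < g0.
Hypothesis Hgpos : forall t, a < t < b -> g0 <= g t.
Hypothesis Ha : a < a'.
Hypothesis Ha' : a' < 0.
Hypothesis Hb' : 1 < b'.
Hypothesis Hb : b' < b.
Let S := S_ g.

Lemma smI_S' : smI a b S.
Proof. apply (smI_S a b g g0); auto; lra. Qed.

Lemma S_lt t u : a < t -> t < u -> u < b -> S t < S u.
Proof.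
  intros Ht Htu Hu.
  destruct (derive_S_lower a b g g0) as (c & Hc & HL); auto; try lra.
  assert (H := smI_increasing a b S c smI_S' Hc HL t u Ht Htu Hu); nra.
Qed.

Lemma S_inj t u : a < t < b -> a < u < b -> S t = S u -> t = u.
Proof.
  intros Ht Hu E; destruct (Rtotal_order t u) as [L|[E'|L]]; auto.
  - assert (S t < S u) by (apply S_lt; lra); lra.
  - assert (S u < S t) by (apply S_lt; lra); lra.
Qed.

Lemma S_lt_iff t u : a < t < b -> a < u < b -> (S t < S u <-> t < u).
Proof.
  intros Ht Hu; split; intros H; [|apply S_lt; lra].
  destruct (Rlt_le_dec t u) as [L|[L|L]]; auto; [|subst; lra].
  assert (S u < S t) by (apply S_lt; lra); lra.
Qed.

Lemma S_inverse : exists psi, smI (S a') (S b') psi /\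
    (forall y, S a' < y < S b' -> a' < psi y < b' /\ S (psi y) = y) /\
    (forall t, a' < t < b' -> S a' < S t < S b' /\ psi (S t) = t).
Proof.
  destruct (derive_S_lower a b g g0) as (c & Hc & HL); auto; try lra.
  apply (smI_inverse a b a' b' S c); auto using smI_S'; lra.
Qed.

(** The duration solves d / sqrt (NN g g t d) = ep with ep = 1/J, an equation of the type of
    [partial_inverse]. Its solution is smooth at ep = 0, so the error coefficients [Pc] and [Qc] are
    smooth up to J = infinity; inverting S makes them functions of S t. *)
Lemma flight_regular : exists r1 r2 dd Pc Qc, 0 < r1 /\ 0 < r2 /\
  Sm (box (S a') (S b') r2) Pc /\ Sm (box (S a') (S b') r2) Qc /\
  forall t ep, a' < t < b' -> 0 < ep < r2 -> let d := dd t ep in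
    0 < d < r1 /\ seg a b t d /\ d = ep * sqrt (NN g g t d) /\ 0 < WW g g t d /\
    0 < WW g g (t + d) (- d) /\ 0 < NN g g t d /\ 0 < NN g g (t + d) (- d) /\
    S (t + d) * (sqrt (NN g g (t + d) (- d)) / d) / 2 = S t * / ep / 2 + 1 + ep ^ 3 * Pc (S t) ep /\
    sqrt (NN g g (t + d) (- d)) / d = / ep + ep ^ 3 * Qc (S t) ep.
Proof.
  destruct (adiabatic_step a b g g0) as (r & c & hS & hN & Hr & Hc & HhS & HhN & HA); auto; try lra.
  (* Departures in (a', b') with durations below r0 arrive inside (a, b). *)
  set (r0 := Rmin r (Rmin (a' - a) (b - b'))).
  assert (M1 := Rmin_l r (Rmin (a' - a) (b - b'))); assert (M2 := Rmin_r r (Rmin (a' - a) (b - b'))).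
  assert (M3 := Rmin_l (a' - a) (b - b')); assert (M4 := Rmin_r (a' - a) (b - b')).
  fold r0 in M1, M2.
  assert (Hr0 : 0 < r0) by (unfold r0; repeat apply Rmin_pos; lra).
  assert (Hbs : forall t d, box a' b' r0 t d -> segr a b r t d).
  { intros t d [H1 H2]; split; [split|]; lra. }
  assert (SN : Sm (box a' b' r0) (NN g g)).
  { apply Sm_sub with (seg a b); [intros t d H; apply (Hbs t d H)|apply Sm_N; auto]. }
  assert (SNr : Sm (segr a b r) (NN g g)) by (apply Sm_segr, Sm_N; auto).
  assert (Sq : Sm (segr a b r) (fun t d => sqrt (NN g g t d))).
  { apply Sm_sqrt with c; auto using open2_segr; intros; apply HA; auto. }
  assert (Sq' : Sm (segr a b r) (fun t d => sqrt (NN g g (t + d) (- d)))).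
  { apply (Sm_flip a b r (fun t d => sqrt (NN g g t d))); auto. }
  destruct (sqrt_N_bounds (box a' b' r0) (NN g g) c) as (c' & Hc' & Hcs);
    auto using open2_box.
  { intros; apply HA; auto. }
  assert (Hsc : 0 < sqrt c) by (apply sqrt_lt_R0; auto).
  destruct (partial_inverse a' b' r0 (fun t d => / sqrt (NN g g t d)) c' Hr0 Hc')
    as (r1 & r2 & dd & Hr1 & Hr2 & Sdd & Hdd & Hmon); auto.
  { apply Sm_inv with (sqrt c); auto.
    - intros t d H; rewrite Rabs_right by (apply Rle_ge, sqrt_pos).
      apply sqrt_le_1_alt, HA, Hbs, H.
    - apply Sm_sqrt with c; auto using open2_box; intros; apply HA; auto. }
  assert (SS : Sm (segr a b r) (fun t d => S (t + d)))
    by (apply (Sm_segr a b r (fun t d => S (t + d))), Sm_seg_right, smI_S').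
  (* The difference of the two roots is d^4 hN over their sum, so J changes by d^3 hQ. The change of
     S J / 2 is (S' - S) J / 2 + S' (J' - J) / 2 = 1 + d^3 hP, primes denoting values at arrival. *)
  set (hQ := fun t d => hN t d / (sqrt (NN g g t d) + sqrt (NN g g (t + d) (- d)))).
  set (hP := fun t d => hS t d / 2 + S (t + d) * hQ t d / 2).
  assert (SQ : Sm (segr a b r) hQ).
  { apply Sm_div with (sqrt c); auto; [|sm].
    intros t d H; rewrite Rabs_right by (apply Rle_ge, Rplus_le_le_0_compat; apply sqrt_pos).
    assert (sqrt c <= sqrt (NN g g t d)) by (apply sqrt_le_1_alt, HA, H).
    generalize (sqrt_pos (NN g g (t + d) (- d))); lra. }
  assert (SP : Sm (segr a b r) hP) by (unfold hP; sm).
  destruct S_inverse as (psi & Spsi & Hpsi1 & Hpsi2).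
  assert (Sth : Sm (box (S a') (S b') r2) (fun th _ => psi th))
    by (apply Sm_box_fst_fun with (S a') (S b'); auto; lra).
  assert (Sd : Sm (box (S a') (S b') r2) (fun th ep => dd (psi th) ep)).
  { apply (Sm_comp _ (box a' b' r2) dd (fun th _ => psi th) (fun _ ep => ep));
      auto using open2_box, Sm_box_snd.
    intros th ep [H1 H2]; split; auto; apply Hpsi1; auto. }
  assert (Hin : forall th ep, box (S a') (S b') r2 th ep -> segr a b r (psi th) (dd (psi th) ep)).
  { intros th ep [H1 H2]; apply Hbs; destruct (Hpsi1 th H1) as [A _].
    destruct (Hdd (psi th) ep) as [B _]; [split; auto|]; split; lra. }
  assert (Scomp : forall f, Sm (segr a b r) f ->
            Sm (box (S a') (S b') r2) (fun th ep => f (psi th) (dd (psi th) ep))).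
  { intros f Hf; apply (Sm_comp _ (segr a b r) f (fun th _ => psi th) (fun th ep => dd (psi th) ep));
      auto using open2_segr. }
  set (sN := fun t d => sqrt (NN g g t d) ^ 3).
  assert (SsN : Sm (segr a b r) sN) by (unfold sN; sm).
  exists r1, r2, dd, (fun th ep => sN (psi th) (dd (psi th) ep) * hP (psi th) (dd (psi th) ep)),
     (fun th ep => sN (psi th) (dd (psi th) ep) * hQ (psi th) (dd (psi th) ep)).
  split; [lra|split; [auto|split; [|split]]].
  - apply Sm_mult; apply Scomp; auto.
  - apply Sm_mult; apply Scomp; auto.
  - intros t ep Ht Hep; destruct (Hpsi2 t Ht) as [HSt ->]; set (d := dd t ep).
    destruct (Hdd t ep) as [Hd1 Hd2]; [split; lra|]; fold d in Hd1, Hd2.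
    assert (Hs : segr a b r t d) by (apply Hbs; split; lra).
    destruct (HA t d Hs) as (N1 & W1 & ES & EN).
    destruct (HA (t + d) (- d) (segr_flip a b r t d Hs)) as (N2 & W2 & _ & _).
    assert (Hq : 0 < sqrt (NN g g t d)) by (apply sqrt_lt_R0; lra).
    assert (Hq' : 0 < sqrt (NN g g (t + d) (- d))) by (apply sqrt_lt_R0; lra).
    assert (Ed : d = ep * sqrt (NN g g t d)) by (rewrite <- Hd2 at 1; field; lra).
    assert (Hdp : 0 < d) by (rewrite Ed; apply Rmult_lt_0_compat; lra).
    assert (Ed3 : d ^ 3 = ep ^ 3 * sN t d) by (unfold sN; rewrite Ed at 1; ring).
    assert (EQ : sqrt (NN g g (t + d) (- d)) / d - sqrt (NN g g t d) / d = d ^ 3 * hQ t d).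
    { unfold hQ; assert (E1 := sqrt_sqrt (NN g g t d) ltac:(lra)).
      assert (E2 := sqrt_sqrt (NN g g (t + d) (- d)) ltac:(lra)).
      apply Rmult_eq_reg_r with (d * (sqrt (NN g g t d) + sqrt (NN g g (t + d) (- d)))); [|nra].
      field_simplify; [|lra|lra].
      replace (hN t d) with ((NN g g (t + d) (- d) - NN g g t d) / d ^ 4) by (rewrite EN; field; lra).
      rewrite <- E1 at 2; rewrite <- E2 at 2; field; lra. }
    assert (EJ : sqrt (NN g g t d) / d = / ep).
    { rewrite Ed at 2; field; lra. }
    repeat split; try lra; try apply Hs.
    + replace (ep ^ 3 * (sN t d * hP t d)) with (d ^ 3 * hP t d) by (rewrite Ed3; ring).
      unfold hP; rewrite <- EJ.
      assert (EJ' : sqrt (NN g g (t + d) (- d)) / d = sqrt (NN g g t d) / d + d ^ 3 * hQ t d) by lra.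
      rewrite EJ'.
      assert (ES' : (S (t + d) - S t) * (sqrt (NN g g t d) / d) = 2 + d ^ 3 * hS t d).
      { unfold Rdiv; rewrite <- Rmult_assoc; fold S in ES; rewrite ES; field; lra. }
      lra.
    + replace (ep ^ 3 * (sN t d * hQ t d)) with (d ^ 3 * hQ t d) by (rewrite Ed3; ring).
      lra.
Qed.

(* f(S) is the curve 1 / J = T / sqrt (Nst T). *)
Definition Nst (T : R) : R := NN g g T (- T).

(** A point of f(S) at time T ends a flight of duration T begun at time 0, where the function S
    vanishes. Reversing that flight, [adiabatic_step] at (T, - T) gives S(T) J = 2 + O(T^3);
    inverting T / sqrt (Nst T) = ep turns this into an expansion in ep with defect ep^4 kap. *)
Lemma strip_boundary : exists rT re T kap, 0 < rT /\ rT < b' /\ 0 < re /\ smI (- re) re T /\ smI (- re) re kap /\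
  (forall t, - rT < t < rT -> a < t < b /\ 0 < Nst t /\ 0 < WW g g t (- t)) /\
  (forall ep, - re < ep < re -> - rT < T ep < rT /\ T ep / sqrt (Nst (T ep)) = ep /\
      S (T ep) = 2 * ep + ep ^ 4 * kap ep) /\
  (forall t u, - rT < t -> t < u -> u < rT -> t / sqrt (Nst t) < u / sqrt (Nst u)).
Proof.
  destruct (adiabatic_step a b g g0) as (r & c & hS & hN & Hr & Hc & HhS & HhN & HA); auto; try lra.
  set (r0 := Rmin r (Rmin (- a') (Rmin 1 (b' / 2)))).
  assert (M1 := Rmin_l r (Rmin (- a') (Rmin 1 (b' / 2)))).
  assert (M2 := Rmin_r r (Rmin (- a') (Rmin 1 (b' / 2)))).
  assert (M3 := Rmin_l (- a') (Rmin 1 (b' / 2))); assert (M4 := Rmin_r (- a') (Rmin 1 (b' / 2))).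
  assert (M5 := Rmin_l 1 (b' / 2)).
  fold r0 in M1, M2.
  assert (Hr0 : 0 < r0) by (unfold r0; repeat apply Rmin_pos; lra).
  assert (Hbs : forall t, - r0 < t < r0 -> segr a b r t (- t)).
  { intros t H; split; [split|]; lra. }
  assert (Sc : forall f, Sm (segr a b r) f -> smI (- r0) r0 (fun t => f t (- t))).
  { intros f Hf; apply (Sm_comp (itv (- r0) r0) (segr a b r) f (fun t _ => t) (fun t _ => - t));
      auto using open2_segr.
    - apply Sm_fst with r0; intros x y H; apply Rabs_le; unfold itv in H; lra.
    - apply (Sm_opp _ (fun x _ => x)), Sm_fst with r0; intros x y H; apply Rabs_le; unfold itv in H; lra. }
  assert (SNr : Sm (segr a b r) (NN g g)) by (apply Sm_segr, Sm_N; auto).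
  assert (Sq : Sm (segr a b r) (fun t d => sqrt (NN g g t d))).
  { apply Sm_sqrt with c; auto using open2_segr; intros; apply HA; auto. }
  assert (Sq0 : smI (- r0) r0 (fun t => sqrt (Nst t))) by exact (Sc _ Sq).
  assert (SN0 : smI (- r0) r0 Nst) by exact (Sc _ SNr).
  assert (Hc0 : forall t, - r0 < t < r0 -> c <= Nst t) by (intros t Ht; apply HA; auto).
  destruct (sqrt_N_bounds (itv (- r0) r0) (fun t _ => Nst t) c) as (c' & Hc' & Hcs);
    auto using open2_itv.
  assert (Hsc : 0 < sqrt c) by (apply sqrt_lt_R0; auto).
  assert (Si : smI (- r0) r0 (fun t => / sqrt (Nst t))).
  { apply smI_inv with (sqrt c); auto; intros t Ht; apply sqrt_le_1_alt; auto. }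
  destruct (partial_inverse1 r0 (fun t => / sqrt (Nst t)) c' Hr0 Hc' Si) as
    (rT & re & T & HrT & Hre & ST & HT & Hmon); [intros; apply (Hcs y 0); auto|].
  exists rT, re, T, (fun ep => - (sqrt (Nst (T ep)) ^ 3 * hS (T ep) (- T ep))).
  split; [lra|split; [lra|split; [auto|split; [auto|split; [|split; [|split]]]]]].
  - assert (St : smI (- re) re (fun ep => sqrt (Nst (T ep)))).
    { apply (Sm_comp1 _ (- r0) r0 (fun t => sqrt (Nst t)) (fun ep _ => T ep)); auto.
      intros x y H; specialize (HT x H); lra. }
    assert (Sh : smI (- re) re (fun ep => hS (T ep) (- T ep))).
    { apply (Sm_comp1 _ (- r0) r0 (fun t => hS t (- t)) (fun ep _ => T ep)); [apply Sc; auto|auto|].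
      intros x y H; specialize (HT x H); lra. }
    apply (Sm_opp _ (fun ep _ => sqrt (Nst (T ep)) ^ 3 * hS (T ep) (- T ep))).
    apply (Sm_mult _ (fun ep _ => sqrt (Nst (T ep)) ^ 3) (fun ep _ => hS (T ep) (- T ep))); auto.
    apply (Sm_pow _ (fun ep _ => sqrt (Nst (T ep)))); auto.
  - intros t Ht; destruct (HA t (- t)) as (A1 & A2 & _); [apply Hbs; lra|].
    unfold Nst; repeat split; lra.
  - intros ep Hep; destruct (HT ep Hep) as [H1 H2]; set (t := T ep) in *.
    assert (Hs : segr a b r t (- t)) by (apply Hbs; lra).
    destruct (HA t (- t) Hs) as (N1 & _ & ES & _).
    assert (Hq : 0 < sqrt (Nst t)) by (apply sqrt_lt_R0; unfold Nst; lra).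
    repeat split; try lra.
    replace (t + - t) with 0 in ES by ring; rewrite S_0 in ES; fold S in ES; fold (Nst t) in ES.
    assert (Et : t = ep * sqrt (Nst t)) by (rewrite <- H2; field; lra).
    apply Rmult_eq_reg_r with (sqrt (Nst t)); [|lra].
    replace (S t * sqrt (Nst t)) with (t * (2 + (- t) ^ 3 * hS t (- t))) by lra.
    replace ((2 * ep + ep ^ 4 * - (sqrt (Nst t) ^ 3 * hS t (- t))) * sqrt (Nst t))
      with (2 * (ep * sqrt (Nst t)) - (ep * sqrt (Nst t)) ^ 4 * hS t (- t)) by ring.
    rewrite <- Et; ring.
  - intros t u H1 H2 H3; apply Hmon; auto.
Qed.
End Step2.

(* The action will be I = al / (2 ep) + H ep, with ep = 1 / J; the derivative of
   H makes dtau /\ dI proportional to omega. *)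
Lemma action_function al re kap : 0 < al -> 0 < re -> smI (- re) re kap ->
  exists ri rw H H2 E, 0 < ri <= re /\ 0 < rw /\ smI (- ri) ri H /\ smI (- ri) ri H2 /\ smI (- rw) rw E /\
    (forall ep, - ri < ep < ri -> is_derive H ep (- (al / 4) * (ep * kap ep)) /\
        H ep = ep ^ 2 * H2 ep /\ 0 < al / 2 + ep * H ep) /\
    (forall w, - rw < w < rw -> - ri < E w < ri /\ E w / (al / 2 + E w * H (E w)) = w) /\
    (forall e1 e2, - ri < e1 -> e1 < e2 -> e2 < ri ->
        e1 / (al / 2 + e1 * H e1) < e2 / (al / 2 + e2 * H e2)).
Proof.
  intros Hal Hre Hk.
  (* This H' solves al/2 - e^2 H'(e) = (al/4) sig(e) / e with sig(e) = 2 e + e^4 kap(e). The left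
     side is dI/dJ, so dtau /\ dI becomes (al/4) J dS /\ dJ. *)
  set (f := fun e => - (al / 4) * (e * kap e)).
  assert (Sf : smI (- re) re f).
  { apply (Sm_mult _ (fun _ _ => - (al / 4)) (fun e _ => e * kap e)); [apply Sm_const|].
    apply (Sm_mult _ (fun e _ => e) (fun e _ => kap e)); auto.
    apply Sm_fst with re; intros x y Hx; unfold itv in Hx; apply Rabs_le; lra. }
  set (H := fun e => RInt f 0 e).
  assert (Hc : forall u, - re < u < re -> continuous f u).
  { intros u Hu; apply (ex_derive_continuous f); eexists; apply (smI_is_derive (- re) re); auto. }
  assert (HD : forall e, - re < e < re -> is_derive H e (f e)).
  { intros e He; apply (is_derive_RInt (V := R_CompleteNormedModule) f H 0 e); auto.
    destruct (locally_2d_slice _ _ _ (open2_itv (- re) re e 0 He)) as [L _].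
    revert L; apply filter_imp; intros u Hu.
    apply RInt_correct, (ex_RInt_continuous (V := R_CompleteNormedModule)).
    intros z; unfold Rmin, Rmax; unfold itv in Hu; destruct (Rle_dec 0 u); intros Hz; apply Hc; lra. }
  assert (H0 : H 0 = 0) by apply (RInt_point (V := R_CompleteNormedModule)).
  destruct (smI_bound _ _ _ Sf) as (K & HK & HB).
  assert (HbH : forall e, - re < e < re -> Rabs (H e) <= K * re).
  { intros e He; replace (H e) with (H e - H 0) by lra.
    eapply Rle_trans; [apply (lipschitz_of_derive H f (- re) re K); auto; lra|].
    apply Rmult_le_compat_l; auto; apply Rabs_le; lra. }
  assert (SH : smI (- re) re H) by (apply smI_intro with f; eauto).
  destruct (taylor (- re) re H 1 SH) as (rr & Hrr & Err).
  (* Keeps |e H(e)| at most al / 4, so that in e / (al/2 + e H(e)), which is 1/I as a function of e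
     = 1/J, the denominator stays away from 0. *)
  set (ri0 := Rmin re (al / (4 * (K * re + 1)))).
  assert (0 <= K * re) by (apply Rmult_le_pos; lra).
  assert (Hri0 : 0 < ri0) by (apply Rmin_pos; auto; apply Rdiv_lt_0_compat; lra).
  assert (Hri0' : ri0 <= re) by apply Rmin_l.
  assert (Hlow : forall e, - ri0 < e < ri0 -> al / 4 <= al / 2 + e * H e <= al).
  { intros e He.
    assert (A : Rabs (e * H e) <= al / (4 * (K * re + 1)) * (K * re + 1)).
    { rewrite Rabs_mult; apply Rmult_le_compat; auto using Rabs_pos.
      - apply Rle_trans with ri0; [apply Rabs_le; lra | apply Rmin_r].
      - specialize (HbH e); lra. }
    replace (al / (4 * (K * re + 1)) * (K * re + 1)) with (al / 4) in A by (field; lra).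
    apply Rabs_le_between in A; lra. }
  assert (Su : smI (- ri0) ri0 (fun e => / (al / 2 + e * H e))).
  { apply smI_inv with (al / 4); [lra|intros; apply Hlow; auto|].
    apply (Sm_plus _ (fun _ _ => al / 2) (fun e _ => e * H e)); [apply Sm_const|].
    apply (Sm_mult _ (fun e _ => e) (fun e _ => H e)).
    - apply Sm_fst with ri0; intros x y Hx; unfold itv in Hx; apply Rabs_le; lra.
    - apply (smI_sub (- re) re); auto; lra. }
  destruct (partial_inverse1 ri0 (fun e => / (al / 2 + e * H e)) (/ al) Hri0) as
    (r1 & rw & E & Hr1 & Hrw & SE & HE & Hmon); auto.
  { apply Rinv_0_lt_compat; auto. }
  { intros e He; specialize (Hlow e He); apply Rinv_le_contravar; lra. }
  exists r1, rw, H, (fun e => rr 0 e), E.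
  split; [lra|split; [auto|split; [|split; [|split; [auto|split; [|split]]]]]].
  - apply (smI_sub (- re) re); auto; lra.
  - apply (Sm_comp (itv (- r1) r1) (seg (- re) re) rr (fun _ _ => 0) (fun e _ => e));
      auto using open2_seg, Sm_const.
    + apply Sm_fst with r1; intros x y Hx; unfold itv in Hx; apply Rabs_le; lra.
    + intros x y Hx; unfold itv in Hx; split; lra.
  - intros e He; split; [apply HD; lra|split; [|specialize (Hlow e); lra]].
    replace (H e) with (H (0 + e)) by (f_equal; ring).
    rewrite Err by (split; lra); simpl; rewrite H0.
    (* H and H' vanish at 0, so the Taylor remainder of H at 0 is the factor of e^2. *)
    assert (E1 : Derive (fun x => H x) 0 = 0).
    { replace 0 with (f 0) at 2 by (unfold f; ring); apply is_derive_unique, HD; lra. }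
    rewrite E1; field.
  - intros w Hw; destruct (HE w Hw); split; auto; lra.
  - intros e1 e2 A B C; apply Hmon; auto.
Qed.

(** Only s0, s1, s2 are prescribed, since the expansions at the jump are explicit up to order 2; s3
    is solved from c3. The radius is reduced until the cubic polynomial stays above k / 2. *)
Lemma jet_sqrt_box A B r f c k c0 c1 c2 c3 s0 s1 s2 : 0 < r -> 0 < c -> 0 < k ->
  (forall x y, box A B r x y -> c <= f x y) -> Sm (box A B r) f ->
  jet (box A B r) f c0 c1 c2 c3 ->
  Sm (box A B r) (fun x _ => s0 x) -> Sm (box A B r) (fun x _ => s1 x) ->
  Sm (box A B r) (fun x _ => s2 x) -> (forall x, A < x < B -> k <= s0 x) ->
  (forall x, A < x < B -> s0 x ^ 2 = c0 x /\ 2 * s0 x * s1 x = c1 x /\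
     2 * s0 x * s2 x + s1 x ^ 2 = c2 x) ->
  exists r' s3, 0 < r' <= r /\ jet (box A B r') (fun x y => sqrt (f x y)) s0 s1 s2 s3.
Proof.
  intros Hr Hc Hk Hcf Sf Jf S0 S1 S2 Hks He.
  pose proof Jf as (_ & _ & _ & C3 & _).
  set (s3 := fun x => (c3 x - 2 * s1 x * s2 x) * (/ 2 * / s0 x)).
  assert (Si : Sm (box A B r) (fun x _ => / s0 x)).
  { apply (Sm_inv _ (fun x _ => s0 x) k); auto; intros x y [Hx _].
    eapply Rle_trans; [exact (Hks x Hx) | apply Rle_abs]. }
  assert (S3 : Sm (box A B r) (fun x _ => s3 x)) by (unfold s3; sm).
  assert (Sy := Sm_box_snd A B r).
  assert (Sp : Sm (box A B r) (fun x y => s1 x + s2 x * y + s3 x * y ^ 2)) by sm.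
  destruct (Sm_bound _ _ Sp) as (K & HK & HB).
  set (r' := Rmin r (k / (2 * (K + 1)))).
  assert (Hr' : 0 < r') by (apply Rmin_pos; auto; apply Rdiv_lt_0_compat; lra).
  assert (Hr'r : r' <= r) by apply Rmin_l.
  assert (HrK : r' * (K + 1) <= k / 2).
  { apply Rle_trans with (k / (2 * (K + 1)) * (K + 1));
      [apply Rmult_le_compat_r; [lra|apply Rmin_r]|right; field; lra]. }
  assert (Hsub : forall x y, box A B r' x y -> box A B r x y) by (unfold box; intros; lra).
  exists r', s3; split; [lra|].
  apply (jet_sqrt _ (open2_box A B r')) with (c := c) (c0 := c0) (c1 := c1) (c2 := c2) (c3 := c3);
    try (apply Sm_sub with (box A B r); assumption); auto.
  - apply (jet_sub (box A B r)); auto.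
  - exists (k / 2); split; [lra|]; intros x y Hxy.
    assert (k <= s0 x) by (apply Hks, Hxy).
    assert (Ab : Rabs (y * (s1 x + s2 x * y + s3 x * y ^ 2)) <= r' * K).
    { rewrite Rabs_mult; apply Rmult_le_compat; auto using Rabs_pos.
      apply Rabs_le; destruct Hxy; lra. }
    apply Rabs_le_between in Ab.
    replace (s0 x + s1 x * y + s2 x * y ^ 2 + s3 x * y ^ 3)
      with (s0 x + y * (s1 x + s2 x * y + s3 x * y ^ 2)) by ring.
    generalize (sqrt_pos (f x y)); lra.
  - intros x y [Hx _]; destruct (He x Hx) as (E0 & E1 & E2); repeat split; auto.
    unfold s3; field; specialize (Hks x Hx); lra.
Qed.

Lemma jet_at A B r a b h t0 k : smI a b h -> a < t0 < b -> Sm (box A B r) (fun x _ => k x) ->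
  (forall x y, box A B r x y -> a < t0 + k x * y < b) ->
  jet (box A B r) (fun x y => h (t0 + k x * y)) (fun _ => h t0) (fun x => k x * Derive_n h 1 t0)
    (fun x => k x ^ 2 * Derive_n h 2 t0 / 2) (fun x => k x ^ 3 * Derive_n h 3 t0 / 6).
Proof.
  intros Hh Ht0 Sk Hin.
  destruct (taylor a b h 3 Hh) as (rr & Srr & E).
  assert (Sy := Sm_box_snd A B r).
  split; [|split; [|split; [|split]]]; try (sm; fail).
  exists (fun x y => k x ^ 4 * rr t0 (k x * y)); split.
  - assert (Sm (box A B r) (fun x y => rr t0 (k x * y))).
    { apply (Sm_comp _ (seg a b) rr (fun _ _ => t0) (fun x y => k x * y));
        auto using open2_seg, Sm_const, Sm_mult.
      intros x y Hxy; split; auto. }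
    sm.
  - intros x y Hxy; rewrite E by (split; auto); simpl; field.
Qed.

(** The divided difference is expanded instead of h itself, because the factor y has to cancel the
    1/y contained in J. *)
Lemma jet_at1 A B r a b h t0 k : smI a b h -> a < t0 < b -> Sm (box A B r) (fun x _ => k x) ->
  (forall x y, box A B r x y -> a < t0 + k x * y < b) ->
  exists sg c3, jet (box A B r) sg (fun _ => Derive_n h 1 t0) (fun x => k x * Derive_n h 2 t0 / 2)
     (fun x => k x ^ 2 * Derive_n h 3 t0 / 6) c3 /\
  forall x y, box A B r x y -> h (t0 + k x * y) - h t0 = k x * y * sg x y.
Proof.
  intros Hh Ht0 Sk Hin.
  destruct (taylor a b h 4 Hh) as (rr & Srr & E).
  assert (Sy := Sm_box_snd A B r).
  exists (fun x y => Derive_n h 1 t0 + k x * Derive_n h 2 t0 / 2 * y + k x ^ 2 * Derive_n h 3 t0 / 6 * y ^ 2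
     + k x ^ 3 * Derive_n h 4 t0 / 24 * y ^ 3 + y ^ 4 * (k x ^ 4 * rr t0 (k x * y))),
    (fun x => k x ^ 3 * Derive_n h 4 t0 / 24).
  split.
  - split; [|split; [|split; [|split]]]; try (sm; fail).
    exists (fun x y => k x ^ 4 * rr t0 (k x * y)); split; [|auto].
    assert (Sm (box A B r) (fun x y => rr t0 (k x * y))).
    { apply (Sm_comp _ (seg a b) rr (fun _ _ => t0) (fun x y => k x * y));
        auto using open2_seg, Sm_const, Sm_mult.
      intros x y Hxy; split; auto. }
    sm.
  - intros x y Hxy; rewrite E by (split; auto); simpl; field.
Qed.

(** * The flight across the jump *)

Section KickJets.
Variables (a b : R) (g : R -> R) (g0 : R).
Hypothesis Hg : smI a b g.
Hypothesis Hg0 : 0 < g0.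
Hypothesis Hgpos : forall t, a < t < b -> g0 <= g t.
Hypothesis Ha : a < 0.
Hypothesis Hb : 1 < b.
Hypothesis Hper : g 0 = g 1.
Let S := S_ g.
Variables (A B r : R).
Hypothesis Hr : 0 < r.
Hypothesis Hin : forall x y, box A B r x y ->
  a < 0 + x * y < b /\ a < 1 + (x - 1) * y < b.

(* x in [0,1] parametrizes the flights across the jump: they leave at 1 + (x - 1) y
   and arrive after the time y, at 1 + x y; m and p stand for the sides before and
   after the jump. *)
Definition Lm (x y : R) : R := g (1 + (x - 1) * y).
Definition Lp (x y : R) : R := g (0 + x * y).
Definition Wm (x y : R) : R := Lm x y * (Lm x y + Lp x y + y * Derive_n g 1 (1 + (x - 1) * y)).
Definition Wp (x y : R) : R := Lp x y * (Lm x y + Lp x y - y * Derive_n g 1 (0 + x * y)).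
Definition Nm (x y : R) : R :=
  Wm x y ^ 2 + 2 / 3 * (Lm x y ^ 3 * Derive_n g 2 (1 + (x - 1) * y)) * y ^ 2.
Definition Np (x y : R) : R :=
  Wp x y ^ 2 + 2 / 3 * (Lp x y ^ 3 * Derive_n g 2 (0 + x * y)) * y ^ 2.

Let U := box A B r.
Let l0 := g 0.
Let pm := Derive_n g 1 1.
Let pp := Derive_n g 1 0.
Let mm := Derive_n g 2 1.
Let mp := Derive_n g 2 0.

Let Sx1 : Sm U (fun x _ => x - 1) :=
  Sm_minus U (fun x _ => x) (fun _ _ => 1) (Sm_box_fst A B r) (Sm_const U 1).

Lemma jet_m k : jet U (fun x y => Derive_n g k (1 + (x - 1) * y)) (fun _ => Derive_n g k 1)
  (fun x => (x - 1) * Derive_n g (1 + k) 1) (fun x => (x - 1) ^ 2 * Derive_n g (2 + k) 1 / 2)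
  (fun x => (x - 1) ^ 3 * Derive_n g (3 + k) 1 / 6).
Proof.
  rewrite <- !(Derive_n_Derive_n g); apply (jet_at A B r a b (Derive_n g k) 1 (fun x => x - 1));
    auto using smI_Derive_n; [lra|]; intros; apply Hin; auto.
Qed.

Lemma jet_p k : jet U (fun x y => Derive_n g k (0 + x * y)) (fun _ => Derive_n g k 0)
  (fun x => x * Derive_n g (1 + k) 0) (fun x => x ^ 2 * Derive_n g (2 + k) 0 / 2)
  (fun x => x ^ 3 * Derive_n g (3 + k) 0 / 6).
Proof.
  rewrite <- !(Derive_n_Derive_n g); apply (jet_at A B r a b (Derive_n g k) 0 (fun x => x));
    auto using smI_Derive_n; [lra| |]; [apply Sm_box_fst | intros; apply Hin; auto].
Qed.

Let HU : open2 U := open2_box A B r.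
Let Hy : Sm U (fun _ y => y) := Sm_box_snd A B r.

(** Coefficients of y and y^2 in W before (m) and after (p) the jump; [pm], [pp] are the first and
    [mm], [mp] the second derivatives of the wall on the two sides. *)
Let wm1 x := l0 * ((pp + pm) * x) - 2 * l0 * (pm * (1 - x)).
Let wp1 x := 2 * l0 * (pp * x) - l0 * ((pp + pm) * (1 - x)).
Let wm2 x := l0 * ((mp * x ^ 2 - mm * (1 - x) ^ 2 - 2 * mm * (1 - x) * x) / 2)
   - pm * (1 - x) * ((pp + pm) * x) + mm * (1 - x) ^ 2 * l0.
Let wp2 x := l0 * ((mm * (1 - x) ^ 2 - mp * x ^ 2 - 2 * mp * x * (1 - x)) / 2)
   - pp * x * ((pp + pm) * (1 - x)) + mp * x ^ 2 * l0.

Lemma jet_Wm : exists c3, jet U Wm (fun _ => 2 * l0 ^ 2) wm1 wm2 c3.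
Proof.
  eexists; eapply (jet_ext U HU).
  - apply (jet_mult _ Hy Lm (fun x y => Lm x y + Lp x y + y * Derive_n g 1 (1 + (x - 1) * y)));
      [exact (jet_m 0)|].
    apply (jet_plus _ (fun x y => Lm x y + Lp x y)).
    + apply (jet_plus _ Lm Lp); [exact (jet_m 0) | exact (jet_p 0)].
    + apply (jet_mult _ Hy (fun _ y => y)); [apply jet_var; exact Hy | exact (jet_m 1)].
  - intros x y Hxy; cbv beta; unfold wm1, wm2, l0, pm, pp, mm, mp; cbn [Nat.add].
    change (Derive_n g 0) with g; rewrite Hper.
    split; [reflexivity|split; [ring|split; [ring|split; [field|reflexivity]]]].
Qed.

Lemma jet_Wp : exists c3, jet U Wp (fun _ => 2 * l0 ^ 2) wp1 wp2 c3.
Proof.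
  eexists; eapply (jet_ext U HU).
  - apply (jet_mult _ Hy Lp (fun x y => Lm x y + Lp x y + - 1 * (y * Derive_n g 1 (0 + x * y))));
      [exact (jet_p 0)|].
    apply (jet_plus _ (fun x y => Lm x y + Lp x y)).
    + apply (jet_plus _ Lm Lp); [exact (jet_m 0) | exact (jet_p 0)].
    + apply (jet_scal _ HU Hy (fun x y => y * Derive_n g 1 (0 + x * y)) (- 1)).
      apply (jet_mult _ Hy (fun _ y => y)); [apply jet_var; exact Hy | exact (jet_p 1)].
  - intros x y Hxy; cbv beta; unfold wp1, wp2, l0, pm, pp, mm, mp; cbn [Nat.add].
    change (Derive_n g 0) with g; rewrite Hper.
    split; [unfold Wp; ring|split; [ring|split; [ring|split; [field|reflexivity]]]].
Qed.

Lemma jet_Nm : exists c3, jet U Nm (fun _ => 4 * l0 ^ 4) (fun x => 4 * l0 ^ 2 * wm1 x)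
   (fun x => 4 * l0 ^ 2 * wm2 x + wm1 x ^ 2 + 2 / 3 * l0 ^ 3 * mm) c3.
Proof.
  destruct jet_Wm as (c3 & Hc).
  eexists; eapply (jet_ext U HU).
  - apply (jet_plus _ (fun x y => Wm x y * Wm x y) (fun x y => 2 / 3 *
      (Lm x y * (Lm x y * (Lm x y * Derive_n g 2 (1 + (x - 1) * y))) * (y * y)))).
    + apply (jet_mult _ Hy Wm Wm); exact Hc.
    + apply (jet_scal _ HU Hy (fun x y => Lm x y * (Lm x y * (Lm x y * Derive_n g 2 (1 + (x - 1) * y))) * (y * y)) (2 / 3)).
      apply (jet_mult _ Hy (fun x y => Lm x y * (Lm x y * (Lm x y * Derive_n g 2 (1 + (x - 1) * y))))
        (fun _ y => y * y)).
      * apply (jet_mult _ Hy Lm); [exact (jet_m 0)|].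
        apply (jet_mult _ Hy Lm); [exact (jet_m 0)|].
        apply (jet_mult _ Hy Lm); [exact (jet_m 0)|exact (jet_m 2)].
      * apply (jet_mult _ Hy (fun _ y => y)); apply jet_var; exact Hy.
  - intros x y Hxy; cbv beta; cbn [Nat.add].
    change (Derive_n g 0) with g; rewrite <- Hper; fold l0; fold mm.
    split; [unfold Nm; ring|split; [ring|split; [ring|split; [ring|reflexivity]]]].
Qed.

Lemma jet_Np : exists c3, jet U Np (fun _ => 4 * l0 ^ 4) (fun x => 4 * l0 ^ 2 * wp1 x)
   (fun x => 4 * l0 ^ 2 * wp2 x + wp1 x ^ 2 + 2 / 3 * l0 ^ 3 * mp) c3.
Proof.
  destruct jet_Wp as (c3 & Hc).
  eexists; eapply (jet_ext U HU).
  - apply (jet_plus _ (fun x y => Wp x y * Wp x y) (fun x y => 2 / 3 *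
      (Lp x y * (Lp x y * (Lp x y * Derive_n g 2 (0 + x * y))) * (y * y)))).
    + apply (jet_mult _ Hy Wp Wp); exact Hc.
    + apply (jet_scal _ HU Hy (fun x y => Lp x y * (Lp x y * (Lp x y * Derive_n g 2 (0 + x * y))) * (y * y)) (2 / 3)).
      apply (jet_mult _ Hy (fun x y => Lp x y * (Lp x y * (Lp x y * Derive_n g 2 (0 + x * y))))
        (fun _ y => y * y)).
      * apply (jet_mult _ Hy Lp); [exact (jet_p 0)|].
        apply (jet_mult _ Hy Lp); [exact (jet_p 0)|].
        apply (jet_mult _ Hy Lp); [exact (jet_p 0)|exact (jet_p 2)].
      * apply (jet_mult _ Hy (fun _ y => y)); apply jet_var; exact Hy.
  - intros x y Hxy; cbv beta; cbn [Nat.add].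
    change (Derive_n g 0) with g; fold l0; fold mp.
    split; [unfold Np; ring|split; [ring|split; [ring|split; [ring|reflexivity]]]].
Qed.

Lemma Sm_jet (V : R -> R -> Prop) f c0 c1 c2 c3 : open2 V -> Sm V (fun _ y => y) ->
  jet V f c0 c1 c2 c3 -> Sm V f.
Proof.
  intros HV Hs (H0 & H1 & H2 & H3 & h & Hh & E).
  apply Sm_ext with (fun x y => c0 x + c1 x * y + c2 x * y ^ 2 + c3 x * y ^ 3 + y ^ 4 * h x y); auto.
  - intros; symmetry; auto.
  - sm.
Qed.

Variable c : R.
Hypothesis Hc : 0 < c.
Hypothesis HNm : forall x y, U x y -> c <= Nm x y.
Hypothesis HNp : forall x y, U x y -> c <= Np x y.

Lemma jet_roots : exists r' cm cp, 0 < r' <= r /\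
   jet (box A B r') (fun x y => sqrt (Nm x y)) (fun _ => 2 * l0 ^ 2) wm1 (fun x => wm2 x + l0 * mm / 6) cm /\
   jet (box A B r') (fun x y => sqrt (Np x y)) (fun _ => 2 * l0 ^ 2) wp1 (fun x => wp2 x + l0 * mp / 6) cp.
Proof.
  destruct jet_Nm as (c3 & J1), jet_Np as (c3' & J2).
  assert (Hl0 : 0 < l0) by (unfold l0; specialize (Hgpos 0); lra).
  assert (Hl2 : 0 < 2 * l0 ^ 2) by (assert (0 < l0 ^ 2) by (apply pow_lt; auto); lra).
  assert (Sx : Sm U (fun x _ => x)) by apply Sm_box_fst.
  destruct (jet_sqrt_box A B r Nm c (2 * l0 ^ 2) _ _ _ _ (fun _ => 2 * l0 ^ 2) wm1
     (fun x => wm2 x + l0 * mm / 6) Hr Hc Hl2 HNm (Sm_jet _ _ _ _ _ _ HU Hy J1) J1) as (r1 & cm & Hr1 & K1).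
  { sm. } { unfold wm1; fold U; sm. } { unfold wm2; fold U; sm. } { intros; lra. }
  { intros x Hx; repeat split; field. }
  destruct (jet_sqrt_box A B r Np c (2 * l0 ^ 2) _ _ _ _ (fun _ => 2 * l0 ^ 2) wp1
     (fun x => wp2 x + l0 * mp / 6) Hr Hc Hl2 HNp (Sm_jet _ _ _ _ _ _ HU Hy J2) J2) as (r2 & cp & Hr2 & K2).
  { sm. } { unfold wp1; fold U; sm. } { unfold wp2; fold U; sm. } { intros; lra. }
  { intros x Hx; repeat split; field. }
  exists (Rmin r1 r2), cm, cp.
  assert (M1 := Rmin_l r1 r2); assert (M2 := Rmin_r r1 r2).
  assert (0 < Rmin r1 r2) by (apply Rmin_pos; lra).
  split; [lra|split].
  - apply (jet_sub (box A B r1)); auto; unfold box; intros; lra.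
  - apply (jet_sub (box A B r2)); auto; unfold box; intros; lra.
Qed.

Let al := S 1.
Let De := al * l0 * (pp - pm).
Let D1 := / 2 * al ^ 2 * l0 ^ 3 * (mp - mm).
Hypothesis Hal : 0 < al.

(** The expansion of al (J' - J) / 2 is multiplied by y sqrt Nm, which clears the denominators
    because y = sqrt Nm / J. Every term is then a jet in y and the coefficients of orders 0, 1 and 2
    have to vanish: order 1 accounts for [De] and order 2 for [D1]. *)
Lemma kick_jets : exists r' k1 k3, 0 < r' <= r /\ Sm (box A B r') k1 /\ Sm (box A B r') k3 /\
  forall x y, box A B r' x y -> y <> 0 ->
    let z := 1 - sqrt (Nm x y) / y * (al - S (1 + (x - 1) * y)) / 2 in
    sqrt (Np x y) / y * S (0 + x * y) / 2 = z + y ^ 2 * k1 x y /\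
    (al / 2 * (sqrt (Np x y) - sqrt (Nm x y)) - y * De * (z - / 2)) * sqrt (Nm x y)
      - 2 / al * D1 * y ^ 2 * ((z - / 2) ^ 2 - / 12) = y ^ 3 * k3 x y.
Proof.
  destruct jet_roots as (r' & cm & cp & Hr' & Jm & Jp).
  set (V := box A B r').
  assert (HV : open2 V) by apply open2_box.
  assert (Vy : Sm V (fun _ y => y)) by apply Sm_box_snd.
  assert (Vx : Sm V (fun x _ => x)) by apply Sm_box_fst.
  assert (HS : smI a b S) by (apply (smI_S a b g g0); auto).
  assert (Hsub : forall x y, V x y -> box A B r x y) by (unfold V, box; intros; lra).
  destruct (jet_at1 A B r' a b S 1 (fun x => x - 1) HS ltac:(lra)) as (sm_ & cm3 & Jsm & Esm).
  { fold V; sm. }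
  { intros x y H; apply Hin, Hsub, H. }
  destruct (jet_at1 A B r' a b S 0 (fun x => x) HS ltac:(lra)) as (sp_ & cp3 & Jsp & Esp).
  { exact Vx. }
  { intros x y H; apply Hin, Hsub, H. }
  fold V in Jm, Jp, Jsm, Jsp, Esm, Esp.
  destruct (S_derivs a b g g0 Hg Hg0 Hgpos Ha Hb 1 ltac:(lra)) as (A1 & A2 & A3).
  destruct (S_derivs a b g g0 Hg Hg0 Hgpos Ha Hb 0 ltac:(lra)) as (B1 & B2 & B3).
  fold S in A1, A2, A3, B1, B2, B3.
  rewrite <- Hper in A1, A2, A3; fold l0 pm mm in A1, A2, A3; fold l0 pp mp in B1, B2, B3.
  assert (Hl0 : l0 <> 0) by (unfold l0; specialize (Hgpos 0); lra).
  assert (Jx : forall f, Sm V (fun x _ => f x) -> jet V (fun x _ => f x) f (fun _ => 0) (fun _ => 0) (fun _ => 0))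
    by (intros; apply jet_const; auto).
  (* As S t - al = (x - 1) y sm_, the division by y disappears from z. The leading coefficient is x:
     to lowest order z is the fraction of the flight spent after the jump. *)
  assert (Jz : exists z3, jet V (fun x y => 1 + (/ 2 * (x - 1)) * (sqrt (Nm x y) * sm_ x y))
     (fun x => x) (fun x => / 2 * (x - 1) * (2 * l0 ^ 2 * ((x - 1) * (- 2 * pm / l0 ^ 3) / 2) + wm1 x / l0 ^ 2))
     (fun x => / 2 * (x - 1) * (2 * l0 ^ 2 * ((x - 1) ^ 2 * (6 * pm ^ 2 / l0 ^ 4 - 2 * mm / l0 ^ 3) / 6)
         + wm1 x * ((x - 1) * (- 2 * pm / l0 ^ 3) / 2) + (wm2 x + l0 * mm / 6) / l0 ^ 2)) z3).
  { eexists; eapply (jet_ext V HV).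
    - apply (jet_plus V (fun _ _ => 1)); [apply (Jx (fun _ => 1)); apply Sm_const|].
      apply (jet_mult V Vy (fun x _ => / 2 * (x - 1))); [apply (Jx (fun x => / 2 * (x - 1))); sm|].
      apply (jet_mult V Vy); [exact Jm | exact Jsm].
    - intros x y Hxy; cbv beta; rewrite A1, A2, A3.
      split; [reflexivity|split; [field; auto|split; [field; auto|split; [field; auto|reflexivity]]]]. }
  destruct Jz as (z3 & Jz).
  set (z := fun x y => 1 + (/ 2 * (x - 1)) * (sqrt (Nm x y) * sm_ x y)) in *.
  assert (J1 : exists c2 c3, jet V (fun x y => / 2 * x * (sqrt (Np x y) * sp_ x y) + - 1 * z x y)
      (fun _ => 0) (fun _ => 0) c2 c3).
  { eexists; eexists; eapply (jet_ext V HV).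
    - apply (jet_plus V (fun x y => / 2 * x * (sqrt (Np x y) * sp_ x y)) (fun x y => - 1 * z x y)).
      + apply (jet_mult V Vy (fun x _ => / 2 * x)); [apply (Jx (fun x => / 2 * x)); sm|].
        apply (jet_mult V Vy); [exact Jp | exact Jsp].
      + apply (jet_scal V HV Vy z (- 1)); exact Jz.
    - intros x y Hxy; cbv beta; rewrite B1, B2.
      split; [reflexivity|split; [field; auto|split; [|split; reflexivity]]].
      unfold wp1, wm1; field; auto. }
  destruct J1 as (c2 & c3 & _ & _ & C2 & C3 & h1 & Sh1 & Eh1).
  assert (J3 : exists c3, jet V (fun x y => (al / 2 * (sqrt (Np x y) + - 1 * sqrt (Nm x y))
         + - De * (y * (z x y + - / 2))) * sqrt (Nm x y)
      + - (2 / al * D1) * (y * y * ((z x y + - / 2) * (z x y + - / 2) + - / 12)))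
      (fun _ => 0) (fun _ => 0) (fun _ => 0) c3).
  { assert (Jz2 : jet V (fun x y => z x y + - / 2) _ _ _ _)
      by (apply (jet_plus V z (fun _ _ => - / 2)); [exact Jz | apply (Jx (fun _ => - / 2)); apply Sm_const]).
    eexists; eapply (jet_ext V HV).
    - apply (jet_plus V (fun x y => (al / 2 * (sqrt (Np x y) + - 1 * sqrt (Nm x y))
         + - De * (y * (z x y + - / 2))) * sqrt (Nm x y))
         (fun x y => - (2 / al * D1) * (y * y * ((z x y + - / 2) * (z x y + - / 2) + - / 12)))).
      + apply (jet_mult V Vy); [|exact Jm].
        apply (jet_plus V).
        * apply (jet_scal V HV Vy); apply (jet_plus V); [exact Jp|].
          apply (jet_scal V HV Vy (fun x y => sqrt (Nm x y)) (- 1)); exact Jm.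
        * apply (jet_scal V HV Vy (fun x y => y * (z x y + - / 2)) (- De)).
          apply (jet_mult V Vy (fun _ y => y)); [apply jet_var; auto | exact Jz2].
      + apply (jet_scal V HV Vy (fun x y => y * y * ((z x y + - / 2) * (z x y + - / 2) + - / 12)) (- (2 / al * D1))).
        apply (jet_mult V Vy (fun _ y => y * y)).
        * apply (jet_mult V Vy (fun _ y => y) (fun _ y => y)); apply jet_var; auto.
        * apply (jet_plus V (fun x y => (z x y + - / 2) * (z x y + - / 2)) (fun _ _ => - / 12));
           [|apply (Jx (fun _ => - / 12)); apply Sm_const].
          apply (jet_mult V Vy); exact Jz2.
    - intros x y Hxy; cbv beta.
      split; [reflexivity|split; [ring|split; [|split; [|reflexivity]]]].
      + unfold De, wp1, wm1; field; split; auto; lra.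
      + unfold De, D1, wp1, wm1, wp2, wm2; field; split; auto; lra. }
  destruct J3 as (c3' & _ & _ & _ & C3' & h3 & Sh3 & Eh3).
  exists r', (fun x y => c2 x + c3 x * y + y ^ 2 * h1 x y), (fun x y => c3' x + y * h3 x y).
  fold V; split; [auto|split; [sm|split; [sm|]]].
  intros x y Hxy Hy0 z'.
  assert (Ez : z' = z x y).
  { unfold z', z, al; replace (S 1 - S (1 + (x - 1) * y)) with (- (S (1 + (x - 1) * y) - S 1)) by ring.
    rewrite Esm by auto; field; auto. }
  rewrite Ez; split.
  - specialize (Eh1 x y Hxy).
    replace (S (0 + x * y)) with (x * y * sp_ x y).
    + replace (sqrt (Np x y) / y * (x * y * sp_ x y) / 2) with (/ 2 * x * (sqrt (Np x y) * sp_ x y))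
        by (field; auto).
      lra.
    + rewrite <- Esp by auto; unfold S; rewrite S_0; ring.
  - specialize (Eh3 x y Hxy).
    rewrite Rmult_0_l, Rmult_0_l, !Rplus_0_l in Eh3.
    transitivity (c3' x * y ^ 3 + y ^ 4 * h3 x y); [|ring].
    rewrite <- Eh3; ring.
Qed.
End KickJets.

(** The wall on [1, 2], with a smooth extension to the left of 1, so that the flight over the jump
    takes place between two smooth walls. *)
Definition shiftg (g : R -> R) (t : R) : R := g (t + -1).

Lemma Derive_n_shift g k t : Derive_n (shiftg g) k t = Derive_n g k (t + -1).
Proof. apply (Derive_n_comp_trans g k t (-1)). Qed.

Lemma smI_shift a b g : smI a b g -> smI (1 + a) (1 + b) (shiftg g).
Proof.
  intros H; apply (Sm_comp1 _ a b g (fun t _ => t + -1)); auto.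
  - apply (Sm_plus _ (fun t _ => t) (fun _ _ => -1)); [|apply Sm_const].
    apply Sm_fst with (Rabs (1 + a) + Rabs (1 + b)); intros x y Hx; unfold itv in Hx.
    apply Rabs_le; generalize (Rle_abs (1 + a)) (Rle_abs (1 + b)) (Rabs_maj2 (1 + a))
      (Rabs_maj2 (1 + b)) (Rabs_pos (1 + a)) (Rabs_pos (1 + b)); lra.
  - intros x y Hx; unfold itv in Hx; lra.
Qed.

Section Kick.
Variables (a b a' b' : R) (g : R -> R) (g0 : R).
Hypothesis Hg : smI a b g.
Hypothesis Hg0 : 0 < g0.
Hypothesis Hgpos : forall t, a < t < b -> g0 <= g t.
Hypothesis Ha : a < a'.
Hypothesis Ha' : a' < 0.
Hypothesis Hb' : 1 < b'.
Hypothesis Hb : b' < b.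
Hypothesis Hper : g 0 = g 1.
Let S := S_ g.
Let gs := shiftg g.
Let al := S 1.
Let De := al * g 0 * (Derive_n g 1 0 - Derive_n g 1 1).
Let D1 := / 2 * al ^ 2 * g 0 ^ 3 * (Derive_n g 2 0 - Derive_n g 2 1).

Lemma NN_kick x y : NN g gs (1 + (x - 1) * y) y = Nm g x y /\
  WW g gs (1 + (x - 1) * y) y = Wm g x y /\
  NN gs g (1 + (x - 1) * y + y) (- y) = Np g x y /\
  WW gs g (1 + (x - 1) * y + y) (- y) = Wp g x y.
Proof.
  assert (E1 : WW g gs (1 + (x - 1) * y) y = Wm g x y).
  { unfold WW, Wm, Lm, Lp, gs, shiftg.
    replace (1 + (x - 1) * y + y + -1) with (0 + x * y) by ring; reflexivity. }
  assert (E2 : WW gs g (1 + (x - 1) * y + y) (- y) = Wp g x y).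
  { unfold WW, Wp, Lm, Lp, gs.
    change (Derive (shiftg g)) with (Derive_n (shiftg g) 1); rewrite Derive_n_shift; unfold shiftg.
    replace (1 + (x - 1) * y + y + -1) with (0 + x * y) by ring.
    replace (1 + (x - 1) * y + y + - y) with (1 + (x - 1) * y) by ring; ring. }
  repeat split; auto.
  - unfold NN, Nm; rewrite E1; reflexivity.
  - unfold NN, Np; rewrite E2; unfold q, gs; rewrite Derive_n_shift; unfold shiftg, Lp.
    replace (1 + (x - 1) * y + y + -1) with (0 + x * y) by ring; ring.
Qed.

(** The data z and ep = 1/J before the jump fix the departure time through S t, and then the
    duration. Since t - 1 and d are both divisible by ep, the fraction x of [kick_jets] is smooth in
    (z, ep) through ep = 0, and composition with it transfers the expansions. *)
Lemma kick : exists e1 k1 k2 B, 0 < e1 /\ Sm (box (-1) 2 e1) k1 /\ Sm (box (-1) 2 e1) k2 /\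
  Sm (box (-1) 2 e1) B /\ forall z ep, -1 < z < 2 -> 0 < ep < e1 -> exists t d,
    / 2 < t < b' /\ a' < t + d + -1 < / 2 /\ 0 < d /\ S t = al - 2 * (1 - z) * ep /\
    d = ep * sqrt (NN g gs t d) /\ B z ep = t + d + -1 /\
    0 < WW g gs t d /\ 0 < WW gs g (t + d) (- d) /\ 0 < NN g gs t d /\ 0 < NN gs g (t + d) (- d) /\
    S (B z ep) * (sqrt (NN gs g (t + d) (- d)) / d) / 2 = z + ep ^ 2 * k1 z ep /\
    al / 2 * (sqrt (NN gs g (t + d) (- d)) / d - / ep) =
      De * (z - / 2) + 2 / al * ep * D1 * ((z - / 2) ^ 2 - / 12) + ep ^ 2 * k2 z ep.
Proof.
  assert (HS0 : S 0 = 0) by apply S_0.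
  assert (Hal : 0 < al) by (rewrite <- HS0; unfold al; apply (S_lt a b a' b' g g0); auto; lra).
  (* Within distance ro of t = 1 both g and its translate are controlled. *)
  set (ro := Rmin (/ 2) (Rmin (- a') (b' - 1))).
  assert (Q1 := Rmin_l (/ 2) (Rmin (- a') (b' - 1))); assert (Q2 := Rmin_r (/ 2) (Rmin (- a') (b' - 1))).
  assert (Q3 := Rmin_l (- a') (b' - 1)); assert (Q4 := Rmin_r (- a') (b' - 1)).
  fold ro in Q1, Q2.
  assert (Hro : 0 < ro) by (unfold ro; repeat apply Rmin_pos; lra).
  set (ak := 1 - ro); set (bk := 1 + ro).
  assert (Gl : smI ak bk g) by (apply (smI_sub a b); auto; unfold ak, bk; lra).
  assert (Gr : smI ak bk gs) by (apply (smI_sub (1 + a) (1 + b)); [unfold ak; lra|unfold bk; lra|apply smI_shift; auto]).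
  assert (Hpos : forall t, ak < t < bk -> g0 <= g t /\ g0 <= gs t).
  { unfold ak, bk, gs, shiftg; intros t Ht; split; apply Hgpos; lra. }
  destruct (N_lower ak bk g gs g0 Gl Hg0 Hpos) as (rl & cl & Hrl & Hcl & HNl).
  destruct (N_lower ak bk gs g g0 Gr Hg0) as (rr & cr & Hrr & Hcr & HNr).
  { intros t Ht; destruct (Hpos t Ht); auto. }
  set (c := Rmin cl cr).
  assert (C1 : c <= cl) by apply Rmin_l. assert (C2 : c <= cr) by apply Rmin_r.
  assert (Hc : 0 < c) by (apply Rmin_pos; auto).
  set (rd := Rmin (ro / 2) (Rmin rl rr)).
  assert (P1 := Rmin_l (ro / 2) (Rmin rl rr)); assert (P2 := Rmin_r (ro / 2) (Rmin rl rr)).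
  assert (P3 := Rmin_l rl rr); assert (P4 := Rmin_r rl rr).
  fold rd in P1, P2.
  assert (Hrd : 0 < rd) by (unfold rd; repeat apply Rmin_pos; lra).
  assert (HN : forall t d, segr ak bk rd t d -> c <= NN g gs t d /\ c <= WW g gs t d /\
     c <= NN gs g (t + d) (- d) /\ c <= WW gs g (t + d) (- d)).
  { intros t d Hs; destruct (segr_flip _ _ _ _ _ Hs) as [F1 F2], Hs as [F3 F4].
    destruct (HNl t d F3) as [G1 G2]; [lra|].
    destruct (HNr (t + d) (- d) F1) as [G3 G4]; [lra|].
    repeat split; lra. }
  set (tb := 1 - ro / 2); set (te := 1 + ro / 2).
  assert (Hbs : forall t d, box tb te rd t d -> segr ak bk rd t d).
  { unfold tb, te, ak, bk; intros t d [B1 B2]; split; [split|]; lra. }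
  assert (SN : Sm (segr ak bk rd) (NN g gs)) by (apply Sm_segr, Sm_N; auto).
  assert (Sq : Sm (segr ak bk rd) (fun t d => sqrt (NN g gs t d))).
  { apply Sm_sqrt with c; auto using open2_segr; intros; apply HN; auto. }
  assert (SqB : Sm (box tb te rd) (fun t d => sqrt (NN g gs t d)))
    by (apply Sm_sub with (segr ak bk rd); auto).
  assert (Hsc : 0 < sqrt c) by (apply sqrt_lt_R0; auto).
  assert (Hsq : forall t d, segr ak bk rd t d -> sqrt c <= sqrt (NN g gs t d))
    by (intros; apply sqrt_le_1_alt, HN; auto).
  destruct (sqrt_N_bounds (box tb te rd) (NN g gs) c) as (c' & Hc' & Hcs); auto using open2_box.
  { apply Sm_sub with (segr ak bk rd); auto. }
  { intros; apply HN; auto. }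
  destruct (partial_inverse tb te rd (fun t d => / sqrt (NN g gs t d)) c' Hrd Hc')
    as (r1 & r2 & dd & Hr1 & Hr2 & Sdd & Hdd & _); auto.
  { apply Sm_inv with (sqrt c); auto.
    intros t d H; rewrite Rabs_right by (apply Rle_ge, sqrt_pos); auto. }
  assert (HS : smI a b S) by (apply (smI_S' a b a' b' g g0); auto).
  destruct (derive_S_lower a b g g0) as (cS & HcS & HSl); auto; try lra.
  destruct (smI_inverse a b tb te S cS HS HcS HSl) as (psi & Spsi & Hpsi1 & Hpsi2);
    try (unfold tb, te; lra).
  destruct (Hpsi2 1) as [Hal1 Epsi1]; [unfold tb, te; lra|]; fold al in Hal1, Epsi1.
  (* Taylor's formula at [al], where the inverse of S takes the value 1, extracts the factor ep from
     t - 1. *)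
  destruct (taylor (S tb) (S te) psi 0 Spsi) as (rp & Srp & Erp).
  set (e2 := Rmin (r2 / 2) (Rmin ((al - S tb) / 8) ((S te - al) / 8))).
  assert (T1 := Rmin_l (r2 / 2) (Rmin ((al - S tb) / 8) ((S te - al) / 8))).
  assert (T2 := Rmin_r (r2 / 2) (Rmin ((al - S tb) / 8) ((S te - al) / 8))).
  assert (T3 := Rmin_l ((al - S tb) / 8) ((S te - al) / 8)).
  assert (T4 := Rmin_r ((al - S tb) / 8) ((S te - al) / 8)).
  fold e2 in T1, T2.
  assert (He2 : 0 < e2) by (unfold e2; repeat apply Rmin_pos; lra).
  set (Z := box (-1) 2 e2).
  assert (Zx : Sm Z (fun z _ => z)) by apply Sm_box_fst.
  assert (Ze : Sm Z (fun _ ep => ep)) by apply Sm_box_snd.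
  assert (HZ : open2 Z) by apply open2_box.
  assert (Hcc : forall z ep, Z z ep -> seg (S tb) (S te) al (- (2 * (1 - z) * ep))).
  { intros z ep [[Z1 Z2] [Z3 Z4]]; split; [lra|].
    assert (Rabs ((1 - z) * ep) <= 2 * e2).
    { rewrite Rabs_mult; apply Rmult_le_compat; auto using Rabs_pos; apply Rabs_le; lra. }
    apply Rabs_le_between in H; lra. }
  set (tt := fun z ep => psi (al + - (2 * (1 - z) * ep))).
  set (rz := fun z ep => rp al (- (2 * (1 - z) * ep))).
  assert (Srz : Sm Z rz).
  { apply (Sm_comp Z (seg (S tb) (S te)) rp (fun _ _ => al) (fun z ep => - (2 * (1 - z) * ep)));
      auto using open2_seg, Sm_const; sm. }
  assert (Ett : forall z ep, Z z ep -> tt z ep = 1 - 2 * (1 - z) * ep * rz z ep).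
  { intros z ep Hz; unfold tt, rz; rewrite Erp by auto; simpl.
    rewrite Epsi1; field. }
  assert (Httb : forall z ep, Z z ep -> tb < tt z ep < te /\ S (tt z ep) = al - 2 * (1 - z) * ep).
  { intros z ep Hz; destruct (Hcc z ep Hz) as [_ H]; destruct (Hpsi1 _ H) as [H1 H2].
    split; [exact H1|]; unfold tt; rewrite H2; ring. }
  assert (Stt : Sm Z tt).
  { apply Sm_ext with (fun z ep => 1 - 2 * (1 - z) * ep * rz z ep); auto.
    - intros; symmetry; auto.
    - sm. }
  set (dz := fun z ep => dd (tt z ep) ep).
  assert (Hbz : forall z ep, Z z ep -> box tb te r2 (tt z ep) ep).
  { intros z ep Hz; split; [apply Httb; auto|]; destruct Hz as [_ Hz]; lra. }
  assert (Sdz : Sm Z dz).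
  { apply (Sm_comp Z (box tb te r2) dd tt (fun _ ep => ep)); auto using open2_box. }
  assert (Hdz : forall z ep, Z z ep -> box tb te rd (tt z ep) (dz z ep) /\
      dz z ep = ep * sqrt (NN g gs (tt z ep) (dz z ep))).
  { intros z ep Hz; destruct (Hdd _ _ (Hbz z ep Hz)) as [H1 H2]; fold (dz z ep) in H1, H2.
    assert (Hb2 : box tb te rd (tt z ep) (dz z ep)) by (split; [apply Httb; auto|lra]).
    split; auto; rewrite <- H2 at 2.
    assert (0 < sqrt (NN g gs (tt z ep) (dz z ep)))
      by (eapply Rlt_le_trans; [exact Hsc | apply Hsq, Hbs, Hb2]).
    field; lra. }
  set (sq := fun z ep => sqrt (NN g gs (tt z ep) (dz z ep))).
  assert (Ssq : Sm Z sq).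
  { apply (Sm_comp Z (box tb te rd) (fun t d => sqrt (NN g gs t d)) tt dz); auto using open2_box.
    intros; apply Hdz; auto. }
  assert (Hsqz : forall z ep, Z z ep -> sqrt c <= sq z ep)
    by (intros z ep Hz; apply Hsq, Hbs, Hdz, Hz).
  assert (Sisq : Sm Z (fun z ep => / sq z ep)).
  { apply Sm_inv with (sqrt c); auto; intros z ep Hz.
    eapply Rle_trans; [exact (Hsqz z ep Hz) | apply Rle_abs]. }
  (* The fraction x = 1 + (t - 1) / d after cancelling ep. *)
  set (lam := fun z ep => 1 - 2 * (1 - z) * rz z ep * / sq z ep).
  assert (Slam : Sm Z lam) by (unfold lam; sm).
  destruct (Sm_bound _ _ Slam) as (L & HL & HLb).
  (* All values of x that occur lie in (- A, A), so [kick_jets] is applied on this range. *)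
  set (A := L + 1).
  set (r4 := Rmin rd (ro / 2 / (A + 1))).
  assert (Hr4 : 0 < r4).
  { apply Rmin_pos; auto; apply Rdiv_lt_0_compat; [lra|unfold A; lra]. }
  assert (R41 : r4 <= rd) by apply Rmin_l.
  assert (R42 : r4 * (A + 1) <= ro / 2).
  { apply Rle_trans with (ro / 2 / (A + 1) * (A + 1)).
    - apply Rmult_le_compat_r; [unfold A; lra | apply Rmin_r].
    - right; field; unfold A; lra. }
  assert (HLA : forall x y, box (- A) A r4 x y -> - (ro / 2) <= x * y <= ro / 2 /\
            - (ro / 2) <= (x - 1) * y <= ro / 2).
  { intros x y [[X1 X2] [X3 X4]].
    assert (B1 : Rabs (x * y) <= (A + 1) * r4).
    { rewrite Rabs_mult; apply Rmult_le_compat; auto using Rabs_pos; apply Rabs_le; lra. }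
    assert (B2 : Rabs ((x - 1) * y) <= (A + 1) * r4).
    { rewrite Rabs_mult; apply Rmult_le_compat; auto using Rabs_pos; apply Rabs_le; lra. }
    apply Rabs_le_between in B1; apply Rabs_le_between in B2; lra. }
  assert (HLs : forall x y, box (- A) A r4 x y -> segr ak bk rd (1 + (x - 1) * y) y).
  { intros x y Hxy; destruct (HLA x y Hxy) as [H1 H2], Hxy as [H3 H4].
    unfold ak, bk; split; [split|]; lra. }
  destruct (kick_jets a b g g0 Hg Hg0 Hgpos ltac:(lra) ltac:(lra) Hper (- A) A r4 Hr4) with (c := c)
    as (r' & j1 & j3 & Hr' & Sj1 & Sj3 & Hj); auto.
  { intros x y Hxy; destruct (HLA x y Hxy); lra. }
  { intros x y Hxy; destruct (NN_kick x y) as (<- & _); apply HN; auto. }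
  { intros x y Hxy; destruct (NN_kick x y) as (_ & _ & <- & _); apply HN; auto. }
  fold S al De D1 in Hj.
  destruct (Sm_bound _ _ Ssq) as (Kq & HKq & HKqb).
  set (e1 := Rmin e2 (r' / (Kq + 1))).
  assert (He1 : 0 < e1) by (apply Rmin_pos; auto; apply Rdiv_lt_0_compat; lra).
  assert (He12 : e1 <= e2) by apply Rmin_l.
  assert (He1K : e1 * (Kq + 1) <= r').
  { apply Rle_trans with (r' / (Kq + 1) * (Kq + 1)).
    - apply Rmult_le_compat_r; [lra | apply Rmin_r].
    - right; field; lra. }
  set (Y := box (-1) 2 e1).
  assert (HYZ : forall z ep, Y z ep -> Z z ep) by (unfold Y, Z, box; intros; lra).
  assert (HYl : forall z ep, Y z ep -> box (- A) A r' (lam z ep) (dz z ep)).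
  { intros z ep Hy; assert (Hz := HYZ z ep Hy).
    assert (B1 := HLb z ep Hz); apply Rabs_le_between in B1.
    destruct (Hdz z ep Hz) as [_ Ed]; fold (sq z ep) in Ed.
    assert (B2 := HKqb z ep Hz).
    split; [unfold A; lra|].
    assert (B3 : Rabs (dz z ep) <= e1 * Kq).
    { rewrite Ed, Rabs_mult; apply Rmult_le_compat; auto using Rabs_pos.
      destruct Hy; apply Rabs_le; lra. }
    apply Rabs_le_between in B3; lra. }
  assert (Sc : forall f, Sm (box (- A) A r') f -> Sm Y (fun z ep => f (lam z ep) (dz z ep))).
  { intros f Hf; apply (Sm_comp Y (box (- A) A r') f lam dz); auto using open2_box;
      apply Sm_sub with Z; auto. }
  assert (Sj1' := Sc _ Sj1); assert (Sj3' := Sc _ Sj3).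
  assert (SsqY : Sm Y sq) by (apply Sm_sub with Z; auto).
  assert (SttY : Sm Y tt) by (apply Sm_sub with Z; auto).
  assert (SdzY : Sm Y dz) by (apply Sm_sub with Z; auto).
  exists e1, (fun z ep => sq z ep ^ 2 * j1 (lam z ep) (dz z ep)),
     (fun z ep => sq z ep * j3 (lam z ep) (dz z ep)), (fun z ep => tt z ep + dz z ep + -1).
  split; [auto|split; [sm|split; [sm|split; [sm|]]]].
  intros z ep Hz Hep.
  assert (HY : Y z ep) by (split; lra).
  assert (HZz := HYZ z ep HY).
  destruct (Httb z ep HZz) as [B1 B2]; destruct (Hdz z ep HZz) as [B3 B4].
  destruct (HN _ _ (Hbs _ _ B3)) as (N1 & N2 & N3 & N4).
  assert (Hs0 : 0 < sq z ep) by (specialize (Hsqz z ep HZz); lra).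
  fold (sq z ep) in B4.
  assert (Hd0 : 0 < dz z ep) by (rewrite B4; apply Rmult_lt_0_compat; lra).
  exists (tt z ep), (dz z ep).
  set (x := lam z ep) in *; set (y := dz z ep) in *.
  assert (Et : tt z ep = 1 + (x - 1) * y).
  { rewrite Ett by auto; unfold x, lam; fold y; rewrite B4; field; lra. }
  assert (EN := NN_kick x y); rewrite <- Et in EN; destruct EN as (E1 & E2 & E3 & E4).
  assert (Esq : sqrt (Nm g x y) = sq z ep) by (rewrite <- E1; reflexivity).
  destruct (Hj x y (HYl z ep HY)) as [J1 J2]; [lra|].
  rewrite <- Et in J1, J2; rewrite Esq in J1, J2.
  assert (Ey : sq z ep / y = / ep) by (rewrite B4; field; lra).
  rewrite Ey, B2 in J1, J2.
  replace (1 - / ep * (al - (al - 2 * (1 - z) * ep)) / 2) with z in J1, J2 by (field; lra).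
  replace (0 + x * y) with (tt z ep + y + -1) in J1 by (rewrite Et; ring).
  rewrite <- E3 in J1, J2.
  unfold tb, te in B1; destruct B3 as [_ B3].
  repeat split; try lra; auto.
  - cbv beta; fold x y; rewrite (Rmult_comm (S _)), J1.
    replace (y ^ 2) with ((ep * sq z ep) ^ 2) by (rewrite <- B4; ring); ring.
  - rewrite <- Ey.
    set (s' := sqrt (NN gs g (tt z ep + y) (- y))) in *.
    set (Q := (z - / 2) ^ 2 - / 12) in *.
    apply Rmult_eq_reg_r with (y * sq z ep); [|nra].
    replace (al / 2 * (s' / y - sq z ep / y) * (y * sq z ep)) with
      ((al / 2 * (s' - sq z ep) - y * De * (z - / 2)) * sq z ep + y * De * (z - / 2) * sq z ep) by (field; lra).
    replace ((al / 2 * (s' - sq z ep) - y * De * (z - / 2)) * sq z ep)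
      with (2 / al * D1 * y ^ 2 * Q + y ^ 3 * j3 x y) by lra.
    rewrite B4; ring.
Qed.
End Kick.

(** * Orbits of the perturbed translation *)

(** Boxes of fixed size, on which bounds by powers of 1 / y0 are uniform in the centre. The size 1/4
    keeps z within (-1, 2) when its value at the centre lies in [- 1/8, 1]. *)
Definition nb (x0 y0 : R) : R -> R -> Prop :=
  fun x y => x0 - / 4 < x < x0 + / 4 /\ y0 - / 4 < y < y0 + / 4.

Lemma open2_nb x0 y0 : open2 (nb x0 y0).
Proof.
  apply (open2_and (fun x _ => x0 - / 4 < x < x0 + / 4) (fun _ y => y0 - / 4 < y < y0 + / 4));
    [apply open2_itv|].
  intros x y H; destruct (open2_itv (y0 - / 4) (y0 + / 4) y x H) as [d D]; exists d; intros u v A B.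
  apply (D v u); auto.
Qed.

Lemma nb_center x0 y0 : nb x0 y0 x0 y0.
Proof. unfold nb; lra. Qed.

(* Uniform C^s bounds, of size w i, for a family of functions f i near the points c i. *)
Section Families.
Variables (I : Type) (s : nat) (G : I -> Prop) (c1 c2 : I -> R).

Definition Fam (w : I -> R) (f : I -> R -> R -> R) : Prop :=
  exists C, 0 <= C /\ forall i, G i -> Cb s (nb (c1 i) (c2 i)) (C * w i) (f i).

Lemma Fam_le w w' f : (exists K, 0 <= K /\ forall i, G i -> w i <= K * w' i) -> Fam w f -> Fam w' f.
Proof.
  intros (K & HK & Hw) (C & HC & H); exists (C * K); split; [apply Rmult_le_pos; auto|].
  intros i Hi; eapply Cb_le; [|apply H; auto].
  rewrite Rmult_assoc; apply Rmult_le_compat_l; auto.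
Qed.

Lemma Fam_ext w f g : (forall i, G i -> forall x y, nb (c1 i) (c2 i) x y -> f i x y = g i x y) ->
  Fam w f -> Fam w g.
Proof.
  intros He (C & HC & H); exists C; split; auto; intros i Hi.
  apply Cb_ext with (f i); auto using open2_nb.
Qed.

Lemma Fam_plus w f g : Fam w f -> Fam w g -> Fam w (fun i x y => f i x y + g i x y).
Proof.
  intros (C & HC & H) (D & HD & K); exists (C + D); split; [lra|]; intros i Hi.
  rewrite Rmult_plus_distr_r; apply Cb_plus; auto.
Qed.

Lemma Fam_opp w f : Fam w f -> Fam w (fun i x y => - f i x y).
Proof. intros (C & HC & H); exists C; split; auto; intros i Hi; apply Cb_opp; auto. Qed.

Lemma Fam_minus w f g : Fam w f -> Fam w g -> Fam w (fun i x y => f i x y - g i x y).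
Proof. intros; unfold Rminus; apply Fam_plus; auto using Fam_opp. Qed.

Lemma Fam_mult w w' f g : Fam w f -> Fam w' g -> Fam (fun i => w i * w' i) (fun i x y => f i x y * g i x y).
Proof.
  intros (C & HC & H) (D & HD & K); exists (2 ^ s * (C * D)); split.
  - apply Rmult_le_pos; [apply pow_le; lra | apply Rmult_le_pos; auto].
  - intros i Hi; replace (2 ^ s * (C * D) * (w i * w' i)) with (2 ^ s * ((C * w i) * (D * w' i))) by ring.
    apply Cb_mult; auto.
Qed.

Lemma Fam_scal w c f : Fam w f -> Fam w (fun i x y => c * f i x y).
Proof.
  intros (C & HC & H); exists (Rabs c * C); split; [apply Rmult_le_pos; auto using Rabs_pos|].
  intros i Hi; rewrite Rmult_assoc; apply Cb_scal; auto.
Qed.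

Lemma Fam_cst w (c : I -> R) : (exists K, 0 <= K /\ forall i, G i -> Rabs (c i) <= K * w i) ->
  Fam w (fun i _ _ => c i).
Proof. intros (K & HK & H); exists K; split; auto; intros; apply Cb_const; auto. Qed.

Lemma Fam_const c : Fam (fun _ => 1) (fun _ _ _ => c).
Proof. apply Fam_cst; exists (Rabs c); split; [apply Rabs_pos|]; intros; lra. Qed.

Lemma Fam_comp V f a b : open2 V -> Sm V f -> Fam (fun _ => 1) a -> Fam (fun _ => 1) b ->
  (forall i, G i -> forall x y, nb (c1 i) (c2 i) x y -> V (a i x y) (b i x y)) ->
  Fam (fun _ => 1) (fun i x y => f (a i x y) (b i x y)).
Proof.
  intros HV Hf (C & HC & H) (D & HD & K) HVi; destruct (Hf s) as (L & HL & HLf).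
  destruct (Cb_comp s L (C + D)) as (M & HM & HMf).
  exists M; split; auto; intros i Hi; rewrite Rmult_1_r.
  apply HMf with V; auto.
  - eapply Cb_le; [|apply H; auto]; lra.
  - eapply Cb_le; [|apply K; auto]; lra.
Qed.

Lemma Fam_comp1 r h a : smI (- r) r h -> Fam (fun _ => 1) a ->
  (forall i, G i -> forall x y, nb (c1 i) (c2 i) x y -> - r < a i x y < r) ->
  Fam (fun _ => 1) (fun i x y => h (a i x y)).
Proof.
  intros Hh Ha Hi; apply (Fam_comp (itv (- r) r) (fun x _ => h x) a a); auto using open2_itv.
Qed.

(** [Cb_inv] is not homogeneous in f, so it is applied to f / w, which is of order 1, and the weight
    is restored afterwards. *)
Lemma Fam_inv w f c : 0 < c -> (forall i, G i -> 0 < w i) ->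
  (forall i, G i -> forall x y, nb (c1 i) (c2 i) x y -> c * w i <= Rabs (f i x y)) ->
  Fam w f -> Fam (fun i => / w i) (fun i x y => / f i x y).
Proof.
  intros Hc Hw Hl (C & HC & H).
  destruct (Cb_inv s C c Hc) as (D & HD & HDf); exists D; split; auto; intros i Hi.
  specialize (Hw i Hi).
  assert (A : Cb s (nb (c1 i) (c2 i)) C (fun x y => / w i * f i x y)).
  { replace C with (Rabs (/ w i) * (C * w i)); [apply Cb_scal; auto|].
    rewrite Rabs_right; [field; lra|]; apply Rle_ge, Rlt_le, Rinv_0_lt_compat; auto. }
  apply HDf in A.
  - apply (Cb_scal _ _ _ (/ w i)) in A.
    rewrite (Rabs_right (/ w i)) in A by (apply Rle_ge, Rlt_le, Rinv_0_lt_compat; auto).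
    rewrite Rmult_comm; revert A; apply Cb_ext; [apply open2_nb|].
    intros x y Hxy; specialize (Hl i Hi x y Hxy).
    assert (f i x y <> 0).
    { intros E; rewrite E, Rabs_R0 in Hl; assert (0 < c * w i) by (apply Rmult_lt_0_compat; auto); lra. }
    field; lra.
  - intros x y Hxy; rewrite Rabs_mult, Rabs_right by (apply Rle_ge, Rlt_le, Rinv_0_lt_compat; auto).
    apply Rmult_le_reg_l with (w i); auto.
    rewrite <- Rmult_assoc, Rinv_r, Rmult_1_l by lra; specialize (Hl i Hi x y Hxy); lra.
Qed.

Lemma Fam_fst : (exists K, forall i, G i -> Rabs (c1 i) <= K) -> Fam (fun _ => 1) (fun _ x _ => x).
Proof.
  intros (K & HK); exists (Rabs K + 1); split; [generalize (Rabs_pos K); lra|].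
  intros i Hi; apply Cb_fst; [generalize (Rabs_pos K); lra|].
  intros x y [Hx _]; specialize (HK i Hi); apply Rabs_le_between in HK.
  apply Rabs_le; generalize (Rle_abs K); lra.
Qed.

Lemma Fam_snd : (forall i, G i -> 1 <= c2 i) -> Fam c2 (fun _ _ y => y).
Proof.
  intros H; exists 2; split; [lra|]; intros i Hi; specialize (H i Hi); apply Cb_snd; [lra|].
  intros x y [_ Hy]; apply Rabs_le; lra.
Qed.

End Families.

(* One regular flight in the variables X = S J / 2 and J. *)
Definition fstep (Pc Qc : R -> R -> R) (p : R * R) : R * R :=
  (fst p + 1 + (/ snd p) ^ 3 * Pc (2 * fst p / snd p) (/ snd p),
   snd p + (/ snd p) ^ 3 * Qc (2 * fst p / snd p) (/ snd p)).

Section Iteration.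
Variables (s : nat) (al A B r2 : R) (Pc Qc X0 J0 : R -> R -> R).
Hypothesis Hal : 0 < al.
Hypothesis HA : A < 0.
Hypothesis HB : al < B.
Hypothesis Hr2 : 0 < r2.
Hypothesis SP : Sm (box A B r2) Pc.
Hypothesis SQ : Sm (box A B r2) Qc.
Variables (C0 M0 : R).
Hypothesis HC0 : 0 <= C0.
Hypothesis Hinit : forall x0 y0, -1 <= x0 <= 2 -> M0 < y0 ->
  Cb s (nb x0 y0) (C0 * (/ y0) ^ 2) (fun x y => X0 x y - x) /\
  Cb s (nb x0 y0) (C0 * (/ y0) ^ 2) (fun x y => J0 x y - 2 / al * y).

Definition orbit (n : nat) (x y : R) : R * R := Nat.iter n (fstep Pc Qc) (X0 x y, J0 x y).
Definition oX (n : nat) (x y : R) : R := fst (orbit n x y).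
Definition oJ (n : nat) (x y : R) : R := snd (orbit n x y).

(* Position pt_n of an orbit that deviates from the linear one by (pt_p, pt_q),
   both of size at most 1 by pgood, near the initial point (pt_x, pt_y). *)
Record pert := { pt_x : R; pt_y : R; pt_n : nat; pt_p : R -> R -> R; pt_q : R -> R -> R }.
Definition pX (i : pert) (x y : R) : R := X0 x y + INR (pt_n i) + pt_p i x y.
Definition pJ (i : pert) (x y : R) : R := J0 x y + pt_q i x y.
Definition pgood (M : R) (i : pert) : Prop :=
  -1 <= pt_x i <= 2 /\ M < pt_y i /\ INR (pt_n i) <= pt_y i + 2 /\
  Cb s (nb (pt_x i) (pt_y i)) 1 (pt_p i) /\ Cb s (nb (pt_x i) (pt_y i)) 1 (pt_q i).

(** J is close to 2 y0 / al, and X is at most y0 plus a constant because n is at most y0 + 2. Hence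
    S = 2 X / J exceeds al at most slightly and stays inside (A, B), while 1/J is small. *)
Lemma pert_bounds : exists M, 1 <= M /\ M0 <= M /\ C0 <= M /\ forall i, pgood M i -> forall x y, nb (pt_x i) (pt_y i) x y ->
   / al * pt_y i <= pJ i x y /\ box A B r2 (2 * pX i x y / pJ i x y) (/ pJ i x y).
Proof.
  (* The summand al / r2 makes 1/J < r2; the next two keep 2 X / J below B and above A. *)
  set (M := 1 + Rabs M0 + C0 + 2 * al + al / r2 + (7 * al + B * (1 + al)) / (B - al) + 10 * al / - A).
  assert (L1 : 0 < al / r2) by (apply Rdiv_lt_0_compat; auto).
  assert (L2 : 0 < 10 * al / - A) by (apply Rdiv_lt_0_compat; lra).
  assert (L0 : 0 < B * (1 + al)) by (apply Rmult_lt_0_compat; lra).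
  assert (L3 : 0 < (7 * al + B * (1 + al)) / (B - al)) by
    (apply Rdiv_lt_0_compat; lra).
  assert (L4 := Rle_abs M0); assert (L5 := Rabs_pos M0).
  exists M; split; [unfold M; lra|split; [unfold M; lra|split; [unfold M; lra|]]].
  intros i (G1 & G2 & G3 & G4 & G5) x y Hxy.
  set (y0 := pt_y i) in *.
  assert (Hy0 : 1 < y0) by (unfold M in G2; lra).
  destruct (Hinit (pt_x i) y0) as [I1 I2]; auto; [unfold M in G2; lra|].
  assert (V1 := Cb_value _ _ _ _ _ _ I1 Hxy); assert (V2 := Cb_value _ _ _ _ _ _ I2 Hxy).
  assert (V3 := Cb_value _ _ _ _ _ _ G4 Hxy); assert (V4 := Cb_value _ _ _ _ _ _ G5 Hxy).
  cbv beta in V1, V2.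
  assert (He : C0 * (/ y0) ^ 2 <= 1).
  { assert (/ y0 <= 1) by (rewrite <- Rinv_1; apply Rinv_le_contravar; lra).
    assert (0 < / y0) by (apply Rinv_0_lt_compat; lra).
    assert (C0 * / y0 <= 1).
    { apply Rmult_le_reg_r with y0; [lra|]; rewrite Rmult_assoc, Rinv_l by lra; unfold M in G2; lra. }
    assert (0 <= C0 * / y0) by (apply Rmult_le_pos; lra).
    simpl; nra. }
  apply Rabs_le_between in V1; apply Rabs_le_between in V2.
  apply Rabs_le_between in V3; apply Rabs_le_between in V4.
  destruct Hxy as [Hx Hy]; fold y0 in Hy.
  assert (N0 := pos_INR (pt_n i)).
  assert (BX : -5 <= pX i x y <= y0 + 7) by (unfold pX; lra).
  assert (BJ : 2 / al * (y0 - / 4) - 2 <= pJ i x y).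
  { assert (2 / al * (y0 - / 4) <= 2 / al * y)
      by (apply Rmult_le_compat_l; [apply Rlt_le, Rdiv_lt_0_compat|]; lra).
    unfold pJ; lra. }
  set (X := pX i x y) in *; set (J := pJ i x y) in *.
  assert (BJ' : 2 * (y0 - / 4) - 2 * al <= al * J).
  { replace (2 * (y0 - / 4) - 2 * al) with (al * (2 / al * (y0 - / 4) - 2)) by (field; lra).
    apply Rmult_le_compat_l; lra. }
  assert (BJ2 : y0 <= al * J) by (unfold M in G2; lra).
  assert (HJ : / al * y0 <= J).
  { apply Rmult_le_reg_l with al; auto; rewrite <- Rmult_assoc, Rinv_r by lra; lra. }
  assert (HJ0 : 0 < J).
  { eapply Rlt_le_trans; [|exact HJ]; apply Rmult_lt_0_compat; [apply Rinv_0_lt_compat|]; lra. }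
  split; auto.
  assert (D1 : al / r2 * r2 = al) by (field; lra).
  assert (D2 : 10 * al / - A * - A = 10 * al) by (field; lra).
  assert (D3 : (7 * al + B * (1 + al)) / (B - al) * (B - al) = 7 * al + B * (1 + al)) by (field; lra).
  assert (E1 : al < y0 * r2).
  { rewrite <- D1 at 1; apply Rmult_lt_compat_r; auto; unfold M in G2; lra. }
  assert (E2 : 10 * al < y0 * - A).
  { assert (10 * al / - A * - A < y0 * - A) by (apply Rmult_lt_compat_r; [lra|]; unfold M in G2; lra). lra. }
  assert (E3 : 7 * al + B * (1 + al) < y0 * (B - al)).
  { rewrite <- D3; apply Rmult_lt_compat_r; [lra|]; unfold M in G2; lra. }
  assert (HiJ : 0 < / J) by (apply Rinv_0_lt_compat; auto).
  split; [split|split; [lra|]].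
  - apply Rmult_lt_reg_r with J; auto; replace (2 * X / J * J) with (2 * X) by (field; lra).
    apply Rmult_lt_reg_r with al; auto.
    replace (A * J * al) with (- (- A * (al * J))) by ring.
    assert (- A * y0 <= - A * (al * J)) by (apply Rmult_le_compat_l; lra); nra.
  - apply Rmult_lt_reg_r with J; auto; replace (2 * X / J * J) with (2 * X) by (field; lra).
    apply Rmult_lt_reg_r with al; auto.
    replace (B * J * al) with (B * (al * J)) by ring.
    assert (B * (2 * (y0 - / 4) - 2 * al) <= B * (al * J)) by (apply Rmult_le_compat_l; lra); nra.
  - apply Rmult_lt_reg_r with J; auto; rewrite Rinv_l by lra.
    apply Rmult_lt_reg_r with al; auto.
    assert (r2 * y0 <= r2 * (al * J)) by (apply Rmult_le_compat_l; lra); lra.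
Qed.

(** M and C do not depend on the number of flights already made: only the C^s size of the deviation,
    at most 1, enters. The factor (1/J)^3 of the step supplies the power of 1 / y0, everything else
    being bounded. *)
Lemma step_bound : exists M C, 1 <= M /\ M0 <= M /\ C0 <= M /\ 0 <= C /\ forall i, pgood M i ->
  Cb s (nb (pt_x i) (pt_y i)) (C * (/ pt_y i) ^ 3)
    (fun x y => (/ pJ i x y) ^ 3 * Pc (2 * pX i x y / pJ i x y) (/ pJ i x y)) /\
  Cb s (nb (pt_x i) (pt_y i)) (C * (/ pt_y i) ^ 3)
    (fun x y => (/ pJ i x y) ^ 3 * Qc (2 * pX i x y / pJ i x y) (/ pJ i x y)).
Proof.
  destruct pert_bounds as (M & M1 & MM0 & MC0 & HB2).
  set (F := Fam pert s (pgood M) pt_x pt_y).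
  assert (Hy1 : forall i, pgood M i -> 1 < pt_y i) by (intros i (_ & G2 & _); lra).
  assert (Hy2 : forall i, pgood M i -> 0 < / pt_y i <= 1).
  { intros i Hi; specialize (Hy1 i Hi); split; [apply Rinv_0_lt_compat; lra|].
    rewrite <- Rinv_1; apply Rinv_le_contravar; lra. }
  assert (Fp : F (fun _ => 1) pt_p).
  { exists 1; split; [lra|]; intros i (_ & _ & _ & G4 & _); rewrite Rmult_1_r; auto. }
  assert (Fq : F (fun _ => 1) pt_q).
  { exists 1; split; [lra|]; intros i (_ & _ & _ & _ & G5); rewrite Rmult_1_r; auto. }
  assert (FX0 : F (fun i => (/ pt_y i) ^ 2) (fun _ x y => X0 x y - x)).
  { exists C0; split; auto; intros i (G1 & G2 & _); apply Hinit; auto; lra. }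
  assert (FJ0 : F (fun i => (/ pt_y i) ^ 2) (fun _ x y => J0 x y - 2 / al * y)).
  { exists C0; split; auto; intros i (G1 & G2 & _); apply Hinit; auto; lra. }
  assert (Up1 : forall f, F (fun _ => 1) f -> F pt_y f).
  { intros f; apply Fam_le; exists 1; split; [lra|]; intros i Hi; specialize (Hy1 i Hi); lra. }
  assert (Up2 : forall f, F (fun i => (/ pt_y i) ^ 2) f -> F (fun _ => 1) f).
  { intros f; apply Fam_le; exists 1; split; [lra|]; intros i Hi; destruct (Hy2 i Hi); simpl; nra. }
  assert (Fx : F (fun _ => 1) (fun _ x _ => x)).
  { apply Fam_fst; exists 2; intros i (G1 & _); apply Rabs_le; lra. }
  assert (Fy : F pt_y (fun _ _ y => y)).
  { apply Fam_snd; intros i Hi; specialize (Hy1 i Hi); lra. }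
  assert (FX : F pt_y pX).
  { unfold F; apply Fam_ext with (fun i x y => ((X0 x y - x) + x) + INR (pt_n i) + pt_p i x y).
    - intros; unfold pX; ring.
    - apply Fam_plus; [apply Fam_plus; [apply Fam_plus|]|]; try (apply Up1; auto; fail).
      apply Fam_cst; exists 3; split; [lra|]; intros i Hi; assert (H1 := Hy1 i Hi).
      destruct Hi as (_ & _ & G3 & _); rewrite Rabs_right by (apply Rle_ge, pos_INR); lra. }
  assert (FJ : F pt_y pJ).
  { unfold F; apply Fam_ext with (fun i x y => ((J0 x y - 2 / al * y) + 2 / al * y) + pt_q i x y).
    - intros; unfold pJ; ring.
    - apply Fam_plus; [apply Fam_plus|]; try (apply Up1; auto; fail).
      apply Fam_scal; auto. }
  assert (FiJ : F (fun i => / pt_y i) (fun i x y => / pJ i x y)).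
  { apply Fam_inv with (/ al); auto; [apply Rinv_0_lt_compat; auto|intros i Hi; specialize (Hy1 i Hi); lra|].
    intros i Hi x y Hxy; eapply Rle_trans; [exact (proj1 (HB2 i Hi x y Hxy)) | apply Rle_abs]. }
  assert (FiJ1 : F (fun _ => 1) (fun i x y => / pJ i x y)).
  { revert FiJ; apply Fam_le; exists 1; split; [lra|]; intros i Hi; destruct (Hy2 i Hi); lra. }
  assert (Fth : F (fun _ => 1) (fun i x y => 2 * pX i x y / pJ i x y)).
  { unfold F; apply Fam_ext with (fun i x y => 2 * (pX i x y * / pJ i x y)).
    - intros; unfold Rdiv; ring.
    - apply Fam_scal.
      apply (Fam_le pert s (pgood M) pt_x pt_y (fun i => pt_y i * / pt_y i)); [|apply Fam_mult; auto].
      exists 1; split; [lra|]; intros i Hi; specialize (Hy1 i Hi); rewrite Rinv_r; lra. }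
  assert (Fst : forall f, Sm (box A B r2) f -> F (fun i => (/ pt_y i) ^ 3)
     (fun i x y => (/ pJ i x y) ^ 3 * f (2 * pX i x y / pJ i x y) (/ pJ i x y))).
  { intros f Hf.
    assert (Ff : F (fun _ => 1) (fun i x y => f (2 * pX i x y / pJ i x y) (/ pJ i x y))).
    { apply (Fam_comp pert s (pgood M) pt_x pt_y (box A B r2)); auto using open2_box.
      intros i Hi x y Hxy; apply HB2; auto. }
    assert (F3 := Fam_mult _ _ _ _ _ _ _ _ _ FiJ (Fam_mult _ _ _ _ _ _ _ _ _ FiJ
       (Fam_mult _ _ _ _ _ _ _ _ _ FiJ Ff))).
    apply (Fam_le _ _ _ _ _ _ (fun i => (/ pt_y i) ^ 3)) in F3.
    - revert F3; apply Fam_ext; intros; ring.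
    - exists 1; split; [lra|]; intros; right; ring. }
  destruct (Fst Pc SP) as (CP & HCP & HP), (Fst Qc SQ) as (CQ & HCQ & HQ).
  exists M, (CP + CQ); repeat split; auto; try lra.
  - eapply Cb_le; [|apply HP; auto]; apply Rmult_le_compat_r; [|lra].
    apply pow_le; destruct (Hy2 i H); lra.
  - eapply Cb_le; [|apply HQ; auto]; apply Rmult_le_compat_r; [|lra].
    apply pow_le; destruct (Hy2 i H); lra.
Qed.

(** If the accumulated deviation is at most 1, the next step adds at most C y0^-3. At most y0 + 2,
    hence at most 3 y0, steps are made, so the total is at most 3 C y0^-2, which for large y0 is
    below 1 again. *)
Lemma orbit_bound : exists M C, 1 <= M /\ 0 <= C /\ forall x0 y0 n, -1 <= x0 <= 2 -> M < y0 -> INR n <= y0 + 2 ->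
  Cb s (nb x0 y0) (C * (/ y0) ^ 2) (fun x y => oX n x y - (x + INR n)) /\
  Cb s (nb x0 y0) (C * (/ y0) ^ 2) (fun x y => oJ n x y - 2 / al * y).
Proof.
  destruct step_bound as (M & C & M1 & MM0 & MC0 & HC & HS).
  exists (M + 3 * C), (C0 + 3 * C); split; [lra|split; [lra|]].
  intros x0 y0 n Hx0 Hy0 Hn.
  assert (Hy : 1 < y0) by lra.
  assert (Hiy : 0 < / y0) by (apply Rinv_0_lt_compat; lra).
  assert (Hiy1 : y0 * / y0 = 1) by (apply Rinv_r; lra).
  assert (Hiy2 : / y0 <= 1) by (rewrite <- Rinv_1; apply Rinv_le_contravar; lra).
  assert (Hbig : forall k, INR k <= y0 + 2 -> INR k * (C * (/ y0) ^ 3) <= 3 * C * (/ y0) ^ 2).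
  { intros k Hk.
    replace (3 * C * (/ y0) ^ 2) with (3 * y0 * (C * (/ y0) ^ 3) + (1 - y0 * / y0) * (3 * C * (/ y0) ^ 2)) by ring.
    rewrite Hiy1, Rminus_diag, Rmult_0_l, Rplus_0_r.
    apply Rmult_le_compat_r; [apply Rmult_le_pos; [auto|apply pow_le; lra]|]; lra. }
  assert (Hsm : 3 * C * (/ y0) ^ 2 <= 1).
  { assert (3 * C * / y0 <= 1).
    { apply Rmult_le_reg_r with y0; [lra|]; rewrite Rmult_assoc, Rinv_l by lra; lra. }
    assert (0 <= 3 * C * / y0) by (apply Rmult_le_pos; lra).
    simpl; nra. }
  assert (Hind : forall k, INR k <= y0 + 2 ->
     Cb s (nb x0 y0) (INR k * (C * (/ y0) ^ 3)) (fun x y => oX k x y - X0 x y - INR k) /\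
     Cb s (nb x0 y0) (INR k * (C * (/ y0) ^ 3)) (fun x y => oJ k x y - J0 x y)).
  { induction k as [|k IH]; intros Hk.
    - simpl INR; rewrite Rmult_0_l; split; eapply Cb_ext;
        try apply (Cb_const s (nb x0 y0) 0 0); try (rewrite Rabs_R0; lra); auto using open2_nb;
        intros x y _; unfold oX, oJ, orbit; simpl; ring.
    - assert (Hk' : INR k <= y0 + 2) by (rewrite S_INR in Hk; lra).
      destruct (IH Hk') as [P1 P2].
      (* The deviation after k steps is itself an admissible perturbation, so [step_bound] controls
         the following step. *)
      set (i := {| pt_x := x0; pt_y := y0; pt_n := k; pt_p := fun x y => oX k x y - X0 x y - INR k;
                   pt_q := fun x y => oJ k x y - J0 x y |}).
      assert (Hi : pgood M i).
      { split; [exact Hx0|split; [simpl; lra|split; [exact Hk'|split]]];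
          (eapply Cb_le; [|eassumption]); simpl; specialize (Hbig k Hk'); simpl in *; lra. }
      assert (EX : forall x y, pX i x y = oX k x y) by (intros; unfold pX; simpl; ring).
      assert (EJ : forall x y, pJ i x y = oJ k x y) by (intros; unfold pJ; simpl; ring).
      destruct (HS i Hi) as [Q1 Q2]; simpl pt_x in *; simpl pt_y in *.
      rewrite S_INR; replace ((INR k + 1) * (C * (/ y0) ^ 3))
        with (INR k * (C * (/ y0) ^ 3) + C * (/ y0) ^ 3) by ring.
      split.
      + eapply Cb_ext; [apply open2_nb| |apply (Cb_plus _ _ _ _ _ _ P1 Q1)].
        intros x y _; cbv beta; rewrite EX, EJ; unfold oX, oJ, orbit; simpl; ring.
      + eapply Cb_ext; [apply open2_nb| |apply (Cb_plus _ _ _ _ _ _ P2 Q2)].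
        intros x y _; cbv beta; rewrite EX, EJ; unfold oX, oJ, orbit; simpl; ring. }
  destruct (Hind n Hn) as [P1 P2], (Hinit x0 y0 Hx0) as [I1 I2]; [lra|].
  specialize (Hbig n Hn).
  rewrite Rmult_plus_distr_r.
  split.
  - eapply Cb_ext; [apply open2_nb| |apply (Cb_plus _ _ _ _ _ _ I1 (Cb_le _ _ _ _ _ Hbig P1))].
    intros; cbv beta; ring.
  - eapply Cb_ext; [apply open2_nb| |apply (Cb_plus _ _ _ _ _ _ I2 (Cb_le _ _ _ _ _ Hbig P2))].
    intros; cbv beta; ring.
Qed.
End Iteration.

(** * The start of the orbit as a function of (tau, I) *)

Section Initial.
Variables (s : nat) (al re ri rw : R) (kap H H2 E : R -> R).
Hypothesis Hal : 0 < al.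
Hypothesis Hri : 0 < ri <= re.
Hypothesis Hrw : 0 < rw.
Hypothesis Skap : smI (- re) re kap.
Hypothesis SH : smI (- ri) ri H.
Hypothesis SH2 : smI (- ri) ri H2.
Hypothesis SE : smI (- rw) rw E.
Hypothesis HH : forall ep, - ri < ep < ri -> H ep = ep ^ 2 * H2 ep /\ 0 < al / 2 + ep * H ep.
Hypothesis HE : forall w, - rw < w < rw -> - ri < E w < ri /\ E w / (al / 2 + E w * H (E w)) = w.

(* X and J as functions of (tau, I) = (x, y): E inverts ep |-> 1 / I. *)
Definition X_init (x y : R) : R := x * (1 + E (/ y) ^ 3 * kap (E (/ y)) / 2).
Definition J_init (x y : R) : R := / E (/ y).

Lemma E_pos y : / rw < y -> 0 < E (/ y) < ri /\ y = al / (2 * E (/ y)) + H (E (/ y)).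
Proof.
  intros Hy; assert (0 < / rw) by (apply Rinv_0_lt_compat; auto).
  assert (Hw : 0 < / y) by (apply Rinv_0_lt_compat; lra).
  assert (Hw2 : / y < rw) by (rewrite <- (Rinv_inv rw); apply Rinv_lt_contravar; auto; apply Rmult_lt_0_compat; lra).
  destruct (HE (/ y)) as [E1 E2]; [lra|].
  destruct (HH _ E1) as [_ H4]; set (e := E (/ y)) in *.
  assert (E3 : e = / y * (al / 2 + e * H e)) by (rewrite <- E2; field; lra).
  assert (He : 0 < e) by (rewrite E3; apply Rmult_lt_0_compat; auto).
  split; [lra|].
  assert (E4 : e * y = al / 2 + e * H e).
  { rewrite E3 at 1; field; lra. }
  apply Rmult_eq_reg_l with e; [|lra]; rewrite E4; field; lra.
Qed.

(** Since y = al J / 2 + H(1/J) and H(e) = e^2 H2(e), the error of J = 2 y / al is O(y^-2); the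
    error of X carries the factor e^3. *)
Lemma initial_bound : exists C0 M0, 0 <= C0 /\ / rw < M0 /\ forall x0 y0, -1 <= x0 <= 2 -> M0 < y0 ->
  Cb s (nb x0 y0) (C0 * (/ y0) ^ 2) (fun x y => X_init x y - x) /\
  Cb s (nb x0 y0) (C0 * (/ y0) ^ 2) (fun x y => J_init x y - 2 / al * y).
Proof.
  set (M0 := / rw + 2).
  assert (Hirw : 0 < / rw) by (apply Rinv_0_lt_compat; auto).
  set (G := fun i : R * R => -1 <= fst i <= 2 /\ M0 < snd i).
  set (F := Fam (R * R) s G fst snd).
  assert (Hy1 : forall i, G i -> 2 + / rw < snd i) by (intros i [_ G2]; unfold M0 in G2; lra).
  assert (Hy2 : forall i, G i -> 0 < / snd i <= 1).
  { intros i Hi; specialize (Hy1 i Hi); split; [apply Rinv_0_lt_compat; lra|].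
    rewrite <- Rinv_1; apply Rinv_le_contravar; lra. }
  assert (Hyn : forall i, G i -> forall x y, nb (fst i) (snd i) x y -> / rw < y /\ 1 < y /\ snd i / 2 <= y).
  { intros i Hi x y [_ Hy]; specialize (Hy1 i Hi); lra. }
  assert (Fy : F snd (fun _ _ y => y)).
  { apply Fam_snd; intros i Hi; specialize (Hy1 i Hi); lra. }
  assert (Fx : F (fun _ => 1) (fun _ x _ => x)).
  { apply Fam_fst; exists 2; intros i (G1 & _); apply Rabs_le; lra. }
  assert (Fiy : F (fun i => / snd i) (fun _ _ y => / y)).
  { apply (Fam_inv (R * R) s G fst snd snd (fun _ _ y => y) (/ 2)); auto; [lra| |].
    - intros i Hi; specialize (Hy1 i Hi); lra.
    - intros i Hi x y Hxy; destruct (Hyn i Hi x y Hxy) as (_ & A1 & A2); rewrite Rabs_right; lra. }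
  assert (Fiy1 : F (fun _ => 1) (fun _ _ y => / y)).
  { revert Fiy; apply Fam_le; exists 1; split; [lra|]; intros i Hi; destruct (Hy2 i Hi); lra. }
  assert (Fe1 : F (fun _ => 1) (fun _ _ y => E (/ y))).
  { apply (Fam_comp1 (R * R) s G fst snd rw E (fun _ _ y => / y)); auto.
    intros i Hi x y Hxy; destruct (Hyn i Hi x y Hxy) as (A0 & A1 & A2).
    assert (0 < / y) by (apply Rinv_0_lt_compat; lra).
    assert (/ y < rw) by (rewrite <- (Rinv_inv rw); apply Rinv_lt_contravar; auto; apply Rmult_lt_0_compat; lra).
    lra. }
  assert (Her : forall i, G i -> forall x y, nb (fst i) (snd i) x y -> 0 < E (/ y) < ri /\
      y = al / (2 * E (/ y)) + H (E (/ y)))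
    by (intros i Hi x y Hxy; apply E_pos; apply (Hyn i Hi x y Hxy)).
  assert (FHe : F (fun _ => 1) (fun _ _ y => H (E (/ y)))).
  { apply (Fam_comp1 (R * R) s G fst snd ri H (fun _ _ y => E (/ y))); auto.
    intros i Hi x y Hxy; destruct (Her i Hi x y Hxy); lra. }
  assert (FH2e : F (fun _ => 1) (fun _ _ y => H2 (E (/ y)))).
  { apply (Fam_comp1 (R * R) s G fst snd ri H2 (fun _ _ y => E (/ y))); auto.
    intros i Hi x y Hxy; destruct (Her i Hi x y Hxy); lra. }
  assert (Fke : F (fun _ => 1) (fun _ _ y => kap (E (/ y)))).
  { apply (Fam_comp1 (R * R) s G fst snd re kap (fun _ _ y => E (/ y))); auto.
    intros i Hi x y Hxy; destruct (Her i Hi x y Hxy); lra. }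
  assert (One : forall w f g, F w f -> F (fun _ => 1) g -> F w (fun i x y => f i x y * g i x y)).
  { intros w f g Hf Hg; assert (A := Fam_mult _ _ _ _ _ _ _ _ _ Hf Hg); revert A; apply Fam_le.
    exists 1; split; [lra|]; intros; right; ring. }
  assert (Fe : F (fun i => / snd i) (fun _ _ y => E (/ y))).
  { apply Fam_ext with (fun _ _ y => / y * (al / 2 + E (/ y) * H (E (/ y)))).
    - intros i Hi x y Hxy; destruct (Her i Hi x y Hxy) as [A1 A2]; destruct (Hyn i Hi x y Hxy) as (_ & A3 & _).
      set (e := E (/ y)) in *.
      apply Rmult_eq_reg_l with y; [|lra]; rewrite <- Rmult_assoc, Rinv_r, Rmult_1_l by lra.
      rewrite A2; field; lra.
    - apply One; auto; apply Fam_plus; [apply Fam_const|]; apply One; auto. }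
  destruct (One _ _ _ Fe Fe1) as (Cz & HCz & Hz); clear Cz HCz Hz.
  assert (Fe2 : F (fun i => (/ snd i) ^ 2) (fun _ _ y => E (/ y) * E (/ y))).
  { assert (A := Fam_mult _ _ _ _ _ _ _ _ _ Fe Fe); revert A; apply Fam_le.
    exists 1; split; [lra|]; intros; right; ring. }
  assert (F1 : F (fun i => (/ snd i) ^ 2) (fun _ x y => X_init x y - x)).
  { apply Fam_ext with (fun _ x y => E (/ y) * E (/ y) * (E (/ y) * (/ 2 * (x * kap (E (/ y)))))).
    - intros; unfold X_init; field.
    - apply One; auto; apply One; auto; apply Fam_scal, One; auto. }
  assert (F2 : F (fun i => (/ snd i) ^ 2) (fun _ x y => J_init x y - 2 / al * y)).
  { apply Fam_ext with (fun _ x y => - (2 / al) * (E (/ y) * E (/ y) * H2 (E (/ y)))).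
    - intros i Hi x y Hxy; destruct (Her i Hi x y Hxy) as [A1 A2]; unfold J_init.
      destruct (HH (E (/ y))) as [A3 _]; [lra|].
      set (e := E (/ y)) in *.
      replace (y) with (al / (2 * e) + H e) by auto; rewrite A3; field; lra.
    - apply Fam_scal, One; auto. }
  destruct F1 as (C1 & HC1 & B1), F2 as (C2 & HC2 & B2).
  exists (C1 + C2), M0; split; [lra|split; [unfold M0; lra|]].
  intros x0 y0 Hx0 Hy0; specialize (B1 (x0, y0) (conj Hx0 Hy0)); specialize (B2 (x0, y0) (conj Hx0 Hy0)).
  simpl fst in *; simpl snd in *.
  assert (0 <= (/ y0) ^ 2) by apply pow2_ge_0.
  split; (eapply Cb_le; [|eassumption]); nra.
Qed.
End Initial.

(** * Expansion of the returned point in (tau, I) *)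

Section Final.
Variables (s : nat) (al De D1 re ri e1 : R) (kap H H2 : R -> R) (k1 k2 B : R -> R -> R).
Variables (oX oJ : nat -> R -> R -> R) (M0 C0 : R).
Hypothesis Hal : 0 < al.
Hypothesis Hri : 0 < ri <= re.
Hypothesis He1 : 0 < e1.
Hypothesis Skap : smI (- re) re kap.
Hypothesis SH2 : smI (- ri) ri H2.
Hypothesis HH : forall ep, - ri < ep < ri -> H ep = ep ^ 2 * H2 ep.
Hypothesis Sk1 : Sm (box (-1) 2 e1) k1.
Hypothesis Sk2 : Sm (box (-1) 2 e1) k2.
Hypothesis SB : Sm (box (-1) 2 e1) B.
Hypothesis HC0 : 0 <= C0.
Hypothesis Horb : forall x0 y0 n, -1 <= x0 <= 2 -> M0 < y0 -> INR n <= y0 + 2 ->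
  Cb s (nb x0 y0) (C0 * (/ y0) ^ 2) (fun x y => oX n x y - (x + INR n)) /\
  Cb s (nb x0 y0) (C0 * (/ y0) ^ 2) (fun x y => oJ n x y - 2 / al * y).

(* After n regular flights t = 1 is at distance 2 (1 - zf n) / J in the variable S.
   Jp is the value of J after the kick, (K1, K2) are tau and I of the returned point
   and Kb is its time. *)
Definition zf (n : nat) (x y : R) : R := 1 + oX n x y - al / 2 * oJ n x y.
Definition Jp (z J : R) : R := J + 2 / al * (De * (z - / 2) + 2 / al * / J * D1 * ((z - / 2) ^ 2 - / 12)
   + (/ J) ^ 2 * k2 z (/ J)).
Definition K1 (n : nat) (x y : R) : R :=
  let z := zf n x y in let J := oJ n x y in let ep := / Jp z J in
  (z + (/ J) ^ 2 * k1 z (/ J)) / (1 + ep ^ 3 * kap ep / 2).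
Definition K2 (n : nat) (x y : R) : R :=
  let z := zf n x y in let J := oJ n x y in al / 2 * Jp z J + H (/ Jp z J).
Definition Kb (n : nat) (x y : R) : R := B (zf n x y) (/ oJ n x y).

Lemma final_bound : exists M C, 1 <= M /\ M0 <= M /\ 0 <= C /\ forall x0 y0 n,
  0 <= x0 <= 1 -> M < y0 -> INR n <= y0 + 2 -> - (1 / 8) <= zf n x0 y0 <= 1 ->
  Cb s (nb x0 y0) (C * (/ y0) ^ 2) (fun x y => K1 n x y - (x - y + (INR n + 1))) /\
  Cb s (nb x0 y0) (C * (/ y0) ^ 2) (fun x y => K2 n x y - (y + De * (x - y + (INR n + 1) - / 2))
     - / y * (D1 * ((x - y + (INR n + 1) - / 2) ^ 2 - / 12))) /\
  Cb s (nb x0 y0) C (zf n) /\ Cb s (nb x0 y0) C (Kb n) /\ Cb s (nb x0 y0) C (K1 n) /\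
  (forall x y, nb x0 y0 x y -> -1 < zf n x y < 2 /\ 0 < / oJ n x y < e1 /\ / al * y0 <= oJ n x y /\
     / Jp (zf n x y) (oJ n x y) < ri /\ / (2 * al) * y0 <= Jp (zf n x y) (oJ n x y) /\
     1 / 2 <= 1 + (/ Jp (zf n x y) (oJ n x y)) ^ 3 * kap (/ Jp (zf n x y) (oJ n x y)) / 2).
Proof.
  destruct (smI_bound _ _ _ Skap) as (Kk & HKk & Bkap).
  destruct (Sm_bound _ _ Sk2) as (L2 & HL2 & Bk2).
  (* Bounds the change of J in the kick, by |z - 1/2| <= 2 and |(z - 1/2)^2 - 1/12| <= 3 for z in
     (-1, 2). *)
  set (DD := 2 / al * (2 * Rabs De + 2 / al * e1 * Rabs D1 * 3 + e1 ^ 2 * L2)).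
  assert (HDD : 0 <= DD).
  { unfold DD; apply Rmult_le_pos; [apply Rlt_le, Rdiv_lt_0_compat; lra|].
    assert (0 <= 2 / al) by (apply Rlt_le, Rdiv_lt_0_compat; lra).
    generalize (Rabs_pos De) (Rabs_pos D1) (pow2_ge_0 e1); intros.
    assert (0 <= 2 / al * e1) by (apply Rmult_le_pos; lra).
    assert (0 <= 2 / al * e1 * Rabs D1) by (apply Rmult_le_pos; lra).
    assert (0 <= e1 ^ 2 * L2) by (apply Rmult_le_pos; lra). lra. }
  (* Once 1/J after the kick is below rr, the denominator 1 + ep^3 kap / 2 of [K1] is at least
     1/2. *)
  set (rr := Rmin (Rmin ri 1) (/ (Kk + 1))).
  assert (Hrr : 0 < rr) by (unfold rr; repeat apply Rmin_pos; try lra; apply Rinv_0_lt_compat; lra).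
  assert (Hrr1 : rr <= ri) by (eapply Rle_trans; [apply Rmin_l | apply Rmin_l]).
  assert (Hrr2 : rr <= 1) by (eapply Rle_trans; [apply Rmin_l | apply Rmin_r]).
  assert (Hrr3 : rr * Kk <= 1).
  { apply Rle_trans with (/ (Kk + 1) * (Kk + 1)); [|right; field; lra].
    apply Rmult_le_compat; try lra; apply Rmin_r. }
  set (M := 4 + Rabs M0 + (1 + al) * (16 * C0) + 4 * al + al / e1 + 2 * al * DD + 2 * al / rr).
  assert (P1 : 0 <= al / e1) by (apply Rlt_le, Rdiv_lt_0_compat; auto).
  assert (P2 : 0 <= 2 * al / rr) by (apply Rlt_le, Rdiv_lt_0_compat; lra).
  assert (P3 : 0 <= 2 * al * DD) by (apply Rmult_le_pos; lra).
  assert (P4 : 0 <= (1 + al) * (16 * C0)) by (apply Rmult_le_pos; lra).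
  assert (P5 := Rabs_pos M0); assert (P6 := Rle_abs M0).
  set (T := (R * R * nat)%type).
  set (c1 := fun i : T => fst (fst i)); set (c2 := fun i : T => snd (fst i)); set (cn := fun i : T => snd i).
  set (G := fun i : T => 0 <= c1 i <= 1 /\ M < c2 i /\ INR (cn i) <= c2 i + 2 /\ - (1 / 8) <= zf (cn i) (c1 i) (c2 i) <= 1).
  assert (Hy1 : forall i, G i -> M < c2 i /\ 4 < c2 i) by (intros i (_ & G2 & _); unfold M in *; lra).
  assert (Hy2 : forall i, G i -> 0 < / c2 i <= 1).
  { intros i Hi; specialize (Hy1 i Hi); split; [apply Rinv_0_lt_compat; lra|].
    rewrite <- Rinv_1; apply Rinv_le_contravar; lra. }
  assert (Hsmall : forall i, G i -> C0 * (/ c2 i) ^ 2 <= / 16 /\ al / 2 * (C0 * (/ c2 i) ^ 2) <= / 32).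
  { intros i Hi; destruct (Hy1 i Hi) as [A1 A2]; destruct (Hy2 i Hi) as [A3 A4].
    assert (A5 : (1 + al) * (16 * C0) * / c2 i <= 1).
    { apply Rmult_le_reg_r with (c2 i); [lra|]; rewrite Rmult_assoc, Rinv_l by lra.
      unfold M in A1; lra. }
    assert (A6 : (1 + al) * (16 * C0) * (/ c2 i) ^ 2 <= 1).
    { assert (0 <= (1 + al) * (16 * C0) * / c2 i) by (apply Rmult_le_pos; lra). simpl; nra. }
    assert (0 <= C0 * (/ c2 i) ^ 2) by (apply Rmult_le_pos; [auto|apply pow2_ge_0]).
    assert (0 <= al * (C0 * (/ c2 i) ^ 2)) by (apply Rmult_le_pos; lra).
    split; lra. }
  assert (FX : Fam T s G c1 c2 (fun i => (/ c2 i) ^ 2) (fun i x y => oX (cn i) x y - (x + INR (cn i)))).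
  { exists C0; split; auto; intros i (G1 & G2 & G3 & G4); apply Horb; auto; unfold M in G2; lra. }
  assert (FJ : Fam T s G c1 c2 (fun i => (/ c2 i) ^ 2) (fun i x y => oJ (cn i) x y - 2 / al * y)).
  { exists C0; split; auto; intros i (G1 & G2 & G3 & G4); apply Horb; auto; unfold M in G2; lra. }
  set (tau := fun i x y => x - y + (INR (cn i) + 1)).
  assert (Val : forall i, G i -> forall x y, nb (c1 i) (c2 i) x y ->
     Rabs (zf (cn i) x y - tau i x y) <= 3 / 32 /\ Rabs (oJ (cn i) x y - 2 / al * y) <= / 4).
  { intros i Hi x y Hxy; destruct (Hsmall i Hi) as [S1 S2].
    pose proof Hi as (G1 & G2 & G3 & G4).
    destruct (Horb (c1 i) (c2 i) (cn i)) as [O1 O2]; auto; [lra|unfold M in G2; lra|].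
    assert (V1 := Cb_value _ _ _ _ _ _ O1 Hxy); assert (V2 := Cb_value _ _ _ _ _ _ O2 Hxy).
    cbv beta in V1, V2; split; [|lra].
    replace (zf (cn i) x y - tau i x y) with
      ((oX (cn i) x y - (x + INR (cn i))) - al / 2 * (oJ (cn i) x y - 2 / al * y)) by (unfold zf, tau; field; lra).
    eapply Rle_trans; [apply Rabs_triang|]; rewrite Rabs_Ropp, Rabs_mult, (Rabs_right (al / 2)) by lra.
    assert (al / 2 * Rabs (oJ (cn i) x y - 2 / al * y) <= al / 2 * (C0 * (/ c2 i) ^ 2))
      by (apply Rmult_le_compat_l; lra).
    lra. }
  assert (Hz : forall i, G i -> forall x y, nb (c1 i) (c2 i) x y -> -1 < zf (cn i) x y < 2 /\
       -1 <= tau i x y <= 2).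
  { intros i Hi x y Hxy; destruct (Val i Hi x y Hxy) as [V1 _].
    destruct (Val i Hi _ _ (nb_center (c1 i) (c2 i))) as [V2 _].
    apply Rabs_le_between in V1; apply Rabs_le_between in V2.
    destruct Hi as (_ & _ & _ & G4), Hxy as [Hx Hy]; unfold tau in *.
    assert (tau i x y - tau i (c1 i) (c2 i) = (x - c1 i) - (y - c2 i)) by (unfold tau; ring).
    unfold tau in *; lra. }
  assert (HJ : forall i, G i -> forall x y, nb (c1 i) (c2 i) x y -> / al * c2 i <= oJ (cn i) x y /\
      0 < / oJ (cn i) x y < e1).
  { intros i Hi x y Hxy; destruct (Val i Hi x y Hxy) as [_ V1]; apply Rabs_le_between in V1.
    destruct (Hy1 i Hi) as [A1 A2]; destruct Hxy as [Hx Hy].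
    assert (B1 : al * (2 / al * y - / 4) = 2 * y - al / 4) by (field; lra).
    assert (B2 : 2 * y - al / 4 <= al * oJ (cn i) x y) by (rewrite <- B1; apply Rmult_le_compat_l; lra).
    assert (B3 : c2 i <= al * oJ (cn i) x y) by (unfold M in A1; lra).
    assert (B4 : / al * c2 i <= oJ (cn i) x y).
    { apply Rmult_le_reg_l with al; auto; rewrite <- Rmult_assoc, Rinv_r by lra; lra. }
    assert (B5 : 0 < / al * c2 i) by (apply Rmult_lt_0_compat; [apply Rinv_0_lt_compat|]; lra).
    split; auto; split; [apply Rinv_0_lt_compat; lra|].
    apply Rmult_lt_reg_r with (oJ (cn i) x y); [lra|]; rewrite Rinv_l by lra.
    apply Rmult_lt_reg_l with al; auto.
    assert (al / e1 * e1 = al) by (field; lra).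
    assert (al / e1 * e1 < c2 i * e1) by (apply Rmult_lt_compat_r; auto; unfold M in A1; lra).
    assert (e1 * c2 i <= e1 * (al * oJ (cn i) x y)) by (apply Rmult_le_compat_l; lra).
    lra. }
  set (Jf := fun i x y => Jp (zf (cn i) x y) (oJ (cn i) x y)).
  assert (HJp : forall i, G i -> forall x y, nb (c1 i) (c2 i) x y ->
      / (2 * al) * c2 i <= Jf i x y /\ 0 < / Jf i x y < rr).
  { intros i Hi x y Hxy; destruct (HJ i Hi x y Hxy) as [B1 B2]; destruct (Hz i Hi x y Hxy) as [B3 _].
    destruct (Hy1 i Hi) as [A1 A2].
    set (z := zf (cn i) x y) in *; set (J := oJ (cn i) x y) in *.
    assert (Hi2 : 0 < / al) by (apply Rinv_0_lt_compat; auto).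
    assert (B4 : Rabs (Jf i x y - J) <= DD).
    { unfold Jf, Jp; fold z J.
      match goal with |- Rabs (J + ?a * ?b - J) <= _ => replace (J + a * b - J) with (a * b) by ring end.
      rewrite Rabs_mult, (Rabs_right (2 / al)) by (apply Rle_ge, Rlt_le, Rdiv_lt_0_compat; lra).
      unfold DD; apply Rmult_le_compat_l; [apply Rlt_le, Rdiv_lt_0_compat; lra|].
      eapply Rle_trans; [apply Rabs_triang|]; apply Rplus_le_compat;
        [eapply Rle_trans; [apply Rabs_triang|]; apply Rplus_le_compat|].
      - rewrite Rabs_mult, Rmult_comm; apply Rmult_le_compat_r; [apply Rabs_pos|]; apply Rabs_le; lra.
      - rewrite !Rabs_mult, (Rabs_right (2 / al)), (Rabs_right (/ J)) by
          (first [apply Rle_ge, Rlt_le, Rdiv_lt_0_compat; lra | lra]).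
        assert (0 < 2 / al) by (apply Rdiv_lt_0_compat; lra).
        apply Rmult_le_compat; auto using Rabs_pos.
        + repeat apply Rmult_le_pos; auto using Rabs_pos; lra.
        + apply Rmult_le_compat_r; [apply Rabs_pos|]; apply Rmult_le_compat_l; lra.
        + apply Rabs_le; assert (0 <= (z - / 2) ^ 2) by apply pow2_ge_0; simpl in *; nra.
      - rewrite Rabs_mult; apply Rmult_le_compat; auto using Rabs_pos.
        + rewrite <- RPow_abs; apply pow_incr; split; [apply Rabs_pos|]; rewrite Rabs_right; lra.
        + apply Bk2; split; lra. }
    apply Rabs_le_between in B4.
    assert (B5 : DD <= / (2 * al) * c2 i).
    { apply Rmult_le_reg_l with (2 * al); [lra|]; rewrite <- Rmult_assoc, Rinv_r by lra.
      unfold M in A1; lra. }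
    assert (B6 : / al * c2 i = 2 * (/ (2 * al) * c2 i)) by (field; lra).
    assert (B7 : / (2 * al) * c2 i <= Jf i x y) by lra.
    assert (B8 : 0 < / (2 * al) * c2 i) by (apply Rmult_lt_0_compat; [apply Rinv_0_lt_compat|]; lra).
    split; auto; split; [apply Rinv_0_lt_compat; lra|].
    apply Rmult_lt_reg_r with (Jf i x y); [lra|]; rewrite Rinv_l by lra.
    assert (C1 : 2 * al / rr * rr = 2 * al) by (field; lra).
    assert (C2 : 2 * al / rr * rr < c2 i * rr) by (apply Rmult_lt_compat_r; auto; unfold M in A1; lra).
    assert (C3 : rr * (/ (2 * al) * c2 i) <= rr * Jf i x y) by (apply Rmult_le_compat_l; lra).
    assert (C4 : 1 < rr * (/ (2 * al) * c2 i)).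
    { apply Rmult_lt_reg_l with (2 * al); [lra|].
      replace (2 * al * (rr * (/ (2 * al) * c2 i))) with (c2 i * rr) by (field; lra); lra. }
    lra. }
  assert (Hv : forall i, G i -> forall x y, nb (c1 i) (c2 i) x y ->
      1 / 2 <= 1 + (/ Jf i x y) ^ 3 * kap (/ Jf i x y) / 2).
  { intros i Hi x y Hxy; destruct (HJp i Hi x y Hxy) as [_ B1]; set (e := / Jf i x y) in *.
    assert (B2 : Rabs (e ^ 3 * kap e) <= rr * Kk).
    { rewrite Rabs_mult; apply Rmult_le_compat; auto using Rabs_pos.
      - rewrite Rabs_right by (apply Rle_ge, pow_le; lra).
        assert (0 <= e * e <= 1) by nra; simpl; nra.
      - apply Bkap; lra. }
    apply Rabs_le_between in B2; lra. }
  assert (One : forall w f g, Fam T s G c1 c2 w f -> Fam T s G c1 c2 (fun _ => 1) g -> Fam T s G c1 c2 w (fun i x y => f i x y * g i x y)).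
  { intros w f g Hf Hg; assert (A := Fam_mult _ _ _ _ _ _ _ _ _ Hf Hg); revert A; apply Fam_le.
    exists 1; split; [lra|]; intros; right; ring. }
  assert (Up2 : forall f, Fam T s G c1 c2 (fun i => (/ c2 i) ^ 2) f -> Fam T s G c1 c2 (fun _ => 1) f).
  { intros f; apply Fam_le; exists 1; split; [lra|]; intros i Hi; destruct (Hy2 i Hi); simpl; nra. }
  assert (Up1 : forall f, Fam T s G c1 c2 (fun i => / c2 i) f -> Fam T s G c1 c2 (fun _ => 1) f).
  { intros f; apply Fam_le; exists 1; split; [lra|]; intros i Hi; destruct (Hy2 i Hi); lra. }
  assert (Upy : forall f, Fam T s G c1 c2 (fun _ => 1) f -> Fam T s G c1 c2 c2 f).
  { intros f; apply Fam_le; exists 1; split; [lra|]; intros i Hi; destruct (Hy1 i Hi); lra. }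
  assert (Fy : Fam T s G c1 c2 c2 (fun _ _ y => y)).
  { apply Fam_snd; intros i Hi; destruct (Hy1 i Hi); lra. }
  assert (Fiy : Fam T s G c1 c2 (fun i => / c2 i) (fun _ _ y => / y)).
  { apply (Fam_inv T s G c1 c2 c2 (fun _ _ y => y) (/ 2)); auto; [lra| |].
    - intros i Hi; destruct (Hy1 i Hi); lra.
    - intros i Hi x y [_ Hy]; destruct (Hy1 i Hi); rewrite Rabs_right; lra. }
  assert (FzT : Fam T s G c1 c2 (fun i => (/ c2 i) ^ 2) (fun i x y => zf (cn i) x y - tau i x y)).
  { apply Fam_ext with (fun i x y => (oX (cn i) x y - (x + INR (cn i))) - al / 2 * (oJ (cn i) x y - 2 / al * y)).
    - intros; unfold zf, tau; field; lra.
    - apply Fam_minus; auto; apply Fam_scal; auto. }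
  assert (Ftau : Fam T s G c1 c2 (fun _ => 1) tau).
  { exists 3; split; [lra|]; intros i Hi; rewrite Rmult_1_r.
    assert (A0 : forall x y, nb (c1 i) (c2 i) x y -> continuity_2d_pt (tau i) x y /\ Rabs (tau i x y) <= 3).
    { intros x y Hxy; split; [|destruct (Hz i Hi x y Hxy); apply Rabs_le; lra].
      apply continuity_2d_pt_plus; [|apply continuity_2d_pt_const].
      apply continuity_2d_pt_minus; [apply continuity_2d_pt_id1 | apply continuity_2d_pt_id2]. }
    destruct s as [|s']; split; auto.
    exists (fun _ _ => 1), (fun _ _ => -1); split; [|split; apply Cb_const; apply Rabs_le; lra].
    intros x y _; unfold tau; split; auto_derive; auto; ring. }
  assert (Fz : Fam T s G c1 c2 (fun _ => 1) (fun i => zf (cn i))).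
  { apply Fam_ext with (fun i x y => (zf (cn i) x y - tau i x y) + tau i x y); [intros; ring|].
    apply Fam_plus; [apply Up2, FzT | exact Ftau]. }
  assert (FJy : Fam T s G c1 c2 c2 (fun i => oJ (cn i))).
  { apply Fam_ext with (fun i x y => (oJ (cn i) x y - 2 / al * y) + 2 / al * y); [intros; ring|].
    apply Fam_plus; [apply Upy, Up2; auto | apply Fam_scal; auto]. }
  assert (FiJ : Fam T s G c1 c2 (fun i => / c2 i) (fun i x y => / oJ (cn i) x y)).
  { apply Fam_inv with (/ al); auto; [apply Rinv_0_lt_compat; auto|intros i Hi; destruct (Hy1 i Hi); lra|].
    intros i Hi x y Hxy; eapply Rle_trans; [exact (proj1 (HJ i Hi x y Hxy)) | apply Rle_abs]. }
  assert (FiJ2 : Fam T s G c1 c2 (fun i => (/ c2 i) ^ 2) (fun i x y => / oJ (cn i) x y * / oJ (cn i) x y)).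
  { assert (A := Fam_mult _ _ _ _ _ _ _ _ _ FiJ FiJ); revert A; apply Fam_le.
    exists 1; split; [lra|]; intros; right; ring. }
  assert (FiJ1 := Up1 _ FiJ); cbv beta in FiJ1.
  assert (Fk : forall k, Sm (box (-1) 2 e1) k -> Fam T s G c1 c2 (fun _ => 1) (fun i x y => k (zf (cn i) x y) (/ oJ (cn i) x y))).
  { intros k Hk; apply (Fam_comp T s G c1 c2 (box (-1) 2 e1)); auto using open2_box.
    intros i Hi x y Hxy; destruct (Hz i Hi x y Hxy); destruct (HJ i Hi x y Hxy); split; lra. }
  assert (Fk1 := Fk k1 Sk1); assert (Fk2 := Fk k2 Sk2); assert (FB := Fk B SB).
  assert (Fc : forall c, Fam T s G c1 c2 (fun _ => 1) (fun _ _ _ => c)) by (intros; apply Fam_const).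
  assert (FQ : Fam T s G c1 c2 (fun _ => 1) (fun i x y => (zf (cn i) x y - / 2) * (zf (cn i) x y - / 2) - / 12)).
  { apply Fam_minus; [apply One; apply Fam_minus|]; auto. }
  assert (FJp : Fam T s G c1 c2 c2 Jf).
  { apply Fam_ext with (fun i x y => oJ (cn i) x y + 2 / al * (De * (zf (cn i) x y - / 2) +
       (2 / al * D1) * (/ oJ (cn i) x y * ((zf (cn i) x y - / 2) * (zf (cn i) x y - / 2) - / 12)) +
       / oJ (cn i) x y * / oJ (cn i) x y * k2 (zf (cn i) x y) (/ oJ (cn i) x y))).
    - intros; unfold Jf, Jp; ring.
    - apply Fam_plus; auto; apply Upy, Fam_scal, Fam_plus; [apply Fam_plus|].
      + apply Fam_scal, Fam_minus; auto.
      + apply Fam_scal, One; auto.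
      + apply One; auto. }
  assert (FiJp : Fam T s G c1 c2 (fun i => / c2 i) (fun i x y => / Jf i x y)).
  { apply Fam_inv with (/ (2 * al)); auto; [apply Rinv_0_lt_compat; lra|intros i Hi; destruct (Hy1 i Hi); lra|].
    intros i Hi x y Hxy; eapply Rle_trans; [exact (proj1 (HJp i Hi x y Hxy)) | apply Rle_abs]. }
  assert (FiJp2 : Fam T s G c1 c2 (fun i => (/ c2 i) ^ 2) (fun i x y => / Jf i x y * / Jf i x y)).
  { assert (A := Fam_mult _ _ _ _ _ _ _ _ _ FiJp FiJp); revert A; apply Fam_le.
    exists 1; split; [lra|]; intros; right; ring. }
  assert (FiJp1 := Up1 _ FiJp); cbv beta in FiJp1.
  assert (Fkap : Fam T s G c1 c2 (fun _ => 1) (fun i x y => kap (/ Jf i x y))).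
  { apply (Fam_comp1 T s G c1 c2 re); auto; intros i Hi x y Hxy; destruct (HJp i Hi x y Hxy); lra. }
  assert (FH2 : Fam T s G c1 c2 (fun _ => 1) (fun i x y => H2 (/ Jf i x y))).
  { apply (Fam_comp1 T s G c1 c2 ri); auto; intros i Hi x y Hxy; destruct (HJp i Hi x y Hxy); lra. }
  set (u := fun i x y => / Jf i x y * / Jf i x y * (/ Jf i x y * (/ 2 * kap (/ Jf i x y)))).
  assert (Fu : Fam T s G c1 c2 (fun i => (/ c2 i) ^ 2) u).
  { unfold u; apply One; auto; apply One; auto; apply Fam_scal; auto. }
  assert (Hu : forall i, G i -> forall x y, nb (c1 i) (c2 i) x y -> 1 / 2 <= 1 + u i x y).
  { intros i Hi x y Hxy; specialize (Hv i Hi x y Hxy); unfold u; lra. }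
  assert (Fv : Fam T s G c1 c2 (fun _ => 1) (fun i x y => / (1 + u i x y))).
  { assert (A : Fam T s G c1 c2 (fun i => / 1) (fun i x y => / (1 + u i x y))).
    { apply Fam_inv with (1 / 2); [lra|intros; lra| |].
      - intros i Hi x y Hxy; rewrite Rmult_1_r; eapply Rle_trans; [exact (Hu i Hi x y Hxy) | apply Rle_abs].
      - apply Fam_plus; auto. }
    revert A; apply Fam_le; exists 1; split; [lra|]; intros; lra. }
  assert (R1 : Fam T s G c1 c2 (fun i => (/ c2 i) ^ 2) (fun i x y => K1 (cn i) x y - tau i x y)).
  { apply Fam_ext with (fun i x y => (zf (cn i) x y - tau i x y) +
       (/ oJ (cn i) x y * / oJ (cn i) x y * (k1 (zf (cn i) x y) (/ oJ (cn i) x y) * / (1 + u i x y))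
        - u i x y * (zf (cn i) x y * / (1 + u i x y)))).
    - intros i Hi x y Hxy; assert (A := Hu i Hi x y Hxy).
      unfold K1; fold (Jf i x y).
      replace (1 + (/ Jf i x y) ^ 3 * kap (/ Jf i x y) / 2) with (1 + u i x y) by (unfold u; field; 
        destruct (HJp i Hi x y Hxy) as [_ [B1 _]]; intros E; rewrite E, Rinv_0 in B1; lra).
      destruct (HJ i Hi x y Hxy) as [_ [B1 _]].
      assert (oJ (cn i) x y <> 0) by (intros E; rewrite E, Rinv_0 in B1; lra).
      field; split; auto; lra.
    - apply Fam_plus; auto; apply Fam_minus; apply One; auto. }
  (* In the [D1] correction, the last two terms of the decomposition replace 2 / (al J) by 1/y and z
     by its comparison value; both differences contain a factor already known to be O(y^-2). *)
  assert (R2 : Fam T s G c1 c2 (fun i => (/ c2 i) ^ 2) (fun i x y => K2 (cn i) x y - (y + De * (tau i x y - / 2))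
     - / y * (D1 * ((tau i x y - / 2) ^ 2 - / 12)))).
  { apply Fam_ext with (fun i x y =>
       al / 2 * (oJ (cn i) x y - 2 / al * y) + De * (zf (cn i) x y - tau i x y)
       + / oJ (cn i) x y * / oJ (cn i) x y * k2 (zf (cn i) x y) (/ oJ (cn i) x y)
       + / Jf i x y * / Jf i x y * H2 (/ Jf i x y)
       + - D1 * ((oJ (cn i) x y - 2 / al * y) * (/ oJ (cn i) x y * (/ y *
             ((zf (cn i) x y - / 2) * (zf (cn i) x y - / 2) - / 12))))
       + D1 * ((zf (cn i) x y - tau i x y) * (/ y * (zf (cn i) x y + tau i x y - 1)))).
    - intros i Hi x y Hxy; unfold K2; fold (Jf i x y).
      destruct (HJp i Hi x y Hxy) as [_ B2].
      rewrite HH by lra.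
      assert (Jf i x y <> 0) by (intros E; rewrite E, Rinv_0 in B2; lra).
      destruct (HJ i Hi x y Hxy) as [_ [B1 _]].
      assert (oJ (cn i) x y <> 0) by (intros E; rewrite E, Rinv_0 in B1; lra).
      assert (y <> 0) by (destruct (Hy1 i Hi), Hxy; lra).
      set (h := H2 (/ Jf i x y)); replace (al / 2 * Jf i x y) with (al / 2 * oJ (cn i) x y +
         (De * (zf (cn i) x y - / 2) + 2 / al * / oJ (cn i) x y * D1 * ((zf (cn i) x y - / 2) ^ 2 - / 12)
   + (/ oJ (cn i) x y) ^ 2 * k2 (zf (cn i) x y) (/ oJ (cn i) x y))) by (unfold Jf, Jp; field; lra).
      field; repeat split; auto; lra.
    - repeat apply Fam_plus; try (apply Fam_scal; auto; fail); try (apply One; auto; fail).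
      apply Fam_scal, One; auto; apply One; auto.
      apply Fam_minus; auto; apply Fam_plus; [exact Fz | exact Ftau]. }
  assert (R3 : Fam T s G c1 c2 (fun _ => 1) (fun i => K1 (cn i))).
  { apply Fam_ext with (fun i x y => (K1 (cn i) x y - tau i x y) + tau i x y); [intros; ring|].
    apply Fam_plus; [apply Up2, R1 | exact Ftau]. }
  destruct R1 as (A1 & HA1 & B1), R2 as (A2 & HA2 & B2), Fz as (A3 & HA3 & B3), FB as (A4 & HA4 & B4), R3 as (A5 & HA5 & B5).
  exists M, (A1 + A2 + A3 + A4 + A5).
  split; [unfold M; lra|split; [unfold M; lra|split; [lra|]]].
  intros x0 y0 n Hx0 Hy0 Hn Hzn.
  set (i := ((x0, y0), n) : T).
  assert (Hi : G i) by exact (conj Hx0 (conj Hy0 (conj Hn Hzn))).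
  specialize (B1 i Hi); specialize (B2 i Hi); specialize (B3 i Hi); specialize (B4 i Hi); specialize (B5 i Hi).
  change (c1 i) with x0 in *; change (c2 i) with y0 in *; change (cn i) with n in *.
  assert (0 <= (/ y0) ^ 2) by apply pow2_ge_0.
  split; [|split; [|split; [|split; [|split]]]].
  - eapply Cb_le; [|exact B1]; apply Rmult_le_compat_r; lra.
  - eapply Cb_le; [|exact B2]; apply Rmult_le_compat_r; lra.
  - eapply Cb_le; [|exact B3]; lra.
  - eapply Cb_le; [|exact B4]; lra.
  - eapply Cb_le; [|exact B5]; lra.
  - intros x y Hxy; destruct (Hz i Hi x y Hxy) as [Q1 _]; destruct (HJ i Hi x y Hxy) as [Q2 Q3].
    destruct (HJp i Hi x y Hxy) as [Q4 Q5]; assert (Q6 := Hv i Hi x y Hxy).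
    unfold Jf in Q4, Q5, Q6; change (c2 i) with y0 in *; change (cn i) with n in *.
    repeat split; try lra.
Qed.
End Final.

(** * Collisions and the strip *)

Lemma frac_part_eq t k : 0 <= t - IZR k < 1 -> frac_part t = t - IZR k.
Proof.
  intros H; unfold frac_part.
  rewrite <- (Int_part_spec t k); [reflexivity|lra].
Qed.

Lemma frac_part_id t : 0 <= t < 1 -> frac_part t = t.
Proof. intros H; rewrite (frac_part_eq t 0); lra. Qed.

Lemma frac_part_minus1 t : 1 <= t < 2 -> frac_part t = t - 1.
Proof. intros H; rewrite (frac_part_eq t 1); lra. Qed.

Lemma lipschitz_continuity_pt (f : R -> R) L : (forall s t, Rabs (f s - f t) <= L * Rabs (s - t)) ->
  forall t, continuity_pt f t.
Proof.
  intros HL t eps He.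
  set (L' := Rabs L + 1); assert (HL' : 0 < L') by (unfold L'; generalize (Rabs_pos L); lra).
  exists (eps / L'); split; [apply Rdiv_lt_0_compat; auto|].
  intros x [_ Hx]; simpl in *; unfold Rdist in *.
  eapply Rle_lt_trans; [apply HL|].
  apply Rle_lt_trans with (L' * Rabs (x - t)).
  - apply Rmult_le_compat_r; [apply Rabs_pos|]; unfold L'; generalize (Rle_abs L); lra.
  - apply Rlt_le_trans with (L' * (eps / L')); [apply Rmult_lt_compat_l; auto|right; field; lra].
Qed.

Section Collision.
Variables (l : R -> R) (L : R).
Hypothesis Hl : forall t, 0 < l t.
Hypothesis HL : forall s t, Rabs (l s - l t) <= L * Rabs (s - t).

Lemma lip_le s t : s <= t -> l s - L * (t - s) <= l t <= l s + L * (t - s).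
Proof.
  intros H; specialize (HL t s); rewrite (Rabs_right (t - s)) in HL by lra.
  apply Rabs_le_between in HL; lra.
Qed.

(** For v > L the unfolded particle outruns the wall: the inequality defining the collision fails
    before d and holds from d on, so the infimum is d. Before d, neither sign of l t - v s allows a
    collision. *)
Lemma flight_time_eq t v d : L < v -> 0 < d -> v * d = l t + l (t + d) -> flight_time l (t, v) = d.
Proof.
  intros Hv Hd E; unfold flight_time; simpl fst; simpl snd.
  assert (H : forall s, 0 < s -> (l (t + s) <= Rabs (l t - v * s) <-> d <= s)).
  { intros s Hs; split; intros H.
    - destruct (Rle_lt_dec d s) as [|Hlt]; auto; exfalso.
      destruct (lip_le t (t + s)) as [A1 A2]; [lra|].
      destruct (lip_le (t + s) (t + d)) as [B1 B2]; [lra|].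
      replace (t + s - t) with s in * by ring; replace (t + d - (t + s)) with (d - s) in * by ring.
      unfold Rabs in H; destruct (Rcase_abs (l t - v * s)) as [C|C].
      + assert (L * (d - s) < v * (d - s)) by (apply Rmult_lt_compat_r; lra). lra.
      + assert (L * s < v * s) by (apply Rmult_lt_compat_r; lra). lra.
    - destruct (lip_le (t + d) (t + s)) as [B1 B2]; [lra|].
      replace (t + s - (t + d)) with (s - d) in * by ring.
      assert (L * (s - d) <= v * (s - d)) by (apply Rmult_le_compat_r; lra).
      assert (Hp := Hl (t + s)).
      rewrite Rabs_left1; lra. }
  rewrite (is_glb_Rbar_unique _ (Finite d)); [reflexivity|].
  split.
  - intros s [Hs1 Hs2]; simpl; apply H; auto.
  - intros m Hm; apply Hm; split; auto; apply H; auto; lra.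
Qed.

Lemma collision_map_eq lpl t v d : L < v -> 0 < d -> v * d = l t + l (t + d) ->
  collision_map l lpl (t, v) = (frac_part (t + d), v - 2 * ldot l lpl (t + d)).
Proof.
  intros Hv Hd E; unfold collision_map; rewrite (flight_time_eq t v d Hv Hd E); simpl fst; simpl snd.
  assert (Hp := Hl (t + d)).
  destruct (Rlt_dec (l t - v * d) 0) as [_|N]; [reflexivity | exfalso; apply N; lra].
Qed.

Lemma flight_exists t v : 0 <= L -> L < v -> exists d, 0 < d /\ v * d = l t + l (t + d).
Proof.
  intros HL0 Hv.
  (* Long enough for v D to exceed 2 l t + L D, an upper bound for l t + l (t + D). *)
  set (D := (2 * l t + 1) / (v - L)).
  assert (Hlt := Hl t).
  assert (HD : 0 < D) by (apply Rdiv_lt_0_compat; lra).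
  assert (ED : (v - L) * D = 2 * l t + 1) by (unfold D; field; lra).
  destruct (Ranalysis5.IVT_interv (fun d => v * d - l t - l (t + d)) 0 D) as (d & Hd & E); auto.
  - intros d Hd1 Hd2; apply continuity_pt_minus.
    + apply continuity_pt_minus; [|apply continuity_const; intros p r; reflexivity].
      apply derivable_continuous_pt, derivable_pt_scal, derivable_pt_id.
    + apply (continuity_pt_comp (fun d => t + d) l).
      * apply derivable_continuous_pt; apply (derivable_pt_plus (fun _ => t) (fun d => d));
          [apply derivable_pt_const | apply derivable_pt_id].
      * apply (lipschitz_continuity_pt l L HL).
  - rewrite Rmult_0_r, Rplus_0_r; lra.
  - destruct (lip_le t (t + D)) as [A1 A2]; [lra|]; replace (t + D - t) with D in * by ring; lra.
  - exists d; split; [|lra].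
    assert (d <> 0); [intros ->|lra].
    rewrite Rmult_0_r, Rplus_0_r in E; lra.
Qed.

(** For a fixed arrival time the earlier departure needs the smaller velocity: shifting the
    departure changes l at a rate of at most L, while the distance flown changes at the rate v' > L.
    This decides below on which side of f(S) an image lies. *)
Lemma departure_monotone r r' t1 v' : r <= r' -> r' < t1 -> L < v' ->
  v' * (t1 - r') = l r' + l t1 -> (l r + l t1) / (t1 - r) <= v' /\ (r < r' -> (l r + l t1) / (t1 - r) < v').
Proof.
  intros H1 H2 Hv E.
  destruct (lip_le r r' H1) as [A1 A2].
  assert (H3 : (l r + l t1) / (t1 - r) * (t1 - r) = l r + l t1) by (field; lra).
  assert (H4 : l r + l t1 <= v' * (t1 - r) - (v' - L) * (r' - r)) by lra.
  assert (0 <= (v' - L) * (r' - r)) by (apply Rmult_le_pos; lra).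
  split.
  - apply Rmult_le_reg_r with (t1 - r); lra.
  - intros Hr; assert (0 < (v' - L) * (r' - r)) by (apply Rmult_lt_0_compat; lra).
    apply Rmult_lt_reg_r with (t1 - r); lra.
Qed.
End Collision.

Definition wf (g : R -> R) (t v : R) : R := g t * (v + Derive g t).
Definition Jf (g : R -> R) (t v : R) : R := sqrt (wf g t v ^ 2 + 2 / 3 * q g t).

Lemma Jf_sq g t v : 0 < Jf g t v -> Jf g t v ^ 2 = wf g t v ^ 2 + 2 / 3 * q g t.
Proof.
  intros H; unfold Jf in *; rewrite <- Rsqr_pow2; apply Rsqr_sqrt.
  destruct (Rle_lt_dec 0 (wf g t v ^ 2 + 2 / 3 * q g t)); auto.
  rewrite sqrt_neg_0 in H; lra.
Qed.

(** The link between velocities and durations: the reflected velocity v - 2 gr' gives w = gr (v -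
    gr'), and d times this is the reversed [WW] once v d is replaced by the sum of the two wall
    distances. *)
Lemma Jf_after gl gr t v d : 0 < d -> v * d = gl t + gr (t + d) ->
  WW gr gl (t + d) (- d) = d * wf gr (t + d) (v - 2 * Derive gr (t + d)) /\
  sqrt (NN gr gl (t + d) (- d)) = d * Jf gr (t + d) (v - 2 * Derive gr (t + d)).
Proof.
  intros Hd E; set (v' := v - 2 * Derive gr (t + d)).
  assert (EW : WW gr gl (t + d) (- d) = d * wf gr (t + d) v').
  { unfold WW, wf, v'; replace (t + d + - d) with t by ring.
    replace (gr (t + d) + gl t) with (v * d) by lra; ring. }
  split; auto.
  unfold NN, Jf; rewrite EW.
  replace ((d * wf gr (t + d) v') ^ 2 + 2 / 3 * q gr (t + d) * (- d) ^ 2)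
    with (d ^ 2 * (wf gr (t + d) v' ^ 2 + 2 / 3 * q gr (t + d))) by ring.
  rewrite sqrt_mult_alt by apply pow2_ge_0.
  rewrite sqrt_pow2; lra.
Qed.

(** From d J = sqrt N follows (d w)^2 = W^2; the positivity hypotheses select d w = W, and this is
    the collision equation multiplied by gl, up to a common term. *)
Lemma flight_of_Jf gl gr t v d : 0 < gl t -> 0 < wf gl t v -> 0 < Jf gl t v -> 0 < WW gl gr t d -> 0 < NN gl gr t d ->
  d = / Jf gl t v * sqrt (NN gl gr t d) -> v * d = gl t + gr (t + d).
Proof.
  intros Hg Hw HJ HW HN E.
  assert (Hq := sqrt_lt_R0 _ HN).
  assert (Hd : 0 < d) by (rewrite E; apply Rmult_lt_0_compat; auto; apply Rinv_0_lt_compat; auto).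
  assert (E1 : d * Jf gl t v = sqrt (NN gl gr t d)) by (rewrite E at 1; field; lra).
  assert (E2 : d ^ 2 * Jf gl t v ^ 2 = NN gl gr t d).
  { rewrite <- Rpow_mult_distr, E1, <- Rsqr_pow2; apply Rsqr_sqrt; lra. }
  rewrite Jf_sq in E2 by auto.
  assert (E3 : (d * wf gl t v) ^ 2 = WW gl gr t d ^ 2) by (unfold NN in E2; lra).
  assert (E4 : d * wf gl t v = WW gl gr t d).
  { apply Rsqr_inj; [apply Rlt_le, Rmult_lt_0_compat; auto | lra | rewrite !Rsqr_pow2; auto]. }
  unfold wf, WW in E4.
  apply Rmult_eq_reg_l with (gl t); [|lra]; lra.
Qed.

Section Velocity.
Variables (a b : R) (g : R -> R) (g0 Gm K Kq : R).
Hypothesis Hg0 : 0 < g0.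
Hypothesis Hgb : forall t, a < t < b -> g0 <= g t <= Gm.
Hypothesis HK : 0 <= K.
Hypothesis Hgd : forall t, a < t < b -> Rabs (Derive g t) <= K.
Hypothesis HKq : 0 <= Kq.
Hypothesis Hq : forall t, a < t < b -> Rabs (2 / 3 * q g t) <= Kq.

Lemma v_large V : exists J1, 0 < J1 /\ forall t v, a < t < b -> 0 < wf g t v -> J1 <= Jf g t v -> V < v.
Proof.
  set (Wm := Rabs Gm * (Rabs V + K)).
  assert (HW : 0 <= Wm) by (apply Rmult_le_pos; [apply Rabs_pos|]; generalize (Rabs_pos V); lra).
  exists (Wm + Kq + 2); split; [lra|].
  intros t v Ht Hw HJ.
  destruct (Rlt_le_dec V v) as [|Hle]; auto; exfalso.
  assert (B1 := Hgb t Ht); assert (B2 := Hgd t Ht); assert (B3 := Hq t Ht).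
  apply Rabs_le_between in B2; apply Rabs_le_between in B3.
  assert (Hwm : wf g t v <= Wm).
  { unfold wf, Wm in *.
    assert (0 < v + Derive g t).
    { destruct (Rlt_le_dec 0 (v + Derive g t)); auto; nra. }
    apply Rmult_le_compat; try lra.
    - generalize (Rle_abs Gm); lra.
    - generalize (Rle_abs V); lra. }
  assert (HJ0 : 0 < Jf g t v) by lra.
  assert (E := Jf_sq g t v HJ0).
  assert (wf g t v ^ 2 <= Wm ^ 2) by (apply pow_incr; lra).
  assert ((Wm + Kq + 2) ^ 2 <= Jf g t v ^ 2) by (apply pow_incr; lra).
  nra.
Qed.

Lemma J_large J1 : exists V, 0 < V /\ forall t v, a < t < b -> V < v -> 0 < wf g t v /\ J1 <= Jf g t v.
Proof.
  set (V := K + (Rabs J1 + Kq + 1) / g0).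
  assert (P : 0 < (Rabs J1 + Kq + 1) / g0) by (apply Rdiv_lt_0_compat; generalize (Rabs_pos J1); lra).
  exists V; split; [unfold V; lra|].
  intros t v Ht Hv.
  assert (B1 := Hgb t Ht); assert (B2 := Hgd t Ht); assert (B3 := Hq t Ht).
  apply Rabs_le_between in B2; apply Rabs_le_between in B3.
  assert (E : g0 * ((Rabs J1 + Kq + 1) / g0) = Rabs J1 + Kq + 1) by (field; lra).
  assert (Hw : Rabs J1 + Kq + 1 <= wf g t v).
  { rewrite <- E; unfold wf, V in *; apply Rmult_le_compat; lra. }
  assert (A := Rabs_pos J1).
  split; [lra|].
  unfold Jf; apply Rle_trans with (Rabs J1); [apply Rle_abs|].
  rewrite <- (sqrt_pow2 (Rabs J1)) by auto; apply sqrt_le_1_alt.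
  assert ((Rabs J1 + Kq + 1) ^ 2 <= wf g t v ^ 2) by (apply pow_incr; lra).
  nra.
Qed.

Lemma Jf_lt t v v' : a < t < b -> 0 < wf g t v -> 0 < Jf g t v -> v < v' -> Jf g t v < Jf g t v'.
Proof.
  intros Ht Hw HJ Hv; assert (B1 := Hgb t Ht).
  assert (E := Jf_sq g t v HJ).
  assert (0 < Jf g t v ^ 2) by (apply pow_lt; auto).
  assert (wf g t v < wf g t v') by (unfold wf; apply Rmult_lt_compat_l; lra).
  unfold Jf; apply sqrt_lt_1_alt; split; [lra|].
  assert (wf g t v ^ 2 < wf g t v' ^ 2) by (simpl; nra). lra.
Qed.

Lemma v_of_J t J : a < t < b -> Kq < J -> 1 <= J -> exists v, 0 < wf g t v /\ Jf g t v = J.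
Proof.
  intros Ht HJ HJ1.
  assert (B1 := Hgb t Ht); assert (B3 := Hq t Ht); apply Rabs_le_between in B3.
  assert (P : 0 < J ^ 2 - 2 / 3 * q g t) by nra.
  exists (sqrt (J ^ 2 - 2 / 3 * q g t) / g t - Derive g t).
  assert (E : wf g t (sqrt (J ^ 2 - 2 / 3 * q g t) / g t - Derive g t) = sqrt (J ^ 2 - 2 / 3 * q g t))
    by (unfold wf; field; lra).
  split; [rewrite E; apply sqrt_lt_R0; auto|].
  unfold Jf; rewrite E, <- Rsqr_pow2, Rsqr_sqrt by lra.
  replace (J ^ 2 - 2 / 3 * q g t + 2 / 3 * q g t) with (J ^ 2) by ring; apply sqrt_pow2; lra.
Qed.
End Velocity.

Lemma periodic_Z (l : R -> R) : (forall t, l (t + 1) = l t) -> forall k t, l (t + IZR k) = l t.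
Proof.
  intros Hp.
  assert (Hn : forall n t, l (t + INR n) = l t).
  { induction n as [|n IH]; intros t; [simpl; f_equal; ring|].
    rewrite S_INR; replace (t + (INR n + 1)) with (t + INR n + 1) by ring; rewrite Hp; auto. }
  intros k t; destruct (Z_le_gt_dec 0 k) as [Hk|Hk].
  - rewrite <- (Z2Nat.id k), <- INR_IZR_INZ by auto; auto.
  - rewrite <- (Hn (Z.to_nat (- k)) (t + IZR k)), INR_IZR_INZ, Z2Nat.id by lia.
    rewrite opp_IZR; f_equal; ring.
Qed.

(** * The periodic wall, its collisions, and the strip as the region below a graph *)

Section Walls.
Variables (l g : R -> R) (lpl L a b g0 Gm K : R).
Hypothesis Hl : forall t, 0 < l t.
Hypothesis HL0 : 0 <= L.
Hypothesis HL : forall s t, Rabs (l s - l t) <= L * Rabs (s - t).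
Hypothesis Hper : forall t, l (t + 1) = l t.
Hypothesis Hlg : forall t, 0 <= t <= 1 -> l t = g t.
Hypothesis Ha : a < 0.
Hypothesis Hb : 1 < b.
Hypothesis Hg : smI a b g.
Hypothesis Hg0 : 0 < g0.
Hypothesis Hgb : forall t, a < t < b -> g0 <= g t <= Gm.
Hypothesis HK : 0 <= K.
Hypothesis Hgd : forall t, a < t < b -> Rabs (Derive g t) <= K.
Hypothesis Hlpl : lpl = Derive g 0.

Lemma g_periodic : g 0 = g 1.
Proof. rewrite <- !Hlg by lra; rewrite <- (Hper 0); f_equal; ring. Qed.

Lemma ldot_frac t : ldot l lpl t = Derive g (frac_part t).
Proof.
  destruct (base_fp t) as [F1 F2]; unfold ldot; destruct (Req_EM_T (frac_part t) 0) as [E|E].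
  - rewrite E; auto.
  - assert (Ht : t = frac_part t + IZR (Int_part t)) by (unfold frac_part; ring).
    rewrite Ht at 1; set (k := Int_part t) in *; set (u := frac_part t) in *.
    rewrite (Derive_ext l (fun s => l (s + - IZR k))).
    + change (Derive (fun s => l (s + - IZR k)) (u + IZR k))
        with (Derive_n (fun s => l (s + - IZR k)) 1 (u + IZR k)).
      rewrite Derive_n_comp_trans; replace (u + IZR k + - IZR k) with u by ring.
      apply Derive_ext_loc.
      assert (Hu : 0 < u < 1) by lra.
      destruct (locally_2d_slice _ _ _ (open2_itv 0 1 u 0 Hu)) as [Lo _].
      revert Lo; apply filter_imp; intros s Hs; apply Hlg; unfold itv in Hs; lra.
    + intros s; rewrite <- opp_IZR, periodic_Z; auto.
Qed.

Lemma ldot_01 t : 0 <= t < 1 -> ldot l lpl t = Derive g t.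
Proof. intros Ht; rewrite ldot_frac, frac_part_id; auto. Qed.

Lemma ldot_bound t : Rabs (ldot l lpl t) <= K.
Proof. rewrite ldot_frac; apply Hgd; destruct (base_fp t); lra. Qed.

Lemma l_minus1 t : l (t + -1) = l t.
Proof. apply (periodic_Z l Hper (-1)). Qed.

Lemma regular_collision t v d : 0 <= t -> 0 < d -> t + d < 1 -> L < v -> v * d = g t + g (t + d) ->
  collision_map l lpl (t, v) = (t + d, v - 2 * Derive g (t + d)).
Proof.
  intros Ht Hd Htd Hv E; rewrite (collision_map_eq l L Hl HL lpl t v d); auto.
  - rewrite frac_part_id, ldot_01 by lra; reflexivity.
  - rewrite !Hlg by lra; auto.
Qed.

Lemma kick_collision t v d : 0 <= t < 1 -> 0 < d -> 1 <= t + d < 2 -> L < v ->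
  v * d = g t + shiftg g (t + d) ->
  collision_map l lpl (t, v) = (t + d + -1, v - 2 * Derive g (t + d + -1)).
Proof.
  intros Ht Hd Htd Hv E; rewrite (collision_map_eq l L Hl HL lpl t v d); auto.
  - rewrite ldot_frac, frac_part_minus1 by lra; reflexivity.
  - rewrite E; unfold shiftg; rewrite <- !Hlg by lra; rewrite l_minus1; auto.
Qed.

Lemma g_lip s t : a < s < b -> a < t < b -> s <= t -> g s - K * (t - s) <= g t <= g s + K * (t - s).
Proof.
  intros Hs Ht Hst.
  assert (A := lipschitz_of_derive g (Derive g) a b K (fun u Hu => smI_is_derive a b g u Hg Hu) Hgd s t Hs Ht).
  rewrite (Rabs_right (t - s)) in A by lra; apply Rabs_le_between in A; lra.
Qed.

(* The regular flight crosses t = 1 exactly when the kicked one does. *)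
Lemma crossing t v d1 d2 : 0 <= t < 1 -> K < v -> v * d1 = g t + g (t + d1) -> a < t + d1 < b ->
  1 <= t + d1 -> v * d2 = g t + shiftg g (t + d2) -> a < t + d2 + -1 < b -> 1 <= t + d2.
Proof.
  intros Ht Hv E1 H1 H2 E2 H3.
  destruct (g_lip 1 (t + d1)) as [A1 A2]; try lra.
  assert (C1 : v * (1 - t) <= g t + g 1).
  { assert (K * (t + d1 - 1) <= v * (t + d1 - 1)) by (apply Rmult_le_compat_r; lra). lra. }
  destruct (Rle_lt_dec 1 (t + d2)) as [|Hlt]; auto; exfalso.
  destruct (g_lip (t + d2 + -1) 0) as [B1 B2]; try lra.
  unfold shiftg in E2; rewrite <- g_periodic in C1.
  assert (K * (1 - t - d2) < v * (1 - t - d2)) by (apply Rmult_lt_compat_r; lra).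
  lra.
Qed.

(* f(S) is the curve v = vst T *)
Definition vst (T : R) : R := (g 0 + g T) / T - 2 * Derive g T.

(** vst T = p(T) / T with p bounded below near 0, so [partial_inverse1] inverts 1 / vst. The bound
    on rho (L + 1) ensures that flights from time 0 arriving before rho are faster than L. *)
Lemma vst_inverse : exists rho w1 Tv, 0 < rho /\ rho < 1 /\ rho < b /\ - rho > a /\ rho * (L + 1) <= g0 /\ 0 < w1 /\
  (forall w, 0 < w < w1 -> 0 < Tv w < rho /\ vst (Tv w) = / w) /\
  (forall t u, 0 < t -> t < u -> u < rho -> 0 < vst u /\ vst u < vst t).
Proof.
  set (r := Rmin (Rmin (- a / 2) (/ 2)) (Rmin (g0 / (2 * (K + 1))) (g0 / (2 * (L + 1))))).
  assert (M1 := Rmin_l (Rmin (- a / 2) (/ 2)) (Rmin (g0 / (2 * (K + 1))) (g0 / (2 * (L + 1))))).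
  assert (M2 := Rmin_r (Rmin (- a / 2) (/ 2)) (Rmin (g0 / (2 * (K + 1))) (g0 / (2 * (L + 1))))).
  assert (M3 := Rmin_l (- a / 2) (/ 2)); assert (M4 := Rmin_r (- a / 2) (/ 2)).
  assert (M5 := Rmin_l (g0 / (2 * (K + 1))) (g0 / (2 * (L + 1)))).
  assert (M6 := Rmin_r (g0 / (2 * (K + 1))) (g0 / (2 * (L + 1)))).
  fold r in M1, M2.
  assert (Hr : 0 < r) by (unfold r; repeat apply Rmin_pos; try lra; apply Rdiv_lt_0_compat; lra).
  assert (HrK : r * (K + 1) <= g0 / 2).
  { apply Rle_trans with (g0 / (2 * (K + 1)) * (K + 1)); [apply Rmult_le_compat_r; lra|right; field; lra]. }
  assert (HrL : r * (L + 1) <= g0 / 2).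
  { apply Rle_trans with (g0 / (2 * (L + 1)) * (L + 1)); [apply Rmult_le_compat_r; lra|right; field; lra]. }
  set (p := fun T => g 0 + g T - 2 * T * Derive g T).
  assert (Hin : forall T, - r < T < r -> a < T < b) by (intros; lra).
  assert (Hp : forall T, - r < T < r -> g0 <= p T).
  { intros T HT; unfold p; destruct (Hgb 0) as [A1 _]; [lra|]; destruct (Hgb T) as [A2 _]; [auto|].
    assert (A3 : Rabs (T * Derive g T) <= r * K).
    { rewrite Rabs_mult; apply Rmult_le_compat; auto using Rabs_pos; apply Rabs_le; lra. }
    apply Rabs_le_between in A3; lra. }
  assert (SH : smI (- r) r g) by (apply (smI_sub a b); auto; lra).
  assert (SD : smI (- r) r (Derive g)) by (apply smI_deriv, SH).
  assert (Sx : Sm (itv (- r) r) (fun x _ => x)).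
  { apply Sm_fst with r; intros x y Hx; unfold itv in Hx; apply Rabs_le; lra. }
  assert (Sp : smI (- r) r p).
  { unfold p, smI; unfold smI in SH, SD; sm. }
  destruct (smI_bound _ _ _ Sp) as (Kp & HKp & Bp).
  assert (Si : smI (- r) r (fun T => / p T)) by (apply smI_inv with g0; auto).
  destruct (partial_inverse1 r (fun T => / p T) (/ (Kp + 1)) Hr) as (r1 & w1 & Tv & Hr1 & Hw1 & _ & HT & Hmon); auto.
  { apply Rinv_0_lt_compat; lra. }
  { intros u Hu; specialize (Hp u Hu); specialize (Bp u Hu); apply Rabs_le_between in Bp.
    apply Rinv_le_contravar; lra. }
  assert (Hv : forall T, 0 < T < r -> vst T = p T / T) by (intros u Hu; unfold vst, p; field; lra).
  exists r1, w1, Tv; repeat split; try lra.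
  - assert (r1 * (L + 1) <= r * (L + 1)) by (apply Rmult_le_compat_r; lra); lra.
  - destruct (HT w) as [A1 A2]; [lra|].
    assert (B := Hp (Tv w) ltac:(lra)).
    assert (E : Tv w = w * p (Tv w)) by (rewrite <- A2 at 2; field; lra).
    rewrite E; apply Rmult_lt_0_compat; lra.
  - destruct (HT w) as [A1 A2]; lra.
  - destruct (HT w) as [A1 A2]; [lra|].
    assert (B := Hp (Tv w) ltac:(lra)).
    assert (E : Tv w = w * p (Tv w)) by (rewrite <- A2 at 2; field; lra).
    assert (0 < Tv w) by (rewrite E; apply Rmult_lt_0_compat; lra).
    rewrite Hv by lra; rewrite <- A2 at 3; field; lra.
  - rewrite Hv by lra; apply Rdiv_lt_0_compat; [|lra]; specialize (Hp u ltac:(lra)); lra.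
  - assert (B1 := Hp t ltac:(lra)); assert (B2 := Hp u ltac:(lra)).
    rewrite !Hv by lra; assert (C := Hmon t u ltac:(lra) ltac:(lra) ltac:(lra)).
    replace (p u / u) with (/ (u * / p u)) by (field; lra).
    replace (p t / t) with (/ (t * / p t)) by (field; lra).
    assert (0 < / p t) by (apply Rinv_0_lt_compat; lra).
    assert (0 < t * / p t) by (apply Rmult_lt_0_compat; lra).
    apply Rinv_lt_contravar; [apply Rmult_lt_0_compat|]; lra.
Qed.

(** A fast flight from S is regular and lasts less than rho, a range in which vst decreases. The
    point of f(S) at height v thus has the time T with vst T = v, and lying to its left means v <
    vst t. *)
Lemma strip_iff : exists rho V1, 0 < rho /\ rho < 1 /\ rho < b /\ rho * (L + 1) <= g0 /\
  (forall t u, 0 < t -> t < u -> u < rho -> 0 < vst u /\ vst u < vst t) /\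
  forall V0 t v, V1 <= V0 -> (strip l lpl V0 (t, v) <-> 0 <= t < rho /\ V0 < v /\ (0 < t -> v < vst t)).
Proof.
  destruct vst_inverse as (rho & w1 & Tv & H1 & H2 & H3 & H4 & H5 & H6 & H7 & H8).
  (* [Rabs lpl] excludes flights that miss the fixed wall, 2 K absorbs the change of velocity at the
     collision, L and 2 Gm / rho make the flight unique and shorter than rho, and 1 / w1 lets vst be
     inverted. *)
  exists rho, (Rabs lpl + 2 * K + L + / w1 + 2 * Gm / rho + 1).
  repeat (split; [assumption|]).
  intros V0 t v HV.
  assert (Hiw : 0 < / w1) by (apply Rinv_0_lt_compat; auto).
  assert (HGm : 0 < Gm) by (destruct (Hgb 0); lra).
  assert (HGr : 0 < 2 * Gm / rho) by (apply Rdiv_lt_0_compat; lra).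
  assert (HGr2 : 2 * Gm / rho * rho = 2 * Gm) by (field; lra).
  assert (Hab := Rle_abs lpl); assert (Hab2 := Rabs_maj2 lpl); assert (Hab3 := Rabs_pos lpl).
  assert (Hl0 : l 0 = g 0) by (apply Hlg; lra).
  split.
  - intros [[Ht Hcs] [HVv (qq & [[Hq1 Hq2] Hq3] & Hq4 & Hq5)]]; simpl in Ht, Hcs, HVv.
    destruct qq as [q0 v0]; simpl in Hq1, Hq2, Hq3; subst q0.
    rewrite ldot_01 in Hq2 by lra; rewrite <- Hlpl in Hq2.
    assert (Hv0 : L + 2 * Gm / rho < v0).
    { revert Hq4; unfold collision_map; simpl.
      set (s := flight_time l (0, v0)).
      assert (Bd := ldot_bound (0 + s)); apply Rabs_le_between in Bd.
      destruct (Rlt_dec (l 0 - v0 * s) 0); simpl; intros; lra. }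
    destruct (flight_exists l L Hl HL 0 v0 HL0) as (d & Hd & Ed); [lra|].
    rewrite Rplus_0_l in Ed.
    assert (Hdr : d < rho).
    { destruct (lip_le l L HL 0 d) as [A1 A2]; [lra|]; rewrite Rminus_0_r in *.
      destruct (Hgb 0) as [_ A3]; [lra|].
      destruct (Rlt_le_dec d rho) as [|Hle]; auto; exfalso.
      assert (2 * Gm / rho * rho <= 2 * Gm / rho * d) by (apply Rmult_le_compat_l; lra).
      assert ((L + 2 * Gm / rho) * d < v0 * d) by (apply Rmult_lt_compat_r; lra).
      lra. }
    assert (EC : collision_map l lpl (0, v0) = (d, v0 - 2 * Derive g d)).
    { rewrite (regular_collision 0 v0 d); try lra.
      - rewrite Rplus_0_l; reflexivity.
      - rewrite Rplus_0_l, Ed, !Hlg by lra; reflexivity. }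
    rewrite EC in Hq4, Hq5; simpl in Hq4, Hq5.
    assert (Ev : v = vst d).
    { unfold vst; rewrite <- Hq4; rewrite <- Hl0, <- (Hlg d) by lra; rewrite <- Ed; field; lra. }
    split; [lra|split; [lra|]]; intros Htp.
    rewrite Ev; apply H8; lra.
  - intros (Ht & HVv & Hvs).
    assert (Hw : 0 < / v < w1).
    { split; [apply Rinv_0_lt_compat; lra|].
      rewrite <- (Rinv_inv w1); apply Rinv_lt_contravar; [apply Rmult_lt_0_compat|]; lra. }
    destruct (H7 (/ v) Hw) as [T1 T2]; set (T := Tv (/ v)) in *; rewrite Rinv_inv in T2.
    assert (Hdg : Rabs (Derive g T) <= K) by (apply Hgd; lra); apply Rabs_le_between in Hdg.
    set (v0 := (g 0 + g T) / T).
    assert (Ev0 : v0 = v + 2 * Derive g T) by (unfold v0; rewrite <- T2; unfold vst; ring).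
    assert (EC : collision_map l lpl (0, v0) = (T, v)).
    { rewrite (regular_collision 0 v0 T); try lra.
      - rewrite Rplus_0_l; f_equal; lra.
      - rewrite Rplus_0_l; unfold v0; field; lra. }
    split; [|split; [exact HVv|]].
    + split; simpl; [lra|]; rewrite ldot_01 by lra.
      assert (Hdt : Rabs (Derive g t) <= K) by (apply Hgd; lra); apply Rabs_le_between in Hdt; lra.
    + exists (0, v0); split; [split; [split; simpl; [lra|]|reflexivity]|].
      * rewrite ldot_01 by lra; lra.
      * rewrite EC; simpl; split; auto.
        destruct (Rle_lt_or_eq_dec 0 t) as [Hp|<-]; [lra| |lra].
        destruct (Rtotal_order t T) as [Hlt|[E|Hgt]]; auto; exfalso.
        -- specialize (Hvs Hp); rewrite E in Hvs; lra.
        -- destruct (H8 T t); try lra.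
Qed.

(** Departing at r >= 0, the flight is at least as fast as the one from S with the same arrival
    time, so it lands on f(S) or beyond. *)
Lemma not_in_strip r t1 v : 0 <= r -> r < t1 -> t1 < 1 -> L < v -> v * (t1 - r) = g r + g t1 ->
  v - 2 * Derive g t1 < vst t1 -> False.
Proof.
  intros H1 H2 H3 H4 E H5.
  destruct (departure_monotone l L HL 0 r t1 v) as [A _]; auto.
  - rewrite !Hlg by lra; auto.
  - rewrite !Hlg, Rminus_0_r in A by lra; unfold vst in H5; lra.
Qed.

(** Departing before the jump, at r < 0, the flight is slower than the one from S with the same
    arrival time, so it lands on the inner side of f(S). *)
Lemma in_strip_after_kick r t1 v rho : -1 <= r -> r < 0 -> 0 < t1 -> t1 < rho -> rho < 1 -> rho * (L + 1) <= g0 ->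
  v * (t1 - r) = g (r + 1) + g t1 -> v - 2 * Derive g t1 < vst t1.
Proof.
  intros H0 H1 H2 H3 H4 H5 E.
  set (v' := (g 0 + g t1) / t1).
  destruct (Hgb 0) as [A1 _]; [lra|]; destruct (Hgb t1) as [A2 _]; [lra|].
  destruct (departure_monotone l L HL r 0 t1 v') as [_ A]; try lra.
  - apply Rmult_lt_reg_r with t1; auto; replace (v' * t1) with (g 0 + g t1) by (unfold v'; field; lra).
    assert (L * t1 <= L * rho) by (apply Rmult_le_compat_l; lra). lra.
  - rewrite !Hlg by lra; unfold v'; field; lra.
  - specialize (A H1).
    replace (l r) with (g (r + 1)) in A by (rewrite <- Hper, Hlg by lra; reflexivity).
    rewrite (Hlg t1) in A by lra.
    assert (v < v').
    { replace v with ((g (r + 1) + g t1) / (t1 - r)); auto; rewrite <- E; field; lra. }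
    unfold vst; fold v'; lra.
Qed.
End Walls.

(** * The first return map *)

Lemma Jf_shiftg g t v : Jf (shiftg g) t v = Jf g (t + -1) v.
Proof.
  unfold Jf, wf, q; change (Derive (shiftg g)) with (Derive_n (shiftg g) 1).
  rewrite !Derive_n_shift; reflexivity.
Qed.

Lemma wf_shiftg g t v : wf (shiftg g) t v = wf g (t + -1) v.
Proof.
  unfold wf; change (Derive (shiftg g)) with (Derive_n (shiftg g) 1).
  rewrite !Derive_n_shift; reflexivity.
Qed.

Lemma open2_pos (U : R -> R -> Prop) f : open2 U -> (forall x y, U x y -> continuity_2d_pt f x y) ->
  open2 (fun x y => U x y /\ 0 < f x y).
Proof.
  intros HU Hf x y [H1 H2].
  destruct (HU x y H1) as [d1 D1], (Hf x y H1 (mkposreal _ H2)) as [d2 D2].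
  exists (mkposreal (Rmin d1 d2) (Rmin_pos _ _ (cond_pos d1) (cond_pos d2))).
  simpl in *; intros u v Hu Hv; split.
  - apply D1; eapply Rlt_le_trans; eauto using Rmin_l.
  - assert (A : Rabs (f u v - f x y) < f x y) by (apply D2; eapply Rlt_le_trans; eauto using Rmin_r).
    apply Rabs_lt_between in A; lra.
Qed.

Lemma Sm_pos_nbhd U f x y : open2 U -> Sm U f -> U x y -> 0 < f x y ->
  exists V : R -> R -> Prop, open2 V /\ (forall u v, V u v -> U u v) /\ V x y /\ forall u v, V u v -> f x y / 2 <= f u v.
Proof.
  intros HU Hf Hxy Hp.
  exists (fun u v => U u v /\ 0 < f u v - f x y / 2); split; [|split; [|split]].
  - apply open2_pos with (f := fun u v => f u v - f x y / 2); auto; intros u v Huv.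
    apply continuity_2d_pt_minus; [eapply Sm_cont; eauto | apply continuity_2d_pt_const].
  - intros u v [A _]; auto.
  - split; auto; lra.
  - intros u v [_ A]; lra.
Qed.

(** [O_s] bounds the derivatives pointwise, so the neighbourhood V may depend on the point; only the
    constant has to be uniform. *)
Lemma O_s_of_Cb s (D W : R -> R -> Prop) psi M C : 1 <= M ->
  (forall x y, D x y -> M < y -> Rabs (psi x y) <= C * (/ y) ^ 2) ->
  (forall x y, W x y -> M < y -> exists V, open2 V /\ V x y /\ Cb s V (C * (/ y) ^ 2) psi) ->
  O_s s 2 D W psi.
Proof.
  intros HM HD HW.
  assert (Hs : forall y r, M < y -> Rabs r <= C * (/ y) ^ 2 -> Rabs (y ^ 2 * r) <= C).
  { intros y r Hy Hr; assert (Hy2 : 0 < y ^ 2) by (apply pow_lt; lra).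
    rewrite Rabs_mult, (Rabs_right (y ^ 2)) by lra.
    replace C with (y ^ 2 * (C * (/ y) ^ 2)) by (field; lra).
    apply Rmult_le_compat_l; lra. }
  exists M, C; split; [intros; apply Hs; auto|].
  intros x y Hxy Hy; destruct (HW x y Hxy Hy) as (V & HV & HVx & HC); split.
  - eapply Cb_ex_diff_n; eauto.
  - intros i j Hij; apply Hs; auto; eapply Cb_partial_derive; eauto.
Qed.

Section Main.
Variables (l g : R -> R) (lpl L a b a' b' g0 Gm K Kq : R).
Hypothesis Hl : forall t, 0 < l t.
Hypothesis HL0 : 0 <= L.
Hypothesis HL : forall s t, Rabs (l s - l t) <= L * Rabs (s - t).
Hypothesis Hper : forall t, l (t + 1) = l t.
Hypothesis Hlg : forall t, 0 <= t <= 1 -> l t = g t.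
Hypothesis Ha : a < a'.
Hypothesis Ha' : a' < 0.
Hypothesis Hb' : 1 < b'.
Hypothesis Hb : b' < b.
Hypothesis Hg : smI a b g.
Hypothesis Hg0 : 0 < g0.
Hypothesis Hgb : forall t, a < t < b -> g0 <= g t <= Gm.
Hypothesis HK : 0 <= K.
Hypothesis Hgd : forall t, a < t < b -> Rabs (Derive g t) <= K.
Hypothesis HKq : 0 <= Kq.
Hypothesis Hq : forall t, a < t < b -> Rabs (2 / 3 * q g t) <= Kq.
Hypothesis Hlpl : lpl = Derive g 0.
Let S := S_ g.
Let al := S 1.
Let De := al * g 0 * (Derive_n g 1 0 - Derive_n g 1 1).
Let D1 := / 2 * al ^ 2 * g 0 ^ 3 * (Derive_n g 2 0 - Derive_n g 2 1).

Variables (r1 r2 : R) (dd Pc Qc : R -> R -> R).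
Hypothesis Hr2 : 0 < r2.
Hypothesis SP : Sm (box (S a') (S b') r2) Pc.
Hypothesis SQ : Sm (box (S a') (S b') r2) Qc.
Hypothesis Hflight : forall t ep, a' < t < b' -> 0 < ep < r2 -> let d := dd t ep in
    0 < d < r1 /\ seg a b t d /\ d = ep * sqrt (NN g g t d) /\ 0 < WW g g t d /\
    0 < WW g g (t + d) (- d) /\ 0 < NN g g t d /\ 0 < NN g g (t + d) (- d) /\
    S (t + d) * (sqrt (NN g g (t + d) (- d)) / d) / 2 = S t * / ep / 2 + 1 + ep ^ 3 * Pc (S t) ep /\
    sqrt (NN g g (t + d) (- d)) / d = / ep + ep ^ 3 * Qc (S t) ep.

Variables (rT re : R) (T kap : R -> R).
Hypothesis HrT : 0 < rT /\ rT < b'.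
Hypothesis Hre : 0 < re.
Hypothesis Skap : smI (- re) re kap.
Hypothesis HNst : forall t, - rT < t < rT -> a < t < b /\ 0 < Nst g t /\ 0 < WW g g t (- t).
Hypothesis HT : forall ep, - re < ep < re -> - rT < T ep < rT /\ T ep / sqrt (Nst g (T ep)) = ep /\
      S (T ep) = 2 * ep + ep ^ 4 * kap ep.
Hypothesis HTmon : forall t u, - rT < t -> t < u -> u < rT -> t / sqrt (Nst g t) < u / sqrt (Nst g u).

Variables (ri rw : R) (H H2 E : R -> R).
Hypothesis Hri : 0 < ri <= re.
Hypothesis Hrw : 0 < rw.
Hypothesis SH : smI (- ri) ri H.
Hypothesis SH2 : smI (- ri) ri H2.
Hypothesis SE : smI (- rw) rw E.
Hypothesis HH : forall ep, - ri < ep < ri -> is_derive H ep (- (al / 4) * (ep * kap ep)) /\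
        H ep = ep ^ 2 * H2 ep /\ 0 < al / 2 + ep * H ep.
Hypothesis HE : forall w, - rw < w < rw -> - ri < E w < ri /\ E w / (al / 2 + E w * H (E w)) = w.
Hypothesis HEmon : forall e1 e2, - ri < e1 -> e1 < e2 -> e2 < ri ->
        e1 / (al / 2 + e1 * H e1) < e2 / (al / 2 + e2 * H e2).

Variables (e1 : R) (k1 k2 B : R -> R -> R).
Hypothesis He1 : 0 < e1.
Hypothesis Sk1 : Sm (box (-1) 2 e1) k1.
Hypothesis Sk2 : Sm (box (-1) 2 e1) k2.
Hypothesis SB : Sm (box (-1) 2 e1) B.
Hypothesis Hkick : forall z ep, -1 < z < 2 -> 0 < ep < e1 -> exists t d,
    / 2 < t < b' /\ a' < t + d + -1 < / 2 /\ 0 < d /\ S t = al - 2 * (1 - z) * ep /\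
    d = ep * sqrt (NN g (shiftg g) t d) /\ B z ep = t + d + -1 /\
    0 < WW g (shiftg g) t d /\ 0 < WW (shiftg g) g (t + d) (- d) /\ 0 < NN g (shiftg g) t d /\
    0 < NN (shiftg g) g (t + d) (- d) /\
    S (B z ep) * (sqrt (NN (shiftg g) g (t + d) (- d)) / d) / 2 = z + ep ^ 2 * k1 z ep /\
    al / 2 * (sqrt (NN (shiftg g) g (t + d) (- d)) / d - / ep) =
      De * (z - / 2) + 2 / al * ep * D1 * ((z - / 2) ^ 2 - / 12) + ep ^ 2 * k2 z ep.

Let Hgpos t (Ht : a < t < b) : g0 <= g t := proj1 (Hgb t Ht).
Let Ha0 : a < 0 := Rlt_trans _ _ _ Ha Ha'.
Let Hb1 : 1 < b := Rlt_trans _ _ _ Hb' Hb.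

Definition sig (ep : R) : R := 2 * ep + ep ^ 4 * kap ep.
Definition tauc (t v : R) : R := S t / sig (/ Jf g t v).
Definition Ic (t v : R) : R := al / 2 * Jf g t v + H (/ Jf g t v).

Let SLt := S_lt_iff a b a' b' g g0 Hg Hg0 Hgpos Ha Ha' Hb' Hb.
Let SInj := S_inj a b a' b' g g0 Hg Hg0 Hgpos Ha Ha' Hb' Hb.

Lemma al_pos : 0 < al.
Proof. unfold al, S; rewrite <- (S_0 g); apply SLt; lra. Qed.

Definition Good (t v X J : R) : Prop :=
  a' < t < b' /\ 0 < wf g t v /\ 0 < J /\ Jf g t v = J /\ S t = 2 * X / J.

(** A step of [fstep] is a flight off the extended wall g, even past t = 1. The bounds on the new
    value of S keep the arrival time in (a', b'). *)
Lemma good_step : forall t v X J, Good t v X J -> / J < r2 ->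
  0 < snd (fstep Pc Qc (X, J)) ->
  S a' < 2 * fst (fstep Pc Qc (X, J)) / snd (fstep Pc Qc (X, J)) < S b' ->
  exists d, 0 < d /\ a < t + d < b /\ v * d = g t + g (t + d) /\
    Good (t + d) (v - 2 * Derive g (t + d)) (fst (fstep Pc Qc (X, J))) (snd (fstep Pc Qc (X, J))).
Proof.
  intros t v X J (G1 & G2 & G3 & G4 & G5) HJ HJ' HS'.
  assert (HiJ : 0 < / J) by (apply Rinv_0_lt_compat; auto).
  destruct (Hflight t (/ J) G1) as (F1 & [F2 F3] & F4 & F5 & F6 & F7 & F8 & F9 & F10); [lra|].
  set (d := dd t (/ J)) in *.
  assert (Ev : v * d = g t + g (t + d)).
  { apply (flight_of_Jf g g t v d); auto; try lra; rewrite ?G4; auto.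
    assert (Hgt := Hgpos t F2); lra. }
  destruct (Jf_after g g t v d ltac:(lra) Ev) as [A1 A2].
  set (v' := v - 2 * Derive g (t + d)) in *.
  assert (EJ : sqrt (NN g g (t + d) (- d)) / d = Jf g (t + d) v') by (rewrite A2; field; lra).
  rewrite EJ in F9, F10; rewrite Rinv_inv in F9, F10.
  set (X' := fst (fstep Pc Qc (X, J))) in *; set (J' := snd (fstep Pc Qc (X, J))) in *.
  assert (EJ' : Jf g (t + d) v' = J') by (unfold J', fstep; cbn [fst snd]; rewrite <- G5; lra).
  assert (EX : S (t + d) = 2 * X' / J').
  { apply Rmult_eq_reg_r with J'; [|lra]; replace (2 * X' / J' * J') with (2 * X') by (field; lra).
    rewrite EJ' in F9; assert (S t * J / 2 = X) by (rewrite G5; field; lra).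
    unfold X', fstep; cbn [fst snd]; rewrite <- G5; lra. }
  exists d; split; [lra|split; [auto|split; [auto|]]].
  split; [|split; [|split; [|split]]]; auto.
  - rewrite <- EX in HS'; destruct HS'; split; apply SLt; auto; lra.
  - apply Rmult_lt_reg_l with d; [lra|]; rewrite Rmult_0_r; fold v'; rewrite <- A1; lra.
Qed.

(** [kick] supplies a departure time with the prescribed value of S; injectivity of S identifies it
    with t. *)
Lemma kick_at : forall t v X J, Good t v X J -> / J < e1 -> -1 < 1 + X - al / 2 * J < 2 ->
  let z := 1 + X - al / 2 * J in
  exists d, 0 < d /\ a' < t + d + -1 < / 2 /\ v * d = g t + shiftg g (t + d) /\ B z (/ J) = t + d + -1 /\
    let t' := t + d + -1 in let v' := v - 2 * Derive g t' in
    0 < wf g t' v' /\ Jf g t' v' = Jp al De D1 k2 z J /\ 0 < Jp al De D1 k2 z J /\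
    S t' * Jp al De D1 k2 z J / 2 = z + (/ J) ^ 2 * k1 z (/ J).
Proof.
  intros t v X J (G1 & G2 & G3 & G4 & G5) HJ Hz z.
  assert (HiJ : 0 < / J) by (apply Rinv_0_lt_compat; auto).
  assert (Hal := al_pos).
  destruct (Hkick z (/ J) Hz) as (t0 & d & F1 & F2 & F3 & F4 & F5 & F6 & F7 & F8 & F9 & F10 & F11 & F12); [lra|].
  assert (Et : t0 = t).
  { apply SInj; try lra; fold S; rewrite F4, G5; unfold z; field; lra. }
  subst t0.
  assert (Ev : v * d = g t + shiftg g (t + d)).
  { apply (flight_of_Jf g (shiftg g) t v d); auto; rewrite ?G4; auto.
    assert (Hgt := Hgpos t ltac:(lra)); lra. }
  destruct (Jf_after g (shiftg g) t v d F3 Ev) as [A1 A2].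
  change (Derive (shiftg g)) with (Derive_n (shiftg g) 1) in A1, A2.
  rewrite Derive_n_shift, Jf_shiftg in A2; rewrite Derive_n_shift, wf_shiftg in A1.
  change (Derive_n g 1) with (Derive g) in A1, A2.
  exists d; split; [auto|split; [auto|split; [auto|split; [auto|]]]].
  set (t' := t + d + -1) in *; set (v' := v - 2 * Derive g t') in *; cbv zeta.
  assert (EJ : sqrt (NN (shiftg g) g (t + d) (- d)) / d = Jf g t' v') by (rewrite A2; field; lra).
  assert (Hw : 0 < wf g t' v').
  { apply Rmult_lt_reg_l with d; [lra|]; rewrite Rmult_0_r, <- A1; lra. }
  assert (HJ' : 0 < Jf g t' v').
  { rewrite <- EJ; apply Rdiv_lt_0_compat; auto; apply sqrt_lt_R0; auto. }
  rewrite EJ in F11, F12; rewrite Rinv_inv in F12.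
  assert (EJp : Jf g t' v' = Jp al De D1 k2 z J).
  { unfold Jp; rewrite <- F12; field; lra. }
  rewrite EJp in *; rewrite F6 in F11; auto.
Qed.

Let X0 := X_init kap E.
Let J0 := J_init E.
Let oX_ := oX Pc Qc X0 J0.
Let oJ_ := oJ Pc Qc X0 J0.
Let zf_ := zf al oX_ oJ_.
Let Kb_ := Kb al B oX_ oJ_.
Let K1_ := K1 al De D1 kap k1 k2 oX_ oJ_.
Let K2_ := K2 al De D1 H k2 oX_ oJ_.

Lemma orbit_bound5 : exists M C, 1 <= M /\ 0 <= C /\ / rw < M /\ forall x0 y0 n, -1 <= x0 <= 2 -> M < y0 -> INR n <= y0 + 2 ->
  Cb 5 (nb x0 y0) (C * (/ y0) ^ 2) (fun x y => oX_ n x y - (x + INR n)) /\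
  Cb 5 (nb x0 y0) (C * (/ y0) ^ 2) (fun x y => oJ_ n x y - 2 / al * y).
Proof.
  assert (Hal := al_pos).
  destruct (initial_bound 5 al re ri rw kap H H2 E) as (C0 & M0 & HC0 & HM0 & Hinit); auto.
  { intros ep Hep; split; apply HH; auto. }
  destruct (orbit_bound 5 al (S a') (S b') r2 Pc Qc X0 J0 Hal) with (C0 := C0) (M0 := M0)
    as (M & C & HM & HC & Ho); auto.
  { unfold S; rewrite <- (S_0 g); apply SLt; lra. }
  { apply SLt; lra. }
  exists (Rmax M M0), C; split; [eapply Rle_trans; [exact HM | apply Rmax_l]|].
  split; [auto|split; [eapply Rlt_le_trans; [exact HM0 | apply Rmax_r]|]].
  intros x0 y0 n Hx Hy Hn; apply Ho; auto; eapply Rle_lt_trans; [apply Rmax_l | exact Hy].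
Qed.

(** The pointwise part of the orbit estimate, with explicit small constants for counting flights; J1
    is an arbitrary threshold that J is made to exceed. *)
Lemma orbit_C0 : forall J1, exists M, 1 <= M /\ / rw < M /\ forall x y k, 0 <= x <= 1 -> M < y -> INR k <= y + 2 ->
  Rabs (oX_ k x y - (x + INR k)) <= / 64 /\ al / 2 * Rabs (oJ_ k x y - 2 / al * y) <= / 64 /\
  J1 <= oJ_ k x y /\ 0 < oJ_ k x y /\ S a' < 2 * oX_ k x y / oJ_ k x y < S b'.
Proof.
  intros J1; assert (Hal := al_pos).
  destruct orbit_bound5 as (M & C & HM & HC & HMrw & Ho).
  assert (HSa : S a' < 0) by (unfold S; rewrite <- (S_0 g); apply SLt; lra).
  assert (HSb : al < S b') by (apply SLt; lra).
  set (p := - S a') in *; set (dl := S b' - al) in *.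
  set (M' := 1 + M + 64 * C + 32 * al * C + al * Rabs J1 + 4 * al + 4 * al / p + (10 * al + S b' * (1 + al)) / dl).
  assert (P1 : 0 <= 64 * C) by lra.
  assert (P2 : 0 <= 32 * al * C) by (apply Rmult_le_pos; lra).
  assert (P3 : 0 <= al * Rabs J1) by (apply Rmult_le_pos; [lra|apply Rabs_pos]).
  assert (P4 : 0 < 4 * al / p) by (apply Rdiv_lt_0_compat; unfold p; lra).
  assert (P5 : 0 < S b' * (1 + al)) by (apply Rmult_lt_0_compat; lra).
  assert (P6 : 0 < (10 * al + S b' * (1 + al)) / dl) by (apply Rdiv_lt_0_compat; unfold dl; lra).
  exists M'; split; [unfold M'; lra|split; [unfold M'; lra|]].
  intros x y k Hx Hy Hk.
  assert (Hy1 : 1 < y) by (unfold M' in Hy; lra).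
  destruct (Ho x y k) as [O1 O2]; auto; [lra|unfold M' in Hy; lra|].
  assert (V1 := Cb_value _ _ _ _ _ _ O1 (nb_center x y)); assert (V2 := Cb_value _ _ _ _ _ _ O2 (nb_center x y)).
  cbv beta in V1, V2.
  assert (Hiy : 0 < / y <= 1).
  { split; [apply Rinv_0_lt_compat; lra|]; rewrite <- Rinv_1; apply Rinv_le_contravar; lra. }
  assert (Q : forall c, 0 <= c -> c * C <= y -> c * (C * (/ y) ^ 2) <= 1).
  { intros c Hc1 Hc2.
    assert (c * C * / y <= 1) by (apply Rmult_le_reg_r with y; [lra|]; rewrite Rmult_assoc, Rinv_l; lra).
    assert (0 <= c * C * / y) by (apply Rmult_le_pos; [apply Rmult_le_pos|]; lra).
    simpl; nra. }
  assert (Q1 := Q 64 ltac:(lra) ltac:(unfold M' in Hy; lra)).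
  assert (Q2 := Q (32 * al) ltac:(lra) ltac:(unfold M' in Hy; lra)).
  assert (V3 : al / 2 * Rabs (oJ_ k x y - 2 / al * y) <= / 64).
  { assert (al / 2 * Rabs (oJ_ k x y - 2 / al * y) <= al / 2 * (C * (/ y) ^ 2)) by (apply Rmult_le_compat_l; lra).
    lra. }
  split; [lra|split; [auto|]].
  set (X := oX_ k x y) in *; set (J := oJ_ k x y) in *.
  assert (V4 : Rabs (al * J - 2 * y) <= / 32).
  { replace (al * J - 2 * y) with (al * (J - 2 / al * y)) by (field; lra).
    rewrite Rabs_mult, (Rabs_right al) by lra; lra. }
  apply Rabs_le_between in V4; apply Rabs_le_between in V1.
  assert (Hik := pos_INR k).
  assert (B1 : y <= al * J) by lra.
  assert (HJ0 : 0 < J).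
  { apply Rmult_lt_reg_l with al; auto; lra. }
  split; [|split; [auto|]].
  - apply Rle_trans with (Rabs J1); [apply Rle_abs|].
    apply Rmult_le_reg_l with al; auto; unfold M' in Hy; lra.
  - split; apply Rmult_lt_reg_r with J; auto; replace (2 * X / J * J) with (2 * X) by (field; lra);
      apply Rmult_lt_reg_l with al; auto.
    + assert (D2 : 4 * al / p * p = 4 * al) by (field; unfold p; lra).
      assert (4 * al / p * p < y * p) by (apply Rmult_lt_compat_r; [unfold p; lra|]; unfold M' in Hy; lra).
      assert (p * y <= p * (al * J)) by (apply Rmult_le_compat_l; [unfold p; lra|auto]).
      replace (al * (S a' * J)) with (- (p * (al * J))) by (unfold p; ring). nra.
    + assert (D3 : (10 * al + S b' * (1 + al)) / dl * dl = 10 * al + S b' * (1 + al)) by (field; unfold dl; lra).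
      assert ((10 * al + S b' * (1 + al)) / dl * dl < y * dl)
        by (apply Rmult_lt_compat_r; [unfold dl; lra|]; unfold M' in Hy; lra).
      assert (S b' * (2 * y - / 32) <= S b' * (al * J)) by (apply Rmult_le_compat_l; lra).
      unfold dl in *; nra.
Qed.

Lemma sig_pos ep : 0 < ep < re -> 0 < sig ep /\ 0 < T ep < rT /\ S (T ep) = sig ep.
Proof.
  intros Hep; destruct (HT ep) as (A1 & A2 & A3); [lra|].
  assert (Hn : 0 < sqrt (Nst g (T ep))) by (apply sqrt_lt_R0, HNst; auto).
  assert (Et : T ep = ep * sqrt (Nst g (T ep))) by (rewrite <- A2 at 2; field; lra).
  assert (0 < T ep) by (rewrite Et; apply Rmult_lt_0_compat; lra).
  split; [|split; [lra|auto]].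
  unfold sig; rewrite <- A3; unfold S; rewrite <- (S_0 g); apply SLt; lra.
Qed.

(** A chain of monotone changes of variable: S increases in t, t / sqrt (Nst t) increases with
    inverse T, this quotient equals 1/J on f(S), and J increases in v. *)
Lemma strip_coordinate t v : 0 <= t < rT -> t < 1 -> 0 < wf g t v -> 0 < Jf g t v -> / Jf g t v < re ->
  (0 < t -> 0 < wf g t (vst g t)) ->
  ((0 < t -> v < vst g t) <-> S t < sig (/ Jf g t v)).
Proof.
  intros Ht Ht1 Hw HJ He Hwv.
  assert (HiJ : 0 < / Jf g t v) by (apply Rinv_0_lt_compat; auto).
  destruct (sig_pos (/ Jf g t v)) as (B1 & B2 & B3); [lra|].
  destruct (HT (/ Jf g t v)) as (_ & B4 & _); [lra|].
  rewrite <- B3.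
  set (ep := / Jf g t v) in *.
  assert (Q1 : S t < S (T ep) <-> t < T ep).
  { apply SLt; [lra|]; apply HNst; lra. }
  rewrite Q1; clear Q1.
  destruct (Rle_lt_or_eq_dec 0 t) as [Hp|<-]; [lra| |split; intros; lra].
  set (v0 := (g 0 + g t) / t).
  assert (Ev0 : v0 * t = g 0 + g (0 + t)) by (unfold v0; rewrite Rplus_0_l; field; lra).
  destruct (Jf_after g g 0 v0 t Hp Ev0) as [_ A2].
  rewrite Rplus_0_l in A2; fold (Nst g t) in A2.
  change (v0 - 2 * Derive g t) with (vst g t) in A2.
  assert (Hn : 0 < sqrt (Nst g t)) by (apply sqrt_lt_R0, HNst; lra).
  assert (HJv : 0 < Jf g t (vst g t)).
  { apply Rmult_lt_reg_l with t; auto; rewrite Rmult_0_r, <- A2; auto. }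
  assert (Es : t / sqrt (Nst g t) = / Jf g t (vst g t)) by (rewrite A2; field; lra).
  assert (Q2 : t < T ep <-> t / sqrt (Nst g t) < ep).
  { split; intros Hlt.
    - rewrite <- B4; apply HTmon; lra.
    - rewrite <- B4 in Hlt; destruct (Rtotal_order t (T ep)) as [|[Eq|Hgt]]; auto; exfalso.
      + rewrite <- Eq in Hlt; lra.
      + assert (T ep / sqrt (Nst g (T ep)) < t / sqrt (Nst g t)) by (apply HTmon; lra); lra. }
  rewrite Q2, Es; unfold ep.
  assert (Htb : a < t < b) by (apply HNst; lra).
  split.
  - intros Hv; apply Rinv_lt_contravar; [apply Rmult_lt_0_compat; auto|].
    apply (Jf_lt a b g g0 Gm Hg0 Hgb); auto.
  - intros Hlt _; destruct (Rtotal_order v (vst g t)) as [|[Eq|Hgt]]; auto; exfalso.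
    + rewrite Eq in Hlt; lra.
    + assert (Jf g t (vst g t) < Jf g t v) by (apply (Jf_lt a b g g0 Gm Hg0 Hgb); auto).
      assert (/ Jf g t v < / Jf g t (vst g t)); [|lra].
      apply Rinv_lt_contravar; [apply Rmult_lt_0_compat|]; auto.
Qed.

(** 1/I is e / (al/2 + e H(e)) at e = 1/J, and E inverts this function, so strict monotonicity gives
    E(1/I) = 1/J. Then S = tau sig(e) yields X = tau (1 + e^3 kap(e) / 2). *)
Lemma good_start t v : a' < t < b' -> 0 < wf g t v -> 0 < Jf g t v -> / Jf g t v < ri -> / rw < Ic t v ->
  Good t v (oX_ 0 (tauc t v) (Ic t v)) (oJ_ 0 (tauc t v) (Ic t v)).
Proof.
  intros Ht Hw HJ He Hy.
  set (x := tauc t v); set (y := Ic t v) in *.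
  assert (HiJ : 0 < / Jf g t v) by (apply Rinv_0_lt_compat; auto).
  set (ep := / Jf g t v) in *.
  destruct (E_pos al ri rw H H2 E Hrw) with (y := y) as [E1 E2]; auto.
  { intros e He'; split; apply HH; auto. }
  assert (E3 : E (/ y) = ep).
  { assert (Hal := al_pos).
    assert (F1 : forall e, 0 < e < ri -> y = al / (2 * e) + H e -> e / (al / 2 + e * H e) = / y).
    { intros e He' Ey; destruct (HH e) as (_ & _ & Hp); [lra|].
      rewrite Ey; field; repeat split; try lra. }
    assert (F2 := F1 _ E1 E2).
    assert (F3 : ep / (al / 2 + ep * H ep) = / y).
    { apply F1; [lra|]; unfold y, Ic, ep; f_equal; field; lra. }
    destruct (Rtotal_order (E (/ y)) ep) as [Hlt|[Eq|Hgt]]; auto; exfalso.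
    - assert (A := HEmon (E (/ y)) ep ltac:(lra) Hlt ltac:(lra)); lra.
    - assert (A := HEmon ep (E (/ y)) ltac:(lra) Hgt ltac:(lra)); lra. }
  assert (EJ : oJ_ 0 x y = Jf g t v).
  { unfold oJ_, oJ, orbit; simpl; unfold J0, J_init; rewrite E3; unfold ep; apply Rinv_inv. }
  assert (EX : oX_ 0 x y = x * (1 + ep ^ 3 * kap ep / 2)).
  { unfold oX_, oX, orbit; simpl; unfold X0, X_init; rewrite E3; reflexivity. }
  split; [auto|split; [auto|rewrite EJ; split; [auto|split; [auto|]]]].
  rewrite EX; destruct (sig_pos ep) as [Hs _]; [lra|].
  replace (S t) with (x * sig ep) by (unfold x, tauc; fold ep; field; lra).
  unfold sig; replace (Jf g t v) with (/ ep) by (unfold ep; apply Rinv_inv); field; lra.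
Qed.

(** * The orbit of a point of the strip until its return *)

Variables (rho V0 Jb J2 : R).
Hypothesis Hrho : 0 < rho /\ rho < 1 /\ rho < b /\ rho * (L + 1) <= g0.
Hypothesis Hstrip : forall t v, strip l lpl V0 (t, v) <-> 0 <= t < rho /\ V0 < v /\ (0 < t -> v < vst g t).
Hypothesis HJb : 0 < Jb /\ / Jb < ri /\ / Jb < r2 /\ / Jb < e1.
Hypothesis HJbv : forall t v, a < t < b -> 0 < wf g t v -> Jb <= Jf g t v -> L < v /\ K < v /\ 2 * Gm / rho < v.
Hypothesis HV0 : forall t v, a < t < b -> V0 < v -> 0 < wf g t v /\ Jb <= Jf g t v.
Hypothesis HV0T : 0 < V0 /\ 2 * Gm + 2 * K <= V0 * rT.
Hypothesis HJ2 : 0 < J2 /\ forall t v, a < t < b -> 0 < wf g t v -> J2 <= Jf g t v -> V0 < v.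
Let f := collision_map l lpl.
Let A := strip l lpl V0.

Lemma inv_Jb J : Jb <= J -> 0 < / J /\ / J < ri /\ / J < r2 /\ / J < e1.
Proof.
  intros HJ; destruct HJb as (A1 & A2 & A3 & A4).
  assert (0 < / J) by (apply Rinv_0_lt_compat; lra).
  assert (/ J <= / Jb) by (apply Rinv_le_contravar; lra). lra.
Qed.

Lemma wf_vst_pos t : 0 < t -> t < rT -> 0 < wf g t (vst g t).
Proof.
  intros H1' H2'; destruct (HNst t) as (B1 & B2 & B3); [lra|].
  set (v0 := (g 0 + g t) / t).
  assert (Ev0 : v0 * t = g 0 + g (0 + t)) by (unfold v0; rewrite Rplus_0_l; field; lra).
  destruct (Jf_after g g 0 v0 t H1' Ev0) as [A1 _].
  rewrite Rplus_0_l in A1; change (v0 - 2 * Derive g t) with (vst g t) in A1.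
  apply Rmult_lt_reg_l with t; [auto|]; rewrite Rmult_0_r, <- A1; auto.
Qed.

Lemma strip_tau t v : A (t, v) -> 0 <= t < rT /\ t < rho /\ V0 < v /\ a' < t < b' /\ 0 < wf g t v /\
  Jb <= Jf g t v /\ S t < sig (/ Jf g t v) /\ 0 <= tauc t v < 1.
Proof.
  intros HA; apply Hstrip in HA; destruct HA as (B1 & B2 & B3).
  assert (Htb : a < t < b) by lra.
  destruct (HV0 t v Htb B2) as [B4 B5].
  destruct (inv_Jb _ B5) as (C1 & C2 & _).
  (* In the strip v < vst t, which is of order 1/t, so v > V0 bounds t; [HV0T] turns this into t <
     rT. *)
  assert (HtT : t < rT).
  { destruct (Rle_lt_or_eq_dec 0 t) as [Hp|<-]; [lra| |lra].
    specialize (B3 Hp); unfold vst in B3.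
    destruct (Hgb 0) as [_ D2]; [lra|]; destruct (Hgb t Htb) as [_ D4].
    assert (D5 := Hgd t Htb); apply Rabs_le_between in D5.
    assert (E1 : V0 * t < 2 * Gm + 2 * K).
    { assert (E2 : (V0 + 2 * Derive g t) * t < (g 0 + g t) / t * t) by (apply Rmult_lt_compat_r; lra).
      replace ((g 0 + g t) / t * t) with (g 0 + g t) in E2 by (field; lra).
      assert (t * (- K) <= t * Derive g t) by (apply Rmult_le_compat_l; lra).
      assert (t * K <= 1 * K) by (apply Rmult_le_compat_r; lra). lra. }
    destruct HV0T as [F1 F2]; apply Rmult_lt_reg_l with V0; lra. }
  assert (HJ : 0 < Jf g t v) by (destruct HJb; lra).
  assert (HS : S t < sig (/ Jf g t v)).
  { apply strip_coordinate; auto; try lra. intros Hp; apply wf_vst_pos; auto. }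
  assert (HS0 : 0 <= S t).
  { unfold S; rewrite <- (S_0 g); destruct (Rle_lt_or_eq_dec 0 t) as [Hp|<-]; [lra| |lra].
    apply Rlt_le, SLt; lra. }
  repeat split; auto; try lra.
  - unfold tauc; apply Rle_mult_inv_pos; lra.
  - unfold tauc; apply Rmult_lt_reg_r with (sig (/ Jf g t v)); [lra|].
    replace (S t / sig (/ Jf g t v) * sig (/ Jf g t v)) with (S t) by (field; lra); lra.
Qed.

Lemma tau_strip t v : 0 <= t -> t < rho -> t < rT -> V0 < v -> S t < sig (/ Jf g t v) -> A (t, v).
Proof.
  intros B1 B2 B3 B4 HS; apply Hstrip; split; [lra|split; [auto|]].
  assert (Htb : a < t < b) by lra.
  destruct (HV0 t v Htb B4) as [B5 B6]; destruct (inv_Jb _ B6) as (C1 & C2 & _).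
  assert (HJ : 0 < Jf g t v) by (destruct HJb; lra).
  apply strip_coordinate; auto; try lra; intros Hp; apply wf_vst_pos; auto.
Qed.

Lemma oXJ_S k x y : oX_ (Datatypes.S k) x y = fst (fstep Pc Qc (oX_ k x y, oJ_ k x y)) /\
  oJ_ (Datatypes.S k) x y = snd (fstep Pc Qc (oX_ k x y, oJ_ k x y)).
Proof.
  unfold oX_, oJ_, oX, oJ; set (o := orbit Pc Qc X0 J0 k x y).
  change (orbit Pc Qc X0 J0 (Datatypes.S k) x y) with (fstep Pc Qc o).
  rewrite <- surjective_pairing; auto.
Qed.

(** The formal orbit continues past t = 1 on the extended wall, while the actual one is known to
    follow it only below t = 1. Times increase along it, so a condition on the last time suffices.
    By [not_in_strip] no image on the way lies in the strip. *)
Lemma orbit_run : exists M, 1 <= M /\ forall t v, A (t, v) -> M < Ic t v -> forall k,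
  INR k <= Ic t v + 2 -> exists tk vk,
  Good tk vk (oX_ k (tauc t v) (Ic t v)) (oJ_ k (tauc t v) (Ic t v)) /\
  Jb <= oJ_ k (tauc t v) (Ic t v) /\ t <= tk /\ (k = 0%nat -> tk = t) /\
  (tk < 1 -> Nat.iter k f (t, v) = (tk, vk) /\ forall j, (0 < j <= k)%nat -> ~ A (Nat.iter j f (t, v))).
Proof.
  destruct (orbit_C0 Jb) as (M & HM & HMr & HO).
  exists M; split; auto; intros t v HA Hy.
  destruct (strip_tau t v HA) as (B1 & B2 & B3 & B4 & B5 & B6 & B7 & B8).
  destruct (inv_Jb _ B6) as (C1 & C2 & C3 & C4).
  assert (HJ : 0 < Jf g t v) by (destruct HJb; lra).
  set (x := tauc t v) in *; set (y := Ic t v) in *.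
  induction k as [|k IH]; intros Hk.
  - exists t, v; split; [apply good_start; auto; fold y; lra|].
    destruct (HO x y 0%nat) as (_ & _ & Dq1 & _); [lra|auto|auto|].
    split; [auto|split; [lra|split; [auto|]]]; intros _; split; [reflexivity|]; intros j Hj; lia.
  - rewrite S_INR in Hk.
    destruct IH as (tk & vk & G1 & G2 & G3 & _ & G4); [lra|].
    destruct (HO x y (Datatypes.S k)) as (_ & _ & Dq1 & D2 & D3); [lra|auto|rewrite S_INR; lra|].
    destruct (oXJ_S k x y) as [EX EJ].
    destruct (inv_Jb _ G2) as (F1 & F2 & F3 & F4).
    destruct (good_step tk vk _ _ G1 F3) as (d & P1 & P2 & P3 & P4).
    { rewrite <- EJ; auto. }
    { rewrite <- EX, <- EJ; auto. }
    rewrite <- EX, <- EJ in P4.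
    exists (tk + d), (vk - 2 * Derive g (tk + d)).
    split; [auto|split; [auto|split; [lra|split; [discriminate|]]]]; intros Htk.
    destruct G4 as [G4 G5]; [lra|].
    destruct G1 as (Q1 & Q2 & Q3 & Q4 & Q5).
    destruct (HJbv tk vk) as (L1 & L2 & L3); [lra|auto|rewrite Q4; auto|].
    assert (Eit : Nat.iter (Datatypes.S k) f (t, v) = (tk + d, vk - 2 * Derive g (tk + d))).
    { change (Nat.iter (Datatypes.S k) f (t, v)) with (f (Nat.iter k f (t, v))); rewrite G4.
      apply (regular_collision l g lpl L Hl HL Hper Hlg Hlpl); auto; lra. }
    split; auto; intros j Hj.
    destruct (Nat.eq_dec j (Datatypes.S k)) as [->|Hne]; [|apply G5; lia].
    rewrite Eit; intros HA'; apply Hstrip in HA'; destruct HA' as (_ & _ & HA').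
    apply (not_in_strip l g L HL Hlg tk (tk + d) vk); try lra.
Qed.

(** [zf_ n] < 1 says that after n regular flights the particle is still before t = 1, and [Kb_ n] >=
    0 that the flight computed with the shifted wall does not arrive before it. So the next flight
    is the one across the jump and lands in the strip, which no earlier image does. *)
Lemma first_return : exists M, 1 <= M /\ forall t v n, A (t, v) -> M < Ic t v -> INR n <= Ic t v + 2 ->
  let x := tauc t v in let y := Ic t v in
  -1 < zf_ n x y < 1 -> 0 <= Kb_ n x y -> J2 <= Jp al De D1 k2 (zf_ n x y) (oJ_ n x y) ->
  / Jp al De D1 k2 (zf_ n x y) (oJ_ n x y) < ri ->
  1 / 2 <= 1 + (/ Jp al De D1 k2 (zf_ n x y) (oJ_ n x y)) ^ 3 * kap (/ Jp al De D1 k2 (zf_ n x y) (oJ_ n x y)) / 2 ->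
  first_return_time f A (t, v) (Datatypes.S n) /\
  exists t' v', Nat.iter (Datatypes.S n) f (t, v) = (t', v') /\ A (t', v') /\
    t' = Kb_ n x y /\ tauc t' v' = K1_ n x y /\ Ic t' v' = K2_ n x y.
Proof.
  destruct orbit_run as (M & HM & HR).
  exists M; split; auto; intros t v n HA Hy Hn x y Hz HKb HJp2 HJpr HJpk.
  destruct (HR t v HA Hy n Hn) as (tn & vn & G1 & G2 & G3 & _ & G4); fold x y in G1, G2.
  destruct (inv_Jb _ G2) as (F1 & F2 & F3 & F4).
  assert (Hal := al_pos).
  destruct (strip_tau t v HA) as (B1 & _).
  pose proof G1 as (Q1 & Q2 & Q3 & Q4 & Q5).
  set (X := oX_ n x y) in *; set (J := oJ_ n x y) in *.
  assert (Ez : zf_ n x y = 1 + X - al / 2 * J) by reflexivity.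
  assert (Htn : tn < 1).
  { apply SLt; [lra|lra|]; fold S; rewrite Q5; fold al.
    apply Rmult_lt_reg_r with J; auto; replace (2 * X / J * J) with (2 * X) by (field; lra); lra. }
  destruct (G4 Htn) as [G5 G6].
  destruct (kick_at tn vn X J G1 F4) as (d & P1 & P2 & P3 & P4 & P5 & P6 & P7 & P8); [lra|].
  rewrite <- Ez in P4, P6, P7, P8.
  set (z := zf_ n x y) in *.
  change (B z (/ J)) with (Kb_ n x y) in P4.
  set (t' := tn + d + -1) in *; set (v' := vn - 2 * Derive g t') in *.
  set (Jq := Jp al De D1 k2 z J) in *.
  destruct (HJbv tn vn) as (L1 & L2 & L3); [lra|auto|rewrite Q4; auto|].
  assert (Eit : Nat.iter (Datatypes.S n) f (t, v) = (t', v')).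
  { change (Nat.iter (Datatypes.S n) f (t, v)) with (f (Nat.iter n f (t, v))); rewrite G5.
    apply (kick_collision l g lpl L Hl HL Hper Hlg Hlpl); auto; unfold t' in *; lra. }
  assert (Htb : a < t' < b) by lra.
  assert (HV' : V0 < v') by (destruct HJ2 as [_ HJ2']; apply (HJ2' t'); auto; rewrite P6; auto).
  assert (HGr : 2 * Gm / rho * rho = 2 * Gm) by (field; lra).
  (* As the departure precedes t = 1, the time t' = tn + d - 1 is below d, hence below rho. *)
  assert (Hd : d < rho).
  { destruct (Rlt_le_dec d rho) as [|Hle]; auto; exfalso.
    destruct (Hgb tn) as [_ U1]; [lra|]; destruct (Hgb t') as [_ U2]; [lra|].
    unfold shiftg in P3; fold t' in P3.
    assert (0 < Gm) by (destruct (Hgb 0); lra).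
    assert (0 < 2 * Gm / rho) by (apply Rdiv_lt_0_compat; lra).
    assert (2 * Gm / rho * rho <= 2 * Gm / rho * d) by (apply Rmult_le_compat_l; lra).
    assert (2 * Gm / rho * d < vn * d) by (apply Rmult_lt_compat_r; lra).
    lra. }
  assert (HA' : A (t', v')).
  { apply Hstrip; split; [unfold t' in *; lra|split; [auto|]]; intros Hp.
    apply (in_strip_after_kick l g L a b g0 Gm HL0 HL Hper Hlg Ha0 Hb1 Hg0 Hgb (tn + -1) t' vn rho);
      try lra.
    - unfold t'; lra.
    - replace (t' - (tn + -1)) with d by (unfold t'; ring); rewrite P3.
      unfold shiftg; fold t'; f_equal; f_equal; ring. }
  split.
  - split; [lia|split; [rewrite Eit; auto|]]; intros j Hj; apply G6; lia.
  - exists t', v'; split; [auto|split; [auto|split; [auto|]]].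
    assert (HiJq : 0 < / Jq) by (apply Rinv_0_lt_compat; auto).
    split.
    + unfold tauc; rewrite P6.
      change (K1_ n x y) with ((z + (/ J) ^ 2 * k1 z (/ J)) / (1 + (/ Jq) ^ 3 * kap (/ Jq) / 2)).
      rewrite <- P8.
      replace (sig (/ Jq)) with (2 * / Jq * (1 + (/ Jq) ^ 3 * kap (/ Jq) / 2)) by (unfold sig; field; lra).
      set (k := 1 + (/ Jq) ^ 3 * kap (/ Jq) / 2) in *; field; lra.
    + unfold Ic; rewrite P6; reflexivity.
Qed.

(** n is least such that one more regular flight reaches t = 1, that is, brings zf to at least 1.
    Since zf grows by nearly 1 at that flight, it is above - 1/8 before it; by [crossing] the flight
    computed with the shifted wall crosses as well. *)
Lemma return_exists : exists M, 1 <= M /\ forall t v, A (t, v) -> M < Ic t v ->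
  exists n, INR n <= Ic t v + 1 /\ - (1 / 8) <= zf_ n (tauc t v) (Ic t v) < 1 /\ 0 <= Kb_ n (tauc t v) (Ic t v).
Proof.
  destruct orbit_run as (M & HM & HR), (orbit_C0 Jb) as (M' & HM' & _ & HO).
  exists (M + M'); split; [lra|]; intros t v HA Hy.
  assert (Hal := al_pos).
  destruct (strip_tau t v HA) as (B1 & B2 & _ & _ & _ & _ & _ & B8).
  set (x := tauc t v) in *; set (y := Ic t v) in *.
  set (P := fun n => al * oJ_ (Datatypes.S n) x y <= 2 * oX_ (Datatypes.S n) x y).
  assert (Hex : exists n, INR (Datatypes.S n) <= y + 2 /\ P n).
  { destruct (archimed (y + 1 / 2)) as [U1 U2]; set (N := up (y + 1 / 2)) in *.
    assert (HN : (0 < N)%Z) by (apply lt_IZR; lra).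
    exists (Z.to_nat (N - 1)).
    assert (EN : INR (Datatypes.S (Z.to_nat (N - 1))) = IZR N).
    { rewrite INR_IZR_INZ, Nat2Z.inj_succ, Z2Nat.id by lia; f_equal; lia. }
    rewrite EN; split; [lra|].
    destruct (HO x y (Datatypes.S (Z.to_nat (N - 1)))) as (Dq1 & D2 & _); [lra|lra|rewrite EN; lra|].
    rewrite EN in Dq1; unfold P; set (X := oX_ _ x y) in *; set (J := oJ_ _ x y) in *.
    apply Rabs_le_between in Dq1.
    assert (D3 : Rabs (al / 2 * (J - 2 / al * y)) <= / 64) by (rewrite Rabs_mult, Rabs_right; lra).
    replace (al / 2 * (J - 2 / al * y)) with (al / 2 * J - y) in D3 by (field; lra).
    apply Rabs_le_between in D3; lra. }
  destruct (dec_inh_nat_subset_has_unique_least_element (fun n => INR (Datatypes.S n) <= y + 2 /\ P n))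
    as (n & [[Hn1 HPn] Hmin] & _); [intros n; apply Classical_Prop.classic | exact Hex |].
  rewrite S_INR in Hn1.
  exists n; split; [lra|].
  destruct (HR t v HA ltac:(fold y; lra) n ltac:(fold y; lra)) as (tn & vn & G1 & G2 & G3 & Gz & _); fold x y in G1, G2.
  destruct (inv_Jb _ G2) as (F1 & F2 & F3 & F4).
  destruct (HO x y (Datatypes.S n)) as (Dq1 & D2 & D3 & D4 & D5); [lra|lra|rewrite S_INR; lra|].
  destruct (HO x y n) as (C1 & C2 & _); [lra|lra|lra|].
  destruct (oXJ_S n x y) as [EX EJ].
  destruct (good_step tn vn _ _ G1 F3) as (d & P1 & P2 & P3 & P4).
  { rewrite <- EJ; auto. }
  { rewrite <- EX, <- EJ; auto. }
  rewrite <- EX, <- EJ in P4; destruct P4 as (R1 & _ & _ & _ & R5).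
  pose proof G1 as (Q1 & Q2 & Q3 & Q4 & Q5).
  set (X := oX_ n x y) in *; set (J := oJ_ n x y) in *.
  set (X' := oX_ (Datatypes.S n) x y) in *; set (J' := oJ_ (Datatypes.S n) x y) in *.
  assert (Htn : tn < 1 /\ 2 * X < al * J).
  { assert (H2X : 2 * X < al * J -> tn < 1).
    { intros Hlt; apply SLt; [lra|lra|]; fold S; rewrite Q5; fold al.
      apply Rmult_lt_reg_r with J; auto; replace (2 * X / J * J) with (2 * X) by (field; lra); lra. }
    assert (H2X' : 2 * X < al * J); [|auto].
    (* For n > 0 minimality applies to n - 1; for n = 0 the point is the starting point, whose time
       is below 1. *)
    destruct n as [|m].
    - assert (St : S tn < S 1) by (rewrite (Gz eq_refl); apply SLt; lra).
      fold al in St; rewrite Q5 in St; apply (Rmult_lt_compat_r J) in St; auto.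
      replace (2 * X / J * J) with (2 * X) in St by (field; lra); lra.
    - destruct (Rlt_le_dec (2 * X) (al * J)) as [|Hle]; auto; exfalso.
      assert (Hm : INR (Datatypes.S m) <= y + 2 /\ P m) by (split; [lra|exact Hle]).
      apply Hmin in Hm; lia. }
  destruct Htn as [Htn H2X].
  assert (Ezn : zf_ n x y = 1 + X - al / 2 * J) by reflexivity.
  assert (HPn' : al * J' <= 2 * X') by exact HPn.
  assert (Hz : - (1 / 8) <= zf_ n x y < 1).
  { rewrite Ezn; split; [|lra].
    assert (E1 : Rabs (al / 2 * (J - 2 / al * y)) <= / 64) by (rewrite Rabs_mult, (Rabs_right (al / 2)); lra).
    assert (E2 : Rabs (al / 2 * (J' - 2 / al * y)) <= / 64) by (rewrite Rabs_mult, (Rabs_right (al / 2)); lra).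
    replace (al / 2 * (J - 2 / al * y)) with (al / 2 * J - y) in E1 by (field; lra).
    replace (al / 2 * (J' - 2 / al * y)) with (al / 2 * J' - y) in E2 by (field; lra).
    rewrite S_INR in Dq1.
    apply Rabs_le_between in E1; apply Rabs_le_between in E2.
    apply Rabs_le_between in Dq1; apply Rabs_le_between in C1; lra. }
  split; [auto|].
  destruct (kick_at tn vn X J G1 F4) as (d2 & K1' & K2' & K3' & K4' & _); [rewrite Ezn in Hz; lra|].
  rewrite <- Ezn in K4'; change (B (zf_ n x y) (/ J)) with (Kb_ n x y) in K4'; rewrite K4'.
  assert (Htd : 1 <= tn + d).
  { destruct (Rle_lt_dec 1 (tn + d)) as [|Hlt]; auto; exfalso.
    assert (St : S (tn + d) < S 1) by (apply SLt; lra).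
    fold al in St; rewrite R5 in St; apply (Rmult_lt_compat_r J') in St; auto.
    replace (2 * X' / J' * J') with (2 * X') in St by (field; lra); lra. }
  destruct (HJbv tn vn) as (L1 & L2 & L3); [lra|auto|rewrite Q4; auto|].
  assert (Hc := crossing l g a b K Hper Hlg Ha0 Hb1 Hg Hgd tn vn d d2 ltac:(lra) L2 P3 P2 Htd K3' ltac:(lra)).
  lra.
Qed.

(** * The coordinates (tau, I) on the strip *)

Hypothesis Hrwb : forall J, Jb <= J -> / rw < al / 2 * J + H (/ J).

Lemma smI_sig : smI (- ri) ri sig.
Proof.
  assert (Sx : Sm (itv (- ri) ri) (fun x _ => x)).
  { apply Sm_fst with ri; intros x y Hx; unfold itv in Hx; apply Rabs_le; lra. }
  assert (Sk : smI (- ri) ri kap) by (apply (smI_sub (- re) re); auto; lra).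
  unfold smI, sig in *; sm.
Qed.

(** The neighbourhood is shrunk three times, so that in turn the radicand of J, J - 1/ri and
    sig(1/J) stay bounded below by positive numbers; every function entering tau and I is then
    evaluated inside its domain. *)
Lemma coordinates_smooth t0 v0 : a < t0 < b -> 0 < wf g t0 v0 -> 0 < Jf g t0 v0 -> / Jf g t0 v0 < ri ->
  0 < sig (/ Jf g t0 v0) ->
  exists U, open2 U /\ U t0 v0 /\ Sm U (Jf g) /\ Sm U tauc /\ Sm U Ic.
Proof.
  intros Ht Hw HJ Hri' Hs.
  set (U0 := fun t v => itv a b t v /\ v0 - 1 < v < v0 + 1).
  assert (HU0 : open2 U0).
  { apply open2_and; [apply open2_itv|].
    apply (open2_and (fun _ v => v0 - 1 < v) (fun _ v => v < v0 + 1)).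
    - apply open2_lt_cont with (fun _ v => v - (v0 - 1)); [|intros; lra].
      intros; apply continuity_2d_pt_minus; [apply continuity_2d_pt_id2 | apply continuity_2d_pt_const].
    - apply open2_lt_cont with (fun _ v => v0 + 1 - v); [|intros; lra].
      intros; apply continuity_2d_pt_minus; [apply continuity_2d_pt_const | apply continuity_2d_pt_id2]. }
  assert (Sin : forall h, smI a b h -> Sm U0 (fun t _ => h t)).
  { intros h Hh; apply Sm_sub with (itv a b); auto; intros x y [Hx _]; exact Hx. }
  assert (Sv : Sm U0 (fun _ v => v)).
  { apply Sm_snd with (Rabs v0 + 1); intros x y [_ Hy].
    apply Rabs_le; assert (A1 := Rle_abs v0); assert (A2 := Rabs_maj2 v0); lra. }
  assert (Sg := Sin g Hg); assert (Sg' := Sin _ (smI_Derive_n a b g 1 Hg)); assert (Sq := Sin _ (smI_q a b g Hg)).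
  cbv beta in Sg'; change (Derive_n g 1) with (Derive g) in Sg'.
  set (rad := fun t v => wf g t v ^ 2 + 2 / 3 * q g t).
  assert (Srad : Sm U0 rad) by (unfold rad, wf; sm).
  assert (Hrad : 0 < rad t0 v0) by (assert (A1 := Jf_sq g t0 v0 HJ); fold (rad t0 v0) in A1; rewrite <- A1; apply pow_lt; auto).
  destruct (Sm_pos_nbhd U0 rad t0 v0) as (U1 & HU1 & HU01 & HU1t & HU1b); auto.
  { split; [exact Ht | lra]. }
  assert (SJ1 : Sm U1 (Jf g)).
  { apply (Sm_sqrt U1 rad (rad t0 v0 / 2)); auto; [lra|]; apply Sm_sub with U0; auto. }
  assert (Hc : 0 < Jf g t0 v0 - / ri).
  { apply Rlt_0_minus; rewrite <- (Rinv_inv (Jf g t0 v0)); apply Rinv_lt_contravar; auto.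
    apply Rmult_lt_0_compat; [apply Rinv_0_lt_compat|]; lra. }
  destruct (Sm_pos_nbhd U1 (fun t v => Jf g t v - / ri) t0 v0) as (U2 & HU2 & HU12 & HU2t & HU2b); auto.
  { sm. }
  assert (Hiri : 0 < / ri) by (apply Rinv_0_lt_compat; lra).
  assert (HJ2b : forall t v, U2 t v -> / ri < Jf g t v) by (intros t v HU; assert (A1 := HU2b t v HU); lra).
  assert (SJ2 : Sm U2 (Jf g)) by (apply Sm_sub with U1; auto).
  assert (SI2 : Sm U2 (fun t v => / Jf g t v)).
  { apply Sm_inv with (/ ri); auto; intros t v HU; rewrite Rabs_right; assert (A1 := HJ2b t v HU); lra. }
  assert (HI2 : forall t v, U2 t v -> - ri < / Jf g t v < ri).
  { intros t v HU; assert (A1 := HJ2b t v HU).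
    assert (0 < / Jf g t v) by (apply Rinv_0_lt_compat; lra).
    split; [lra|]; rewrite <- (Rinv_inv ri); apply Rinv_lt_contravar; auto.
    apply Rmult_lt_0_compat; lra. }
  assert (Ss2 : Sm U2 (fun t v => sig (/ Jf g t v))).
  { apply (Sm_comp1 U2 (- ri) ri sig); auto; apply smI_sig. }
  destruct (Sm_pos_nbhd U2 (fun t v => sig (/ Jf g t v)) t0 v0) as (U3 & HU3 & HU23 & HU3t & HU3b); auto.
  exists U3; split; [auto|split; [auto|split; [|split]]].
  - apply Sm_sub with U2; auto.
  - unfold tauc.
    apply (Sm_div U3 (fun t _ => S t) (fun t v => sig (/ Jf g t v)) (sig (/ Jf g t0 v0) / 2)); [lra| | |].
    + intros t v HU; rewrite Rabs_right; assert (A1 := HU3b t v HU); lra.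
    + apply Sm_sub with U0; auto; apply Sin; apply (smI_S a b g g0); auto.
    + apply Sm_sub with U2; auto.
  - apply Sm_sub with U2; auto; unfold Ic.
    assert (SHc : Sm U2 (fun t v => H (/ Jf g t v))) by (apply (Sm_comp1 U2 (- ri) ri H); auto).
    sm.
Qed.

(** tau and I depend on (t, v) through S and J only, so the t-derivative of J drops out of the
    determinant. What remains is the product of S' = 1/g^2, dJ/dv = w g / J and (dI/dJ) / sig = al J
    / 4. *)
Lemma coordinates_jacobian t v : a < t < b -> 0 < wf g t v -> 0 < Jf g t v -> / Jf g t v < ri ->
  0 < sig (/ Jf g t v) -> jacobian tauc Ic t v = al / 4 * (v + Derive g t).
Proof.
  intros Ht Hw HJ Hri' Hs.
  destruct (coordinates_smooth t v Ht Hw HJ Hri' Hs) as (U & HU & HUt & SJ & _ & _).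
  destruct (Sm_deriv U (Jf g) HU SJ) as (Jt & Jv & Hd & _).
  destruct (Hd t v HUt) as [Dt _]; set (jt := Jt t v) in *; clearbody jt; clear Hd Jv.
  assert (HiJ : 0 < / Jf g t v) by (apply Rinv_0_lt_compat; auto).
  set (J := Jf g t v) in *.
  assert (Hgt := Hgpos t Ht).
  assert (Dv : is_derive (fun z => Jf g t z) v (wf g t v * g t / J)).
  { assert (A1 := Jf_sq g t v HJ); fold J in A1.
    assert (0 < J ^ 2) by (apply pow_lt; auto).
    unfold Jf, wf; auto_derive.
    - unfold wf in A1; rewrite A1 in *; lra.
    - change (sqrt _) with J; unfold wf; field; lra. }
  assert (Dinv : is_derive (fun z => / z) J (- / J ^ 2)) by (auto_derive; [lra | field; lra]).
  assert (Ds : is_derive (fun z => / sig (/ z)) J (- (- / J ^ 2 * Derive sig (/ J)) / sig (/ J) ^ 2)).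
  { apply (is_derive_inv (fun z => sig (/ z))); [|lra].
    apply (is_derive_comp sig (fun z => / z)); auto.
    apply (smI_is_derive (- ri) ri); [apply smI_sig | lra]. }
  assert (Di : is_derive (fun z => al / 2 * z + H (/ z)) J (al / 4 * (J * sig (/ J)))).
  { destruct (HH (/ J)) as (A1 & _ & _); [lra|].
    replace (al / 4 * (J * sig (/ J))) with (al / 2 + - / J ^ 2 * (- (al / 4) * (/ J * kap (/ J))))
      by (unfold sig; field; lra).
    apply (is_derive_plus (V := R_NormedModule)).
    - auto_derive; auto; ring.
    - apply (is_derive_comp H (fun z => / z)); auto. }
  set (ds := - (- / J ^ 2 * Derive sig (/ J)) / sig (/ J) ^ 2) in *.
  set (di := al / 4 * (J * sig (/ J))) in *.
  assert (DS : is_derive S t (/ g t ^ 2)) by (apply (S_is_derive a b g g0); auto).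
  assert (E1 : Derive (fun z => tauc z v) t = / g t ^ 2 * / sig (/ J) + S t * (jt * ds)).
  { apply is_derive_unique; unfold tauc, Rdiv; apply (is_derive_mult (K := R_AbsRing) S (fun z => / sig (/ Jf g z v)) t (/ g t ^ 2) (jt * ds)); auto.
    - apply (is_derive_comp (fun z => / sig (/ z)) (fun z => Jf g z v)); auto.
    - intros; apply Rmult_comm. }
  assert (E2 : Derive (fun z => Ic t z) v = wf g t v * g t / J * di).
  { apply is_derive_unique; apply (is_derive_comp (fun z => al / 2 * z + H (/ z)) (fun z => Jf g t z)); auto. }
  assert (E3 : Derive (fun z => Ic z v) t = jt * di).
  { apply is_derive_unique; apply (is_derive_comp (fun z => al / 2 * z + H (/ z)) (fun z => Jf g z v)); auto. }
  assert (E4 : Derive (fun z => tauc t z) v = S t * (wf g t v * g t / J * ds)).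
  { apply is_derive_unique; unfold tauc, Rdiv.
    apply (is_derive_scal (fun z => / sig (/ Jf g t z)) v (S t)).
    apply (is_derive_comp (fun z => / sig (/ z)) (fun z => Jf g t z)); auto. }
  unfold jacobian; rewrite E1, E2, E3, E4; unfold di, wf; field; repeat split; lra.
Qed.

Lemma coordinates_injective t v t' v' : A (t, v) -> A (t', v') ->
  tauc t v = tauc t' v' -> Ic t v = Ic t' v' -> t = t' /\ v = v'.
Proof.
  intros HA HA' Et EI.
  destruct (strip_tau t v HA) as (_ & _ & _ & B4 & B5 & B6 & _).
  destruct (strip_tau t' v' HA') as (_ & _ & _ & C4 & C5 & C6 & _).
  destruct (inv_Jb _ B6) as (_ & B7 & _); destruct (inv_Jb _ C6) as (_ & C7 & _).
  assert (HJ : 0 < Jf g t v) by (destruct HJb; lra); assert (HJ' : 0 < Jf g t' v') by (destruct HJb; lra).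
  destruct (good_start t v) as (_ & _ & _ & D1' & D2); auto; [apply Hrwb; auto|].
  destruct (good_start t' v') as (_ & _ & _ & D3 & D4); auto; [apply Hrwb; auto|].
  rewrite <- Et, <- EI in D3, D4.
  assert (E1 : t = t') by (apply SInj; try lra; fold S; lra).
  split; auto; subst t'.
  destruct (Rtotal_order v v') as [Hlt|[Eq|Hgt]]; auto; exfalso.
  - assert (Jf g t v < Jf g t v') by (apply (Jf_lt a b g g0 Gm Hg0 Hgb); auto; lra); lra.
  - assert (Jf g t v' < Jf g t v) by (apply (Jf_lt a b g g0 Gm Hg0 Hgb); auto; lra); lra.
Qed.

(** The unknowns are found one at a time: ep = E(1/y), then t from S t = x sig(ep), then v from J =
    1/ep. *)
Lemma coordinates_surjective : exists M, 1 <= M /\ forall x y, 0 <= x < 1 -> M < y ->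
  exists t v, A (t, v) /\ tauc t v = x /\ Ic t v = y.
Proof.
  assert (HSrho : 0 < S rho) by (unfold S; rewrite <- (S_0 g); apply SLt; lra).
  destruct (smI_bound _ _ _ (smI_sub (- re) re (- ri) ri kap ltac:(lra) ltac:(lra) Skap)) as (Kk & HKk & Bk).
  (* At step 0 the orbit has J = 1/ep. The threshold gives ep < 1 and sig(ep) <= ep (2 + Kk) < S
     rho, hence t < rho; also J > Kq, to solve for v, and J >= J2, for v > V0. *)
  destruct (orbit_C0 (1 + J2 + Kq + (2 + Kk) / S rho)) as (M & HM & HMr & HO).
  assert (HKS : 0 < (2 + Kk) / S rho) by (apply Rdiv_lt_0_compat; lra).
  destruct (S_inverse a b a' b' g g0 Hg Hg0 Hgpos Ha Ha' Hb' Hb) as (psi & _ & Hpsi & _).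
  exists M; split; auto; intros x y Hx Hy.
  destruct (HO x y 0%nat) as (_ & _ & A1 & A2 & _); [lra|auto|simpl; lra|].
  destruct (E_pos al ri rw H H2 E Hrw) with (y := y) as [E1 E2]; [|auto|lra|].
  { intros e He'; split; apply HH; auto. }
  change (oJ_ 0 x y) with (/ E (/ y)) in A1, A2.
  set (ep := E (/ y)) in *.
  destruct (sig_pos ep) as (C1 & C2 & C3); [lra|].
  destruct HJ2 as [HJ2a HJ2b].
  assert (Hep1 : ep < 1).
  { assert (0 < J2) by auto; rewrite <- (Rinv_inv ep), <- Rinv_1; apply Rinv_lt_contravar; lra. }
  assert (Hsr : sig ep < S rho).
  { assert (A3 : sig ep <= ep * (2 + Kk)).
    { unfold sig; specialize (Bk ep ltac:(lra)); apply Rabs_le_between in Bk.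
      assert (0 <= ep ^ 3 <= 1) by (split; [apply pow_le; lra | rewrite <- (pow1 3); apply pow_incr; lra]).
      assert (ep ^ 3 * kap ep <= ep ^ 3 * Kk) by (apply Rmult_le_compat_l; lra).
      assert (ep ^ 3 * Kk <= 1 * Kk) by (apply Rmult_le_compat_r; lra).
      replace (2 * ep + ep ^ 4 * kap ep) with (ep * (2 + ep ^ 3 * kap ep)) by ring.
      apply Rmult_le_compat_l; lra. }
    eapply Rle_lt_trans; [exact A3|].
    assert (A4 : (2 + Kk) / S rho < / ep) by lra.
    apply (Rmult_lt_compat_r (ep * S rho)) in A4; [|apply Rmult_lt_0_compat; lra].
    replace ((2 + Kk) / S rho * (ep * S rho)) with (ep * (2 + Kk)) in A4 by (field; lra).
    replace (/ ep * (ep * S rho)) with (S rho) in A4 by (field; lra); auto. }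
  assert (Hxs : 0 <= x * sig ep < sig ep).
  { split; [apply Rmult_le_pos; lra|]; apply Rlt_le_trans with (1 * sig ep); [apply Rmult_lt_compat_r|]; lra. }
  destruct (Hpsi (x * sig ep)) as [P1 P2].
  { assert (S a' < S 0) by (apply SLt; lra).
    assert (S (T ep) < S b') by (apply SLt; lra).
    fold S; rewrite (S_0 g : S 0 = 0) in *; lra. }
  fold S in P2; set (t := psi (x * sig ep)) in *.
  assert (Q1 : t < T ep) by (apply SLt; [lra|lra|]; fold S; lra).
  assert (Q2 : t < rho) by (apply SLt; [lra|lra|]; fold S; lra).
  assert (Q3 : 0 <= t).
  { destruct (Rle_lt_dec 0 t) as [|Hlt]; auto; exfalso.
    assert (S t < S 0) by (apply SLt; lra); rewrite (S_0 g : S 0 = 0) in *; lra. }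
  destruct (v_of_J a b g g0 Gm Kq Hg0 Hgb Hq t (/ ep)) as (v & V1 & V2); try lra.
  assert (HVv : V0 < v) by (apply (HJ2b t); auto; lra).
  assert (HA : A (t, v)).
  { apply tau_strip; auto; [lra|]; rewrite V2, Rinv_inv; fold S; lra. }
  exists t, v; split; [auto|split].
  - unfold tauc; rewrite V2, Rinv_inv, P2; field; lra.
  - unfold Ic; rewrite V2, Rinv_inv, E2; field; lra.
Qed.

(** For the last two conditions: I differs from al J / 2 by a bounded amount, so large I, large J
    and large v amount to the same. *)
Lemma main_coordinates : strip_coordinates A tauc Ic.
Proof.
  assert (HA : forall t v, A (t, v) -> 0 <= t < 1 /\ a < t < b /\ 0 < wf g t v /\ 0 < Jf g t v /\ / Jf g t v < ri /\
    0 < sig (/ Jf g t v)).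
  { intros t v HA; destruct (strip_tau t v HA) as (B1 & B2 & _ & B4 & B5 & B6 & _).
    destruct (inv_Jb _ B6) as (B7 & B8 & _).
    assert (HJ : 0 < Jf g t v) by (destruct HJb; lra).
    destruct (sig_pos (/ Jf g t v)) as [Hs _]; lra. }
  assert (Hal := al_pos).
  destruct (smI_bound _ _ _ SH) as (KH & HKH & BH).
  assert (HI : forall t v, A (t, v) -> Rabs (Ic t v - al / 2 * Jf g t v) <= KH).
  { intros t v HA'; destruct (HA t v HA') as (B1 & B2 & B3 & B4 & B5 & B6).
    replace (Ic t v - al / 2 * Jf g t v) with (H (/ Jf g t v)) by (unfold Ic; ring).
    apply BH; assert (0 < / Jf g t v) by (apply Rinv_0_lt_compat; auto); lra. }
  split; [|split; [|split; [|split; [|split; [|split]]]]].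
  - exists (fun p => exists U, open2 U /\ U (fst p) (snd p) /\ Sm U tauc /\ Sm U Ic); split; [|split; [|split]].
    + intros [t v] (U & HU & HUt & S1 & S2).
      assert (L1 := HU _ _ HUt); apply locally_2d_locally in L1.
      revert L1; apply filter_imp; intros [t' v'] HU'; exists U; auto.
    + intros [t v] HA'; destruct (HA t v HA') as (B1 & B2 & B3 & B4 & B5 & B6).
      destruct (coordinates_smooth t v) as (U & U1 & U2 & _ & U3 & U4); auto; exists U; auto.
    + intros n t v (U & U1 & U2 & U3 & _); destruct (U3 n) as (C & _ & HC); apply (Cb_ex_diff_n n U C); auto.
    + intros n t v (U & U1 & U2 & _ & U3); destruct (U3 n) as (C & _ & HC); apply (Cb_ex_diff_n n U C); auto.
  - intros t v HA'; destruct (HA t v HA') as (B1 & B2 & B3 & B4 & B5 & B6).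
    rewrite coordinates_jacobian by auto.
    assert (0 < v + Derive g t).
    { assert (Hgt := Hgpos t B2); unfold wf in B3; apply Rmult_lt_reg_l with (g t); lra. }
    apply Rgt_not_eq, Rmult_lt_0_compat; lra.
  - apply coordinates_injective.
  - intros t v HA'; apply strip_tau; auto.
  - destruct coordinates_surjective as (M & _ & HM); exists M; auto.
  - intros M; destruct (J_large a b g g0 Gm K Kq Hg0 Hgb HK Hgd HKq Hq (2 / al * (M + KH + 1))) as (V & HV & HVJ).
    exists V; intros t v HA' Hv; destruct (HA t v HA') as (B1 & B2 & _).
    destruct (HVJ t v B2 Hv) as [_ B3]; assert (B4 := HI t v HA'); apply Rabs_le_between in B4.
    apply (Rmult_le_compat_l (al / 2)) in B3; [|lra].
    replace (al / 2 * (2 / al * (M + KH + 1))) with (M + KH + 1) in B3 by (field; lra); lra.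
  - intros V; destruct (v_large a b g g0 Gm K Kq Hg0 Hgb HK Hgd HKq Hq V) as (J1 & HJ1 & HJV).
    exists (al / 2 * J1 + KH); intros t v HA' Hv; destruct (HA t v HA') as (B1 & B2 & B3 & _).
    assert (B4 := HI t v HA'); apply Rabs_le_between in B4.
    apply (HJV t v B2 B3); apply Rlt_le, Rmult_lt_reg_l with (al / 2); lra.
Qed.

Lemma main_jacobian t v : A (t, v) -> jacobian tauc Ic t v = al / 4 * (v + ldot l lpl t).
Proof.
  intros HA; destruct (strip_tau t v HA) as (B1 & B1' & _ & B4 & B5 & B6 & _).
  destruct (inv_Jb _ B6) as (B7 & B8 & _).
  assert (HJ : 0 < Jf g t v) by (destruct HJb; lra).
  destruct (sig_pos (/ Jf g t v)) as [Hs _]; [lra|].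
  rewrite (ldot_01 l g lpl Hper Hlg Hlpl) by lra; apply coordinates_jacobian; auto; lra.
Qed.

(** F1 and F2 are read off from a number n of regular flights chosen for each (x, y), and m is n +
    1. Uniqueness of the first return time shows that near a point with F1 > 0 the same n is chosen,
    so the functions are smooth there. *)
Lemma main_return : exists (I0 : R) (F1 F2 : R -> R -> R) (m : R -> R -> Z),
  (forall t v, A (t, v) -> I0 < Ic t v -> exists n t' v',
     first_return_time f A (t, v) n /\ Nat.iter n f (t, v) = (t', v') /\
     tauc t' v' = F1 (tauc t v) (Ic t v) /\ Ic t' v' = F2 (tauc t v) (Ic t v)) /\
  (let D := fun x y => 0 <= x < 1 /\ I0 < y in
   let W := fun x y => 0 < x < 1 /\ I0 < y /\ 0 < F1 x y < 1 in
   O_s 5 2 D W (fun x y => F1 x y - fst (Fhat De (m x y) x y) - fst (Fcorr D1 (m x y) x y)) /\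
   O_s 5 2 D W (fun x y => F2 x y - snd (Fhat De (m x y) x y) - snd (Fcorr D1 (m x y) x y))).
Proof.
  assert (Hal := al_pos).
  destruct orbit_bound5 as (Mo & Co & HMo & HCo & _ & Ho).
  destruct (final_bound 5 al De D1 re ri e1 kap H H2 k1 k2 B oX_ oJ_ Mo Co) as (Mf & C & HMf & _ & HC & Hf); auto.
  { intros ep Hep; apply HH; auto. }
  destruct first_return as (Mr & HMr & Hr), return_exists as (Me & HMe & He), coordinates_surjective as (Ms & HMs & Hs).
  set (I0 := Mf + Mr + Me + Ms + 2 * al * J2).
  assert (HJ2' : 0 < 2 * al * J2) by (apply Rmult_lt_0_compat; destruct HJ2; lra).
  (* The conditions under which flight n + 1 is the return; [return_exists] provides such an n. *)
  set (Sel := fun n x y => - (1 / 8) <= zf_ n x y < 1 /\ 0 <= Kb_ n x y /\ INR n <= y + 1).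
  set (cnt := fun x y => epsilon (inhabits 0%nat) (fun n => Sel n x y)).
  assert (Hcnt : forall x y, 0 <= x < 1 -> I0 < y -> Sel (cnt x y) x y).
  { intros x y Hx Hy; unfold I0 in Hy; apply (epsilon_spec (inhabits 0%nat) (fun n => Sel n x y)).
    destruct (Hs x y Hx) as (t & v & HA & <- & <-); [lra|].
    destruct (He t v HA) as (n & N1 & N2 & N3); [lra|].
    exists n; repeat split; auto; lra. }
  assert (HJp : forall y0 z J, I0 < y0 -> / (2 * al) * y0 <= Jp al De D1 k2 z J -> J2 <= Jp al De D1 k2 z J).
  { intros y0 z J Hy Hz; eapply Rle_trans; [|exact Hz].
    apply Rmult_le_reg_l with (2 * al); [lra|].
    replace (2 * al * (/ (2 * al) * y0)) with y0 by (field; lra); unfold I0 in Hy; lra. }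
  assert (Hpre : forall x y, 0 <= x < 1 -> I0 < y ->
    0 <= x <= 1 /\ Mf < y /\ INR (cnt x y) <= y + 2 /\ - (1 / 8) <= zf_ (cnt x y) x y <= 1).
  { intros x y Hx Hy; destruct (Hcnt x y Hx Hy) as (N1 & _ & N3); unfold I0 in Hy; repeat split; lra. }
  pose (Hfin := fun x y (Hx : 0 <= x < 1) (Hy : I0 < y) => let P := Hpre x y Hx Hy in
    Hf x y (cnt x y) (proj1 P) (proj1 (proj2 P)) (proj1 (proj2 (proj2 P))) (proj2 (proj2 (proj2 P)))).
  set (Ret := fun n t v => first_return_time f A (t, v) (Datatypes.S n) /\
    exists t' v', Nat.iter (Datatypes.S n) f (t, v) = (t', v') /\ A (t', v') /\ t' = Kb_ n (tauc t v) (Ic t v) /\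
      tauc t' v' = K1_ n (tauc t v) (Ic t v) /\ Ic t' v' = K2_ n (tauc t v) (Ic t v)).
  assert (Hret : forall x0 y0 t v, 0 <= x0 < 1 -> I0 < y0 -> A (t, v) -> I0 < Ic t v ->
    nb x0 y0 (tauc t v) (Ic t v) -> INR (cnt x0 y0) <= Ic t v + 2 -> zf_ (cnt x0 y0) (tauc t v) (Ic t v) < 1 ->
    0 <= Kb_ (cnt x0 y0) (tauc t v) (Ic t v) -> Ret (cnt x0 y0) t v).
  { intros x0 y0 t v Hx0 Hy0 HA Hy Hnb Hn Hz HK'.
    destruct (Hfin x0 y0 Hx0 Hy0) as (_ & _ & _ & _ & _ & P).
    destruct (P _ _ Hnb) as (P1 & P2 & P3 & P4 & P5 & P6).
    refine (Hr t v (cnt x0 y0) HA _ Hn _ HK' _ P4 P6).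
    - unfold I0 in Hy; lra.
    - unfold zf_ in *; lra.
    - apply (HJp y0); auto. }
  assert (Hself : forall t v, A (t, v) -> I0 < Ic t v -> Ret (cnt (tauc t v) (Ic t v)) t v).
  { intros t v HA Hy; destruct (strip_tau t v HA) as (_ & _ & _ & _ & _ & _ & _ & Ht).
    destruct (Hcnt _ _ Ht Hy) as (N1 & N2 & N3).
    apply Hret; auto using nb_center; lra. }
  exists I0, (fun x y => K1_ (cnt x y) x y), (fun x y => K2_ (cnt x y) x y),
    (fun x y => Z.of_nat (Datatypes.S (cnt x y))).
  split.
  { intros t v HA Hy; destruct (Hself t v HA Hy) as (R1 & t' & v' & R2 & R3 & R4 & R5 & R6).
    exists (Datatypes.S (cnt (tauc t v) (Ic t v))), t', v'; auto. }
  assert (HI0 : 1 <= I0) by (unfold I0; lra).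
  assert (Hm : forall n, IZR (Z.of_nat (Datatypes.S n)) = INR n + 1).
  { intros n; rewrite <- INR_IZR_INZ, S_INR; auto. }
  cbv zeta.
  (* V is cut out by strict inequalities that hold at the centre and under which the n of the centre
     still describes the return; minimality of the return time then forces the chosen n to
     coincide. *)
  assert (Hloc : forall x0 y0, 0 < x0 < 1 -> I0 < y0 -> 0 < K1_ (cnt x0 y0) x0 y0 ->
    exists V : R -> R -> Prop, open2 V /\ V x0 y0 /\ forall x y, V x y -> nb x0 y0 x y /\ cnt x y = cnt x0 y0).
  { intros x0 y0 Hx0 Hy0 HK1.
    assert (Hx0' : 0 <= x0 < 1) by lra.
    destruct (Hcnt x0 y0 Hx0' Hy0) as (N1 & N2 & N3).
    destruct (Hfin x0 y0 Hx0' Hy0) as (_ & _ & G1 & G2 & _).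
    set (n0 := cnt x0 y0) in *.
    set (V := fun x y => ((((nb x0 y0 x y /\ 0 < x) /\ 0 < 1 - x) /\ 0 < y - I0) /\ 0 < 1 - zf_ n0 x y) /\ 0 < Kb_ n0 x y).
    exists V; split; [|split].
    - unfold V; do 5 (apply open2_pos; [|intros x y Hxy; assert (Hnb : nb x0 y0 x y) by tauto; clear Hxy;
        try apply continuity_2d_pt_minus; try apply continuity_2d_pt_id1; try apply continuity_2d_pt_id2;
        try apply continuity_2d_pt_const; eapply Cb_cont; eauto]).
      apply open2_nb.
    (* Kb = 0 would put the image at time 0, hence on tau = 0, against F1 > 0. The strict inequality
       is an open condition. *)
    - assert (HKb : 0 < Kb_ n0 x0 y0).
      { destruct (Rle_lt_or_eq_dec _ _ N2) as [|E0]; auto; exfalso.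
        destruct (Hs x0 y0 Hx0') as (t & v & HA & Et & EI); [unfold I0 in Hy0; lra|].
        destruct (Hself t v HA) as (_ & t' & v' & _ & _ & R4 & R5 & _); [lra|].
        rewrite Et, EI in R4, R5; fold n0 in R4, R5.
        rewrite <- R5, R4, <- E0 in HK1; unfold tauc in HK1; rewrite (S_0 g : S 0 = 0) in HK1; lra. }
      unfold V; repeat split; try lra; apply nb_center.
    - intros x y (((((Hnb & V1) & V2) & V3) & V4) & V5); split; auto.
      destruct (Hs x y) as (t & v & HA & <- & <-); [lra|unfold I0 in V3; lra|].
      destruct (Hself t v HA) as [R1 _]; [lra|].
      destruct (Hret x0 y0 t v Hx0' Hy0 HA) as [R2 _]; auto; try lra; [fold n0; unfold nb in Hnb; lra|fold n0; lra|fold n0; lra|].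
      fold n0 in R2; destruct R1 as (_ & R1 & R3), R2 as (_ & R2 & R4).
      destruct (lt_eq_lt_dec (cnt (tauc t v) (Ic t v)) n0) as [[Hlt|]|Hgt]; auto; exfalso.
      + apply (R4 (Datatypes.S (cnt (tauc t v) (Ic t v)))); auto; lia.
      + apply (R3 (Datatypes.S n0)); auto; lia. }
  split; apply (O_s_of_Cb 5 _ _ _ I0 C HI0).
  - intros x y [Hx Hy] _; destruct (Hfin x y Hx Hy) as (G & _).
    unfold Fhat, Fcorr, tau_bar; cbn [fst snd]; rewrite Hm, Rminus_0_r.
    exact (Cb_value _ _ _ _ _ _ G (nb_center x y)).
  - intros x y (Hx & Hy & HK1 & _) _; destruct (Hloc x y Hx Hy HK1) as (V & V1 & V2 & V3).
    destruct (Hfin x y ltac:(lra) Hy) as (G & _).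
    exists V; split; [auto|split; [auto|]]; eapply Cb_ext; [auto| |eapply Cb_sub; [|exact G]].
    + intros u w Huw; destruct (V3 u w Huw) as [_ V4]; unfold Fhat, Fcorr, tau_bar; cbn [fst snd].
      rewrite V4, Hm, Rminus_0_r; reflexivity.
    + intros u w Huw; apply V3; auto.
  - intros x y [Hx Hy] _; destruct (Hfin x y Hx Hy) as (_ & G & _).
    unfold Fhat, Fcorr, tau_bar; cbn [fst snd]; rewrite Hm.
    exact (Cb_value _ _ _ _ _ _ G (nb_center x y)).
  - intros x y (Hx & Hy & HK1 & _) _; destruct (Hloc x y Hx Hy HK1) as (V & V1 & V2 & V3).
    destruct (Hfin x y ltac:(lra) Hy) as (_ & G & _).
    exists V; split; [auto|split; [auto|]]; eapply Cb_ext; [auto| |eapply Cb_sub; [|exact G]].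
    + intros u w Huw; destruct (V3 u w Huw) as [_ V4]; unfold Fhat, Fcorr, tau_bar; cbn [fst snd].
      rewrite V4, Hm; reflexivity.
    + intros u w Huw; apply V3; auto.
Qed.
End Main.

(** * The extended wall, its one-sided derivatives, and the choice of constants *)

Lemma positive_margin g : smI (-1) 2 g -> (forall t, 0 <= t <= 1 -> 0 < g t) ->
  exists dl g0, 0 < dl < 1 /\ 0 < g0 /\ forall t, - dl < t < 1 + dl -> g0 <= g t.
Proof.
  intros Hg Hp.
  (* By compactness 1/g <= K on [0, 1], so g >= 1/K there; dl is so small that g, whose derivative
     is at most K1, loses at most half of this within distance dl. *)
  destruct (bounded_on_segment (fun t => / g t) 0 1) as (K & HK).
  { intros c Hc; apply continuity_pt_filterlim, (ex_derive_continuous (fun t => / g t)).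
    apply (ex_derive_comp Rinv g).
    - auto_derive; specialize (Hp c Hc); lra.
    - eexists; apply (smI_is_derive (-1) 2); auto; lra. }
  assert (HK0 : 0 < K).
  { apply Rlt_le_trans with (/ g 0); [apply Rinv_0_lt_compat, Hp; lra|].
    eapply Rle_trans; [apply Rle_abs | apply HK; lra]. }
  assert (Hlow : forall t, 0 <= t <= 1 -> / K <= g t).
  { intros t Ht; assert (A1 := HK t Ht); assert (A2 := Hp t Ht).
    assert (A3 := Rle_abs (/ g t)).
    rewrite <- (Rinv_inv (g t)); apply Rinv_le_contravar; [apply Rinv_0_lt_compat; auto | lra]. }
  destruct (smI_bound (-1) 2 (Derive g)) as (K1 & HK1 & B1); [apply smI_deriv, Hg|].
  assert (HiK : 0 < / K) by (apply Rinv_0_lt_compat; auto).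
  set (dl := Rmin (/ 2) (/ K / (2 * (K1 + 1)))).
  assert (D1 := Rmin_l (/ 2) (/ K / (2 * (K1 + 1)))); assert (D2 := Rmin_r (/ 2) (/ K / (2 * (K1 + 1)))).
  fold dl in D1, D2.
  assert (D3 : 0 < dl) by (apply Rmin_pos; [lra | apply Rdiv_lt_0_compat; lra]).
  assert (D4 : K1 * dl <= / K / 2).
  { apply Rle_trans with ((K1 + 1) * (/ K / (2 * (K1 + 1)))); [apply Rmult_le_compat; lra | right; field; lra]. }
  exists dl, (/ K / 2); split; [lra|split; [lra|]]; intros t Ht.
  assert (Hlip := lipschitz_of_derive g (Derive g) (-1) 2 K1 (fun u Hu => smI_is_derive (-1) 2 g u Hg Hu) B1).
  assert (Hnear : forall s, 0 <= s <= 1 -> Rabs (t - s) <= dl -> / K / 2 <= g t).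
  { intros s Hs Hts; assert (A1 := Hlow s Hs); assert (A2 := Hlip s t ltac:(lra) ltac:(lra)).
    assert (K1 * Rabs (t - s) <= K1 * dl) by (apply Rmult_le_compat_l; lra).
    apply Rabs_le_between in A2; lra. }
  destruct (Rle_lt_dec t 0); [apply (Hnear 0); try lra; apply Rabs_le; lra|].
  destruct (Rle_lt_dec t 1); [apply (Hnear t); try lra; apply Rabs_le; lra|].
  apply (Hnear 1); try lra; apply Rabs_le; lra.
Qed.

Lemma right_limit_eq (f h : R -> R) y : (forall t, 0 < t < 1 -> f t = h t) -> continuous h 0 ->
  filterlim f (at_right 0) (locally y) -> y = h 0.
Proof.
  intros He Hc Hf.
  apply (filterlim_locally_unique (F := at_right 0) h).
  - revert Hf; apply filterlim_ext_loc.
    exists (mkposreal 1 Rlt_0_1); intros t Ht Hp; apply He.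
    apply Rabs_lt_between in Ht; unfold minus, plus, opp in Ht; simpl in Ht; lra.
  - eapply filterlim_filter_le_1; [apply filter_le_within | exact Hc].
Qed.

Lemma left_limit_eq (f h : R -> R) y : (forall t, -1 < t < 0 -> f t = h t) -> continuous h 0 ->
  filterlim f (at_left 0) (locally y) -> y = h 0.
Proof.
  intros He Hc Hf.
  apply (filterlim_locally_unique (F := at_left 0) h).
  - revert Hf; apply filterlim_ext_loc.
    exists (mkposreal 1 Rlt_0_1); intros t Ht Hp; apply He.
    apply Rabs_lt_between in Ht; unfold minus, plus, opp in Ht; simpl in Ht; lra.
  - eapply filterlim_filter_le_1; [apply filter_le_within | exact Hc].
Qed.

Section Limits.
Variables (l g : R -> R).
Hypothesis Hper : forall t, l (t + 1) = l t.
Hypothesis Hg : forall n t, ex_derive_n g n t.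
Hypothesis Hlg : forall t, 0 <= t <= 1 -> l t = g t.

Lemma continuous_Derive_n k t : continuous (Derive_n g k) t.
Proof. apply (ex_derive_continuous (Derive_n g k)); exact (Hg (S k) t). Qed.

Lemma right_limit_Derive_n k y : filterlim (Derive_n l k) (at_right 0) (locally y) -> y = Derive_n g k 0.
Proof.
  apply right_limit_eq; [|apply continuous_Derive_n]; intros t Ht; apply Derive_n_ext_loc.
  destruct (locally_2d_slice _ _ _ (open2_itv 0 1 t 0 Ht)) as [L _].
  revert L; apply filter_imp; intros s [Hs1 Hs2]; apply Hlg; lra.
Qed.

(** To the left of 0 the wall is the translate of g on [0, 1], so left limits at 0 are read at 1. *)
Lemma left_limit_Derive_n k y : filterlim (Derive_n l k) (at_left 0) (locally y) -> y = Derive_n g k 1.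
Proof.
  intros Hf; replace (Derive_n g k 1) with (Derive_n g k (0 + 1)) by (f_equal; ring).
  revert Hf; apply (left_limit_eq _ (fun t => Derive_n g k (t + 1))).
  - intros t Ht; rewrite <- Derive_n_comp_trans; apply Derive_n_ext_loc.
    destruct (locally_2d_slice _ _ _ (open2_itv (-1) 0 t 0 Ht)) as [L _].
    revert L; apply filter_imp; intros s [Hs1 Hs2]; rewrite <- Hper; apply Hlg; lra.
  - apply (continuous_comp (fun t => t + 1) (Derive_n g k)); [|apply continuous_Derive_n].
    apply (continuous_plus (V := R_NormedModule)); [apply continuous_id | apply continuous_const].
Qed.
End Limits.

Theorem theorem1 :
  forall (l : R -> R) (lp lm lpp lmm : R),
    fermi_ulam_wall l ->
    filterlim (Derive l) (at_right 0) (locally lp) ->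
    filterlim (Derive l) (at_left 0) (locally lm) ->
    filterlim (Derive_n l 2) (at_right 0) (locally lpp) ->
    filterlim (Derive_n l 2) (at_left 0) (locally lmm) ->
    lp <> lm ->
    let alpha := RInt (fun s => / (l s) ^ 2) 0 1 in
    let Delta := alpha * l 0 * (lp - lm) in
    let Delta1 := / 2 * alpha ^ 2 * (l 0) ^ 3 * (lpp - lmm) in
    let f := collision_map l lp in
    exists (V0 : R) (tau I : R -> R -> R),
      let A := strip l lp V0 in
      strip_coordinates A tau I /\
      (exists (I0 : R) (F1 F2 : R -> R -> R) (m : R -> R -> Z),
        (* (F1, F2) is the first return map in the coordinates (tau, I) *)
        (forall t v, A (t, v) -> I0 < I t v ->
           exists n t' v',
             first_return_time f A (t, v) n /\
             Nat.iter n f (t, v) = (t', v') /\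
             tau t' v' = F1 (tau t v) (I t v) /\
             I t' v' = F2 (tau t v) (I t v)) /\
        (let D := fun x y => 0 <= x < 1 /\ I0 < y in
         (* the return map is discontinuous where its image lies on {tau = 0} *)
         let W := fun x y => 0 < x < 1 /\ I0 < y /\ 0 < F1 x y < 1 in
         O_s 5 2 D W (fun x y =>
           F1 x y - fst (Fhat Delta (m x y) x y)
                  - fst (Fcorr Delta1 (m x y) x y)) /\
         O_s 5 2 D W (fun x y =>
           F2 x y - snd (Fhat Delta (m x y) x y)
                  - snd (Fcorr Delta1 (m x y) x y)))) /\
      (* dtau /\ dI = (alpha / 4) omega, with omega = (v + ldot) dt /\ dv *)
      (forall t v, A (t, v) ->
         jacobian tau I t v = alpha / 4 * (v + ldot l lp t)).
Proof.
  intros l lp lm lpp lmm (Hl & (L & HL) & Hper & g & Hgs & Hlg) Hlp Hlm Hlpp Hlmm _ alpha Delta Delta1 f.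
  apply (right_limit_Derive_n l g Hgs Hlg 1) in Hlp; apply (right_limit_Derive_n l g Hgs Hlg 2) in Hlpp.
  apply (left_limit_Derive_n l g Hper Hgs Hlg 1) in Hlm; apply (left_limit_Derive_n l g Hper Hgs Hlg 2) in Hlmm.
  assert (Ealpha : alpha = S_ g 1).
  { unfold alpha, S_; apply RInt_ext; intros s Hs; rewrite Rmin_left, Rmax_right in Hs by lra.
    rewrite Hlg by lra; reflexivity. }
  assert (El0 : l 0 = g 0) by (apply Hlg; lra).
  subst Delta Delta1 f; clearbody alpha; subst alpha.
  rewrite Hlpp, Hlm, Hlmm, El0; replace (lp - Derive_n g 1 1) with (Derive_n g 1 0 - Derive_n g 1 1) by (rewrite Hlp; reflexivity).
  clear lm lpp lmm Hlm Hlpp Hlmm.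
  assert (HL0 : 0 <= L).
  { assert (A1 := HL 1 0); assert (A2 := Rabs_pos (l 1 - l 0)); rewrite Rminus_0_r, Rabs_R1 in A1; lra. }
  destruct (positive_margin g) as (dl & g0 & Hdl & Hg0 & Hgpos).
  { apply smI_of_ex_derive_n; auto. }
  { intros t Ht; rewrite <- Hlg; auto. }
  (* Departures range over (a', b') and arrivals over the larger (a, b); both contain [0, 1] with a
     margin for formal flights that overshoot the jump. *)
  set (a := - dl) in *; set (a' := - (dl / 2)); set (b' := 1 + dl / 2); set (b := 1 + dl) in *.
  assert (Ha : a < a') by (unfold a, a'; lra); assert (Ha' : a' < 0) by (unfold a'; lra).
  assert (Hb' : 1 < b') by (unfold b'; lra); assert (Hb : b' < b) by (unfold b', b; lra).
  clearbody a a' b' b.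
  assert (Hg : smI a b g) by (apply smI_of_ex_derive_n; auto).
  destruct (smI_bound a b g Hg) as (Gm & HGm & Bg).
  destruct (smI_bound a b (Derive g)) as (K & HK & Hgd); [apply smI_deriv, Hg|].
  destruct (smI_bound a b (q g)) as (Kq & HKq & Bq); [apply smI_q, Hg|].
  assert (Hgb : forall t, a < t < b -> g0 <= g t <= Gm).
  { intros t Ht; split; auto; eapply Rle_trans; [apply Rle_abs | auto]. }
  assert (Hq : forall t, a < t < b -> Rabs (2 / 3 * q g t) <= Kq).
  { intros t Ht; rewrite Rabs_mult, (Rabs_right (2 / 3)) by lra; specialize (Bq t Ht).
    assert (A1 := Rabs_pos (q g t)); lra. }
  assert (Hg01 : g 0 = g 1) by (apply (g_periodic l g); auto).
  assert (Ha0 : a < 0) by lra; assert (Hb1 : 1 < b) by lra.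
  assert (Hal : 0 < S_ g 1) by (apply (al_pos g a b a' b' g0 Gm); auto).
  destruct (flight_regular a b a' b' g g0 Hg Hg0 Hgpos Ha Ha' Hb' Hb)
    as (r1 & r2 & dd & Pc & Qc & Hr1 & Hr2 & SP & SQ & Hflight).
  destruct (strip_boundary a b a' b' g g0 Hg Hg0 Hgpos Ha Ha' Hb' Hb)
    as (rT & re & T & kap & HrT & HrT' & Hre & _ & Skap & HN & HT & HTmon).
  destruct (action_function (S_ g 1) re kap Hal Hre Skap)
    as (ri & rw & H & H2 & E & Hri & Hrw & SH & SH2 & SE & HH & HE & HEmon).
  destruct (kick a b a' b' g g0 Hg Hg0 Hgpos Ha Ha' Hb' Hb Hg01)
    as (e1 & k1 & k2 & B & He1 & Sk1 & Sk2 & SB & Hkick).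
  destruct (strip_iff l g lp L a b g0 Gm K Hl HL0 HL Hper Hlg Ha0 Hb1 Hg Hg0 Hgb HK Hgd Hlp)
    as (rho & V1 & Hrho1 & Hrho2 & Hrho3 & Hrho4 & _ & Hstrip).
  destruct (smI_bound _ _ _ SH) as (KH & HKH & BH).
  destruct (v_large a b g g0 Gm K Kq Hg0 Hgb HK Hgd HKq Hq (L + K + 2 * Gm / rho)) as (J1 & HJ1 & HJ1v).
  assert (HGr : 0 <= 2 * Gm / rho) by (apply Rle_mult_inv_pos; lra).
  assert (Hiri : 0 < / ri) by (apply Rinv_0_lt_compat; lra).
  assert (Hir2 : 0 < / r2) by (apply Rinv_0_lt_compat; lra).
  assert (Hie1 : 0 < / e1) by (apply Rinv_0_lt_compat; lra).
  assert (Hirw : 0 < / rw) by (apply Rinv_0_lt_compat; lra).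
  assert (HKrw : 0 < 2 / S_ g 1 * (/ rw + KH + 1)) by (apply Rmult_lt_0_compat; [apply Rdiv_lt_0_compat|]; lra).
  (* One threshold for J: above it v exceeds L, K and 2 Gm / rho, 1/J is below ri, r2 and e1, and I
     exceeds 1 / rw. *)
  set (Jb := 1 + J1 + / ri + / r2 + / e1 + 2 / S_ g 1 * (/ rw + KH + 1)).
  assert (HJinv : forall r, 0 < r -> / r < Jb -> / Jb < r).
  { intros r Hr Hlt; rewrite <- (Rinv_inv r); apply Rinv_lt_contravar; auto.
    apply Rmult_lt_0_compat; [apply Rinv_0_lt_compat; auto | unfold Jb; lra]. }
  assert (HJb : 0 < Jb /\ / Jb < ri /\ / Jb < r2 /\ / Jb < e1).
  { split; [unfold Jb; lra|]; repeat split; apply HJinv; try lra; unfold Jb; lra. }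
  assert (Hrwb : forall J, Jb <= J -> / rw < S_ g 1 / 2 * J + H (/ J)).
  { intros J HJ; destruct HJb as (A1 & A2 & _).
    assert (A3 : 0 < / J <= / Jb) by (split; [apply Rinv_0_lt_compat | apply Rinv_le_contravar]; lra).
    specialize (BH (/ J) ltac:(lra)); apply Rabs_le_between in BH.
    assert (A4 : S_ g 1 / 2 * (2 / S_ g 1 * (/ rw + KH + 1)) <= S_ g 1 / 2 * J)
      by (apply Rmult_le_compat_l; [lra | unfold Jb in HJ; lra]).
    replace (S_ g 1 / 2 * (2 / S_ g 1 * (/ rw + KH + 1))) with (/ rw + KH + 1) in A4 by (field; lra); lra. }
  destruct (J_large a b g g0 Gm K Kq Hg0 Hgb HK Hgd HKq Hq Jb) as (V3 & HV3 & HV3J).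
  assert (HGK : 0 <= (2 * Gm + 2 * K) / rT) by (apply Rle_mult_inv_pos; lra).
  (* Above V0 the strip is described by [strip_iff], J is at least Jb, and the times in the strip
     are below rT. *)
  set (V0 := Rabs V1 + V3 + (2 * Gm + 2 * K) / rT + 1).
  assert (HV1 := Rle_abs V1); assert (HV1' := Rabs_pos V1).
  assert (HstripV0 : forall t v, strip l lp V0 (t, v) <-> 0 <= t < rho /\ V0 < v /\ (0 < t -> v < vst g t))
    by (intros; apply Hstrip; unfold V0; lra).
  assert (HJbv : forall t v, a < t < b -> 0 < wf g t v -> Jb <= Jf g t v -> L < v /\ K < v /\ 2 * Gm / rho < v).
  { intros t v Ht Hw HJ; specialize (HJ1v t v Ht Hw ltac:(unfold Jb in HJ; lra)); lra. }
  assert (HV0 : forall t v, a < t < b -> V0 < v -> 0 < wf g t v /\ Jb <= Jf g t v).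
  { intros t v Ht Hv; apply HV3J; auto; unfold V0 in Hv; lra. }
  assert (HV0T : 0 < V0 /\ 2 * Gm + 2 * K <= V0 * rT).
  { split; [unfold V0; lra|].
    replace (2 * Gm + 2 * K) with ((2 * Gm + 2 * K) / rT * rT) by (field; lra).
    apply Rmult_le_compat_r; [lra | unfold V0; lra]. }
  destruct (v_large a b g g0 Gm K Kq Hg0 Hgb HK Hgd HKq Hq V0) as (J2 & HJ2).
  assert (Hrho : 0 < rho /\ rho < 1 /\ rho < b /\ rho * (L + 1) <= g0) by auto.
  assert (HrTb : 0 < rT /\ rT < b') by auto.
  exists V0, (tauc g kap), (Ic g H); cbv zeta.
  split; [|split].
  - apply (main_coordinates l g lp L a b a' b' g0 Gm K Kq Ha Ha' Hb' Hb Hg Hg0 Hgb HK Hgd HKq Hq r2 Pc Qc Hr2 SP SQ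
      rT re T kap HrTb Hre Skap HN HT HTmon ri rw H H2 E Hri Hrw SH SH2 SE HH HE HEmon e1 rho V0 Jb J2 Hrho HstripV0
      HJb HV0 HV0T HJ2 Hrwb).
  - exact (main_return l g lp L a b a' b' g0 Gm K Kq Hl HL0 HL Hper Hlg Ha Ha' Hb' Hb Hg Hg0 Hgb HK Hgd HKq Hq Hlp
      r1 r2 dd Pc Qc Hr2 SP SQ Hflight rT re T kap HrTb Hre Skap HN HT HTmon ri rw H H2 E Hri Hrw SH SH2 SE HH HE HEmon
      e1 k1 k2 B He1 Sk1 Sk2 SB Hkick rho V0 Jb J2 Hrho HstripV0 HJb HJbv HV0 HV0T HJ2).
  - exact (main_jacobian l g lp L a b a' b' g0 Gm K Hper Hlg Ha Ha' Hb' Hb Hg Hg0 Hgb HK Hgd Hlp r2 rT re T kap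
      HrTb Hre Skap HN HT HTmon ri H H2 Hri SH HH e1 rho V0 Jb Hrho HstripV0 HJb HV0 HV0T).
Qed.
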